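(* Let $\Omega\subset\mathbb{R}^n$ be a non-empty bounded open set. Let $f:\Omega\to\mathbb{R}^n$ be a continuous bi-Sobolev map such that $f^{-1}\in W^{1,q}(f(\Omega),\mathbb{R}^n)$, and suppose that for a measurable set $E\subset\Omega$ we have $Jf=0$ almost everywhere on $E$. Let $m\in\mathbb{N}$ and assume one of the following: (a) $q=m$ and $f^{-1}$ is Hölder continuous; (b) $q>m$. Then $\operatorname{rank}(Df)\le n-m-1$ almost everywhere on $E$.
   Context: A continuous bi-Sobolev map $f:\Omega\to\mathbb{R}^n$ is an injective continuous map, a homeomorphism onto its image $f(\Omega)$, such that both $f$ and its inverse $f^{-1}:f(\Omega)\to\Omega$ are Sobolev maps (in $W^{1,1}$). Here $q\ge 1$. $Jf=\det Df$ denotes the Jacobian of $f$, with $Df$ the weak derivative. Hölder continuous means belonging to $C^\alpha$ for some exponent $\alpha\in(0,1]$, i.e. bounded with finite $\alpha$-Hölder seminorm. *)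

(* Defs.v *)
From HB Require Import structures.
From mathcomp Require Import all_boot all_order all_algebra.
From mathcomp Require Import all_classical all_reals all_analysis.
From mathcomp Require Import measurable_realfun.

Set Implicit Arguments.
Unset Strict Implicit.
Unset Printing Implicit Defensive.
Import Order.TTheory GRing.Theory Num.Theory.
Import numFieldNormedType.Exports.

Local Open Scope classical_set_scope.
Local Open Scope ring_scope.

(* The sigma-algebra on R^n is generated by the coordinate maps; since R is
   second countable, it is the Borel sigma-algebra of the topology of 'rV_n. *)
Definition measure_rV_display : measure_display -> measure_display.
Proof. exact. Qed.

Section measurable_rV.
Context (R : realType) (n : nat).

Let coord : 'I_n -> 'rV[R]_n -> measurableTypeR R := fun i x => x ord0 i.

Let rV_set0 : g_sigma_preimage coord set0.
Proof. exact: sigma_algebra0. Qed.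

Let rV_setC A : g_sigma_preimage coord A -> g_sigma_preimage coord (~` A).
Proof. exact: sigma_algebraC. Qed.

Let rV_bigcup (F : (set 'rV[R]_n)^nat) :
  (forall i, g_sigma_preimage coord (F i)) ->
  g_sigma_preimage coord (\bigcup_i (F i)).
Proof. exact: sigma_algebra_bigcup. Qed.

HB.instance Definition _ := @isMeasurable.Build
  (measure_rV_display (R.-ocitv.-measurable).-sigma) 'rV[R]_n
  (g_sigma_preimage coord) rV_set0 rV_setC rV_bigcup.

Lemma measurable_coord (i : 'I_n) :
  measurable_fun [set: 'rV[R]_n] (coord i).
Proof.
move=> _ Y mY; rewrite setTI; apply: sub_sigma_algebra => /=.
rewrite -bigcup_seq/=; exists i => /=; first by rewrite mem_index_enum.
by exists Y => //; rewrite setTI.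
Qed.

Lemma measurable_fun_rV d (T : measurableType d) (f : T -> 'rV[R]_n) :
  (forall i, measurable_fun [set: T] (coord i \o f)) ->
  measurable_fun [set: T] f.
Proof.
move=> mf _ A; rewrite setTI.
apply: (smallest_sub (X := [set A | measurable (f @^-1` A)])).
  split => [|B mB|F mF] /=.
  - by rewrite preimage_set0.
  - by rewrite setTD preimage_setC; exact: measurableC.
  - by rewrite preimage_bigcup; exact: bigcupT_measurable.
move=> B; rewrite -bigcup_seq/= => -[i _ [C mC <-]] /=.
by rewrite setTI; have := mf i measurableT C mC; rewrite setTI.
Qed.

End measurable_rV.

Section lebesgue_rV.
Context (R : realType).

Definition cons_rV n (z : 'rV[R]_n * measurableTypeR R) : 'rV[R]_n.+1 :=
  \row_i oapp (z.1 ord0) z.2 (unlift ord0 i).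

Lemma measurable_cons_rV n : measurable_fun [set: _] (@cons_rV n).
Proof.
apply: measurable_fun_rV => i; case: (unliftP ord0 i) => [j|] ->.
  rewrite [X in measurable_fun _ X](_ : _ = (fun x : 'rV[R]_n => x ord0 j) \o fst).
    exact: measurableT_comp (@measurable_coord R n j) measurable_fst.
  by apply/funext => z /=; rewrite mxE liftK.
rewrite [X in measurable_fun _ X](_ : _ = snd); first exact: measurable_snd.
by apply/funext => z /=; rewrite mxE unlift_none.
Qed.

Definition product_lebesgue n (m : {measure set 'rV[R]_n -> \bar R}) :
    set 'rV[R]_n.+1 -> \bar R :=
  pushforward (m \x @lebesgue_measure R)%E (@cons_rV n).

Section product_lebesgue.
Context (n : nat) (m : {measure set 'rV[R]_n -> \bar R}).

Let product_lebesgue0 : product_lebesgue m set0 = 0%E.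
Proof. by apply: measure0; exact: measurable_cons_rV. Qed.

Let product_lebesgue_ge0 A : (0 <= product_lebesgue m A)%E.
Proof. by apply: measure_ge0; exact: measurable_cons_rV. Qed.

Let product_lebesgue_sigma_additive : semi_sigma_additive (product_lebesgue m).
Proof.
by apply: measure_semi_sigma_additive; exact: measurable_cons_rV.
Qed.

HB.instance Definition _ := isMeasure.Build _ _ _ (product_lebesgue m)
  product_lebesgue0 product_lebesgue_ge0 product_lebesgue_sigma_additive.

End product_lebesgue.

(* Lebesgue measure on R^n: the n-fold product of the one-dimensional one *)
Fixpoint lebesgue_rV n : {measure set 'rV[R]_n -> \bar R} :=
  match n with
  | 0 => dirac (0 : 'rV[R]_0)
  | k.+1 => product_lebesgue (lebesgue_rV k)
  end.

Lemma lebesgue_rV_box n (A : 'I_n -> set (measurableTypeR R)) :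
  (forall i, measurable (A i)) ->
  lebesgue_rV n [set x | forall i, A i (x ord0 i)] =
  (\prod_(i < n) lebesgue_measure (A i))%E.
Proof.
elim: n A => [|n IHn] A mA /=.
  by rewrite big_ord0 /= diracE mem_set// => -[].
rewrite /product_lebesgue /pushforward (_ : _ @^-1` _ =
    [set x : 'rV[R]_n | forall i, A (lift ord0 i) (x ord0 i)] `*` A ord0).
  have mA' : measurable
      [set x : 'rV[R]_n | forall i, A (lift ord0 i) (x ord0 i)].
    rewrite (_ : mkset _ = \bigcap_(i in [set: 'I_n])
        ((fun x : 'rV[R]_n => x ord0 i) @^-1` A (lift ord0 i))).
      apply: fin_bigcap_measurable => // i _.
      by rewrite -[X in measurable X]setTI; apply: (measurable_coord i) => //; exact: mA.
    by apply/seteqP; split => [x h i _|x h i]; [exact: h|exact: (h i I)].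
  rewrite big_ord_recl muleC -(IHn (fun i => A (lift ord0 i))); last first.
    by move=> i; exact: mA.
  by apply: product_measure1E => //; exact: mA.
apply/seteqP; split => [[x t]|[x t] [/= h h0] i] /=.
  move=> h; split => [i|] /=.
    by have := h (lift ord0 i); rewrite mxE liftK.
  by have := h ord0; rewrite mxE unlift_none.
by case: (unliftP ord0 i) => [j|] ->; rewrite mxE ?liftK ?unlift_none/=.
Qed.

End lebesgue_rV.

Definition lebesgue_measurable (R : realType) n (E : set 'rV[R]_n) : Prop :=
  completed_algebra_gen (lebesgue_rV R n) E.

Section sobolev.
Context (R : realType) (n : nat).
Local Notation mu := (lebesgue_rV R n).
Implicit Types (U : set 'rV[R]_n) (phi u v : 'rV[R]_n -> R) (q : R).

Fixpoint of_class_C k phi : Prop :=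
  continuous phi /\
  if k is k'.+1 then
    forall j : 'I_n, (forall x, derivable phi x ('e_j : 'rV[R]_n)) /\
      of_class_C k' (fun x => 'D_('e_j : 'rV[R]_n) phi x)
  else True.

(* phi in C_c^oo(U), extended by 0 outside of U *)
Definition test_function U phi : Prop :=
  (forall k, of_class_C k phi) /\
  compact (closure [set x | phi x != 0]) /\
  closure [set x | phi x != 0] `<=` U.

Definition is_weak_partial U (j : 'I_n) u v : Prop :=
  forall phi, test_function U phi ->
    \int[mu]_(x in U) (u x * 'D_('e_j : 'rV[R]_n) phi x) =
    - \int[mu]_(x in U) (v x * phi x).

(* Functions on U are represented by total functions whose values outside of U
   are irrelevant; [u \_ U] vanishes outside of U. *)
Definition in_Lq q U u : Prop := u \_ U \in Lfun mu q%:E.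

(* f belongs to W^{1,q}(U, R^p) and its weak derivative is (the class of) Df,
   where Df x i j is the j-th partial derivative of the i-th component. *)
Definition sobolev_with_derivative p q U (f : 'rV[R]_n -> 'rV[R]_p)
    (Df : 'rV[R]_n -> 'M[R]_(p, n)) : Prop :=
  forall i : 'I_p, in_Lq q U (fun x => f x ord0 i) /\
    forall j : 'I_n, in_Lq q U (fun x => Df x i j) /\
      is_weak_partial U j (fun x => f x ord0 i) (fun x => Df x i j).

Definition sobolev p q U (f : 'rV[R]_n -> 'rV[R]_p) : Prop :=
  exists Df, sobolev_with_derivative q U f Df.

Definition hoelder_continuous p U (f : 'rV[R]_n -> 'rV[R]_p) : Prop :=
  exists2 alpha : R, 0 < alpha <= 1 &
    (exists M : R, forall x, U x -> `|f x| <= M) /\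
    (exists C : R, forall x y, U x -> U y ->
       `|f x - f y| <= C * `|x - y| `^ alpha).

(* g represents the inverse map of f, and is only relevant on f(U). *)
Definition homeomorphism_onto_image U (f g : 'rV[R]_n -> 'rV[R]_n) : Prop :=
  [/\ {in U, cancel f g}, {within U, continuous f} &
      {within f @` U, continuous g}].

Definition bi_sobolev U (f g : 'rV[R]_n -> 'rV[R]_n) : Prop :=
  [/\ homeomorphism_onto_image U f g, sobolev 1 U f & sobolev 1 (f @` U) g].

End sobolev.

(* Main.v *)
Require Import Defs.
From HB Require Import structures.
From mathcomp Require Import all_boot all_order all_algebra.
From mathcomp Require Import all_classical all_reals all_analysis.
From mathcomp Require Import fingroup perm measurable_realfun zify ring lra.

Set Implicit Arguments.
Unset Strict Implicit.
Unset Printing Implicit Defensive.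
Import Order.TTheory GRing.Theory Num.Theory.
Import numFieldNormedType.Exports.

Local Open Scope classical_set_scope.
Local Open Scope ring_scope.

(** The Jacobian vanishes on [E], so [Df] has rank less than [n] there, and it is
    enough to show that [{rank Df = k}] is null whenever [1 <= n - k <= m]. Put
    [m' = n - k]. Up to a null set, [Omega] is a countable union of compact sets on
    which [f] differs from its linearization at any point of the set by at most
    [eps |y - x|]. After permuting coordinates, write [f = (f1, f2)] with [f1] the
    first [k] components, chosen so that on the set under consideration [Df2] is a
    combination of [Df1], and [x = (x1, x2)] so that [x |-> (f1 x, x2)] is
    bi-Lipschitz on the pieces. Along the fibre [f1 = y], the Lipschitz constant of
    [x2 |-> f2 x] is [O(eps)] on finer and finer pieces, hence the values of [f2] on
    the fibre form a null set [N_y] of [R^m']. For almost every [y] the slice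
    [z |-> (f^-1 (y, z))_2] is a continuous Sobolev map on an open subset of [R^m'],
    and as [q > m'], or [q = m'] and the slice is Hoelder continuous, it maps null
    sets to null sets. So the fibres have null [x2]-projections, and Fubini
    concludes.

    Lusin's condition for a map [h] with upper gradient [G] in [L^n(R^n)] follows from a
    Poincare inequality between two level sets of [|h - h x|] at a scale where their
    measures are comparable, and a Vitali covering in the image. The
    set [f(Omega)] is open by invariance of domain, for which the zero-finding step
    (Poincare-Miranda) is a mod 2 cup product of cochains on a grid. *)

(** * Lebesgue measure on row vectors *)

(** The hypothesis on [q] passes from [m] to every [m' <= m]: if [m' < m] then [q > m'], so Hoelder
    continuity only serves the critical case [q = m' = m]. A map in [W^{1,1}] need not be
    differentiable almost everywhere, so the linearization is built from one-variable derivatives: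
    absolute continuity on lines gives difference quotients along each axis, uniform on countably
    many pieces, and density points join two points of a piece by moves parallel to the axes. The
    exponent matters only for Lusin's condition. There each point needs a scale at which
    [|h - h x| >= rho] still fills a fixed share of a cube, while [|h - h x| <= la * rho] already
    fills a fixed share of the cube of half the size. Without it, [|h - h x| >= c * la ^ j] would
    hold on half of the cube of radius [2 ^ -j] for all large [j]. For [la] close to 1, Hoelder
    continuity excludes this at once, and for [q > n] an iteration of the Poincare inequality does.
    Truncating [|h - h x|] confines the integral of [G ^ n] to the preimage of the ball of radius
    [rho], so that the estimates over disjoint balls add up. *)

Lemma natSinv_lt (R : realType) (e : R) : 0 < e -> exists k, k.+1%:R^-1 < e.
Proof.
move=> e0; have [k _ /(_ k (leqnn k))] := near_infty_natSinv_lt (PosNum e0).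
by exists k.
Qed.

Section rV_norm.
Context (R : realType) (n : nat).
Implicit Types x y : 'rV[R]_n.

Lemma ler_coord_norm x i : `|x ord0 i| <= `|x|.
Proof.
rewrite [leRHS]/Num.norm /= mx_normrE.
by apply: (@le_bigmax _ _ _ 0 (fun ij : 'I_1 * 'I_n => `|x ij.1 ij.2|) (ord0, i)).
Qed.

Lemma norm_rV_le x (c : R) : 0 <= c -> (forall i, `|x ord0 i| <= c) -> `|x| <= c.
Proof.
move=> c0 xc; rewrite [leLHS]/Num.norm /= mx_normrE; apply/bigmax_leP; split => //.
by move=> [i j] _ /=; rewrite ord1.
Qed.

Lemma norm_rV_lt x (c : R) : 0 < c -> (forall i, `|x ord0 i| < c) -> `|x| < c.
Proof.
move=> c0 xc; rewrite [ltLHS]/Num.norm /= mx_normrE; apply/bigmax_ltP; split => //.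
by move=> [i j] _ /=; rewrite ord1.
Qed.

Lemma open_ballP (U : set 'rV[R]_n) x : open U -> U x ->
  exists2 e : R, 0 < e & forall y, `|y - x| < e -> U y.
Proof.
move=> oU Ux; have /nbhs_ballP[e e0 eU] := open_nbhs_nbhs (conj oU Ux).
by exists e => // y yx; apply: eU; rewrite -ball_normE /ball_ /= distrC.
Qed.

Lemma ballP_open (U : set 'rV[R]_n) :
  (forall x, U x -> exists2 e : R, 0 < e & forall y, `|y - x| < e -> U y) -> open U.
Proof.
move=> UU; rewrite openE => x /UU[e e0 eU]; apply/nbhs_ballP; exists e => //.
by move=> y; rewrite -ball_normE /ball_ /= distrC => /eU.
Qed.

End rV_norm.

Lemma le_meas d (T : measurableType d) (R : realType) (m : {measure set T -> \bar R})
    (A B : set T) : measurable A -> measurable B -> A `<=` B -> (m A <= m B)%E.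
Proof. by move=> mA mB AB; apply: le_measure => //; exact/mem_set. Qed.

Lemma meas_bigcup_le d (T : measurableType d) (R : realType) (m : {measure set T -> \bar R})
    (F : nat -> set T) : (forall k, measurable (F k)) ->
  (m (\bigcup_k F k) <= \sum_(k <oo) m (F k))%E.
Proof.
move=> mF; apply: measure_sigma_subadditive => //; exact: bigcup_measurable.
Qed.

Lemma open_norm_lt (R : realType) n (c : 'rV[R]_n) (r : R) : open [set x | `|x - c| < r].
Proof.
apply: ballP_open => x /= xr; exists (r - `|x - c|); first by rewrite subr_gt0.
move=> y; rewrite ltrBrDr; apply: le_lt_trans.
by rewrite (le_trans _ (ler_normD _ _))// addrA subrK.
Qed.

Section rV_measurable.
Context (R : realType) (n : nat).
Implicit Types (x y : 'rV[R]_n) (A : 'I_n -> set R).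

Definition rbox A : set 'rV[R]_n := [set x | forall i, A i (x ord0 i)].

Lemma measurable_coordT i : measurable_fun [set: 'rV[R]_n] (fun x => x ord0 i : R).
Proof. exact: measurable_coord. Qed.

Lemma measurable_rbox A : (forall i, measurable (A i)) -> measurable (rbox A).
Proof.
move=> mA; rewrite (_ : rbox A = \bigcap_(i in [set: 'I_n])
    ((fun x : 'rV[R]_n => x ord0 i) @^-1` A i)).
  apply: fin_bigcap_measurable => // i _.
  by rewrite -[X in measurable X]setTI; apply: measurable_coordT.
by apply/seteqP; split => [x h i _|x h i]; [exact: h|exact: (h i I)].
Qed.

Definition rcube (c : 'rV[R]_n) (r : R) : set 'rV[R]_n :=
  rbox (fun i => `[c ord0 i - r, c ord0 i + r]%classic).

Lemma rcubeP (c x : 'rV[R]_n) r : 0 <= r -> rcube c r x <-> `|x - c| <= r.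
Proof.
move=> r0; split => [h|h i].
  apply: norm_rV_le => // i; have := h i; rewrite /= in_itv/= !mxE => /andP[? ?].
  by rewrite ler_distl; apply/andP.
have := le_trans (ler_coord_norm (x - c) i) h.
by rewrite !mxE ler_distl /= in_itv.
Qed.

Lemma compact_rcube c r : compact (rcube c r).
Proof. by apply: rV_compact => i; exact: segment_compact. Qed.

Lemma measurable_rcube c r : measurable (rcube c r).
Proof. by apply: measurable_rbox => i; exact: measurable_itv. Qed.

Lemma dist_lt_mid (a x y k e : R) : k < e / 2 -> a - k < x < a + k ->
  a - k < y < a + k -> `|y - x| < e.
Proof. by move=> ke /andP[? ?] /andP[? ?]; rewrite ltr_norml; apply/andP; split; lra. Qed.

Definition rat_box (p : 'rV[rat]_n * nat) : set 'rV[R]_n :=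
  rbox (fun i => `](ratr (p.1 ord0 i) - p.2.+1%:R^-1), (ratr (p.1 ord0 i) + p.2.+1%:R^-1)[%classic).

Lemma open_rV_ratP (U : set 'rV[R]_n) x : open U -> U x ->
  exists p, rat_box p x /\ rat_box p `<=` U.
Proof.
move=> oU Ux.
have [e e0 eU] := open_ballP oU Ux.
have [k ke] : exists k, k.+1%:R^-1 < e / 2 :> R by apply: natSinv_lt; rewrite divr_gt0.
have k0 : 0 < k.+1%:R^-1 :> R by rewrite invr_gt0.
have /choice[c cP] : forall i, exists q : rat, ratr q \in `](x ord0 i - k.+1%:R^-1)%R, (x ord0 i + k.+1%:R^-1)%R[.
  by move=> i; apply: rat_in_itvoo; rewrite ltrBlDr -addrA ltrDl addr_gt0.
have xin : rat_box (\row_i c i, k) x.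
  by move=> i; have := cP i; rewrite /rat_box /= !in_itv/= mxE => /andP[h1 h2]; rewrite ltrBlDr h2 /= -ltrBlDr h1.
exists (\row_i c i, k); split => // y yin; apply: eU.
apply: norm_rV_lt => // i; have := yin i; have := xin i.
rewrite /= !in_itv/= !mxE; exact: dist_lt_mid.
Qed.

(** Boxes with rational centres and radii [1/(k+1)] form a countable base, so open sets belong to
    the sigma-algebra generated by the coordinates. *)
Lemma open_rV_ratE (U : set 'rV[R]_n) : open U ->
  U = \bigcup_(p : 'rV[rat]_n * nat)
   (if `[< rat_box p `<=` U >] then rat_box p else set0).
Proof.
move=> oU; apply/seteqP; split => [x Ux|x [p _ /=]]; last first.
  by case: ifPn => // /asboolP; exact.
have [p [px pU]] := open_rV_ratP oU Ux; exists p => //.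
by case: ifPn => // /asboolP.
Qed.

Lemma open_rV_measurable (U : set 'rV[R]_n) : open U -> measurable U.
Proof.
move=> /open_rV_ratE ->; apply: countable_bigcupT_measurable.
  exact: countableP.
move=> p; case: ifP => // _; apply: measurable_rbox => i; exact: measurable_itv.
Qed.

Lemma closed_rV_measurable (U : set 'rV[R]_n) : closed U -> measurable U.
Proof.
by move=> cU; rewrite -(setCK U); apply: measurableC; apply: open_rV_measurable; exact: closed_openC.
Qed.

Lemma compact_rV_closed (K : set 'rV[R]_n) : compact K -> closed K.
Proof. by apply: compact_closed; exact: norm_hausdorff. Qed.

Lemma compact_rV_measurable (K : set 'rV[R]_n) : compact K -> measurable K.
Proof. by move=> /compact_rV_closed/closed_rV_measurable. Qed.

Lemma open_continuous_measurable_rV (U : set 'rV[R]_n) (f : 'rV[R]_n -> R) :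
  open U -> (forall x, U x -> {for x, continuous f}) -> measurable_fun U f.
Proof.
move=> oU cf; apply: (measurability _ (RGenOpens.measurableE R)).
move=> _ [_ [a [b ->]] <-]; apply: open_rV_measurable.
rewrite openE => x [Ux fx]; apply: filterI; first exact: open_nbhs_nbhs.
by apply: (cf x Ux); apply: open_nbhs_nbhs; split => //; exact: itv_open.
Qed.

Lemma continuous_measurable_rV (f : 'rV[R]_n -> R) :
  continuous f -> measurable_fun setT f.
Proof.
by move=> cf; apply: open_continuous_measurable_rV => [|x _]; [exact: openT|exact: cf].
Qed.

Lemma measurable_fun_to_rV d (T : measurableType d) (D : set T) (f : T -> 'rV[R]_n) :
  (forall i, measurable_fun D (fun t => f t ord0 i)) -> measurable_fun D f.
Proof.
move=> mf mD A.
apply: (smallest_sub (X := [set A | measurable (D `&` f @^-1` A)])).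
  split => [|B mB|F mF] /=.
  - by rewrite preimage_set0 setI0.
  - rewrite setTD preimage_setC -setDE (_ : _ `\` _ = D `\` (D `&` f @^-1` B)); first exact: measurableD.
    by rewrite setDIr setDv set0U.
  - by rewrite preimage_bigcup setI_bigcupr; exact: bigcupT_measurable.
move=> B; rewrite -bigcup_seq/= => -[i _ [C mC <-]] /=.
by rewrite setTI; exact: mf.
Qed.

End rV_measurable.

(* [leb] is [lebesgue_rV] behind a name to which instances can be attached. *)
Definition leb (R : realType) n : set 'rV[R]_n -> \bar R := lebesgue_rV R n.

HB.instance Definition _ (R : realType) n :=
  Measure.copy (@leb R n) (lebesgue_rV R n).

Section leb.
Context (R : realType).

Lemma leb_rbox n (A : 'I_n -> set R) : (forall i, measurable (A i)) ->
  leb (rbox A) = (\prod_(i < n) lebesgue_measure (A i))%E.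
Proof. by move=> mA; exact: lebesgue_rV_box. Qed.

Lemma leb_itv_box n (a b : 'I_n -> R) : (forall i, a i <= b i) ->
  leb (rbox (fun i => `[a i, b i]%classic)) = (\prod_(i < n) (b i - a i))%:E.
Proof.
move=> ab; rewrite leb_rbox; last by move=> i; exact: measurable_itv.
rewrite -prodEFin; apply: eq_bigr => i _.
rewrite lebesgue_measure_itv/= lte_fin; case: ltP => [//|ba].
by rewrite (_ : b i = a i) ?subrr//; apply/eqP; rewrite eq_le ba ab.
Qed.

Lemma leb_rcube n (c : 'rV[R]_n) (r : R) : 0 <= r -> leb (rcube c r) = ((r *+ 2) ^+ n)%:E.
Proof.
move=> r0; rewrite leb_itv_box => [|i]; last by rewrite lerBlDr -addrA lerDl addr_ge0.
congr (_%:E); rewrite (eq_bigr (fun=> r *+ 2)) => [|i _].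
  by rewrite prodr_const card_ord.
by rewrite opprB addrC addrA subrK mulr2n.
Qed.

Lemma bigcup_rcube n : \bigcup_k (@rcube R n 0 k%:R) = setT.
Proof.
apply/seteqP; split => // x _; exists (`|Num.floor `|x| |.+1)%N => //.
apply/rcubeP => //; rewrite subr0.
rewrite -natr1 natr_absz ger0_norm ?floor_ge0//.
by have := floorD1_gt `|x|; rewrite intrD1 => /ltW.
Qed.

Lemma leb_sigma_finite n : sigma_finite [set: 'rV[R]_n] (@leb R n).
Proof.
exists (fun k : nat => rcube 0 k%:R); first by rewrite bigcup_rcube.
move=> k; split; first exact: measurable_rcube.
by rewrite leb_rcube// ltry.
Qed.

HB.instance Definition _ n :=
  Measure_isSigmaFinite.Build _ _ _ (@leb R n) (@leb_sigma_finite n).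

(** Boxes with measurable sides form a generating family stable under intersections, and cubes of
    finite measure exhaust the space. The changes of coordinates [leb_ins] and [leb_joinp] reduce to
    boxes through it. *)
Lemma leb_unique n (m : {measure set 'rV[R]_n -> \bar R}) :
  (forall A, (forall i, measurable (A i)) ->
    m (rbox A) = (\prod_(i < n) lebesgue_measure (A i))%E) ->
  forall A, measurable A -> leb A = m A.
Proof.
move=> mbox A mA.
pose G := [set B : set 'rV[R]_n | exists2 A, (forall i, measurable (A i)) & B = rbox A].
apply: (measure_unique G (fun k : nat => rcube 0 k%:R)) => //.
- apply/seteqP; split; last first.
    apply: smallest_sub; first exact: sigma_algebra_measurable.
    by move=> _ [B mB ->]; exact: measurable_rbox.
  apply: smallest_sub; first exact: smallest_sigma_algebra.
  move=> B; rewrite -bigcup_seq/= => -[i _ [C mC <-]] /=; rewrite setTI.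
  apply: sub_sigma_algebra.
  exists (fun j => if j == i then C else setT).
    by move=> j; case: ifP.
  apply/seteqP; split => [x Cx j|x /(_ i)]; first by case: eqVneq => // ->.
  by rewrite eqxx.
- move=> _ _ [B mB ->] [C mC ->]; exists (fun i => B i `&` C i).
    by move=> i; exact: measurableI.
  by apply/seteqP; split => [x [h1 h2] i|x h]; split => // i; have [] := h i.
- by move=> k; exists (fun i => `[(0 : 'rV[R]_n) ord0 i - k%:R, (0 : 'rV[R]_n) ord0 i + k%:R]%classic).
- exact: bigcup_rcube.
- by move=> _ [B mB ->]; rewrite mbox//; exact: leb_rbox.
- by move=> k; rewrite [ltLHS](leb_rcube 0)// ltry.
Qed.

(** [cons_rV] with the new coordinate at an arbitrary position [j]: it gives Fubini along every
    axis, not only along the one by which the measure is built. *)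
Definition ins n (j : 'I_n.+1) (z : 'rV[R]_n * measurableTypeR R) : 'rV[R]_n.+1 :=
  \row_i oapp (z.1 ord0) z.2 (unlift j i).

Lemma insE n (j : 'I_n.+1) z : ins j z ord0 j = z.2.
Proof. by rewrite mxE unlift_none. Qed.

Lemma ins_lift n (j : 'I_n.+1) z i : ins j z ord0 (lift j i) = z.1 ord0 i.
Proof. by rewrite mxE liftK. Qed.

Lemma measurable_ins n (j : 'I_n.+1) : measurable_fun setT (ins j).
Proof.
apply: measurable_fun_to_rV => i; case: (unliftP j i) => [k|] ->.
  under eq_fun do rewrite ins_lift.
  by apply: (measurableT_comp (measurable_coordT k)); exact: measurable_fst.
by under eq_fun do rewrite insE; exact: measurable_snd.
Qed.

Lemma ins_rbox n (j : 'I_n.+1) (A : 'I_n.+1 -> set R) :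
  ins j @^-1` rbox A = rbox (fun i => A (lift j i)) `*` A j.
Proof.
apply/seteqP; split => [[x t]|[x t] [/= h h0] i] /=.
  move=> h; split => [i|] /=; first by have := h (lift j i); rewrite ins_lift.
  by have := h j; rewrite insE.
by case: (unliftP j i) => [k|] ->; rewrite ?ins_lift ?insE//; exact: h.
Qed.

Lemma leb_ins n (j : 'I_n.+1) (A : set 'rV[R]_n.+1) : measurable A ->
  leb A = (leb (n:=n) \x (@lebesgue_measure R))%E (ins j @^-1` A).
Proof.
pose m : {measure set 'rV[R]_n.+1 -> \bar R} :=
  measure_function_pushforward__canonical__measure_function_Measure (leb (n:=n) \x (@lebesgue_measure R))%E (measurable_ins j).
move=> mA; rewrite (@leb_unique _ m)// => {mA}A mA.
rewrite /m /= /pushforward ins_rbox.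
have mA' : measurable (rbox (fun i => A (lift j i))) by exact: measurable_rbox.
rewrite (product_measure1E (leb (n:=n)) (@lebesgue_measure R) mA' (mA j)).
by rewrite (bigD1_ord j)//= muleC; congr (_ * _)%E; exact: leb_rbox.
Qed.

(** Fubini for a splitting into [k] and [m] coordinates chosen by the permutation [s]: coordinate
    [i] of the point is entry [s i] of the concatenation. The image and the domain of [f] will be
    split by different permutations. *)
Definition joinp k m (s : {perm 'I_(k + m)}) (z : 'rV[R]_k * 'rV[R]_m) : 'rV[R]_(k + m) :=
  \row_i row_mx z.1 z.2 ord0 (s i).

Lemma joinpl k m (s : {perm 'I_(k + m)}) z i : joinp s z ord0 ((s^-1)%g (lshift m i)) = z.1 ord0 i.
Proof. by rewrite mxE permKV row_mxEl. Qed.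

Lemma joinpr k m (s : {perm 'I_(k + m)}) z i : joinp s z ord0 ((s^-1)%g (rshift k i)) = z.2 ord0 i.
Proof. by rewrite mxE permKV row_mxEr. Qed.

Lemma joinp_ind k m (s : {perm 'I_(k + m)}) (P : 'I_(k + m) -> Prop) :
  (forall i, P ((s^-1)%g (lshift m i))) -> (forall i, P ((s^-1)%g (rshift k i))) ->
  forall i, P i.
Proof.
move=> Pl Pr i; rewrite -(permK s i).
by case: (splitP (s i)) => j ej;
  [rewrite (_ : s i = lshift m j)//|rewrite (_ : s i = rshift k j)//]; apply/val_inj.
Qed.

Lemma measurable_joinp k m (s : {perm 'I_(k + m)}) : measurable_fun setT (joinp s).
Proof.
apply: measurable_fun_to_rV; apply: (joinp_ind (s := s)) => i.
  under eq_fun do rewrite joinpl.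
  by apply: (measurableT_comp (measurable_coordT i)); exact: measurable_fst.
under eq_fun do rewrite joinpr.
by apply: (measurableT_comp (measurable_coordT i)); exact: measurable_snd.
Qed.

Lemma joinp_rbox k m (s : {perm 'I_(k + m)}) (A : 'I_(k + m) -> set R) :
  joinp s @^-1` rbox A = rbox (fun i => A ((s^-1)%g (lshift m i))) `*`
                         rbox (fun i => A ((s^-1)%g (rshift k i))).
Proof.
apply/seteqP; split => [[x t] h|[x t] [/= h1 h2]] /=.
  split => i /=; first by rewrite -(joinpl s (x, t)); exact: h.
  by rewrite -(joinpr s (x, t)); exact: h.
by apply: (joinp_ind (s := s)) => i; rewrite ?joinpl ?joinpr.
Qed.

Lemma leb_joinp k m (s : {perm 'I_(k + m)}) (A : set 'rV[R]_(k + m)) : measurable A ->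
  leb A = (leb (n:=k) \x leb (n:=m))%E (joinp s @^-1` A).
Proof.
pose mm : {measure set 'rV[R]_(k + m) -> \bar R} :=
  measure_function_pushforward__canonical__measure_function_Measure (leb (n:=k) \x leb (n:=m))%E (measurable_joinp s).
move=> mA; rewrite (@leb_unique _ mm)// => {mA}A mA.
rewrite /mm /= /pushforward joinp_rbox.
have m1 : measurable (rbox (fun i => A ((s^-1)%g (lshift m i)))) by exact: measurable_rbox.
have m2 : measurable (rbox (fun i => A ((s^-1)%g (rshift k i)))) by exact: measurable_rbox.
rewrite (product_measure1E (leb (n:=k)) (leb (n:=m)) m1 m2).
rewrite [X in (X * _)%E]leb_rbox// [X in (_ * X)%E]leb_rbox// [RHS](reindex_inj (@perm_inj _ (s^-1)%g)) big_split_ord //.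
Qed.

End leb.

(** * Null sets in products *)

Section product_ae.
Local Open Scope ereal_scope.
Context d1 d2 (T1 : measurableType d1) (T2 : measurableType d2) (R : realType).
Variable m1 : {sigma_finite_measure set T1 -> \bar R}.
Variable m2 : {sigma_finite_measure set T2 -> \bar R}.

Lemma product_null_ae (A : set (T1 * T2)) : measurable A -> (m1 \x m2) A = 0 ->
  {ae m1, forall x, m2 (xsection A x) = 0}.
Proof.
move=> mA A0.
have mf : measurable_fun setT (m2 \o xsection A) by exact: measurable_fun_xsection.
have /(ae_eq_integral_abs _ measurableT mf) : \int[m1]_x `|(m2 \o xsection A) x| = 0.
  by rewrite -A0; apply: eq_integral => x _; rewrite gee0_abs.
by apply: filterS => x /(_ I).
Qed.

Lemma ae_product_null (A : set (T1 * T2)) : measurable A ->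
  {ae m1, forall x, m2 (xsection A x) = 0} -> (m1 \x m2) A = 0.
Proof.
move=> mA A0.
have mf : measurable_fun setT (m2 \o xsection A) by exact: measurable_fun_xsection.
transitivity (\int[m1]_x `|(m2 \o xsection A) x|).
  by apply: eq_integral => x _; rewrite gee0_abs.
by apply/(ae_eq_integral_abs _ measurableT mf); apply: filterS A0 => x + _.
Qed.

Lemma ae_prod (P : T1 * T2 -> Prop) : {ae m1 \x m2, forall z, P z} ->
  {ae m1, forall x, {ae m2, forall y, P (x, y)}}.
Proof.
move=> [N [mN N0 PN]]; apply: filterS (product_null_ae mN N0) => x Nx0.
exists (xsection N x); split => //; first exact: measurable_xsection.
by move=> y /= Pxy; apply/xsectionP; exact: PN.
Qed.

(** Null sections make a set null only if it is measurable; applications therefore rewrite their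
    predicate by countable unions and intersections first. *)
Lemma ae_prodP (P : T1 * T2 -> Prop) : measurable [set z | P z] ->
  {ae m1, forall x, {ae m2, forall y, P (x, y)}} -> {ae m1 \x m2, forall z, P z}.
Proof.
move=> mP PP; exists (~` [set z | P z]); split => //; first exact: measurableC.
apply: ae_product_null; first exact: measurableC.
apply: filterS PP => x [N [mN N0 PN]].
apply: (subset_measure0 _ mN _ N0); first by apply: measurable_xsection; exact: measurableC.
by move=> y /xsectionP /= nP; exact: PN.
Qed.

Lemma ae_prod_fst (P : T1 -> Prop) : {ae m1, forall x, P x} ->
  {ae m1 \x m2, forall z, P z.1}.
Proof.
move=> [N [mN N0 PN]]; exists (N `*` setT); split; first exact: measurableX.
  transitivity (m1 N * m2 setT); last by rewrite N0 mul0e.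
  exact: product_measure1E.
by move=> [x y] /= /PN.
Qed.

End product_ae.

Section leb_ae.
Context (R : realType).
Local Notation lm := (@lebesgue_measure R).

Definition del n (j : 'I_n.+1) (x : 'rV[R]_n.+1) : 'rV[R]_n := \row_i x ord0 (lift j i).

Lemma insK n (j : 'I_n.+1) z : (del j (ins j z), ins j z ord0 j) = z.
Proof.
case: z => x t; congr pair; last by rewrite insE.
by apply/rowP => i; rewrite mxE ins_lift.
Qed.

Lemma delK n (j : 'I_n.+1) x : ins j (del j x, x ord0 j) = x.
Proof.
by apply/rowP => i; case: (unliftP j i) => [k|] ->; rewrite ?ins_lift ?insE ?mxE.
Qed.

Definition upd n (x : 'rV[R]_n) (j : 'I_n) (t : R) : 'rV[R]_n :=
  \row_i if i == j then t else x ord0 i.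

Lemma upd_ins n (x : 'rV[R]_n.+1) j t : upd x j t = ins j (del j x, t).
Proof.
apply/rowP => i; case: (unliftP j i) => [k|] ->; rewrite ?ins_lift ?insE !mxE ?eqxx//.
by rewrite eq_sym (negbTE (neq_lift _ _)).
Qed.

Lemma upd_insE n (z : 'rV[R]_n * measurableTypeR R) (j : 'I_n.+1) t : upd (ins j z) j t = ins j (z.1, t).
Proof. by rewrite upd_ins; have := insK j z; case: z => a b /= [-> _]. Qed.

Lemma upd_same n (x : 'rV[R]_n) j : upd x j (x ord0 j) = x.
Proof. by apply/rowP => i; rewrite mxE; case: eqVneq => // ->. Qed.

Lemma updE n (x : 'rV[R]_n) j t : upd x j t ord0 j = t.
Proof. by rewrite mxE eqxx. Qed.

Lemma updE_neq n (x : 'rV[R]_n) j t i : i != j -> upd x j t ord0 i = x ord0 i.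
Proof. by move=> ij; rewrite mxE (negbTE ij). Qed.

Lemma measurable_del n (j : 'I_n.+1) : measurable_fun setT (del j).
Proof.
apply: measurable_fun_to_rV => i; under eq_fun do rewrite mxE.
exact: measurable_coordT.
Qed.

Lemma measurable_delp n (j : 'I_n.+1) :
  measurable_fun setT (fun x => (del j x, x ord0 j : measurableTypeR R)).
Proof.
by apply: measurable_fun_pair; [exact: measurable_del|exact: measurable_coordT].
Qed.

Lemma ae_ins n (j : 'I_n.+1) (P : 'rV[R]_n.+1 -> Prop) :
  {ae leb (n:=n.+1), forall x, P x} <->
  {ae (leb (n:=n) \x lm)%E, forall z, P (ins j z)}.
Proof.
split=> [[N [mN N0 PN]]|[N [mN N0 PN]]].
  exists (ins j @^-1` N); split.
  - by rewrite -[X in measurable X]setTI; exact: measurable_ins.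
  - by rewrite -leb_ins.
  - by move=> z /= /PN.
exists ((fun x => (del j x, x ord0 j : measurableTypeR R)) @^-1` N).
have mN' : measurable ((fun x => (del j x, x ord0 j : measurableTypeR R)) @^-1` N).
  by rewrite -[X in measurable X]setTI; exact: measurable_delp.
split => //.
- rewrite (leb_ins j)// -comp_preimage (_ : _ \o _ = id) ?preimage_id//.
  by apply/funext => z /=; rewrite insK.
- by move=> x /= Px; apply: PN; rewrite /= delK.
Qed.

Lemma ae_joinp k m (s : {perm 'I_(k + m)}) (P : 'rV[R]_(k + m) -> Prop) :
  {ae leb (n:=k + m), forall x, P x} ->
  {ae leb (n:=k), forall y, {ae leb (n:=m), forall z, P (joinp s (y, z))}}.
Proof.
move=> [N [mN N0 PN]]; apply: (@ae_prod _ _ _ _ _ _ _ (P \o joinp s)).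
exists (joinp s @^-1` N); split.
- by rewrite -[X in measurable X]setTI; exact: measurable_joinp.
- by rewrite -leb_joinp.
- by move=> z /= /PN.
Qed.

Lemma leb_joinp0 k m (s : {perm 'I_(k + m)}) (A : set 'rV[R]_(k + m)) : measurable A ->
  {ae leb (n:=k), forall y, (leb (n:=m)).-negligible [set z | A (joinp s (y, z))]} ->
  leb A = 0%E.
Proof.
move=> mA A0; rewrite (leb_joinp s)//; apply: ae_product_null.
  by rewrite -[X in measurable X]setTI; exact: measurable_joinp.
have mA' : measurable (joinp s @^-1` A).
  by rewrite -[X in measurable X]setTI; exact: measurable_joinp.
apply: filterS A0 => y /negligibleP Ay.
rewrite (_ : xsection _ _ = [set z | A (joinp s (y, z))]).
  apply: Ay; rewrite (_ : mkset _ = xsection (joinp s @^-1` A) y).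
    exact: measurable_xsection.
  by apply/seteqP; split => [z Az|z /xsectionP//]; apply/xsectionP.
by apply/seteqP; split => [z /xsectionP//|z Az]; apply/xsectionP.
Qed.

Lemma integral_ins n (j : 'I_n.+1) (f : 'rV[R]_n.+1 -> \bar R) :
  measurable_fun setT f -> (forall x, 0 <= f x)%E ->
  (\int[leb (n:=n.+1)]_x f x = \int[leb (n:=n)]_x \int[lm]_t f (ins j (x, t)))%E.
Proof.
move=> mf f0.
transitivity (\int[(leb (n:=n) \x lm)]_z f (ins j z))%E; last first.
  rewrite fubini_tonelli1//.
  by apply: measurableT_comp => //; exact: measurable_ins.
transitivity (\int[measure_function_pushforward__canonical__measure_function_Measure (leb (n:=n) \x lm)%E (measurable_ins j)]_x f x)%E.
  by apply: eq_measure_integral => A mA _; exact: leb_ins.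
exact: (ge0_integral_pushforward (measurable_ins j) _ measurableT mf).
Qed.

Lemma integral_joinp k m (s : {perm 'I_(k + m)}) (f : 'rV[R]_(k + m) -> \bar R) :
  measurable_fun setT f -> (forall x, 0 <= f x)%E ->
  (\int[leb (n:=k + m)]_x f x = \int[leb (n:=k)]_y \int[leb (n:=m)]_z f (joinp s (y, z)))%E.
Proof.
move=> mf f0.
transitivity (\int[(leb (n:=k) \x leb (n:=m))]_z f (joinp s z))%E; last first.
  rewrite fubini_tonelli1//.
  by apply: measurableT_comp => //; exact: measurable_joinp.
transitivity (\int[measure_function_pushforward__canonical__measure_function_Measure (leb (n:=k) \x leb (n:=m))%E (measurable_joinp s)]_x f x)%E.
  by apply: eq_measure_integral => A mA _; exact: leb_joinp.
exact: (ge0_integral_pushforward (measurable_joinp s) _ measurableT mf).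
Qed.

End leb_ae.

(** * Regularity of Lebesgue measure *)

Section regularity.
Context (R : realType) (n : nat).
Local Open Scope ereal_scope.

Section finite.
Variable m : {finite_measure set 'rV[R]_n -> \bar R}.

Definition regular_set (A : set 'rV[R]_n) := forall e : R, (0 < e)%R ->
  exists F U, [/\ closed F, open U, F `<=` A, A `<=` U & m (U `\` F) < e%:E].

Lemma regular_setC A : regular_set A -> regular_set (~` A).
Proof.
move=> rA e e0; have [F [U [cF oU FA AU m0]]] := rA e e0.
exists (~` U), (~` F); split.
- exact: open_closedC.
- exact: closed_openC.
- exact: subsetC.
- exact: subsetC.
- by rewrite setDE setCK setIC -setDE.
Qed.

Lemma cvg_lt_decr (F : nat -> set 'rV[R]_n) (e : R) : (0 < e)%R ->
  (forall k, measurable (F k)) -> (forall k, F k.+1 `<=` F k) ->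
  \bigcap_k F k = set0 -> exists k, m (F k) < e%:E.
Proof.
move=> e0 mF dF F0.
have := @nonincreasing_cvg_mu _ _ _ m F.
rewrite F0 measure0 => /(_ _ mF measurable0).
have m0oo : m (F 0%N) < +oo by rewrite ltey_eq fin_num_measure.
have ni : nonincreasing_seq F by apply/nonincreasing_seqP => k; apply/subsetPset.
move=> /(_ m0oo ni) /fine_cvgP[_ /cvgrPdist_lt /(_ _ e0)[k _ /(_ k (leqnn k))]].
rewrite sub0r normrN /= => mk; exists k.
rewrite -[ltLHS]fineK ?fin_num_measure// lte_fin.
by apply: le_lt_trans mk; exact: ler_norm.
Qed.

Lemma regular_bigcup (F : nat -> set 'rV[R]_n) :
  (forall k, regular_set (F k)) -> regular_set (\bigcup_k F k).
Proof.
move=> rF e e0.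
have e20 : (0 < e / 2)%R by rewrite divr_gt0.
have /choice[C CP] : forall k, exists CU : set 'rV[R]_n * set 'rV[R]_n,
    [/\ closed CU.1, open CU.2, CU.1 `<=` F k, F k `<=` CU.2 &
      m (CU.2 `\` CU.1) < (e / 2 / (2 ^ k.+1)%:R)%:E].
  move=> k; have [|K [U H]] := rF k (e / 2 / (2 ^ k.+1)%:R)%R.
    by rewrite divr_gt0// ltr0n expn_gt0.
  by exists (K, U).
have mC k : measurable (C k).1 by have [/closed_rV_measurable] := CP k.
have mU k : measurable (C k).2 by have [_ /open_rV_measurable] := CP k.
(* An infinite union of closed sets need not be closed. [H N] is what is lost by keeping only the
   first [N] of them; it decreases to the empty set, which costs the second half of [e]. *)
pose H N := \bigcup_k (C k).1 `\` \bigcup_(k in `I_N) (C k).1.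
have [N|N||N HN] := @cvg_lt_decr H (e / 2) e20.
- apply: measurableD; first exact: bigcup_measurable.
  exact: bigcup_measurable.
- move=> x [Ux Nx]; split => // -[k /= kN Cx]; apply: Nx.
  by exists k => //=; rewrite (leq_trans kN).
- apply/seteqP; split => // x Hx; have [[k _ Ck] _] := Hx 0%N I.
  by have [_] := Hx k.+1 I; apply; exists k => /=.
exists (\bigcup_(k in `I_N) (C k).1), (\bigcup_k (C k).2); split.
- by apply: closed_bigcup => //= k _; have [] := CP k.
- by apply: bigcup_open => k _; have [] := CP k.
- by move=> x [k _ Ck]; exists k => //; have [_ _ + _ _] := CP k; apply.
- by move=> x [k _ Ck]; exists k => //; have [_ _ _ + _] := CP k; apply.
apply: (@le_lt_trans _ _ (m (\bigcup_k ((C k).2 `\` (C k).1) `|` H N))).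
  apply: le_meas.
  - by apply: measurableD; apply: bigcup_measurable.
  - apply: measurableU; first by apply: bigcup_measurable => k _; exact: measurableD.
    by apply: measurableD; apply: bigcup_measurable.
  move=> x [[k _ Uk] nx]; have [[l _ Cl]|nC] := pselect ((\bigcup_k (C k).1) x).
    by right; split => //; exists l.
  by left; exists k => //; split => // Ck; apply: nC; exists k.
apply: (le_lt_trans (measureU2 _ _ _)).
- by apply: bigcup_measurable => k _; exact: measurableD.
- by apply: measurableD; apply: bigcup_measurable.
rewrite (_ : e = e / 2 + e / 2)%R; last by rewrite -splitr.
rewrite EFinD lee_ltD//.
  by apply: fin_num_measure; apply: bigcup_measurable => k _; exact: measurableD.
have mD k : measurable ((C k).2 `\` (C k).1) by exact: measurableD.
apply: (le_trans (meas_bigcup_le _ mD)).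
apply: le_trans (epsilon_trick0 xpredT (ltW e20)).
by apply: lee_nneseries => // k _; apply: ltW; have [] := CP k.
Qed.

Lemma regular_coord_ray i (a : R) : regular_set [set x | (a <= x ord0 i)%R].
Proof.
move=> e e0.
have cF : closed [set x : 'rV[R]_n | (a <= x ord0 i)%R].
  rewrite (_ : mkset _ = (fun x : 'rV[R]_n => x ord0 i) @^-1` [set t | (a <= t)%R])//.
  by apply: closed_comp; [move=> x _; exact: coord_continuous|exact: closed_ge].
pose U k := [set x : 'rV[R]_n | (a - k.+1%:R^-1 < x ord0 i)%R].
have oU k : open (U k).
  rewrite (_ : U k = (fun x : 'rV[R]_n => x ord0 i) @^-1` [set t | (a - k.+1%:R^-1 < t)%R])//.
  by apply: open_comp; [move=> x _; exact: coord_continuous|exact: open_gt].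
have [k|k||k mk] := @cvg_lt_decr (fun k => U k `\` [set x | (a <= x ord0 i)%R]) e e0.
- apply: measurableD; first exact: open_rV_measurable.
  exact: closed_rV_measurable.
- move=> x [Ux Nx]; split => //; apply: le_lt_trans Ux.
  by rewrite lerB// lef_pV2 ?posrE ?ltr0n// ler_nat.
- apply/seteqP; split => // x Ux; have [_] := Ux 0%N I; apply => /=.
  rewrite leNgt; apply/negP => xa.
  have [k ka] : exists k, (k.+1%:R^-1 < a - x ord0 i)%R by apply: natSinv_lt; rewrite subr_gt0.
  by have [] := Ux k I; rewrite /U/= ltrBlDr => + _; rewrite ltNge -lerBrDl (ltW ka).
exists [set x : 'rV[R]_n | (a <= x ord0 i)%R], (U k); split => //.
by move=> x /= ax; rewrite /U /= (lt_le_trans _ ax)// ltrBlDr ltrDl invr_gt0 ltr0n.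
Qed.

(** The regular sets form a sigma-algebra, and it contains the closed half-spaces [a <= x i], which
    generate. *)
Lemma regular_measurable (A : set 'rV[R]_n) : measurable A -> regular_set A.
Proof.
apply: smallest_sub => [|B].
  split.
  - move=> e e0; exists set0, set0; split; [exact: closed0|exact: open0|by []|by []|].
    by rewrite setD0 measure0 lte_fin.
  - by move=> B rB; rewrite setTD; exact: regular_setC.
  - exact: regular_bigcup.
rewrite -bigcup_seq/= => -[i _ [C mC <-]]; rewrite setTI.
rewrite RGenCInfty.measurableE in mC.
move: mC; apply: (smallest_sub (X := [set C | regular_set ((fun x : 'rV[R]_n => x ord0 i) @^-1` C)])).
  split.
  - move=> e e0; exists set0, set0; split; [exact: closed0|exact: open0|by []|by []|].
    by rewrite setD0 measure0 lte_fin.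
  - by move=> D rD /=; rewrite setTD preimage_setC; exact: regular_setC.
  - by move=> F rF /=; rewrite preimage_bigcup; exact: regular_bigcup.
move=> _ [a ->] /=; have := @regular_coord_ray i a.
rewrite (_ : (fun x : 'rV_n => _) = (fun x : 'rV[R]_n => x ord0 i) @^-1` `[a, +oo[%classic); last first.
  by apply/funext => x /=; rewrite in_itv/= andbT.
exact.
Qed.

End finite.

Lemma leb_cube_restr_finite (k : nat) : fin_num_fun (mrestr (@leb R n) (@measurable_rcube R n 0 k%:R)).
Proof.
move=> A mA; rewrite ge0_fin_numE// /mrestr; apply: le_lt_trans (ltry ((k%:R *+ 2) ^+ n : R)).
rewrite -[leRHS](@leb_rcube R n 0 k%:R)//.
apply: le_meas; [|exact: measurable_rcube|exact: subIsetr].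
by apply: measurableI => //; exact: measurable_rcube.
Qed.

Definition leb_cube (k : nat) := mrestr (@leb R n) (@measurable_rcube R n 0 k%:R).
HB.instance Definition _ k := Measure.copy (leb_cube k) (mrestr (@leb R n) (@measurable_rcube R n 0 k%:R)).
HB.instance Definition _ k := @Measure_isFinite.Build _ _ _ (leb_cube k) (leb_cube_restr_finite k).

(** Regularity of the finite measure [leb_cube k] is used inside the open ball of radius [k], with
    errors [e / 2 ^ k.+1] that add up to at most [e]. *)
Lemma leb_open_approx (A : set 'rV[R]_n) (e : R) : measurable A -> (0 < e)%R ->
  exists U, [/\ open U, A `<=` U & leb U <= leb A + e%:E].
Proof.
move=> mA e0.
have /choice[U UP] : forall k : nat, exists U : set 'rV[R]_n, [/\ open U, A `&` [set x | (`|x| < k%:R)%R] `<=` U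
   & leb (U `\` A) <= (e / (2 ^ k.+1)%:R)%:E].
  move=> k; have oB : open [set x : 'rV[R]_n | (`|x| < k%:R)%R].
    by have := @open_norm_lt R n 0 k%:R; under eq_set do rewrite subr0.
  have [|F [V [cF oV FA AV mV]]] := regular_measurable (leb_cube k) mA (e := (e / (2 ^ k.+1)%:R)%R).
    by rewrite divr_gt0// ltr0n expn_gt0.
  exists (V `&` [set x | (`|x| < k%:R)%R]); split.
  - exact: openI.
  - by move=> x [Ax xk]; split => //; exact: AV.
  - apply: le_trans (ltW mV); rewrite /leb_cube /= /mrestr.
    have mB : measurable [set x : 'rV[R]_n | (`|x| < k%:R)%R] by exact: open_rV_measurable.
    have mV' := open_rV_measurable oV; have mF := closed_rV_measurable cF.
    apply: le_meas.
    + by apply: measurableD => //; exact: measurableI.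
    + by apply: measurableI; [exact: measurableD|exact: measurable_rcube].
    move=> x [[Vx xk] nAx]; split; first by split => // /FA.
    by apply/rcubeP => //; rewrite subr0 ltW.
have mU k : measurable (U k) by have [/open_rV_measurable] := UP k.
exists (\bigcup_k U k); split.
- by apply: bigcup_open => k _; have [] := UP k.
- move=> x Ax; have [k _ /rcubeP] : (\bigcup_k (@rcube R n 0 k%:R)) x by rewrite bigcup_rcube.
  rewrite subr0 => /(_ (ler0n _ _)) xk; exists k.+1 => //; have [_ + _] := UP k.+1; apply.
  by split => //=; rewrite (le_lt_trans xk)// ltr_nat.
apply: (@le_trans _ _ (leb (A `|` \bigcup_k (U k `\` A)))).
  have mUA : measurable (\bigcup_k (U k `\` A)).
    by apply: bigcup_measurable => k _; exact: measurableD.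
  apply: le_meas.
  - exact: bigcup_measurable.
  - exact: measurableU.
  move=> x [k _ Ux]; have [Ax|nAx] := pselect (A x); first by left.
  by right; exists k.
have mUA : measurable (\bigcup_k (U k `\` A)).
  by apply: bigcup_measurable => k _; exact: measurableD.
apply: (le_trans (measureU2 _ _ _)) => //; apply: leeD => //.
apply: (le_trans (meas_bigcup_le _ _)); first by move=> k; exact: measurableD.
apply: le_trans (epsilon_trick0 xpredT (ltW e0)).
by apply: lee_nneseries => // k _; have [] := UP k.
Qed.

(* Up to a null set, a measurable set is a countable disjoint union of compact
   sets. *)
Lemma compact_exhaustion (A : set 'rV[R]_n) : measurable A ->
  exists K : nat -> set 'rV[R]_n, [/\ forall i, compact (K i), forall i, K i `<=` A,
    trivIset setT K & leb (A `\` \bigcup_i K i) = 0].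
Proof.
move=> mA.
have step (k : nat) (B : set 'rV[R]_n) : exists K, measurable B ->
   [/\ compact K, K `<=` B & leb_cube k (B `\` K) < (k.+1%:R^-1)%:E].
  have [mB|nB] := pselect (measurable B); last by exists set0.
  have k0 : (0 < k.+1%:R^-1 :> R)%R by rewrite invr_gt0.
  have [F [U [cF oU FB BU mU]]] := regular_measurable (leb_cube k) mB k0.
  exists (F `&` rcube 0 k%:R) => _; split.
  - by rewrite setIC; apply: compact_closedI => //; exact: compact_rcube.
  - by move=> x [/FB].
  - apply: le_lt_trans mU; rewrite /leb_cube /= /mrestr.
    have mU := open_rV_measurable oU; have mF := closed_rV_measurable cF.
    have mc := @measurable_rcube R n 0 k%:R.
    apply: le_meas.
    + by apply: measurableI => //; apply: measurableD => //; apply: measurableI.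
    + by apply: measurableI => //; apply: measurableD.
    by move=> x [[Bx nF] xk]; split => //; split; [exact: BU|move=> Fx; apply: nF].
pose K0 k B := sval (cid (step k B)); have K0P k B := svalP (cid (step k B)).
pose B := fix B k := if k is k'.+1 then B k' `\` K0 k' (B k') else A.
have mB k : measurable (B k).
  elim: k => [//|k IH] /=; apply: measurableD => //; apply: compact_rV_measurable.
  by have [] := K0P k _ IH.
have BA k : B k `<=` A by elim: k => [//|k IH] x /= [/IH].
have KB k : K0 k (B k) `<=` B k by have [] := K0P k _ (mB k).
have Bmono k l : (k <= l)%N -> B l `<=` B k.
  elim: l => [|l IH]; first by rewrite leqn0 => /eqP ->.
  by rewrite leq_eqVlt => /orP[/eqP ->//|/IH Blk] x [/Blk].
have BE : A `\` \bigcup_i K0 i (B i) = \bigcap_k B k.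
  apply/seteqP; split => [x [Ax nK] k _|x Bx].
    elim: k => [//|k IH] /=; split => // Kx; apply: nK; by exists k.
  split; first exact: (Bx 0%N I).
  by move=> [k _ Kx]; have [_] := Bx k.+1 I.
exists (fun k => K0 k (B k)); split.
- by move=> k; have [] := K0P k _ (mB k).
- by move=> k; apply: subset_trans (KB k) (BA k).
- have dis k l : (k < l)%N -> K0 k (B k) `&` K0 l (B l) = set0.
    move=> kl; apply/seteqP; split => // x [Kx /KB /(Bmono _ _ kl)] [_]; exact.
  apply/trivIsetP => k l _ _; rewrite neq_ltn => /orP[|]; first exact: dis.
  by rewrite setIC; exact: dis.
- have mC : measurable (\bigcap_k B k) by exact: bigcapT_measurable.
  rewrite BE -[X in leb X]setIT -bigcup_rcube setI_bigcupr.
  apply/eqP; rewrite eq_le measure_ge0 andbT.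
  have mCk i : measurable (\bigcap_k B k `&` (@rcube R n 0 i%:R)).
    by apply: measurableI => //; exact: measurable_rcube.
  apply: (le_trans (meas_bigcup_le _ mCk)).
  rewrite eseries0// => i _ _; apply/eqP; rewrite eq_le measure_ge0 andbT.
  apply/lee_addgt0Pr => e e0; rewrite add0e.
  have [k ke] := natSinv_lt e0.
  (* An index for which the cube of radius [l] contains that of radius [i] and the error [1/(l+1)]
     is below [e]. *)
  pose l := maxn i k; have [_ _ Hl] := K0P l _ (mB l).
  apply: (@le_trans _ _ (leb_cube l (B l `\` K0 l (B l)))).
    rewrite /leb_cube /= /mrestr; apply: le_meas.
    + exact: mCk.
    + by apply: measurableI; [exact: (mB l.+1)|exact: measurable_rcube].
    move=> x [Bx /rcubeP]; rewrite subr0 => /(_ (ler0n _ _)) xi; split; first exact: (Bx l.+1 I).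
    by apply/rcubeP => //; rewrite subr0 (le_trans xi)// ler_nat leq_maxl.
  apply: (le_trans (ltW Hl)); rewrite lee_fin; apply: le_trans (ltW ke).
  by rewrite lef_pV2 ?posrE ?ltr0n// ler_nat ltnS leq_maxr.
Qed.

End regularity.

(** * Lipschitz images *)

Lemma negligible_small d (T : measurableType d) (R : realType)
    (m : {measure set T -> \bar R}) (A : set T) :
  (forall e : R, 0 < e -> exists B, [/\ measurable B, A `<=` B & (m B <= e%:E)%E]) ->
  m.-negligible A.
Proof.
move=> small.
have /choice[B BP] : forall k, exists B, [/\ measurable B, A `<=` B & (m B <= (k.+1%:R^-1)%:E)%E].
  by move=> k; apply: small; rewrite invr_gt0 ltr0n.
have mB : measurable (\bigcap_k B k) by apply: bigcapT_measurable => k; have [] := BP k.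
exists (\bigcap_k B k); split => //; last first.
  by move=> x Ax k _; have [_ + _] := BP k; apply.
apply/eqP; rewrite eq_le measure_ge0 andbT; apply/lee_addgt0Pr => e e0; rewrite add0e.
have [k ke] := natSinv_lt e0; have [mBk _ Bk] := BP k.
apply: le_trans (le_trans Bk _); last by rewrite lee_fin ltW.
by apply: le_meas => // x; apply.
Qed.

Lemma trivIset_if T (b : nat -> bool) (F : nat -> set T) : trivIset setT F ->
  trivIset setT (fun i => if b i then F i else set0).
Proof.
move=> /trivIsetP tF; apply/trivIsetP => p q _ _ pq.
by case: (b p); case: (b q); rewrite ?set0I ?setI0//; exact: tF.
Qed.

Section lipschitz_image.
Context (R : realType) (n : nat).
Local Notation lebn := (@leb R n).

Lemma dist_le_itv (a x y r : R) : a <= y -> y < a + r -> a <= x -> x < a + r ->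
  `|x - y| <= r.
Proof. by move=> *; rewrite ler_distl; apply/andP; split; lra. Qed.

(** Half-open sides, so that the cells of a given mesh partition the space. *)
Definition cell (k : nat) (z : 'rV[int]_n) : set 'rV[R]_n :=
  rbox (fun i => `[(z ord0 i)%:~R / k.+1%:R, ((z ord0 i)%:~R + 1) / k.+1%:R[%classic).

Definition cellN k p := if pickle_inv p is Some z then cell k z else set0.

Lemma cellP k z x : cell k z x <-> forall i, z ord0 i = Num.floor (x ord0 i * k.+1%:R).
Proof.
split=> h i; have := h i; rewrite /= in_itv/= ler_pdivrMr ?ltr0n// ltr_pdivlMr ?ltr0n//.
  by rewrite -intrD1 => /floor_def.
by move=> ->; rewrite floor_le_tmp -intrD1 floorD1_gt.
Qed.

Lemma measurable_cellN k p : measurable (cellN k p).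
Proof.
rewrite /cellN; case: pickle_inv => [z|]; last exact: measurable0.
by apply: measurable_rbox => i; exact: measurable_itv.
Qed.

Lemma leb_cell k z : leb (cell k z) = ((k.+1%:R^-1) ^+ n)%:E.
Proof.
rewrite leb_rbox => [|i]; last exact: measurable_itv.
rewrite -[n in RHS]card_ord -prodr_const -prodEFin; apply: eq_bigr => i _.
rewrite lebesgue_measure_itv/= lte_fin ltr_pM2r ?invr_gt0 ?ltr0n// ltrDl ltr01.
by rewrite -EFinB -mulrBl addrAC subrr add0r mul1r.
Qed.

Lemma trivIset_cellN k : trivIset setT (cellN k).
Proof.
apply/trivIsetP => p q _ _ pq; apply/seteqP; split => // x [].
rewrite /cellN; have := @pickle_invK 'rV[int]_n p; have := @pickle_invK 'rV[int]_n q.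
case: pickle_inv => [z|//] /= zq; case: pickle_inv => [w|//] /= wp.
move=> /cellP hw /cellP hz; move/eqP: pq; apply; rewrite -zq -wp; congr pickle.
by apply/rowP => i; rewrite hw hz.
Qed.

Lemma cellN_cover k x : exists p, cellN k p x.
Proof.
exists (pickle (\row_i Num.floor (x ord0 i * k.+1%:R) : 'rV[int]_n)).
by rewrite /cellN pickleK_inv; apply/cellP => i; rewrite mxE.
Qed.

Lemma cellN_diam k p x y : cellN k p x -> cellN k p y -> `|x - y| <= k.+1%:R^-1.
Proof.
rewrite /cellN; case: pickle_inv => [z|//] hx hy; apply: norm_rV_le => [|i].
  by rewrite invr_ge0.
have := hx i; have := hy i; rewrite /= !in_itv/= !mxE mulrDl mul1r => /andP[a b] /andP[c d].
exact: dist_le_itv a b c d.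
Qed.

(** The part of [A] in a cell of side [1/(k+1)] is mapped into a cube of radius [L/(k+1)], whose
    volume is [(2 L) ^ n] times that of the cell; summing over the cells inside an open set slightly
    larger than [M] gives the bound. Nothing is assumed on the measurability of [A] or of its image,
    hence the set [B]. *)
Lemma lip_image_le (A M : set 'rV[R]_n) (h : 'rV[R]_n -> 'rV[R]_n) (L e : R) :
  A `<=` M -> measurable M -> 0 <= L -> 0 < e ->
  (forall x y, A x -> A y -> `|h x - h y| <= L * `|x - y|) ->
  exists B, [/\ measurable B, h @` A `<=` B &
    (leb B <= ((L *+ 2) ^+ n)%:E * (leb M + e%:E))%E].
Proof.
move=> AM mM L0 e0 hL; have [V [oV MV VM]] := leb_open_approx mM e0.
have mV := open_rV_measurable oV.
pose sel k p := `[< cellN k p `<=` V /\ (cellN k p `&` A) !=set0 >].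
pose a k p := xget 0 (cellN k p `&` A).
pose B k := \bigcup_p (if sel k p then rcube (h (a k p)) (L / k.+1%:R) else set0).
have mB k : measurable (B k).
  by apply: bigcup_measurable => p _; case: ifP => // _; exact: measurable_rcube.
have Lk k : 0 <= L / k.+1%:R by rewrite divr_ge0.
have leB k : (leb (B k) <= ((L *+ 2) ^+ n)%:E * leb V)%E.
  have mb p : measurable (if sel k p then rcube (h (a k p)) (L / k.+1%:R) else set0).
    by case: ifP => // _; exact: measurable_rcube.
  apply: (le_trans (meas_bigcup_le _ mb)).
  have mc p : measurable (if sel k p then cellN k p else set0).
    by case: ifP => // _; exact: measurable_cellN.
  rewrite (eq_eseriesr (g := fun p => ((L *+ 2) ^+ n)%:E * leb (if sel k p then cellN k p else set0))%E); last first.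
    move=> p _; case: ifP => [/asboolP[_ [y [+ _]]]|_]; last by rewrite !measure0 mule0.
    rewrite /cellN; case: pickle_inv => [z _|//].
    by rewrite [LHS]leb_rcube// [leb _ in RHS]leb_cell -EFinM -exprMn mulrnAl.
  rewrite nneseriesZl//.
  apply: lee_wpmul2l; first by rewrite lee_fin exprn_ge0// mulrn_wge0.
  rewrite -measure_semi_bigcup//.
  - apply: le_meas => //; first exact: bigcup_measurable.
    by move=> x [p _]; case: ifP => // /asboolP[+ _]; apply.
  - exact: trivIset_if (@trivIset_cellN k).
  - exact: bigcup_measurable.
(* A point of [A] lies in a cell contained in [V] only from some mesh on, which depends on the
   point. Hence the lower limit of the sets [B k], whose measure obeys the common bound. *)
pose C N := \bigcap_k B (N + k)%N.
have mC N : measurable (C N) by exact: bigcapT_measurable.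
have mUC : measurable (\bigcup_N C N) by exact: bigcup_measurable.
exists (\bigcup_N C N); split => //.
- move=> _ [x Ax <-].
  have [d d0 dV] := open_ballP oV (MV _ (AM _ Ax)).
  have [N Nd] := natSinv_lt d0; exists N => // k _.
  have [p px] := cellN_cover (N + k)%N x; exists p => //.
  have sp : sel (N + k)%N p.
    apply/asboolP; split; last by exists x.
    move=> y py; apply: dV; apply: le_lt_trans (cellN_diam py px) _.
    by apply: le_lt_trans Nd; rewrite lef_pV2 ?posrE ?ltr0n// ler_nat ltnS leq_addr.
  rewrite sp; have [pa Aa] : (cellN (N + k)%N p `&` A) (a (N + k)%N p).
    by apply: xgetPex; exists x.
  apply/rcubeP => //; apply: le_trans (hL _ _ Ax Aa) _.
  by apply: ler_wpM2l => //; exact: cellN_diam px pa.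
- apply: (@le_trans _ _ (((L *+ 2) ^+ n)%:E * leb V)%E); last first.
    by apply: lee_wpmul2l => //; rewrite lee_fin exprn_ge0// mulrn_wge0.
  have ndC : nondecreasing_seq C.
    move=> N N' NN'; apply/subsetPset => x Cx k _.
    by rewrite -(subnKC NN') -addnA; exact: Cx.
  rewrite -(cvg_lim _ (nondecreasing_cvg_mu (mu := lebn) mC mUC ndC))//.
  apply: lime_le; first by apply/cvg_ex; eexists; exact: nondecreasing_cvg_mu.
  apply: nearW => N /=; apply: le_trans (leB N).
  by apply: le_meas => // x /(_ 0%N I); rewrite addn0.
Qed.

Lemma negligible_lip_image (A : set 'rV[R]_n) (h : 'rV[R]_n -> 'rV[R]_n) (L : R) :
  (leb (n:=n)).-negligible A -> 0 <= L ->
  (forall x y, A x -> A y -> `|h x - h y| <= L * `|x - y|) ->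
  (leb (n:=n)).-negligible (h @` A).
Proof.
move=> [M [mM M0 AM]] L0 hL; apply: negligible_small => e e0.
pose c := (L *+ 2) ^+ n + 1.
have c0 : 0 < c by rewrite ltr_pwDr// exprn_ge0// mulrn_wge0.
have [|B [mB AB leB]] := @lip_image_le A M h L (e / c) AM mM L0 _ hL.
  by rewrite divr_gt0.
exists B; split => //; apply: le_trans leB _.
rewrite [leb M]M0 add0e -EFinM lee_fin.
rewrite -[leRHS](divfK (lt0r_neq0 c0)) mulrC ler_wpM2l// ?divr_ge0 ?ltW//.
by rewrite /c ltrDl.
Qed.

End lipschitz_image.

(** * Smooth bump functions *)

Section smooth.
Context (R : realType).
Implicit Types f g : R -> R.

(** Derivatives are carried as witnesses, so that stability under products, inverses and affine
    changes is an induction on [k]. *)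
Fixpoint smooth k f : Prop :=
  if k is k'.+1 then exists2 f', (forall x : R, is_derive x 1 f (f' x)) & smooth k' f'
  else continuous f.

Lemma is_derive_continuous f f' : (forall x : R, is_derive x 1 f (f' x)) -> continuous f.
Proof.
move=> df x; apply: differentiable_continuous; apply/derivable1_diffP.
by have [] := df x.
Qed.

Lemma smoothW k f : smooth k.+1 f -> smooth k f.
Proof.
elim: k f => [|k IH] f [f' df sf] /=; first exact: is_derive_continuous df.
by exists f' => //; exact: IH.
Qed.

Lemma smooth_continuous k f : smooth k f -> continuous f.
Proof. by elim: k => // k IH /smoothW. Qed.

Lemma smooth_cst k (c : R) : smooth k (fun=> c).
Proof.
elim: k c => [c x|k IH c]; first exact: cvg_cst.
by exists (fun=> 0) => // x; exact: is_derive_cst.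
Qed.

Lemma smoothD k f g : smooth k f -> smooth k g -> smooth k (fun x => f x + g x).
Proof.
elim: k f g => [|k IH] f g; first by move=> cf cg x; apply: cvgD; [exact: cf|exact: cg].
move=> [f' df sf] [g' dg sg]; exists (fun x => f' x + g' x); last exact: IH.
by move=> x; exact: is_deriveD.
Qed.

Lemma smoothM k f g : smooth k f -> smooth k g -> smooth k (fun x => f x * g x).
Proof.
elim: k f g => [|k IH] f g; first by move=> cf cg x; apply: cvgM; [exact: cf|exact: cg].
move=> sf sg; have [f' df sf'] := sf; have [g' dg sg'] := sg.
exists (fun x => f x * g' x + g x * f' x).
  by move=> x; exact: (@is_deriveM _ _ f g).
by apply: smoothD; apply: IH => //; exact: smoothW.
Qed.

Lemma smoothZ k c f : smooth k f -> smooth k (fun x => c * f x).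
Proof. by move=> sf; apply: smoothM => //; exact: smooth_cst. Qed.

Lemma smoothB k f g : smooth k f -> smooth k g -> smooth k (fun x => f x - g x).
Proof.
move=> sf sg; apply: smoothD => //.
rewrite (_ : (fun x => _) = (fun x => -1 * g x)); first exact: smoothZ.
by apply/funext => x; rewrite mulN1r.
Qed.

Lemma smooth_affine k f (a b : R) : smooth k f -> smooth k (fun x => f (a * x + b)).
Proof.
elim: k f => [|k IH] f.
  move=> cf x; apply: (continuous_comp (f := fun x => a * x + b)); last exact: cf.
  by apply: cvgD; [apply: cvgM; [exact: cvg_cst|exact: cvg_id]|exact: cvg_cst].
move=> [f' df sf]; exists (fun x => a * f' (a * x + b)); last by apply: smoothZ; exact: IH.
move=> x; rewrite mulrC.
apply: (@is_derive1_comp _ f (fun x => a * x + b) x).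
have := is_deriveD (is_deriveZ a (is_derive_id x 1)) (is_derive_cst b x 1).
by rewrite /GRing.scale /= mulr1 addr0.
Qed.

Lemma smoothV k f : (forall x, 0 < f x) -> smooth k f -> smooth k (fun x => (f x)^-1).
Proof.
move=> f0; elim: k => [|k IH] sf.
  by move=> x; apply: cvgV; [exact: lt0r_neq0|exact: sf].
have [f' df sf'] := sf.
exists (fun x => - (f x)^-1 * (f x)^-1 * f' x).
  move=> x; rewrite (_ : _ * f' x = - (f x) ^- 2 *: f' x).
    by apply: is_deriveV; exact: lt0r_neq0.
  by rewrite /GRing.scale /= mulNr -expr2 exprVn.
have sV := IH (smoothW sf).
apply: smoothM => //; apply: smoothM => //.
rewrite (_ : (fun x => _) = (fun x => -1 * (f x)^-1)); first exact: smoothZ.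
by apply/funext => x; rewrite mulN1r.
Qed.

Lemma is_derive_ext f g (x a b : R) : f =1 g -> a = b ->
  is_derive x 1 f a -> is_derive x 1 g b.
Proof. by move=> /funext -> ->. Qed.

(* The flat functions t^-n exp(-1/t) are stable under differentiation up to
   linear combinations, and 0 to the left of the origin. *)
Definition flat n (t : R) : R := if 0 < t then t^-1 ^+ n * expR (- t^-1) else 0.

(** The term of degree [n + 1] of the exponential series gives
    [exp (1/t) >= t ^ -(n+1) / (n+1)!]. *)
Lemma flat_le n (t : R) : 0 < t -> `|flat n t| <= n.+1`!%:R * t.
Proof.
move=> t0; rewrite /flat t0 ger0_norm ?mulr_ge0 ?exprn_ge0 ?invr_ge0 ?expR_ge0 ?(ltW t0)//.
have ti : 0 <= t^-1 by rewrite invr_ge0 ltW.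
rewrite expRN ler_pdivrMr ?expR_gt0//.
have := expR_ge1Dxn n ti.
rewrite -(ler_pM2l t0) -(@ler_pM2l _ (n.+1`!)%:R) ?ltr0n ?fact_gt0// => h.
rewrite -mulrA; apply: le_trans h; rewrite !mulrDr !mulr1 ler_wpDl//.
  by rewrite mulr_ge0// ltW.
have F : n.+1`!%:R != 0 :> R by rewrite pnatr_eq0 -lt0n fact_gt0.
have T : t != 0 by exact: lt0r_neq0.
rewrite (_ : _ * (_ * _) = t^-1 ^+ n)// exprS.
by move: (n.+1`!%:R : R) F => c F; field; apply/andP.
Qed.

Lemma flat_le_all n t : `|flat n t| <= n.+1`!%:R * `|t|.
Proof.
have [t0|t0] := ltP 0 t; first by rewrite (gtr0_norm t0) flat_le.
by rewrite /flat ltNge t0 /= normr0 mulr_ge0.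
Qed.

Lemma is_derive_flat n (t : R) : is_derive t 1 (flat n) (flat n.+2 t - n%:R * flat n.+1 t).
Proof.
have [t0|t0|t0] := ltgtP 0 t; last rewrite -{}t0.
- apply: (@near_eq_is_derive _ _ _ (fun t : R => t^-1 ^+ n * expR (- t^-1))).
    near=> s; rewrite /flat ifT//; near: s.
    exact: (open_nbhs_nbhs (conj (@open_gt R 0) t0)).
  have tn0 : t != 0 by exact: lt0r_neq0.
  have dV : is_derive t 1 (fun t : R => t^-1) (- t ^- 2).
    have := @is_deriveV _ id t 1 1 tn0 (is_derive_id _ _).
    by rewrite /GRing.scale /= mulr1.
  have dN : is_derive t 1 (fun t : R => - t^-1) (t ^- 2).
    by rewrite -[t ^- 2]opprK; exact: is_deriveN.
  have dE : is_derive t 1 (fun t : R => expR (- t^-1)) (t ^- 2 * expR (- t^-1)).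
    by rewrite mulrC; apply: (@is_derive1_comp _ expR (fun t => - t^-1)).
  have dX : is_derive t 1 (fun t : R => t^-1 ^+ n) (- n%:R * t^-1 ^+ n.+1).
    apply: is_derive_ext (@is_deriveX _ _ (fun t : R => t^-1) n t 1 (- t ^- 2) dV) => [s|].
      by rewrite fctE.
    rewrite /GRing.scale /= -exprVn; case: n => [|n]; first by rewrite mulr0n oppr0 !mul0r.
    by rewrite /= mulrN mulNr; rewrite -mulrA -exprD addn2.
  apply: is_derive_ext (@is_deriveM _ _ _ _ t 1 _ _ dX dE) => //.
  by rewrite /GRing.scale /flat t0 -exprVn /= !exprS; ring.
- apply: (@near_eq_is_derive _ _ _ (fun=> 0)).
    near=> s; rewrite /flat ltNge ltW//; near: s.
    exact: (open_nbhs_nbhs (conj (@open_lt R 0) t0)).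
  rewrite /flat !(ltNge 0 t) (ltW t0) /= mulr0 subr0; exact: is_derive_cst.
- rewrite /flat ltxx mulr0 subr0.
  (* At the origin the difference quotient of [flat n] is [flat n.+1], which is [O(h)] by
     [flat_le_all]. *)
  have L : h^-1 *: (flat n (h *: 1 + 0) - flat n 0) @[h --> 0^'] --> (0 : R).
    apply/cvgr0Pnorm_lt => e e0.
    have c0 : 0 < (n.+2)`!%:R :> R by rewrite ltr0n fact_gt0.
    near=> h.
    rewrite addr0 /GRing.scale /= mulr1 {2}/flat ltxx subr0.
    have -> : h^-1 * flat n h = flat n.+1 h.
      by rewrite /flat; case: ifP => _; rewrite ?mulr0// mulrA exprS.
    apply: le_lt_trans (flat_le_all _ _) _.
    rewrite -ltr_pdivlMl//; near: h; apply: dnbhs0_lt.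
    by rewrite mulr_gt0 ?invr_gt0.
  apply: DeriveDef; first by apply/cvg_ex; exists 0.
  exact: cvg_lim L.
Unshelve. all: by end_near. Qed.

Lemma smooth_flat k n : smooth k (flat n).
Proof.
elim: k n => [|k IH] n.
  by apply: is_derive_continuous; exact: is_derive_flat.
exists (fun t => flat n.+2 t - n%:R * flat n.+1 t); first exact: is_derive_flat.
by apply: smoothB => //; exact: smoothZ.
Qed.

Lemma flat_ge0 t : 0 <= flat 0 t.
Proof. by rewrite /flat; case: ifP => // _; rewrite expr0 mul1r expR_ge0. Qed.

Lemma flat_gt0 t : 0 < t -> 0 < flat 0 t.
Proof. by move=> t0; rewrite /flat t0 expr0 mul1r expR_gt0. Qed.

Lemma flat_eq0 t : t <= 0 -> flat 0 t = 0.
Proof. by move=> t0; rewrite /flat ltNge t0. Qed.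

Definition sstep (t : R) := flat 0 t / (flat 0 t + flat 0 (1 - t)).

Lemma sstep_den t : 0 < flat 0 t + flat 0 (1 - t).
Proof.
have [t0|t0] := ltP 0 t; first by rewrite ltr_pwDl ?flat_gt0 ?flat_ge0.
by rewrite ltr_pwDr ?flat_ge0// flat_gt0// subr_gt0 (le_lt_trans t0).
Qed.

Lemma smooth_sstep k : smooth k sstep.
Proof.
apply: smoothM; first exact: smooth_flat.
apply: smoothV; first exact: sstep_den.
apply: smoothD; first exact: smooth_flat.
have := @smooth_affine k (flat 0) (-1) 1 (smooth_flat k 0).
by congr smooth; apply/funext => t; congr flat; rewrite mulN1r addrC.
Qed.

Lemma sstep0 t : t <= 0 -> sstep t = 0.
Proof. by move=> t0; rewrite /sstep (flat_eq0 t0) mul0r. Qed.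

Lemma sstep1 t : 1 <= t -> sstep t = 1.
Proof.
move=> t1; rewrite /sstep (@flat_eq0 (1 - t)) ?subr_le0// addr0 divff//.
by rewrite lt0r_neq0// flat_gt0// (lt_le_trans ltr01).
Qed.

Lemma sstep_itv t : 0 <= sstep t <= 1.
Proof.
have d := sstep_den t; apply/andP; split; first by rewrite divr_ge0 ?flat_ge0 ?ltW.
by rewrite ler_pdivrMr// mul1r lerDl flat_ge0.
Qed.

End smooth.

Section product_test_function.
Context (R : realType) (n : nat).
Implicit Types (eta : 'I_n -> R -> R) (x : 'rV[R]_n).

Definition tensor eta x : R := \prod_(i < n) eta i (x ord0 i).

Lemma continuous_tensor eta : (forall i, continuous (eta i)) -> continuous (tensor eta).
Proof.
move=> ce; rewrite /tensor.
suff : forall s : seq 'I_n, continuous (fun x : 'rV[R]_n => \prod_(i <- s) eta i (x ord0 i)) by apply.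
elim=> [|i s IH] x.
  rewrite (_ : (fun x => _) = fun=> 1); first exact: cst_continuous.
  by apply/funext => y; rewrite big_nil.
rewrite (_ : (fun x => _) = fun x : 'rV[R]_n => eta i (x ord0 i) * \prod_(i <- s) eta i (x ord0 i)); last first.
  by apply/funext => y; rewrite big_cons.
have h1 : {for x, continuous (fun x : 'rV[R]_n => eta i (x ord0 i))}.
  by apply: (continuous_comp (f := fun x : 'rV[R]_n => x ord0 i)); [exact: coord_continuous|exact: ce].
exact: (continuousM h1 (IH x)).
Qed.

Lemma is_derive_tensor eta (j : 'I_n) x d : is_derive (x ord0 j) 1 (eta j) d ->
  is_derive x ('e_j : 'rV[R]_n) (tensor eta)
    ((\prod_(i < n | i != j) eta i (x ord0 i)) * d).
Proof.
move=> [de <-].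
have L : h^-1 *: (tensor eta (h *: 'e_j + x) - tensor eta x) @[h --> 0^'] -->
    (\prod_(i < n | i != j) eta i (x ord0 i)) * 'D_1 (eta j) (x ord0 j).
  rewrite (_ : (fun h => _) = fun h => (\prod_(i < n | i != j) eta i (x ord0 i)) *
      (h^-1 *: (eta j (h *: 1 + x ord0 j) - eta j (x ord0 j)))).
    by apply: cvgM; [exact: cvg_cst|exact: de].
  apply/funext => h; rewrite /tensor (bigD1 j)//= [X in _ *: (_ - X)](bigD1 j)//=.
  rewrite !mxE !eqxx /=.
  have -> : \prod_(i < n | i != j) eta i ((h *: 'e_j + x) ord0 i) =
            \prod_(i < n | i != j) eta i (x ord0 i).
    by apply: eq_bigr => i ij; rewrite !mxE (negbTE ij) andbF mulr0 add0r.
  by rewrite -mulrBl /GRing.scale /= mulrA mulrC.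
apply: DeriveDef; first by apply/cvg_ex; eexists; exact: L.
exact: cvg_lim L.
Qed.

Lemma of_class_C_tensor k eta : (forall i, smooth k (eta i)) -> of_class_C k (tensor eta).
Proof.
elim: k eta => [|k IH] eta se /=.
  by split => //; apply: continuous_tensor.
split; first by apply: continuous_tensor => i; exact: smooth_continuous (se i).
move=> j; have [d de sd] := se j.
have dt x : is_derive x ('e_j : 'rV[R]_n) (tensor eta)
   ((\prod_(i < n | i != j) eta i (x ord0 i)) * d (x ord0 j)).
  exact: is_derive_tensor.
split; first by move=> x; have [] := dt x.
rewrite (_ : (fun x => _) = tensor (fun i => if i == j then d else eta i)).
  by apply: IH => i; case: ifP => // _; exact: smoothW.
apply/funext => x; have [_ ->] := dt x; rewrite /tensor [RHS](bigD1 j)//= eqxx mulrC.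
by congr (_ * _); apply: eq_bigr => i /negbTE ->.
Qed.

(** Weak derivatives are only ever tested against such products of one-variable functions, whose
    partial derivatives are again products. *)
Lemma test_function_tensor (U : set 'rV[R]_n) eta (a b : 'I_n -> R) :
  (forall k i, smooth k (eta i)) ->
  (forall i t, eta i t != 0 -> a i <= t <= b i) ->
  rbox (fun i => `[a i, b i]%classic) `<=` U ->
  test_function U (tensor eta).
Proof.
move=> se supp BU; split; first by move=> k; exact: of_class_C_tensor.
have cB : compact (@rbox R n (fun i => `[a i, b i]%classic)).
  by apply: rV_compact => i; exact: segment_compact.
have sub : closure [set x | tensor eta x != 0] `<=` rbox (fun i => `[a i, b i]%classic).
  apply: subset_trans (compact_rV_closed cB).
  apply: closure_subset => x /= nz i /=; rewrite in_itv/=; apply: supp.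
  by apply: contra nz => /eqP e0; rewrite /tensor (bigD1 i)//= e0 mul0r.
split; first by apply: subclosed_compact cB sub; exact: closed_closure.
exact: subset_trans sub BU.
Qed.

End product_test_function.

Section step.
Context (R : realType).

Definition sstep' : R -> R := projT1 (cid2 (@smooth_sstep R 1)).

Lemma is_derive_sstep (t : R) : is_derive t 1 (@sstep R) (sstep' t).
Proof. by rewrite /sstep'; case: (cid2 _). Qed.

Lemma sstep'_continuous : continuous sstep'.
Proof. by rewrite /sstep'; case: (cid2 _). Qed.

Lemma sstep'_bounded : exists C, forall t, 0 <= t <= 1 -> `|sstep' t| <= C.
Proof.
have /compact_bounded[M [_ HM]] : compact (sstep' @` `[0, 1]%classic).
  apply: continuous_compact; last exact: segment_compact.
  by apply: continuous_subspaceT; exact: sstep'_continuous.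
exists (M + 1) => t t01; apply: (HM (M + 1)); first by rewrite ltrDl.
by exists t => //=; rewrite in_itv.
Qed.

(* A smooth approximation of the indicator of ]s, s']. *)
Definition bump (N : R) (s s' t : R) := sstep (N * (t - s)) - sstep (N * (t - s')).

Lemma smooth_bump k N s s' : smooth k (bump N s s').
Proof.
apply: smoothB.
  have := @smooth_affine R k _ N (- (N * s)) (smooth_sstep R k).
  by congr smooth; apply/funext => t; rewrite mulrBr.
have := @smooth_affine R k _ N (- (N * s')) (smooth_sstep R k).
by congr smooth; apply/funext => t; rewrite mulrBr.
Qed.

Lemma is_derive_sstepN (N s t : R) :
  is_derive t 1 (fun t => sstep (N * (t - s))) (N * sstep' (N * (t - s))).
Proof.
rewrite mulrC; apply: (@is_derive1_comp _ (@sstep R) (fun t => N * (t - s))).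
  exact: is_derive_sstep.
have := is_deriveZ N (is_deriveB (is_derive_id t 1) (is_derive_cst s t 1)).
by rewrite subr0 /GRing.scale /= mulr1.
Qed.

Lemma is_derive_bump (N s s' t : R) :
  is_derive t 1 (bump N s s') (N * sstep' (N * (t - s)) - N * sstep' (N * (t - s'))).
Proof. by apply: is_deriveB; exact: is_derive_sstepN. Qed.

Lemma bump_itv N s s' t : -1 <= bump N s s' t <= 1.
Proof.
have /andP[a b] := sstep_itv (N * (t - s)); have /andP[c d] := sstep_itv (N * (t - s')).
by rewrite /bump; apply/andP; split; lra.
Qed.

Lemma bump_supp N s s' t : 0 < N -> s <= s' -> bump N s s' t != 0 ->
  s <= t <= s' + N^-1.
Proof.
move=> N0 ss'; apply: contraR; rewrite negb_and -!ltNge => /orP[ts|ts]; apply/eqP.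
  rewrite /bump !sstep0 ?subrr// pmulr_rle0// subr_le0 ?(ltW ts)//.
  by rewrite (le_trans (ltW ts)).
have h : 1 <= N * (t - s').
  by rewrite -ler_pdivrMl// mulr1 lerBrDl ltW.
rewrite /bump !sstep1 ?subrr//; apply: le_trans h _.
by rewrite ler_pM2l// lerB.
Qed.

Lemma sstep_cvg (s t : R) : sstep (k%:R * (t - s)) @[k --> \oo] --> ((s < t)%R%:R : R).
Proof.
have [st|ts] := ltP s t; last first.
  under eq_cvg do rewrite sstep0 ?mulr_ge0_le0 ?subr_le0//; exact: cvg_cst.
have ts0 : 0 < t - s by rewrite subr_gt0.
apply: (@cvg_near_cst _ _ _ _ _ _) => //.
near=> k; apply: sstep1; rewrite -ler_pdivrMr// mul1r; near: k.
exact: nbhs_infty_ger.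
Unshelve. all: by end_near. Qed.

Lemma bump_cvg (s s' t : R) : s <= s' ->
  bump k%:R s s' t @[k --> \oo] --> ((s < t <= s')%R%:R : R).
Proof.
move=> ss'; rewrite (_ : _%:R = (s < t)%R%:R - (s' < t)%R%:R :> R).
  by apply: cvgB; exact: sstep_cvg.
have [st|ts] := ltP s t; have [s't|ts'] := ltP s' t; rewrite /= ?subrr ?subr0//.
by have := lt_le_trans s't (le_trans ts ss'); rewrite ltxx.
Qed.

End step.

(** * Functions with vanishing integrals over boxes *)

Section zero_boxes.
Context (R : realType) (n : nat).

(** Half-open on this side because the functions [bump] converge pointwise to indicators of
    intervals []s, s']]. *)
Definition ocbox (a b : 'I_n -> R) : set 'rV[R]_n := rbox (fun i => `]a i, b i]%classic).

Lemma measurable_ocbox a b : measurable (ocbox a b).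
Proof. by apply: measurable_rbox => i; exact: measurable_itv. Qed.

Definition ocboxes : set (set 'rV[R]_n) := [set B | exists a b, B = ocbox a b].

Lemma ocboxI a b a' b' : ocbox a b `&` ocbox a' b' =
  ocbox (fun i => Num.max (a i) (a' i)) (fun i => Num.min (b i) (b' i)).
Proof.
apply/seteqP; split => [x [h h'] i|x h]; last split => i; have := h i.
- by have := h' i; rewrite /= !in_itv/= gt_max le_min => /andP[-> ->] /andP[-> ->].
- by rewrite /= !in_itv/= gt_max le_min => /andP[/andP[-> _] /andP[-> _]].
- by rewrite /= !in_itv/= gt_max le_min => /andP[/andP[_ ->] /andP[_ ->]].
Qed.

Lemma ocboxes_generate : @measurable _ 'rV[R]_n = <<s ocboxes >>.
Proof.
apply/seteqP; split; last first.
  apply: smallest_sub; first exact: sigma_algebra_measurable.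
  by move=> _ [a [b ->]]; exact: measurable_ocbox.
apply: smallest_sub; first exact: smallest_sigma_algebra.
move=> B; rewrite -bigcup_seq/= => -[i _ [C mC <-]] /=; rewrite setTI.
have [g0 gC gU] := smallest_sigma_algebra setT ocboxes.
move: mC; apply: (smallest_sub (X := [set C | <<s ocboxes >> ((fun x : 'rV[R]_n => x ord0 i) @^-1` C)])).
  split.
  - exact: g0.
  - by move=> D /= gD; rewrite setTD preimage_setC -setTD; exact: gC.
  - by move=> F gF /=; rewrite preimage_bigcup; exact: gU.
move=> _ [[a b] _ <-] /=.
rewrite (_ : _ @^-1` _ = \bigcup_k ocbox (fun j => if j == i then a else - k%:R)
    (fun j => if j == i then b else k%:R)).
  by apply: gU => k; apply: sub_sigma_algebra; eexists; eexists.
apply/seteqP; split => [x /= xi|x [k _ /(_ i)]] /=; last by rewrite eqxx.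
have [k _ /rcubeP] : (\bigcup_k (@rcube R n 0 k%:R)) x by rewrite bigcup_rcube.
rewrite subr0 => /(_ (ler0n _ _)) xk; exists k.+1 => //= j.
case: eqVneq => [->//|_] /=; rewrite in_itv/=.
have : `|x ord0 j| < k.+1%:R by rewrite (le_lt_trans (le_trans (ler_coord_norm x j) xk))// ltr_nat.
by rewrite ltr_norml => /andP[-> /ltW].
Qed.

Lemma zero_ocbox_ae (K : 'rV[R]_n -> R) : (leb (n:=n)).-integrable setT (EFin \o K) ->
  (\int[leb (n:=n)]_x (K x)%:E = 0)%E ->
  (forall a b, \int[leb (n:=n)]_(x in ocbox a b) (K x)%:E = 0)%E ->
  {ae leb (n:=n), forall x, K x = 0}.
Proof.
move=> iK KT K0.
have iKS A : measurable A -> (leb (n:=n)).-integrable A (EFin \o K).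
  by move=> mA; apply: integrableS iK.
have all A : measurable A -> (\int[leb (n:=n)]_(x in A) (K x)%:E = 0)%E.
  move=> mA; have : <<s ocboxes >> A by rewrite -ocboxes_generate.
  move: A {mA}.
  have H := @dynkin_induction _ _ ocboxes (fun A => \int[leb (n:=n)]_(x in A) (K x)%:E = 0)%E ocboxes_generate.
  apply: H.
  - by move=> _ _ [a [b ->]] [a' [b' ->]]; rewrite ocboxI; eexists; eexists.
  - exact: KT.
  - by move=> _ [a [b ->]]; exact: K0.
  - move=> A mA A0.
    have mK : measurable_fun (A `|` ~` A) (EFin \o K).
      by apply: measurable_funTS; case/integrableP: iK.
    have := integral_setU (leb (n:=n)) mA (measurableC mA) mK (introT disj_setPCl (@subset_refl _ _)).
    by rewrite setUv KT A0 add0e.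
  - move=> F mF tF F0; rewrite integral_bigcup//; last by apply: iKS; exact: bigcup_measurable.
    by apply: eseries0 => k _ _; exact: F0.
have := @integral_ae_eq _ _ _ (leb (n:=n)) _ measurableT (cst 0%E) _ iK (@measurable_cst _ _ _ _ _ _).
have E0 (E : set 'rV[R]_n) : E `<=` setT -> measurable E ->
    (\int[leb (n:=n)]_(x in E) (EFin \o K) x = \int[leb (n:=n)]_(x in E) cst 0 x)%E.
  by move=> _ mE; rewrite all// integral0.
by move=> /(_ E0); apply: filterS => x /(_ I) [].
Qed.

End zero_boxes.

Lemma compact_open_dist (R : realType) n (K U : set 'rV[R]_n) : compact K -> open U -> K `<=` U ->
  exists2 d : R, 0 < d & forall x y, K x -> `|y - x| < d -> U y.
Proof.
move=> cK oU KU.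
have := near_covering_withinP K.
pose P (d : R) (x : 'rV[R]_n) := forall y, `|y - x| < d -> U y.
have nc : near_covering K by rewrite -compact_near_coveringP.
have /nc : forall x, K x -> \forall x' \near x & d \near (0:R)^'+, P d x'.
  move=> x Kx; have [e e0 eU] := open_ballP oU (KU x Kx).
  have e20 : 0 < e / 2 by rewrite divr_gt0.
  exists (ball x (e / 2), [set d | d < e / 2]); first split => /=.
  - exact: nbhsx_ballx.
  - exact: nbhs_right_lt.
  move=> [x' d] /= [xx' de] y yx'; apply: eU.
  rewrite -ball_normE /ball_ /= in xx'.
  have := ler_normD (y - x') (x' - x); rewrite addrA subrK => h.
  apply: le_lt_trans h _.
  by rewrite [ltRHS]splitr ltrD// ?(lt_trans yx')// distrC.
move=> H.
have [d [d0 Hd]] : exists d : R, 0 < d /\ K `<=` P d.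
  have : \forall d \near (0 : R)^'+, 0 < d /\ K `<=` P d.
    by apply: filterI => //; exact: nbhs_right_gt.
  exact: filter_ex.
by exists d => // x y Kx; exact: Hd.
Qed.

Lemma ae_forall_count (I : countType) d (T : measurableType d) (R : realType)
    (m : {measure set T -> \bar R}) (P : I -> T -> Prop) :
  (forall i, {ae m, forall x, P i x}) -> {ae m, forall x, forall i, P i x}.
Proof.
move=> PP.
have /ae_foralln : forall k, {ae m, forall x, if unpickle k is Some i then P i x else True}.
  by move=> k; case: unpickle => [i|]; [exact: PP|exact: aeW].
by apply: filterS => x Px i; have := Px (pickle i); rewrite pickleK.
Qed.

Lemma seq_cvg_unique (R : realType) (f g : nat -> R) (a b : R) :
  f k @[k --> \oo] --> a -> g k @[k --> \oo] --> b ->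
  (\forall k \near \oo, f k = g k) -> a = b.
Proof.
move=> fa gb fg; rewrite -(cvg_lim _ fa)// -(cvg_lim _ gb)//.
have H : f k @[k --> \oo] --> b.
  by apply: cvg_trans gb; apply: near_eq_cvg; apply: filterS fg => k ->.
by rewrite (cvg_lim _ H)// (cvg_lim _ gb).
Qed.

Section dct.
Context d (T : measurableType d) (R : realType) (m : {measure set T -> \bar R}).

Lemma integrable_bounded_mul (D : set T) (v c : T -> R) (M : R) : measurable D ->
  m.-integrable D (EFin \o v) -> measurable_fun D c -> (forall x, D x -> `|c x| <= M) ->
  m.-integrable D (EFin \o (fun x => v x * c x)).
Proof.
move=> mD iv mc cM.
have mv : measurable_fun D v by case/integrableP: iv => /measurable_EFinP.
have iM : m.-integrable D (fun x => (`|M| * `|v x|)%:E).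
  by under eq_fun do rewrite EFinM; apply: integrableZl => //; exact: integrable_norm.
apply: le_integrable iM => //; first by apply/measurable_EFinP/measurable_funM.
move=> x Dx /=; rewrite !lee_fin !normrM !normr_id mulrC ler_wpM2r//.
exact: le_trans (cM x Dx) (ler_norm _).
Qed.

Lemma dct_bounded (D : set T) (v : T -> R) (chi : nat -> T -> R) (c : T -> R) : measurable D ->
  m.-integrable D (EFin \o v) -> (forall k, measurable_fun D (chi k)) ->
  (forall k x, D x -> `|chi k x| <= 1) -> (forall x, D x -> chi k x @[k --> \oo] --> c x) ->
  \int[m]_(x in D) (v x * chi k x) @[k --> \oo] --> \int[m]_(x in D) (v x * c x).
Proof.
move=> mD iv mchi chi1 chic.
have mv : measurable_fun D v by case/integrableP: iv => /measurable_EFinP.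
have mc : measurable_fun D c by exact: measurable_fun_cvg mchi chic.
have c1 x : D x -> `|c x| <= 1.
  move=> Dx; rewrite -(cvg_lim _ (cvg_norm (chic x Dx)))//.
  apply: limr_le; first by apply/cvg_ex; eexists; exact: cvg_norm (chic x Dx).
  by apply: nearW => k; exact: chi1.
have ivk k : m.-integrable D (EFin \o (fun x => v x * chi k x)).
  by apply: integrable_bounded_mul (chi1 k).
have ivc : m.-integrable D (EFin \o (fun x => v x * c x)).
  exact: integrable_bounded_mul c1.
apply: fine_cvg; rewrite fineK; last exact: integrable_fin_num.
have h1 : {ae m, forall x, D x -> (v x * chi k x)%:E @[k --> \oo] --> (v x * c x)%:E}.
  apply: aeW => x Dx; apply: cvg_EFin; first exact: nearW.
  by apply: cvgM; [exact: cvg_cst|exact: chic].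
have h2 : {ae m, forall x (k : nat), D x -> (`|(v x * chi k x)%:E| <= `|v x|%:E)%E}.
  by apply: aeW => x k Dx; rewrite /= lee_fin normrM ler_piMr//; exact: chi1.
by have [_ _] := @dominated_convergence _ _ _ m D mD (fun k x => (v x * chi k x)%:E)
  (fun x => (v x * c x)%:E) (fun x => `|v x|%:E)
  (fun k => measurable_int _ (ivk k)) (measurable_int _ ivc) h1 (integrable_norm iv) h2.
Qed.

End dct.

(** * Approximate identities and primitives on the line *)

Section dirac.
Context (R : realType).
Local Notation lm := (@lebesgue_measure R).

Lemma sstep'_out (t : R) : (t < 0) || (1 < t) -> sstep' t = 0.
Proof.
move=> t01; have [_ <-] := is_derive_sstep t.
have [c tc] : exists c : R, \near t, c = sstep t.
  case/orP: t01 => t01; [exists 0|exists 1]; near=> s.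
    rewrite sstep0// ltW//; near: s.
    exact: (open_nbhs_nbhs (conj (@open_lt R 0) t01)).
  rewrite sstep1// ltW//; near: s.
  exact: (open_nbhs_nbhs (conj (@open_gt R 1) t01)).
have [_ <-] := near_eq_is_derive tc (is_derive_cst c t 1).
by [].
Unshelve. all: by end_near. Qed.

Lemma continuous_integrable_itv (f : R -> R) (a b : R) :
  (forall t, a <= t <= b -> {for t, continuous f}) ->
  lm.-integrable `[a, b] (EFin \o f).
Proof.
move=> cf; apply: continuous_compact_integrable; first exact: segment_compact.
apply: continuous_in_subspaceT => t /set_mem/=; rewrite in_itv/= => tab; exact: cf.
Qed.

Lemma continuous_sstep'N (N s : R) : continuous (fun t => N * sstep' (N * (t - s))).
Proof.
move=> t; apply: cvgM; first exact: cvg_cst.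
apply: (@continuous_comp _ _ _ (fun t => N * (t - s)) (@sstep' R)); last exact: sstep'_continuous.
by apply: cvgM; [exact: cvg_cst|apply: cvgB; [exact: cvg_id|exact: cvg_cst]].
Qed.

Lemma Rintegral_sstep' (N s s0 s1 : R) : 0 < N -> s0 <= s -> s + N^-1 <= s1 ->
  \int[lm]_(t in `[s0, s1]) (N * sstep' (N * (t - s))) = 1.
Proof.
move=> N0 s0s ss1.
have s01 : s0 < s1.
  by apply: le_lt_trans s0s (lt_le_trans _ ss1); rewrite ltrDl invr_gt0.
have cs : continuous (fun t => sstep (N * (t - s))).
  by apply: is_derive_continuous; exact: is_derive_sstepN.
rewrite /Rintegral (@continuous_FTC2 _ _ (fun t => sstep (N * (t - s))) s0 s1 s01).
- rewrite -EFinB /= (@sstep0 _ (N * (s0 - s))); last first.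
    by rewrite pmulr_rle0// subr_le0.
  rewrite subr0 sstep1// -ler_pdivrMl// mulr1 lerBrDl//.
- by apply: continuous_subspaceT; exact: continuous_sstep'N.
- split.
  + by move=> t _; have [] := is_derive_sstepN N s t.
  + by apply: cvg_at_right_filter; exact: cs.
  + by apply: cvg_at_left_filter; exact: cs.
- by move=> t _; rewrite derive1E; have [_ ->] := is_derive_sstepN N s t.
Qed.

(** The kernels have integral 1, are supported in [[s, s + 1/(k+1)]] and bounded there by [C (k+1)],
    where [C] bounds [|sstep'|]; so the error is at most [C] times the oscillation of [u] on that
    interval. *)
Lemma cvg_dirac (u : R -> R) (s s0 s1 : R) : s0 <= s -> s < s1 ->
  (forall t, s0 <= t <= s1 -> {for t, continuous u}) ->
  \int[lm]_(t in `[s0, s1]) (u t * (k.+1%:R * sstep' (k.+1%:R * (t - s)))) @[k --> \oo] --> u s.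
Proof.
move=> s0s ss1 cu.
have [C0 HC0] := sstep'_bounded R; pose C := Num.max C0 1.
have C1 : 0 < C by rewrite lt_max ltr01 orbT.
have HC t : `|@sstep' R t| <= C.
  have [t01|t01] := boolP (0 <= t <= 1); first by rewrite le_max HC0.
  rewrite sstep'_out ?normr0 ?ltW//.
  by move: t01; rewrite negb_and -!ltNge.
apply/cvgrPdist_le => e e0.
have eC : 0 < e / C by rewrite divr_gt0.
have := cu s; rewrite s0s (ltW ss1) => /(_ isT) /cvgrPdist_le /(_ _ eC) /nbhs_ballP [del del0 Hdel].
near=> k.
have k0 : 0 < k.+1%:R :> R by [].
have kdel : k.+1%:R^-1 < del by near: k; apply: near_infty_natSinv_lt (PosNum del0).
have ks1 : s + k.+1%:R^-1 <= s1.
  rewrite -lerBrDl ltW//; near: k.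
  have ss10 : 0 < s1 - s by rewrite subr_gt0.
  exact: near_infty_natSinv_lt (PosNum ss10).
set g := fun t => k.+1%:R * sstep' (k.+1%:R * (t - s)).
have ig : lm.-integrable `[s0, s1] (EFin \o g).
  by apply: continuous_integrable_itv => t _; exact: continuous_sstep'N.
have iug : lm.-integrable `[s0, s1] (EFin \o (fun t => u t * g t)).
  apply: continuous_integrable_itv => t t01; apply: continuousM; first exact: cu.
  exact: continuous_sstep'N.
have iusg : lm.-integrable `[s0, s1] (EFin \o (fun t => u s * g t)).
  apply: continuous_integrable_itv => t t01; apply: continuousM; first exact: cst_continuous.
  exact: continuous_sstep'N.
have -> : u s = \int[lm]_(t in `[s0, s1]) (u s * g t).
  by rewrite RintegralZl// Rintegral_sstep'// mulr1.
rewrite -RintegralB//.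
pose h t := u s * g t - u t * g t.
have ih : lm.-integrable `[s0, s1] (EFin \o h).
  apply: continuous_integrable_itv => t t01; apply: continuousB; apply: continuousM.
  - exact: cst_continuous.
  - exact: continuous_sstep'N.
  - exact: cu.
  - exact: continuous_sstep'N.
pose J := `[s, (s + k.+1%:R^-1)%R]%classic.
have JI : J `<=` `[s0, s1]%classic.
  by move=> t; rewrite /J /= !in_itv/= => /andP[a b]; rewrite (le_trans s0s a) (le_trans b ks1).
have -> : \int[lm]_(t in `[s0, s1]) h t = \int[lm]_(t in J) h t.
  rewrite Rintegral_mkcond [RHS]Rintegral_mkcond; apply: eq_Rintegral => t _.
  rewrite !patchE; case: ifPn => tI; case: ifPn => tJ //; last first.
    by move: tI; rewrite mem_set//; exact/JI/set_mem.
  rewrite /h /g sstep'_out ?mulr0 ?subr0//.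
  move: tJ; rewrite notin_setE /J /= in_itv/= => /negP; rewrite negb_and -!ltNge.
  rewrite -ltrBrDl => /orP[a|a]; apply/orP; [left|right].
    by rewrite pmulr_rlt0// subr_lt0.
  by rewrite -ltr_pdivrMl// mulr1.
have mJ : measurable J by exact: measurable_itv.
have ihJ : lm.-integrable J (EFin \o h) by apply: integrableS ih.
apply: le_trans; first by apply: le_normr_Rintegral ihJ; exact: measurable_itv.
apply: (@le_trans _ _ (\int[lm]_(t in J) (e * k.+1%:R))).
  apply: le_Rintegral => //.
  - exact: integrable_norm.
  - by apply: continuous_integrable_itv => t _; exact: cst_continuous.
  move=> t; rewrite /J /= in_itv/= => /andP[a b].
  rewrite /h -mulrBl normrM /g normrM (ger0_norm (ltW k0)).
  rewrite (_ : e * k.+1%:R = e / C * (C * k.+1%:R)); last by rewrite mulrA divfK ?lt0r_neq0.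
  rewrite ler_pM ?mulr_ge0//.
    apply: Hdel; rewrite -ball_normE /ball_ /= distrC ger0_norm ?subr_ge0//.
    by apply: le_lt_trans kdel; rewrite lerBlDl.
  by rewrite mulrC ler_wpM2r.
have lJ : lm J = (k.+1%:R^-1)%:E.
  by rewrite /J lebesgue_measure_itv/= lte_fin ltrDl invr_gt0 k0 -EFinD [s + _]addrC addrK.
have -> : \int[lm]_(_ in J) (e * k.+1%:R) = e * k.+1%:R * fine (lm J) by exact: Rintegral_cst.
by rewrite lJ /= -mulrA divff// mulr1.
Unshelve. all: by end_near. Qed.

End dirac.

Section line.
Context (R : realType).
Local Notation lm := (@lebesgue_measure R).
Variables (u v : R -> R) (s0 s1 : R).
Hypothesis cu : forall t, s0 <= t <= s1 -> {for t, continuous u}.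
Hypothesis iv : lm.-integrable `[s0, s1] (EFin \o v).

Definition bump' (N s s' t : R) := N * sstep' (N * (t - s)) - N * sstep' (N * (t - s')).

Lemma continuous_bump' N s s' : continuous (bump' N s s').
Proof. by move=> t; apply: cvgB; exact: continuous_sstep'N. Qed.

Lemma continuous_bump (N s s' : R) : continuous (bump N s s').
Proof. exact: (smooth_continuous (smooth_bump 0 N s s')). Qed.

Lemma measurable_bump (N s s' : R) D : measurable_fun D (bump N s s').
Proof.
by apply: measurable_funTS; apply: continuous_measurable_fun; exact: continuous_bump.
Qed.

(** [bump'] is the difference of the approximate identities at [s] and at [s'], while [bump] tends
    to the indicator of []s, s']]; the limit of the weak identity is the fundamental theorem of
    calculus between [s] and [s']. *)
Lemma bump_limit (s s' : R) : s0 <= s -> s < s' -> s' < s1 ->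
  (forall k : nat, s' + k.+1%:R^-1 <= s1 ->
    \int[lm]_(t in `[s0, s1]) (u t * bump' k.+1%:R s s' t + v t * bump k.+1%:R s s' t) = 0) ->
  \int[lm]_(t in `[s0, s1]) (v t * (s < t <= s')%R%:R) = u s' - u s.
Proof.
move=> s0s ss' s's1 H.
have mI : measurable (`[s0, s1]%classic : set R) by exact: measurable_itv.
have L1 : \int[lm]_(t in `[s0, s1]) (v t * bump k.+1%:R s s' t) @[k --> \oo] -->
    \int[lm]_(t in `[s0, s1]) (v t * (s < t <= s')%R%:R).
  apply: dct_bounded => //.
  - by move=> k; exact: measurable_bump.
  - by move=> k t _; rewrite ler_norml bump_itv.
  - by move=> t _; have := @bump_cvg R s s' t (ltW ss'); rewrite -(cvg_shiftS (fun k => bump k%:R s s' t)).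
have L2 := @cvg_dirac R u s s0 s1 s0s (lt_trans ss' s's1) cu.
have L3 := @cvg_dirac R u s' s0 s1 (le_trans s0s (ltW ss')) s's1 cu.
have L4 := cvgB L3 L2.
apply: (seq_cvg_unique L1 (L4 _)).
near=> k; rewrite fctE.
have ks1 : s' + k.+1%:R^-1 <= s1.
  rewrite -lerBrDl ltW//; near: k.
  have ss10 : 0 < s1 - s' by rewrite subr_gt0.
  exact: near_infty_natSinv_lt (PosNum ss10).
have i1 x : lm.-integrable `[s0, s1] (EFin \o (fun t => u t * (k.+1%:R * sstep' (k.+1%:R * (t - x))))).
  apply: continuous_integrable_itv => t t01; apply: continuousM; first exact: cu.
  exact: continuous_sstep'N.
have i2 : lm.-integrable `[s0, s1] (EFin \o (fun t => u t * bump' k.+1%:R s s' t)).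
  apply: continuous_integrable_itv => t t01; apply: continuousM; first exact: cu.
  exact: continuous_bump'.
have i3 : lm.-integrable `[s0, s1] (EFin \o (fun t => v t * bump k.+1%:R s s' t)).
  apply: (@integrable_bounded_mul _ _ _ _ _ _ _ 1) => //; first exact: measurable_bump.
  by move=> t _; rewrite ler_norml bump_itv.
have := H k ks1; rewrite RintegralD// => /eqP; rewrite addr_eq0 => /eqP Hk.
rewrite -[LHS]opprK -Hk -[RHS]opprB; congr (- _).
rewrite -RintegralB//; apply: eq_Rintegral => t _.
by rewrite /bump' mulrBr.
Unshelve. all: by end_near. Qed.

(** Once countably many null sets are discarded, only rational endpoints are available. Rational
    sequences tending to [a] and [b] from the right give the others, by continuity of [u] and
    dominated convergence. *)
Lemma line_ftc (a b : R) : s0 < a -> a <= b -> b < s1 ->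
  (forall s s', s0 < ratr s -> ratr s < ratr s' :> R -> ratr s' < s1 ->
    \int[lm]_(t in `[s0, s1]) (v t * (ratr s < t <= ratr s')%R%:R) = u (ratr s') - u (ratr s)) ->
  \int[lm]_(t in `[a, b]) v t = u b - u a.
Proof.
move=> s0a ab bs1 H.
have [->|ab'] := eqVneq a b.
  by rewrite subrr set_itv1 Rintegral_set1.
have {ab'}ab : a < b by rewrite lt_neqAle ab' ab.
have mI : measurable (`[s0, s1]%classic : set R) by exact: measurable_itv.
have ab0 : 0 < Num.min (b - a) (s1 - b) by rewrite lt_min !subr_gt0 ab.
have /choice[s sP] : forall k : nat, exists q : rat, ratr q \in `]a, (a + Num.min (b - a) (s1 - b) / k.+1%:R)[.
  by move=> k; apply: rat_in_itvoo; rewrite ltrDl divr_gt0.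
have /choice[s' s'P] : forall k : nat, exists q : rat, ratr q \in `]b, (b + Num.min (b - a) (s1 - b) / k.+1%:R)[.
  by move=> k; apply: rat_in_itvoo; rewrite ltrDl divr_gt0.
have le1 (k : nat) : Num.min (b - a) (s1 - b) / k.+1%:R <= Num.min (b - a) (s1 - b).
  by rewrite ler_pdivrMr// ler_peMr ?(ltW ab0)// ler1n.
have dk : Num.min (b - a) (s1 - b) / k.+1%:R @[k --> \oo] --> (0 : R).
  rewrite -[X in _ --> X](mulr0 (Num.min (b - a) (s1 - b))).
  by apply: cvgM; [exact: cvg_cst|exact: cvg_harmonic].
have cs : (ratr (s k) : R) @[k --> \oo] --> a.
  apply: (@squeeze_cvgr _ _ _ _ (fun=> a) (fun k => a + Num.min (b - a) (s1 - b) / k.+1%:R)).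
  - by apply: nearW => k; have := sP k; rewrite in_itv/= => /andP[/ltW -> /ltW ->].
  - exact: cvg_cst.
  - by rewrite -[X in _ --> X]addr0; apply: cvgD => //; exact: cvg_cst.
have cs' : (ratr (s' k) : R) @[k --> \oo] --> b.
  apply: (@squeeze_cvgr _ _ _ _ (fun=> b) (fun k => b + Num.min (b - a) (s1 - b) / k.+1%:R)).
  - by apply: nearW => k; have := s'P k; rewrite in_itv/= => /andP[/ltW -> /ltW ->].
  - exact: cvg_cst.
  - by rewrite -[X in _ --> X]addr0; apply: cvgD => //; exact: cvg_cst.
have E k : \int[lm]_(t in `[s0, s1]) (v t * (ratr (s k) < t <= ratr (s' k))%R%:R) =
    u (ratr (s' k)) - u (ratr (s k)).
  have := sP k; have := s'P k; rewrite !in_itv/= => /andP[b1 b2] /andP[a1 a2].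
  apply: H; first exact: lt_trans a1.
    apply: (lt_trans a2); apply: le_lt_trans b1.
    by rewrite -lerBrDl (le_trans (le1 k))// ge_min lexx.
  apply: (lt_le_trans b2); rewrite -lerBrDl (le_trans (le1 k))// ge_min lexx orbT//.
have L : \int[lm]_(t in `[s0, s1]) (v t * (ratr (s k) < t <= ratr (s' k))%R%:R) @[k --> \oo] -->
    \int[lm]_(t in `[s0, s1]) (v t * (a < t <= b)%R%:R).
  apply: dct_bounded => //.
  - move=> k; apply: (@measurable_funS _ _ _ _ setT) => //.
    rewrite (_ : (fun t => _) = \1_(`](ratr (s k)), (ratr (s' k))]%classic)).
      by apply/measurable_indicP; exact: measurable_itv.
    by apply/funext => t; rewrite indicE mem_setE /= in_itv/=.
  - by move=> k t _; case: (_ < _ <= _); rewrite ?normr1 ?normr0.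
  - move=> t _; apply: cvg_near_cst.
    have [ta|ta] := leP t a.
      apply: nearW => k; have := sP k; rewrite in_itv/= => /andP[/(le_lt_trans ta)/ltW].
      by rewrite leNgt => /negbTE -> .
    have [tb|tb] /= := leP t b.
      have : \forall k \near \oo, ratr (s k) < t.
        by apply: (cvgr_lt a cs).
      apply: filterS => k ->; have := s'P k; rewrite in_itv/= => /andP[/(le_lt_trans tb)/ltW -> _].
      by [].
    have : \forall k \near \oo, ratr (s' k) < t by apply: (cvgr_lt b cs').
    by apply: filterS => k; rewrite ltNge => /negbTE ->; rewrite andbF.
have cu' t : a <= t <= b -> {for t, continuous u}.
  move=> /andP[h1 h2]; apply: cu.
  by rewrite (le_trans (ltW s0a) h1) (le_trans h2 (ltW bs1)).
have L' : u (ratr (s' k)) - u (ratr (s k)) @[k --> \oo] --> u b - u a.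
  apply: cvgB; apply: continuous_cvg => //; apply: cu'; rewrite lexx ltW//.
rewrite -(seq_cvg_unique L L'); last by apply: nearW => k; exact: E.
rewrite -Rintegral_itv_obnd_cbnd; last first.
  apply: integrableS iv => //.
  move=> t; rewrite /= !in_itv/= => /andP[h1 h2].
  by rewrite (ltW (lt_trans s0a h1)) (le_trans h2 (ltW bs1)).
rewrite Rintegral_mkcond [RHS]Rintegral_mkcond; apply: eq_Rintegral => t _.
rewrite !patchE; case: ifPn => tI.
  have := set_mem tI; rewrite /= in_itv/= => tab.
  rewrite ifT; first by rewrite tab mulr1.
  apply/mem_set; move: tab; rewrite /= in_itv/= => /andP[h1 h2].
  by rewrite (ltW (lt_trans s0a h1)) (le_trans h2 (ltW bs1)).
case: ifPn => // _; move: tI; rewrite notin_setE /= in_itv/= => /negP/negbTE ->.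
by rewrite mulr0.
Qed.

End line.

(** * Absolute continuity on lines *)

Section fubini_ins.
Context (R : realType) (n : nat) (j : 'I_n.+1).
Local Notation lm := (@lebesgue_measure R).
Local Open Scope ereal_scope.
Variable f : 'rV[R]_n.+1 -> R.
Hypothesis intf : (leb (n:=n.+1)).-integrable setT (EFin \o f).

Let mf : measurable_fun setT (EFin \o f). Proof. by case/integrableP: intf. Qed.
Let mfi : measurable_fun setT (fun z => (f (ins j z))%:E).
Proof. by apply: measurableT_comp mf _; exact: measurable_ins. Qed.

Lemma integrable_ins : (leb (n:=n) \x lm).-integrable setT (fun z => (f (ins j z))%:E).
Proof.
apply/integrableP; split => //.
rewrite fubini_tonelli1//; last by apply: measurableT_comp.
case/integrableP: intf => _; rewrite (integral_ins j)//.
by apply: measurableT_comp.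
Qed.

Lemma integral_ins_prod : \int[leb (n:=n.+1)]_x (f x)%:E = \int[leb (n:=n) \x lm]_z (f (ins j z))%:E.
Proof.
rewrite integralE [RHS]integralE; congr (_ - _).
  rewrite (integral_ins j)//; last exact: measurable_funepos.
  rewrite (fubini_tonelli1 _ (measurable_funepos mfi) (fun z => funepos_ge0 _ z)).
  apply: eq_integral => x _; apply: eq_integral => t _.
  by rewrite !funeposE.
rewrite (integral_ins j)//; last exact: measurable_funeneg.
rewrite (fubini_tonelli1 _ (measurable_funeneg mfi) (fun z => funeneg_ge0 _ z)).
apply: eq_integral => x _; apply: eq_integral => t _.
by rewrite !funenegE.
Qed.

End fubini_ins.

Section rbox_indic.
Context (R : realType) (n : nat).

Lemma rbox_indic_integrable (a b : 'I_n -> R) :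
  (leb (n:=n)).-integrable setT (EFin \o (\1_(rbox (fun i => `[a i, b i]%classic)) : 'rV[R]_n -> R)).
Proof.
have mB : measurable (@rbox R n (fun i => `[a i, b i]%classic)).
  by apply: measurable_rbox => i; exact: measurable_itv.
rewrite (_ : EFin \o _ = (EFin \o cst (1 : R)) \_ (rbox (fun i => `[a i, b i]%classic))); last first.
  by apply/funext => x; rewrite /= patchE indicE; case: ifP.
apply/(integrable_mkcond _ mB); apply: measurable_bounded_integrable => //.
  rewrite [ltLHS]leb_rbox; last by move=> i; exact: measurable_itv.
rewrite (eq_bigr (fun i => (fine (lebesgue_measure `[a i, b i]%classic))%:E)).
    by rewrite prodEFin ltry.
  move=> i _; rewrite fineK// lebesgue_measure_itv/=; case: ifP => // _.
exact: bounded_cst.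
Qed.

End rbox_indic.

Lemma cvg_prod_seq (R : realType) (I : Type) (s : seq I) (f : nat -> I -> R) (l : I -> R) :
  (forall i, f k i @[k --> \oo] --> l i) -> \prod_(i <- s) f k i @[k --> \oo] --> \prod_(i <- s) l i.
Proof.
move=> fl; elim: s => [|i s IH].
  by rewrite big_nil; under eq_fun do rewrite big_nil; exact: cvg_cst.
by rewrite big_cons; under eq_fun do rewrite big_cons; exact: cvgM.
Qed.

Lemma clamp_dist (R : realType) (a b s0 s1 y d : R) : 0 < d -> a <= b -> a - d / 4 < s0 -> s1 < b + d / 4 ->
  s0 <= y <= s1 -> `|y - Num.min (Num.max a y) b| < d.
Proof.
move=> d0 ab h1 h2 /andP[h3 h4]; rewrite ltr_norml.
have [h|h] := leP a y; have [h'|h'] := leP _ b; lra.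
Qed.

Lemma center_near (R : realType) (c r x : R) : x - r < c -> c < x -> 0 < r -> c - r < x <= c + r.
Proof. by move=> h1 h2 h3; apply/andP; split; lra. Qed.

Lemma near_center (R : realType) (c r x y d : R) : r < d / 4 -> c - r < x <= c + r ->
  c - (r + r) <= y <= c + (r + r) -> `|y - x| < d.
Proof. by move=> h1 /andP[h2 h3] /andP[h4 h5]; rewrite ltr_norml; lra. Qed.

Lemma continuous_ins (R : realType) n (j : 'I_n.+1) (x : 'rV[R]_n) (t : R) :
  {for t, continuous (fun t : R => ins j (x, t))}.
Proof.
apply/cvgrPdist_lt => e e0; near=> s; apply: norm_rV_lt => // i; rewrite !mxE /=.
case: (unlift j i) => [k|] /=; first by rewrite subrr normr0.
by near: s; apply: (@cvgr_dist_lt _ _ _ _ _ id t) => //; exact: cvg_id.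
Unshelve. all: by end_near. Qed.

Section weak_line.
Context (R : realType) (n : nat) (j : 'I_n.+1).
Local Notation lm := (@lebesgue_measure R).
Variables (U : set 'rV[R]_n.+1) (u v : 'rV[R]_n.+1 -> R).
Hypothesis oU : open U.
Hypothesis cu : forall x, U x -> {for x, continuous u}.
Hypothesis mv : measurable_fun U v.
Hypothesis iv : forall a b : 'I_n.+1 -> R, rbox (fun i => `[a i, b i]%classic) `<=` U ->
  (leb (n:=n.+1)).-integrable (rbox (fun i => `[a i, b i]%classic)) (EFin \o v).
Hypothesis wp : is_weak_partial U j u v.

Lemma sstep'_le : exists2 C : R, 0 < C & forall t, `|@sstep' R t| <= C.
Proof.
have [C0 HC0] := sstep'_bounded R; exists (Num.max C0 1).
  by rewrite lt_max ltr01 orbT.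
move=> t; have [t01|t01] := boolP (0 <= t <= 1); first by rewrite le_max HC0.
rewrite sstep'_out ?normr0 ?le_max ?ler01 ?orbT//.
by move: t01; rewrite negb_and -!ltNge.
Qed.

Lemma bump'_le (N s s' : R) : exists M, forall t, `|bump' N s s' t| <= M.
Proof.
have [C C0 HC] := sstep'_le; exists (`|N| * C + `|N| * C) => t.
rewrite /bump'; apply: le_trans (ler_normB _ _) _; rewrite !normrM.
by rewrite lerD// ler_wpM2l.
Qed.

Lemma bump'_supp (N s s' t : R) : 0 < N -> s <= s' -> bump' N s s' t != 0 ->
  s <= t <= s' + N^-1.
Proof.
move=> N0 ss'; apply: contraR; rewrite negb_and -!ltNge => ts; apply/eqP.
rewrite /bump' !sstep'_out ?mulr0 ?subrr//; case/orP: ts => ts.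
- by rewrite pmulr_rlt0// subr_lt0 (lt_le_trans ts).
- by rewrite -ltr_pdivrMl// mulr1 ltrBrDl ts orbT.
- by rewrite pmulr_rlt0// subr_lt0 ts.
- by rewrite -ltr_pdivrMl// mulr1 ltrBrDl (le_lt_trans _ ts) ?orbT// lerD2r.
Qed.

Section box.
Variables (c : 'rV[R]_n) (r s0 s1 : R).
Hypothesis r0 : 0 < r.
Let lo (i : 'I_n.+1) := oapp (fun k => c ord0 k - (r + r)) s0 (unlift j i).
Let hi (i : 'I_n.+1) := oapp (fun k => c ord0 k + (r + r)) s1 (unlift j i).
Let Q := @rbox R n.+1 (fun i => `[lo i, hi i]%classic).
Hypothesis QU : Q `<=` U.

Let mQ : measurable Q. Proof. by apply: measurable_rbox => i; exact: measurable_itv. Qed.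
Let mU : measurable U := open_rV_measurable oU.

Let QP x : Q x <-> (forall k, c ord0 k - (r + r) <= x ord0 (lift j k) <= c ord0 k + (r + r)) /\
  s0 <= x ord0 j <= s1.
Proof.
split => [h|[h1 h2] i].
  split => [k|]; first by have := h (lift j k); rewrite /= in_itv /lo /hi liftK.
  by have := h j; rewrite /= in_itv /lo /hi unlift_none.
have [k ->|->] := unliftP j i; rewrite /= in_itv/= /lo /hi ?liftK ?unlift_none//=; exact: h1.
Qed.

(** What multiplies the transversal factor of a product test function in the weak identity, cut off
    to the box [Q], where it is integrable. Its integrals along lines are shown to vanish for almost
    every line. *)
Definition wkern (N s s' : R) (x : 'rV[R]_n.+1) : R :=
  \1_Q x * (u x * bump' N s s' (x ord0 j)) + v x * \1_Q x * bump N s s' (x ord0 j).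

Let mcoord (h : R -> R) : continuous h -> measurable_fun setT (fun x : 'rV[R]_n.+1 => h (x ord0 j)).
Proof.
move=> ch; apply: (@measurableT_comp _ _ _ _ _ _ h); first exact: continuous_measurable_fun.
exact: measurable_coordT.
Qed.

Let iu N s s' : (leb (n:=n.+1)).-integrable setT (EFin \o (fun x => \1_Q x * (u x * bump' N s s' (x ord0 j)))).
Proof.
have cQ : compact Q by apply: rV_compact => i; exact: segment_compact.
have [M uM] : exists M, forall x, Q x -> `|u x| <= M.
  have /compact_bounded[M [_ HM]] : compact (u @` Q).
    apply: continuous_compact => //; apply: continuous_in_subspaceT => x /set_mem Qx.
    by apply: cu; exact: QU.
  exists (M + 1) => x Qx; apply: (HM (M + 1)); first by rewrite ltrDl.
  by exists x.
have [M' bM] := bump'_le N s s'.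
rewrite (_ : EFin \o _ = EFin \o (fun x => \1_Q x * ((u \_ Q) x * bump' N s s' (x ord0 j)))); last first.
  apply/funext => x /=; congr EFin; rewrite patchE indicE; case: ifPn => // _.
  by rewrite !mul0r.
apply: (@integrable_bounded_mul _ _ _ _ _ _ _ (`|M| * `|M'|)) => //.
- exact: rbox_indic_integrable.
- apply: measurable_funM; last by apply: mcoord; exact: continuous_bump'.
  apply/(measurable_restrictT _ mQ); apply: (measurable_funS mU) => //.
  exact: open_continuous_measurable_rV.
- move=> x _; rewrite normrM ler_pM//; last exact: le_trans (bM _) (ler_norm _).
  rewrite patchE; case: ifPn => [/set_mem Qx|_]; last by rewrite normr0.
  exact: le_trans (uM _ Qx) (ler_norm _).
Qed.

Let ivQ : (leb (n:=n.+1)).-integrable setT (EFin \o (fun x => v x * \1_Q x)).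
Proof.
rewrite (_ : EFin \o _ = (EFin \o v) \_ Q).
  by apply/(integrable_mkcond _ mQ); exact: iv.
apply/funext => x /=; rewrite patchE indicE; case: ifPn => _; rewrite ?mulr1 ?mulr0//.
Qed.

Let ivb N s s' : (leb (n:=n.+1)).-integrable setT (EFin \o (fun x => v x * \1_Q x * bump N s s' (x ord0 j))).
Proof.
apply: (@integrable_bounded_mul _ _ _ _ _ _ _ 1) => //.
  by apply: mcoord; exact: continuous_bump.
by move=> x _; rewrite ler_norml bump_itv.
Qed.

Lemma wkern_integrable N s s' : (leb (n:=n.+1)).-integrable setT (EFin \o wkern N s s').
Proof.
rewrite (_ : EFin \o _ = (EFin \o (fun x => \1_Q x * (u x * bump' N s s' (x ord0 j)))) \+
  (EFin \o (fun x => v x * \1_Q x * bump N s s' (x ord0 j)))).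
  exact: integrableD (iu N s s') (ivb N s s').
by apply/funext.
Qed.

Lemma weak_tensor (N N' s s' : R) (a b : 'I_n -> R) : 0 < N -> 0 < N' -> s0 <= s -> s <= s' -> s' + N'^-1 <= s1 ->
  (forall k, [/\ c ord0 k - (r + r) <= a k, a k <= b k & b k + N^-1 <= c ord0 k + (r + r)]) ->
  \int[leb (n:=n.+1)]_x (wkern N' s s' x * tensor (fun k => bump N (a k) (b k)) (del j x)) = 0.
Proof.
move=> N0 N'0 s0s ss' s's1 abc.
pose eta (i : 'I_n.+1) := oapp (fun k => bump N (a k) (b k)) (bump N' s s') (unlift j i).
pose psi := tensor (fun k => bump N (a k) (b k)).
have etaE x : tensor eta x = psi (del j x) * bump N' s s' (x ord0 j).
  rewrite /tensor (bigD1_ord j)//= /eta unlift_none /= mulrC; congr (_ * _).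
  by apply: eq_bigr => k _; rewrite liftK /= mxE.
have prodE (x : 'rV[R]_n.+1) : \prod_(i < n.+1 | i != j) eta i (x ord0 i) = psi (del j x).
  transitivity (\prod_(i < n.+1) (if i == j then 1 else eta i (x ord0 i))).
    by rewrite [RHS](bigD1 j)//= eqxx mul1r; apply: eq_bigr => i /negbTE ->.
  rewrite (bigD1_ord j)//= eqxx mul1r; apply: eq_bigr => k _.
  by rewrite eq_sym (negbTE (neq_lift _ _)) /eta liftK /= mxE.
have psiQ x : psi (del j x) != 0 -> forall k, c ord0 k - (r + r) <= x ord0 (lift j k) <= c ord0 k + (r + r).
  move=> p0 k; have [h1 h2 h3] := abc k.
  have : bump N (a k) (b k) (x ord0 (lift j k)) != 0.
    apply: contra p0 => /eqP b0; rewrite /psi /tensor (bigD1 k)//= mxE b0 mul0r//.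
  by move=> /(bump_supp N0 h2)/andP[h4 h5]; rewrite (le_trans h1 h4) (le_trans h5 h3).
have itvQ (x : 'rV[R]_n.+1) : s <= x ord0 j <= s' + N'^-1 -> s0 <= x ord0 j <= s1.
  by move=> /andP[h1 h2]; rewrite (le_trans s0s h1) (le_trans h2 s's1).
have tf : test_function U (tensor eta).
  apply: (@test_function_tensor _ _ _ _ lo hi) => //.
  - by move=> k i; rewrite /eta; case: (unlift j i) => [l|] /=; exact: smooth_bump.
  - move=> i t; rewrite /eta /lo /hi; case: (unlift j i) => [k|] /=.
      have [h1 h2 h3] := abc k.
      by move=> /(bump_supp N0 h2)/andP[h4 h5]; rewrite (le_trans h1 h4) (le_trans h5 h3).
    by move=> /(bump_supp N'0 ss')/andP[h4 h5]; rewrite (le_trans s0s h4) (le_trans h5 s's1).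
have D x : 'D_('e_j : 'rV[R]_n.+1) (tensor eta) x = psi (del j x) * bump' N' s s' (x ord0 j).
  rewrite -prodE; have : is_derive (x ord0 j) 1 (eta j) (bump' N' s s' (x ord0 j)).
    by rewrite /eta unlift_none /=; exact: is_derive_bump.
  by move=> /is_derive_tensor [_ ->].
have := wp tf; rewrite Rintegral_mkcond [in RHS]Rintegral_mkcond.
have -> : (fun x => u x * 'D_('e_j : 'rV[R]_n.+1) (tensor eta) x) \_ U =
    (fun x => \1_Q x * (u x * bump' N' s s' (x ord0 j)) * psi (del j x)).
  apply/funext => x; rewrite patchE; case: ifPn => Ux; last first.
    rewrite indicE memNset ?mul0r//.
    by move=> /QU; move: Ux; rewrite notin_setE.
  rewrite D indicE; have [/set_mem Qx|nQ] := boolP (x \in Q).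
    by rewrite mul1r mulrCA mulrC.
  rewrite !mul0r; apply/eqP; rewrite mulf_eq0 orbC; apply/orP; left.
  apply: contraR nQ; rewrite mulf_eq0 negb_or => /andP[p0 b0].
  apply/mem_set/QP; split; first exact: psiQ.
  by apply: itvQ; exact: bump'_supp b0.
have -> : (fun x => v x * tensor eta x) \_ U =
    (fun x => v x * \1_Q x * bump N' s s' (x ord0 j) * psi (del j x)).
  apply/funext => x; rewrite patchE; case: ifPn => Ux; last first.
    rewrite indicE memNset ?mulr0 ?mul0r//.
    by move=> /QU; move: Ux; rewrite notin_setE.
  rewrite etaE indicE; have [/set_mem Qx|nQ] := boolP (x \in Q).
    by rewrite mulr1 mulrCA mulrC.
  rewrite mulr0 !mul0r; apply/eqP; rewrite mulf_eq0 orbC; apply/orP; left.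
  apply: contraR nQ; rewrite mulf_eq0 negb_or => /andP[p0 b0].
  apply/mem_set/QP; split; first exact: psiQ.
  by apply: itvQ; exact: bump_supp b0.
have psi1 x : `|psi x| <= 1.
  rewrite /psi /tensor normr_prod; apply: prodr_ile1 => k _.
  by rewrite normr_ge0 /= ler_norml bump_itv.
have mpsi : measurable_fun setT (fun x : 'rV[R]_n.+1 => psi (del j x)).
  apply: (@measurableT_comp _ _ _ _ _ _ psi); last exact: measurable_del.
  by apply: continuous_measurable_rV; apply: continuous_tensor => k; exact: continuous_bump.
move=> E; rewrite /wkern.
under eq_Rintegral do rewrite mulrDl.
rewrite RintegralD//.
- by apply/eqP; rewrite addr_eq0; apply/eqP; exact: E.
- by apply: (@integrable_bounded_mul _ _ _ _ _ _ _ 1).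
- by apply: (@integrable_bounded_mul _ _ _ _ _ _ _ 1).
Qed.

Definition wline (N s s' : R) (x : 'rV[R]_n) : R := \int[lm]_t wkern N s s' (ins j (x, t)).

Let iwl N s s' : (leb (n:=n)).-integrable setT (fun x => \int[lm]_t (wkern N s s' (ins j (x, t)))%:E)%E.
Proof. exact: integrable_fubini_F (integrable_ins j (wkern_integrable N s s')). Qed.

Let wlineE N s s' : {ae leb (n:=n), forall x,
  (\int[lm]_t (wkern N s s' (ins j (x, t)))%:E)%E = (wline N s s' x)%:E}.
Proof.
have := integrable_ae measurableT (iwl N s s').
by apply: filterS => x /(_ I) h; rewrite /wline /Rintegral fineK.
Qed.

Let mwl N s s' : measurable_fun setT (wline N s s').
Proof.
by apply: measurableT_comp => //; case/integrableP: (iwl N s s').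
Qed.

Let iwline N s s' : (leb (n:=n)).-integrable setT (EFin \o wline N s s').
Proof.
apply/integrableP; split; first exact/measurable_EFinP.
case/integrableP: (iwl N s s') => m1; apply: le_lt_trans.
rewrite (ae_eq_integral (fun x => `|\int[lm]_t (wkern N s s' (ins j (x, t)))%:E|)%E)//.
- by apply: measurableT_comp => //; exact/measurable_EFinP.
- exact: measurableT_comp.
- by apply: filterS (wlineE N s s') => x -> _.
Qed.

Lemma wline_tensor (N N' s s' : R) (a b : 'I_n -> R) : 0 < N -> 0 < N' -> s0 <= s -> s <= s' -> s' + N'^-1 <= s1 ->
  (forall k, [/\ c ord0 k - (r + r) <= a k, a k <= b k & b k + N^-1 <= c ord0 k + (r + r)]) ->
  \int[leb (n:=n)]_x (wline N' s s' x * tensor (fun k => bump N (a k) (b k)) x) = 0.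
Proof.
move=> N0 N'0 s0s ss' s's1 abc.
rewrite -(weak_tensor N0 N'0 s0s ss' s's1 abc).
set psi := tensor _.
have mpsi : measurable_fun setT psi.
  by apply: continuous_measurable_rV; apply: continuous_tensor => k; exact: continuous_bump.
have psi1 x : `|psi x| <= 1.
  rewrite /psi /tensor normr_prod; apply: prodr_ile1 => k _.
  by rewrite normr_ge0 /= ler_norml bump_itv.
have iw : (leb (n:=n.+1)).-integrable setT (EFin \o (fun x => wkern N' s s' x * psi (del j x))).
  apply: (@integrable_bounded_mul _ _ _ _ _ _ _ 1) => //; first exact: wkern_integrable.
  by apply: (@measurableT_comp _ _ _ _ _ _ psi) => //; exact: measurable_del.
rewrite /Rintegral (integral_ins_prod j iw) -(integral12_prod_meas1 (integrable_ins j iw)).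
congr fine; apply: ae_eq_integral => //.
- apply/measurable_EFinP; exact: measurable_funM.
- by case/integrableP: (integrable_fubini_F (integrable_ins j iw)).
have := ae_integrable1 (integrable_ins j (wkern_integrable N' s s')).
apply: filterS2 (wlineE N' s s') => x wE ix _.
rewrite /fubini_F /= EFinM -wE muleC -integralZl//.
apply: eq_integral => t _; rewrite EFinM muleC; congr (_ * (psi _)%:E)%E.
by have [-> _] := insK j (x, t : measurableTypeR R).
Qed.

Let cr := fun k => c ord0 k - r.
Let cr' := fun k => c ord0 k + r.

(** Transversal bumps converge to the indicator of the box. They overshoot its upper sides by [1/N],
    so the box is confined to radius [r] while the bumps may use radius [2 r]. *)
Lemma wline_ocbox (N s s' : R) (a b : 'I_n -> R) : 0 < N -> s0 <= s -> s <= s' -> s' + N^-1 <= s1 ->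
  (forall k, cr k <= a k /\ b k <= cr' k) ->
  \int[leb (n:=n)]_x (wline N s s' x * \1_(ocbox a b) x) = 0.
Proof.
move=> N0 s0s ss' s's1 abc.
have [ab|] := pselect (forall k, a k <= b k); last first.
  move=> /existsNP[k /negP]; rewrite -ltNge => ba.
  rewrite /Rintegral integral0_eq// => x _.
  rewrite indicE memNset ?mulr0// => /(_ k); rewrite /= in_itv/= => /andP[h1 h2].
  by have := lt_le_trans h1 h2; rewrite ltNge (ltW ba).
have L : \int[leb (n:=n)]_x (wline N s s' x * tensor (fun k => bump i.+1%:R (a k) (b k)) x) @[i --> \oo] -->
    \int[leb (n:=n)]_x (wline N s s' x * \1_(ocbox a b) x).
  apply: dct_bounded => //.
  - move=> i; apply: continuous_measurable_rV; apply: continuous_tensor => k; exact: continuous_bump.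
  - move=> i x _; rewrite /tensor normr_prod; apply: prodr_ile1 => k _.
    by rewrite normr_ge0 /= ler_norml bump_itv.
  - move=> x _; rewrite (_ : \1_(ocbox a b) x = \prod_(k < n) (a k < x ord0 k <= b k)%R%:R).
      apply: cvg_prod_seq => k.
      have := @bump_cvg R (a k) (b k) (x ord0 k) (ab k).
      by rewrite -(cvg_shiftS (fun i => bump i%:R (a k) (b k) (x ord0 k))).
    rewrite indicE; have [/set_mem xB|xB] := boolP (x \in _).
      by rewrite big1// => k _; have := xB k; rewrite /= in_itv/= => ->.
    move: xB; rewrite notin_setE => /existsNP[k /=]; rewrite in_itv/= => /negP/negbTE xk.
    by rewrite (bigD1 k)//= xk mul0r.
apply: (seq_cvg_unique L (cvg_cst 0)).
near=> i; apply: wline_tensor => // k; split => //.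
  by have [h1 _] := abc k; apply: le_trans h1; rewrite /cr lerB// lerDl ltW.
have [_ h2] := abc k; apply: le_trans (lerD h2 (lexx _)) _.
rewrite /cr' -addrA lerD2l lerD2l ltW//.
by near: i; exact: near_infty_natSinv_lt (PosNum r0).
Unshelve. all: by end_near. Qed.

Lemma wline_ae (N s s' : R) : 0 < N -> s0 <= s -> s <= s' -> s' + N^-1 <= s1 ->
  {ae leb (n:=n), forall x : 'rV[R]_n, (forall k, cr k < x ord0 k <= cr' k) -> wline N s s' x = 0}.
Proof.
move=> N0 s0s ss' s's1.
set B := ocbox cr cr'.
pose K x := wline N s s' x * \1_B x.
have mB : measurable B by exact: measurable_ocbox.
have iK : (leb (n:=n)).-integrable setT (EFin \o K).
  apply: (@integrable_bounded_mul _ _ _ _ _ _ _ 1) => //.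
  by move=> x _; rewrite indicE; case: (_ \in _); rewrite ?normr1 ?normr0.
have finK A : measurable A -> (\int[leb (n:=n)]_(x in A) (K x)%:E)%E \is a fin_num.
  by move=> mA; apply: integrable_fin_num => //; exact: integrableS iK.
have K0 : {ae leb (n:=n), forall x, K x = 0}.
  apply: zero_ocbox_ae => // [|a b].
    by rewrite -[LHS]fineK ?finK//; congr EFin; exact: wline_ocbox.
  rewrite -[LHS]fineK ?finK//; last exact: measurable_ocbox.
  congr EFin; rewrite -[fine _]/(\int[_]_(x in _) K x) Rintegral_mkcond.
  rewrite -(@wline_ocbox N s s' (fun i => Num.max (a i) (cr i)) (fun i => Num.min (b i) (cr' i)))//.
    apply: eq_Rintegral => x _; rewrite patchE -ocboxI /K -/B !indicE in_setI.
    by case: ifP => _ /=; rewrite ?mulr0.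
  by move=> k; split; rewrite ?le_max ?ge_min lexx orbT.
apply: filterS K0 => x; rewrite /K indicE => xK xk; move: xK; rewrite mem_set ?mulr1//.
Qed.

Let Qins (x : 'rV[R]_n) (t : R) : (forall k, cr k < x ord0 k <= cr' k) -> Q (ins j (x, t)) <-> s0 <= t <= s1.
Proof.
move=> xB; rewrite QP; split => [[_]|st]; first by rewrite insE.
split => [k|]; last by rewrite insE.
have /andP[h1 h2] := xB k; rewrite ins_lift /=; apply/andP; split.
  by apply: le_trans (ltW h1); rewrite /cr lerB// lerDl ltW.
by apply: le_trans h2 _; rewrite /cr' lerD// lerDl ltW.
Qed.

(** One null set of lines serves the countably many parameters consisting of a bump width and two
    rational endpoints. Off it, [bump_limit] gives the formula for rational endpoints and [line_ftc]
    for all. *)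
Lemma wline_ftc : {ae leb (n:=n), forall x : 'rV[R]_n, (forall k, cr k < x ord0 k <= cr' k) ->
  lm.-integrable `[s0, s1] (fun t => (v (ins j (x, t)))%:E) /\
  forall a b : R, s0 < a -> a <= b -> b < s1 ->
    \int[lm]_(t in `[a, b]) v (ins j (x, t)) = u (ins j (x, b)) - u (ins j (x, a))}.
Proof.
have mI : measurable (`[s0, s1]%classic : set R) by exact: measurable_itv.
pose I := (nat * rat * rat)%type.
pose P (i : I) (x : 'rV[R]_n) := s0 <= ratr i.1.2 -> ratr i.1.2 <= ratr i.2 :> R ->
  ratr i.2 + i.1.1.+1%:R^-1 <= s1 ->
  (forall k, cr k < x ord0 k <= cr' k) -> wline i.1.1.+1%:R (ratr i.1.2) (ratr i.2) x = 0.
have aeP : {ae leb (n:=n), forall x, forall i, P i x}.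
  apply: ae_forall_count => -[[k s] s']; rewrite /P /=.
  have [h1|h1] := boolP (s0 <= ratr s); last by apply: aeW.
  have [h2|h2] := boolP (ratr s <= ratr s' :> R); last by apply: aeW.
  have [h3|h3] := boolP (ratr s' + k.+1%:R^-1 <= s1); last by apply: aeW.
  by have := @wline_ae k.+1%:R _ _ (ltr0Sn _ _) h1 h2 h3; apply: filterS => x H _ _ _; exact: H.
have aeV := ae_integrable1 (integrable_ins j ivQ).
apply: filterS2 aeP aeV => x Px ix xB.
have ixI : lm.-integrable `[s0, s1] (fun t => (v (ins j (x, t)))%:E).
  have [_ H] := @integrable_mkcond _ _ _ lm _ (fun t => (v (ins j (x, t)))%:E) mI; apply: H; move: ix; congr (_.-integrable _ _).
  apply/funext => t; rewrite patchE indicE; have [tI|tI] := boolP (t \in _).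
    by rewrite mem_set ?mulr1//; apply/(Qins t xB); have := set_mem tI; rewrite /= in_itv.
  rewrite memNset ?mulr0// => /(Qins t xB) h.
  by move: tI; rewrite notin_setE; apply; rewrite /= in_itv.
split=> // a b s0a ab bs1.
have cux t : s0 <= t <= s1 -> {for t, continuous (fun t => u (ins j (x, t)))}.
  move=> ts; apply: (@continuous_comp _ _ _ (fun t => ins j (x, t)) u); last first.
    by apply: cu; apply: QU; exact/Qins.
  apply: continuous_ins.
apply: (@line_ftc R (fun t => u (ins j (x, t))) _ s0 s1 cux ixI a b) => // s s' h1 h2 h3.
apply: (@bump_limit R (fun t => u (ins j (x, t))) _ s0 s1 cux ixI) => //; first exact: ltW.
move=> k h4.
have := Px (k, s, s') (ltW h1) (ltW h2) h4 xB; rewrite /= => <-.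
rewrite /wline [LHS]Rintegral_mkcond; apply: eq_Rintegral => t _.
rewrite patchE /wkern indicE insE /=; have [tI|tI] := boolP (t \in _).
  by rewrite mem_set ?mul1r ?mulr1//; apply/(Qins t xB); have := set_mem tI; rewrite /= in_itv.
rewrite memNset ?mulr0 ?mul0r ?addr0// => /(Qins t xB) h.
by move: tI; rewrite notin_setE; apply; rewrite /= in_itv.
Qed.

End box.

(** There are countably many rational boxes inside [U], and by compactness every segment in [U]
    parallel to the axis [j] lies in the interior part of one of them. The exceptional set of lines
    thus depends on no segment. *)
Lemma weak_partial_acl : {ae leb (n:=n.+1), forall x, forall a b : R, a <= b ->
  (forall t, a <= t <= b -> U (upd x j t)) ->
  lm.-integrable `[a, b] (fun t => (v (upd x j t))%:E) /\
  \int[lm]_(t in `[a, b]) v (upd x j t) = u (upd x j b) - u (upd x j a)}.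
Proof.
pose I := ({ffun 'I_n -> rat} * rat * (rat * rat))%type.
pose c (i : I) : 'rV[R]_n := \row_k ratr (i.1.1 k).
pose lo (i : I) (l : 'I_n.+1) : R := oapp (fun k => c i ord0 k - (ratr i.1.2 + ratr i.1.2)) (ratr i.2.1) (unlift j l).
pose hi (i : I) (l : 'I_n.+1) : R := oapp (fun k => c i ord0 k + (ratr i.1.2 + ratr i.1.2)) (ratr i.2.2) (unlift j l).
have ae0 : {ae leb (n:=n), forall x : 'rV[R]_n, forall i : I, 0 < ratr i.1.2 :> R ->
    rbox (fun l => `[lo i l, hi i l]%classic) `<=` U ->
    (forall k, c i ord0 k - ratr i.1.2 < x ord0 k <= c i ord0 k + ratr i.1.2) ->
    lm.-integrable `[ratr i.2.1, ratr i.2.2] (fun t => (v (ins j (x, t)))%:E) /\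
    forall a b : R, ratr i.2.1 < a -> a <= b -> b < ratr i.2.2 ->
    \int[lm]_(t in `[a, b]) v (ins j (x, t)) = u (ins j (x, b)) - u (ins j (x, a))}.
  apply: ae_forall_count => i.
  have [h1|h1] := boolP (0 < ratr i.1.2 :> R); last by apply: aeW.
  have [h2|h2] := pselect (rbox (fun l => `[lo i l, hi i l]%classic) `<=` U); last by apply: aeW => x _ /h2.
  by have := wline_ftc h1 h2; apply: filterS => x h _ _; exact: h.
apply/(ae_ins j); have := @ae_prod_fst _ _ _ _ _ _ lm _ ae0.
apply: filterS => -[x t0] /= Hx a b ab xU.
have E t : upd (ins j (x, t0)) j t = ins j (x, t) by exact: (upd_insE (x, t0)).
rewrite !E; under eq_Rintegral do rewrite E.
have -> : (fun t : measurableTypeR R => (v (upd (ins j (x, t0)) j t))%:E) = (fun t => (v (ins j (x, t)))%:E).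
  by apply/funext => t; rewrite E.
have {}xU t : a <= t <= b -> U (ins j (x, t)) by move=> /xU; rewrite E.
have cK : compact ((fun t => ins j (x, t)) @` `[a, b]).
  apply: continuous_compact; last exact: segment_compact.
  by apply: continuous_subspaceT => t; exact: continuous_ins.
have [d d0 Hd] : exists2 d : R, 0 < d & forall t y, a <= t <= b -> `|y - ins j (x, t)| < d -> U y.
  have [|d d0 H] := compact_open_dist cK oU; first by move=> _ [t tab <-]; apply: xU; rewrite /= in_itv in tab.
  by exists d => // t y tab; apply: H; exists t => //; rewrite /= in_itv.
have d40 : 0 < d / 4 by rewrite divr_gt0.
have [s0 /itvP s0P] : exists q : rat, ratr q \in `]a - d / 4, a[.
  by apply: rat_in_itvoo; rewrite ltrBlDr ltrDl.
have [s1 /itvP s1P] : exists q : rat, ratr q \in `]b, b + d / 4[.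
  by apply: rat_in_itvoo; rewrite ltrDl.
have [r /itvP rP] : exists q : rat, ratr q \in `]0, d / 4[ by exact: rat_in_itvoo.
have r0 : 0 < ratr r :> R by rewrite rP.
have /choice[cc ccP] : forall k : 'I_n, exists q : rat, ratr q \in `](x ord0 k - ratr r), (x ord0 k)[.
  by move=> k; apply: rat_in_itvoo; rewrite ltrBlDr ltrDl.
have xc k : (ratr (cc k) : R) - ratr r < x ord0 k <= ratr (cc k) + ratr r.
  have := ccP k; rewrite in_itv/= => /andP[h1 h2].
  exact: center_near h1 h2 r0.
have := Hx ([ffun k => cc k], r, (s0, s1)) r0 _ _; case=> /=.
- move=> y yB.
  (* The parameter of the point of the segment whose [j]-th coordinate is nearest to that of [y]. *)
  pose t := Num.min (Num.max a (y ord0 j)) b.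
  have tab : a <= t <= b by rewrite le_min ge_min lexx orbT andbT le_max lexx.
  apply: (Hd t) => //; apply: norm_rV_lt => // l; rewrite !mxE.
  have := yB l; rewrite /= in_itv/= /lo /hi; case: unliftP => [k|] -> /=.
    rewrite !mxE ffunE => yk; have := xc k; move: yk; have : ratr r < d / 4 :> R by rewrite rP.
    by move=> h1 h2 h3; exact: near_center h1 h3 h2.
  apply: clamp_dist => //; rewrite ?s0P ?s1P//.
- by move=> k; rewrite mxE ffunE.
move=> h1 h2; split; last by apply: h2; rewrite ?s0P ?s1P.
apply: integrableS h1 => // t; rewrite /= !in_itv/= => /andP[ta tb].
rewrite (le_trans _ ta) ?(le_trans tb)// ltW ?s0P ?s1P//.
Qed.
End weak_line.

(** * Invariance of domain *)

Section cup.
Variables (n M : nat).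
Implicit Types (x y : 'I_n -> nat) (T : {set 'I_n}) (i j : 'I_n).
Variable B : nat -> ('I_n -> nat) -> 'F_2.

Let addff (a : 'F_2) : a + a = 0.
Proof. by apply: addrr_pchar2; exact: pchar_Fp. Qed.

Definition shift x i : 'I_n -> nat := fun l => (x l + (l == i))%N.

Lemma shiftC x i j : shift (shift x i) j = shift (shift x j) i.
Proof. by apply/funext => l; rewrite /shift addnAC. Qed.

(* The value on the cube based at [x] with directions [T] of the mod 2 cup
   product of the coboundaries of [B d.-1, ..., B 0]. *)
Fixpoint cupB d T x : 'F_2 :=
  if d is d'.+1 then \sum_(i in T) (B d' (shift x i) + B d' x) * cupB d' (T :\ i) (shift x i)
  else 1.

Let setD11C T i j : T :\ i :\ j = T :\ j :\ i.
Proof. by apply/setP => l; rewrite !inE andbCA. Qed.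

Let sum_swap T (F : 'I_n -> 'I_n -> 'F_2) :
  \sum_(i in T) \sum_(j in T :\ i) F i j = \sum_(i in T) \sum_(j in T :\ i) F j i.
Proof.
rewrite (exchange_big_dep (mem T)) /=; last by move=> i j _; rewrite !inE => /andP[].
apply: eq_bigr => j jT; apply: eq_bigl => i; rewrite !inE jT andbT eq_sym; exact: andbC.
Qed.

Let sum_sym T (F : 'I_n -> 'I_n -> 'F_2) : (forall i j, F i j = F j i) ->
  \sum_(i in T) \sum_(j in T :\ i) F i j = 0.
Proof.
move=> FC.
have E i : i \in T -> \sum_(j in T :\ i) F i j =
    \sum_(j in T | (i < j)%N) F i j + \sum_(j in T | (j < i)%N) F i j.
  move=> iT; rewrite (bigID (fun j : 'I_n => (i < j)%N)) /=; congr (_ + _); apply: eq_bigl => j.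
    by rewrite !inE -val_eqE /=; case: (ltngtP i j) => //= _; rewrite ?andbF ?andbT.
  by rewrite !inE -val_eqE /=; case: (ltngtP i j) => //= _; rewrite ?andbF ?andbT.
rewrite (eq_bigr _ E) big_split /=.
rewrite [X in _ + X](exchange_big_dep (mem T)) /=; last by move=> i j _ /andP[].
rewrite -[RHS](addff (\sum_(i in T) \sum_(j in T | (i < j)%N) F i j)); congr (_ + _).
apply: eq_bigr => j jT; rewrite (eq_bigr (fun i => F j i)); last by move=> i _; exact: FC.
by apply: eq_bigl => i; rewrite jT.
Qed.

(** A cup product of coboundaries is a cocycle. After expansion over ordered pairs [i != j] of
    directions, the terms symmetric in [i] and [j] cancel mod 2 and the others are handled by the
    induction hypothesis. *)
Lemma cupB_closed d T x :
  \sum_(i in T) (cupB d (T :\ i) (shift x i) + cupB d (T :\ i) x) = 0.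
Proof.
elim: d T x => [|d IH] T x /=; first by rewrite big1// => i _; exact: addff.
pose V i j y := cupB d (T :\ i :\ j) y.
have VC i j y : V i j y = V j i y by rewrite /V setD11C.
transitivity (\sum_(i in T) \sum_(j in T :\ i) B d (shift (shift x i) j) * V i j (shift (shift x i) j)
  + \sum_(i in T) \sum_(j in T :\ i) B d (shift x i) * V i j (shift (shift x i) j)
  + \sum_(i in T) \sum_(j in T :\ i) B d (shift x j) * V i j (shift x j)
  + \sum_(i in T) \sum_(j in T :\ i) B d x * V i j (shift x j)).
  rewrite -!big_split; apply: eq_bigr => i _; rewrite -!big_split; apply: eq_bigr => j _ /=.
  by rewrite !mulrDl !addrA.
rewrite (sum_sym _ (F := fun i j => B d (shift (shift x i) j) * V i j (shift (shift x i) j))); last first.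
  by move=> i j /=; rewrite shiftC VC.
rewrite add0r (sum_swap T (fun i j => B d (shift x j) * V i j (shift x j))) -big_split /=.
rewrite [X in X + _]big1 ?add0r; last first.
  move=> i iT; rewrite -big_split; transitivity (B d (shift x i) * 0); last by rewrite mulr0.
  rewrite -[in RHS](IH (T :\ i) (shift x i)) big_distrr.
  by apply: eq_bigr => j _ /=; rewrite mulrDr; congr (_ + _ * _); exact: VC.
transitivity (B d x * \sum_(i in T) \sum_(j in T :\ i) V i j x); last first.
  by rewrite sum_sym ?mulr0// => i j; exact: VC.
rewrite big_distrr; apply: eq_bigr => i _ /=; rewrite -big_distrr; congr (_ * _) => /=.
apply/eqP; rewrite -subr_eq0 -sumrB; apply/eqP; rewrite -[RHS](IH (T :\ i) x).
by apply: eq_bigr => j _; rewrite (oppr_pchar2 (pchar_Fp (isT : prime 2))).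
Qed.

(** The lower cup product [c] is closed, so the product of the coboundary of [B d] with [c] is the
    coboundary of [B d * c]. *)
Lemma cupB_stokes d T x : cupB d.+1 T x =
  \sum_(i in T) (B d (shift x i) * cupB d (T :\ i) (shift x i) + B d x * cupB d (T :\ i) x).
Proof.
apply/eqP; rewrite -subr_eq0 /= -sumrB.
rewrite -[X in _ == X](mulr0 (B d x)) -[X in _ == _ * X](cupB_closed d T x) big_distrr; apply/eqP.
apply: eq_bigr => i _ /=; rewrite (oppr_pchar2 (pchar_Fp (isT : prime 2))).
rewrite mulrDl mulrDr.
set a := _ * _; set b := _ * _; set c := _ * _.
by rewrite addrACA addff add0r.
Qed.

Hypothesis B0 : forall i x, x i = 0%N -> B i x = 0.
Hypothesis B1 : forall i x, x i = M -> B i x = 1.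

(** On a cube that does not extend in the direction [i] and lies in one of the two faces orthogonal
    to it, [B i] is constant, so the factor it contributes is 0. *)
Lemma cupB_face d T x i : (i < d)%N -> i \notin T -> x i = 0%N \/ x i = M -> cupB d T x = 0.
Proof.
elim: d T x => //= d IH T x; rewrite ltnS leq_eqVlt => /orP[/eqP id|id] iT xi; apply: big1 => j jT.
  have ij : (i == j) = false by apply: contraNF iT => /eqP ->.
  have xj : shift x j i = x i by rewrite /shift ij addn0.
  rewrite -id; case: xi => xi; first by rewrite !B0 ?xj// addr0 mul0r.
  by rewrite !B1 ?xj// addff mul0r.
have ij : (i == j) = false by apply: contraNF iT => /eqP ->.
rewrite IH ?mulr0//; first by rewrite !inE negb_and iT orbT.
by rewrite /shift ij addn0.
Qed.

Hypothesis M0 : (0 < M)%N.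

Definition gpt (x : {ffun 'I_n -> 'I_M.+1}) : 'I_n -> nat := fun l => x l.

Let shift_ord i (x : {ffun 'I_n -> 'I_M.+1}) : {ffun 'I_n -> 'I_M.+1} :=
  [ffun l => if l == i then ordS (x l) else x l].
Let unshift_ord i (x : {ffun 'I_n -> 'I_M.+1}) : {ffun 'I_n -> 'I_M.+1} :=
  [ffun l => if l == i then ord_pred (x l) else x l].

(** Mod 2 the inner layers are counted twice, and only the two extreme layers in the direction [i]
    survive. *)
Lemma sum_telescope i (P : {ffun 'I_n -> 'I_M.+1} -> bool) (g : ('I_n -> nat) -> 'F_2) :
  (forall x x' : {ffun 'I_n -> 'I_M.+1}, (forall l, l != i -> x l = x' l) -> P x = P x') ->
  \sum_(x | P x && (x i != ord_max)) (g (shift (gpt x) i) + g (gpt x)) =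
  \sum_(x | P x && (x i == ord_max)) g (gpt x) + \sum_(x | P x && (x i == ord0)) g (gpt x).
Proof.
move=> Pi; rewrite big_split /=.
have ordS_inord (y : 'I_M.+1) : y != ord_max -> ordS y = y.+1 :> nat.
  move=> yM; rewrite /= modn_small// ltnS ltn_neqAle -ltnS ltn_ord andbT.
  by apply: contra yM => /eqP yM; apply/eqP/val_inj.
have ordS0 (y : 'I_M.+1) : (ordS y == ord0) = (y == ord_max).
  apply/idP/idP => [|/eqP ->]; last by rewrite -val_eqE /= modnn.
  by apply: contraTT => /ordS_inord e; rewrite -val_eqE /= -[(_ %% _)%N]/(nat_of_ord (ordS y)) e.
(* The cyclic successor in the coordinate [i] is a bijection of the grid that agrees with the shift
   off the last layer. *)
have -> : \sum_(x | P x && (x i != ord_max)) g (shift (gpt x) i) =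
    \sum_(x | P x && (x i != ord0)) g (gpt x).
  rewrite [RHS](reindex (shift_ord i)); last first.
    exists (unshift_ord i) => x _; apply/ffunP => l; rewrite !ffunE; case: eqP => // _.
      exact: ordSK.
    exact: ord_predK.
  apply: eq_big => x.
    rewrite (Pi (shift_ord i x) x); last by move=> l li; rewrite ffunE (negbTE li).
    by rewrite ffunE eqxx ordS0.
  move=> /andP[_ xM]; congr g; apply/funext => l; rewrite /shift /gpt ffunE.
  by case: eqP => [->|_]; rewrite ?addn0// ordS_inord// addn1.
have om : (ord0 : 'I_M.+1) != ord_max by rewrite -val_eqE /= eq_sym -lt0n.
have om' : (ord_max : 'I_M.+1) != ord0 by rewrite eq_sym.
rewrite [X in X + _](bigID (fun z : {ffun 'I_n -> 'I_M.+1} => z i == ord_max)) [X in _ + X](bigID (fun z : {ffun 'I_n -> 'I_M.+1} => z i == ord0)) /=.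
rewrite [X in (X + _) + _](eq_bigl (fun z : {ffun 'I_n -> 'I_M.+1} => P z && (z i == ord_max))); last first.
  move=> x /=; rewrite -andbA; case: (P x) => //=; by case: eqVneq => [->|_]; rewrite ?andbT ?andbF ?(negbTE om) ?(negbTE om').
rewrite [X in _ + (X + _)](eq_bigl (fun z : {ffun 'I_n -> 'I_M.+1} => P z && (z i == ord0))); last first.
  move=> x /=; rewrite -andbA; case: (P x) => //=; by case: eqVneq => [->|_]; rewrite ?andbT ?andbF ?(negbTE om) ?(negbTE om').
rewrite [X in _ + (_ + X)](eq_bigl (fun z : {ffun 'I_n -> 'I_M.+1} => (P z && (z i != ord0)) && (z i != ord_max))); last first.
  by move=> x /=; rewrite andbAC.
by rewrite addrACA addff addr0.
Qed.

(** Base points of the [d]-dimensional cubes in the face where the coordinates from [d] on are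
    maximal; the inequality leaves room for a shift. *)
Definition gface d (x : {ffun 'I_n -> 'I_M.+1}) :=
  [forall l : 'I_n, if (l < d)%N then x l != ord_max else x l == ord_max].

Definition ltset d : {set 'I_n} := [set i : 'I_n | (i < d)%N].

(** By Stokes the sum reduces to the extreme layers. Those in the directions [i < d] vanish by
    [cupB_face]; in the direction [d] the layer at 0 is killed by [B d = 0], and at the opposite one
    [B d = 1] leaves the sum for one dimension less. *)
Lemma cupB_sum d : (d <= n)%N -> \sum_(x | gface d x) cupB d (ltset d) (gpt x) = 1.
Proof.
elim: d => [|d IH] dn.
  rewrite (big_pred1 [ffun=> ord_max])//= => x; apply/forallP/eqP => [h|-> l].
    by apply/ffunP => l; rewrite ffunE; apply/eqP; exact: h.
  by rewrite ffunE.
rewrite -(IH (ltnW dn)); under eq_bigr do rewrite cupB_stokes.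
rewrite exchange_big /=.
pose P (i : 'I_n) (x : {ffun 'I_n -> 'I_M.+1}) :=
  [forall l : 'I_n, (l != i) ==> (if (l < d.+1)%N then x l != ord_max else x l == ord_max)].
have PE i (x : {ffun 'I_n -> 'I_M.+1}) : i \in ltset d.+1 -> gface d.+1 x = P i x && (x i != ord_max).
  rewrite inE => id; apply/forallP/andP => [h|[/forallP h xi] l].
    by split; [apply/forallP => l; rewrite h implybT|have := h i; rewrite id].
  by have := h l; case: eqP => [->|//]; rewrite id.
have PP i (x x' : {ffun 'I_n -> 'I_M.+1}) : (forall l, l != i -> x l = x' l) -> P i x = P i x'.
  move=> xx'; apply: eq_forallb => l; case: (eqVneq l i) => //= li; rewrite xx'//.
pose od := Ordinal dn.
rewrite (bigD1 od) ?inE//= [X in _ + X]big1 ?addr0; last first.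
  move=> i /andP[iT iod]; rewrite (eq_bigl _ _ (fun z => PE i z iT)).
  pose g x := B d x * cupB d (ltset d.+1 :\ i) x.
  rewrite (@sum_telescope i (P i) g (PP i)) !big1 ?addr0// => x /andP[_ /eqP xi].
    rewrite /g (@cupB_face _ _ _ i) ?mulr0//.
    - by move: iT iod; rewrite inE ltnS leq_eqVlt -val_eqE /= => /orP[->|].
    - by rewrite !inE eqxx.
    - by left; rewrite /gpt xi.
  rewrite /g (@cupB_face _ _ _ i) ?mulr0//.
  - by move: iT iod; rewrite inE ltnS leq_eqVlt -val_eqE /= => /orP[->|].
  - by rewrite !inE eqxx.
  - by right; rewrite /gpt xi.
have odT : od \in ltset d.+1 by rewrite inE.
have TE : ltset d.+1 :\ od = ltset d.
  apply/setP => l; rewrite !inE -val_eqE /= ltnS [RHS]ltn_neqAle; exact: erefl.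
rewrite (eq_bigl _ _ (fun z => PE od z odT)) TE.
pose g x := B d x * cupB d (ltset d) x.
rewrite (@sum_telescope od (P od) g (PP od)) [X in _ + X]big1 ?addr0; last first.
  by move=> x /andP[_ /eqP xi]; rewrite /g (@B0 od) ?mul0r// /gpt xi.
apply: eq_big => x; last by move=> /andP[_ /eqP xi]; rewrite /g (@B1 od) ?mul1r// /gpt xi.
apply/andP/forallP => [[/forallP h xi] l|h].
  have := h l; case: eqP => [->|/eqP/=]; first by rewrite /= ltnn.
  by rewrite -val_eqE /= ltnS leq_eqVlt => /negbTE ->.
split; last by have := h od; rewrite /= ltnn.
apply/forallP => l; apply/implyP => lod; have := h l.
by move: lod; rewrite -val_eqE /= ltnS [(l <= d)%N]leq_eqVlt => /negbTE ->.
Qed.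

(** A nonzero product has a term all of whose factors are nonzero, and a nonzero factor is a change
    of [B k] along an edge of the cube. *)
Lemma cupB_neq0 d T x : cupB d T x != 0 -> forall k, (k < d)%N ->
  exists y z, [/\ forall l, (x l <= y l <= x l + (l \in T))%N,
    forall l, (x l <= z l <= x l + (l \in T))%N & B k y != B k z].
Proof.
elim: d T x => //= d IH T x V0.
have [j jT] : exists2 j, j \in T & (B d (shift x j) + B d x) * cupB d (T :\ j) (shift x j) != 0.
  apply/exists_inP; apply: contraNT V0 => /exists_inPn h; rewrite big1// => j jT.
  by have := h j jT; rewrite negbK => /eqP.
rewrite mulf_eq0 negb_or => /andP[Bj Vj] k; rewrite ltnS leq_eqVlt => /orP[/eqP ->|kd].
  exists (shift x j), x; split => [l|l|].
  - by rewrite /shift leq_addr leq_add2l; case: eqP => // ->; rewrite jT.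
  - by rewrite leqnn leq_addr.
  - by apply: contra Bj => /eqP ->; rewrite addff.
have [y [z [h1 h2 h3]]] := IH _ _ Vj k kd; exists y, z.
have H w : (forall l, (shift x j l <= w l <= shift x j l + (l \in T :\ j))%N) ->
    forall l, (x l <= w l <= x l + (l \in T))%N.
  move=> hw l; have /andP[a b] := hw l; apply/andP; split.
    by apply: leq_trans a; exact: leq_addr.
  apply: leq_trans b _; rewrite /shift !inE -addnA leq_add2l.
  by case: eqP => [->|_] /=; rewrite ?jT.
by split => //; exact: H.
Qed.

(* Otherwise the cup product would vanish on every cube, whereas by Stokes its sum
   over the grid is determined by the boundary values and equals 1. *)
Lemma sign_change_cube : exists x : 'I_n -> nat, (forall l, (x l < M)%N) /\ forall k : 'I_n,
  exists y z, [/\ forall l, (x l <= y l <= (x l).+1)%N,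
    forall l, (x l <= z l <= (x l).+1)%N & B k y != B k z].
Proof.
have : \sum_(x | gface n x) cupB n (ltset n) (gpt x) != 0 by rewrite cupB_sum ?oner_neq0.
move=> S0; have [x xf V0] : exists2 x, gface n x & cupB n (ltset n) (gpt x) != 0.
  apply/exists_inP; apply: contraNT S0 => /exists_inPn h; rewrite big1// => j jT.
  by have := h j jT; rewrite negbK => /eqP.
exists (gpt x); split => [l|k].
  have /forallP/(_ l) := xf; rewrite ltn_ord => xl; rewrite /gpt ltn_neqAle -ltnS ltn_ord andbT.
  by apply: contra xl => /eqP e; apply/eqP/val_inj.
have [y [z [h1 h2 h3]]] := cupB_neq0 V0 (ltn_ord k); exists y, z; split=> // l.
  by have := h1 l; rewrite inE ltn_ord addn1.
by have := h2 l; rewrite inE ltn_ord addn1.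
Qed.

End cup.

(** * Uniformity on compact sets *)

Section compact.
Context (R : realType) (n : nat).
Implicit Types (x y p : 'rV[R]_n) (K : set 'rV[R]_n).

Lemma lebesgue_number K (rho : 'rV[R]_n -> R) : compact K -> (forall x, K x -> 0 < rho x) ->
  exists2 d : R, 0 < d & forall p, K p -> exists2 x, K x & forall y, `|y - p| < d -> `|y - x| < rho x.
Proof.
move=> cK r0.
pose P (d : R) p := exists2 x, K x & forall y, `|y - p| < d -> `|y - x| < rho x.
have nc : near_covering K by rewrite -compact_near_coveringP.
have /nc : forall x, K x -> \forall x' \near x & d \near (0:R)^'+, P d x'.
  move=> x Kx; have e20 : 0 < rho x / 2 by rewrite divr_gt0// r0.
  exists (ball x (rho x / 2), [set d | d < rho x / 2]); first split => /=.
  - exact: nbhsx_ballx.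
  - exact: nbhs_right_lt.
  move=> [x' d] /= [xx' de]; exists x => // y yx'.
  rewrite -ball_normE /ball_ /= in xx'.
  have := ler_normD (y - x') (x' - x); rewrite addrA subrK => h.
  apply: le_lt_trans h _.
  by rewrite [ltRHS]splitr ltrD// ?(lt_trans yx')// distrC.
move=> H.
have : \forall d \near (0 : R)^'+, 0 < d /\ K `<=` P d.
  by apply: filterI => //; exact: nbhs_right_gt.
by move=> /filter_ex[d [d0 Hd]]; exists d.
Qed.

Definition cont_on m K (h : 'rV[R]_n -> 'rV[R]_m) := forall x, K x -> forall e : R, 0 < e ->
  exists2 d : R, 0 < d & forall y, K y -> `|y - x| < d -> `|h y - h x| < e.

Lemma within_cont_on m K (h : 'rV[R]_n -> 'rV[R]_m) : {within K, continuous h} -> cont_on K h.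
Proof.
move=> /subspace_continuousP ch x Kx e e0; have /cvgrPdist_lt/(_ e e0) := ch x Kx.
move=> /nbhs_ballP[d d0 H]; exists d => // y Ky yx; rewrite distrC; apply: H => //.
by rewrite -ball_normE /ball_ /= distrC.
Qed.

Lemma cont_on_within m K (h : 'rV[R]_n -> 'rV[R]_m) : cont_on K h -> {within K, continuous h}.
Proof.
move=> ch; apply/subspace_continuousP => x Kx; apply/cvgrPdist_lt => e e0.
have [d d0 H] := ch x Kx e e0; apply/nbhs_ballP; exists d => // y.
by rewrite -ball_normE /ball_ /= distrC => yx Ky; rewrite distrC; exact: H.
Qed.

Lemma cont_on_unif m K (h : 'rV[R]_n -> 'rV[R]_m) (e : R) : compact K -> cont_on K h -> 0 < e ->
  exists2 d : R, 0 < d & forall x y, K x -> K y -> `|y - x| < d -> `|h y - h x| < e.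
Proof.
move=> cK ch e0; have e20 : 0 < e / 2 by rewrite divr_gt0.
have /choice[rho rhoP] : forall x, exists r : R, K x -> 0 < r /\
    forall y, K y -> `|y - x| < r -> `|h y - h x| < e / 2.
  move=> x; have [Kx|nK] := pselect (K x); last by exists 0.
  by have [d d0 H] := ch x Kx _ e20; exists d.
have [|d d0 H] := @lebesgue_number K rho cK; first by move=> x /rhoP[].
exists d => // x y Kx Ky xy; have [x0 Kx0 Hx0] := H _ Kx.
have [_ H1] := rhoP _ Kx0.
have h1 := H1 _ Ky (Hx0 _ xy).
have h2 : `|h x - h x0| < e / 2 by apply: H1 => //; apply: Hx0; rewrite subrr normr0.
have -> : h y - h x = (h y - h x0) - (h x - h x0) by rewrite opprB addrA subrK.
by rewrite (le_lt_trans (ler_normB _ _))// [ltRHS]splitr ltrD.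
Qed.

Lemma cont_on_min m K (h : 'rV[R]_n -> 'rV[R]_m) : compact K -> cont_on K h ->
  (forall x, K x -> h x != 0) -> exists2 d : R, 0 < d & forall x, K x -> d <= `|h x|.
Proof.
move=> cK ch h0.
pose P (d : R) p := K p -> d <= `|h p|.
have nc : near_covering K by rewrite -compact_near_coveringP.
have /nc : forall x, K x -> \forall x' \near x & d \near (0:R)^'+, P d x'.
  move=> x Kx; have e20 : 0 < `|h x| / 2 by rewrite divr_gt0// normr_gt0 h0.
  have [r r0 H] := ch x Kx _ e20.
  exists (ball x r, [set d | d < `|h x| / 2]); first split => /=.
  - exact: nbhsx_ballx.
  - exact: nbhs_right_lt.
  move=> [y d] /= [xy de] Ky.
  rewrite -ball_normE /ball_ /= distrC in xy.
  have h1 := H y Ky xy; have := ler_normB (h y) (h y - h x); rewrite subKr => h2.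
  lra.
move=> H.
have : \forall d \near (0 : R)^'+, 0 < d /\ K `<=` P d.
  by apply: filterI => //; exact: nbhs_right_gt.
by move=> /filter_ex[d [d0 Hd]]; exists d => // x Kx; exact: Hd.
Qed.

End compact.

(** * The Poincare-Miranda theorem *)

Section miranda.
Context (R : realType) (n : nat) (phi : 'rV[R]_n -> 'rV[R]_n).
Local Notation Q := (@rcube R n 0 1).
Hypothesis cphi : cont_on Q phi.

(** Without a zero, some component keeps a strict sign near each point, and a Lebesgue number makes
    this hold on every cube of a fine grid. The cube of [sign_change_cube], on which all components
    change sign, is then impossible. *)
Lemma miranda : (forall x k, Q x -> x ord0 k = -1 -> phi x ord0 k <= 0) ->
  (forall x k, Q x -> x ord0 k = 1 -> 0 <= phi x ord0 k) ->
  exists2 x, Q x & phi x = 0.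
Proof.
move=> phiN phiP; apply: contrapT => nophi.
have phi0 x : Q x -> exists k, phi x ord0 k != 0.
  move=> Qx; apply: contrapT => h; apply: nophi; exists x => //; apply/rowP => k; rewrite mxE.
  by apply/eqP; apply: contrapT => /negP h'; apply: h; exists k.
have /choice[rho rhoP] : forall x, exists r : R, Q x -> 0 < r /\ exists2 k, phi x ord0 k != 0 &
    forall y, Q y -> `|y - x| < r -> `|phi y ord0 k - phi x ord0 k| < `|phi x ord0 k|.
  move=> x; have [Qx|nQ] := pselect (Q x); last by exists 0.
  have [k pk] := phi0 _ Qx; have pk0 : 0 < `|phi x ord0 k| by rewrite normr_gt0.
  have [d d0 H] := cphi Qx pk0; exists d => _; split => //; exists k => // y Qy yx.
  apply: le_lt_trans (H _ Qy yx); have := ler_coord_norm (phi y - phi x) k.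
  by rewrite !mxE.
have [|d d0 Hd] := lebesgue_number (@compact_rcube R n 0 1) (rho := rho).
  by move=> x /rhoP[].
have d20 : 0 < d / 2 by rewrite divr_gt0.
have [M Md] : exists M : nat, M.+1%:R^-1 < d / 2.
  by have := near_infty_natSinv_lt (PosNum d20); move/filter_ex.
pose pt (x : 'I_n -> nat) : 'rV[R]_n := \row_l (-1 + 2 * ((x l)%:R / M.+1%:R)).
have ptQ x : (forall l, (x l <= M.+1)%N) -> Q (pt x).
  move=> xM; apply/rcubeP => //; rewrite subr0; apply: norm_rV_le => // l; rewrite mxE.
  have : 0 <= ((x l)%:R / M.+1%:R : R) <= 1.
    by rewrite divr_ge0//= ler_pdivrMr// mul1r ler_nat.
  by set a := _ / _ => /andP[a0 a1]; rewrite ler_norml; apply/andP; split; lra.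
have pt0 x l : x l = 0%N -> pt x ord0 l = -1 by move=> xl; rewrite mxE xl mul0r mulr0 addr0.
have pt1 x l : x l = M.+1 -> pt x ord0 l = 1.
  by move=> xl; rewrite mxE xl divff//; lra.
have ptd x y : (forall l, (x l <= y l <= (x l).+1)%N) -> `|pt y - pt x| < d.
  move=> xy; apply: norm_rV_lt => // l; rewrite !mxE.
  have [->|->] : y l = x l \/ y l = (x l).+1.
    by have := xy l; rewrite leq_eqVlt => /andP[/orP[/eqP ->|h1] h2]; [left|right; apply/eqP; rewrite eqn_leq h2].
    by rewrite subrr normr0.
  have -> : (x l).+1%:R / M.+1%:R = (x l)%:R / M.+1%:R + M.+1%:R^-1 :> R by rewrite -natr1 mulrDl mul1r.
  move: Md; set a := _ / _; set b := _^-1 => bd.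
  have b0 : 0 < b by rewrite invr_gt0.
  by rewrite ltr_norml; apply/andP; split; lra.
(* The sign of the [i]-th component, with its values on the two faces orthogonal to [i] prescribed.
   By the boundary hypotheses this agrees with the true sign wherever the component is nonzero. *)
pose B (i : nat) (x : 'I_n -> nat) : 'F_2 :=
  if insub i is Some k then ((x k == M.+1) || ((x k != 0%N) && (0 < phi (pt x) ord0 k)))%:R else 0.
have BE (k : 'I_n) x : B k x = ((x k == M.+1) || ((x k != 0%N) && (0 < phi (pt x) ord0 k)))%:R.
  by rewrite /B valK.
have [||//|x [xM H]] := @sign_change_cube n M.+1 B.
- by move=> i x xi; rewrite BE xi.
- by move=> i x xi; rewrite BE xi eqxx.
have [x0 Qx0 Hx0] := Hd _ (ptQ x (fun l => ltnW (xM l))).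
have [_ [k pk Hk]] := rhoP _ Qx0.
have [y [z [xy xz]]] := H k; rewrite !BE.
have S w : (forall l, (x l <= w l <= (x l).+1)%N) ->
    ((w k == M.+1) || ((w k != 0%N) && (0 < phi (pt w) ord0 k))) = (0 < phi x0 ord0 k).
  move=> xw.
  have Qw : Q (pt w) by apply: ptQ => l; have /andP[_ h] := xw l; exact: leq_trans h (xM l).
  have := Hk _ Qw (Hx0 _ (ptd _ _ xw)); rewrite ltr_norml => /andP[h1 h2].
  have [pos|neg|e] := ltgtP (phi x0 ord0 k) 0; last by rewrite e eqxx in pk.
    rewrite ltr0_norm// in h1 h2; have pw : phi (pt w) ord0 k < 0 by lra.
    have [wM|_] := eqVneq (w k) M.+1; last by rewrite ltNge (ltW pw) andbF.
    by have := phiP _ _ Qw (pt1 _ _ wM); rewrite leNgt pw.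
  rewrite gtr0_norm// in h1 h2; have pw : 0 < phi (pt w) ord0 k by lra.
  rewrite pw andbT; have [w0|_] := eqVneq (w k) 0%N; last by rewrite orbT.
  by have := phiN _ _ Qw (pt0 _ _ w0); rewrite leNgt pw.
by rewrite !S// eqxx.
Qed.

Lemma zero_stability : (forall x, Q x -> `|phi x - x| <= 1) -> exists2 x, Q x & phi x = 0.
Proof.
move=> H; apply: miranda => x k Qx xk; have := le_trans (ler_coord_norm (phi x - x) k) (H x Qx);
  rewrite !mxE xk ler_norml => /andP[h1 h2]; lra.
Qed.

End miranda.

Lemma radial_continuous (R : realType) n (c y : 'rV[R]_n) (ep : R) : 0 < `|y - c| ->
  {for y, continuous (fun y : 'rV[R]_n => c + Num.max 1 (ep / `|y - c|) *: (y - c))}.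
Proof.
move=> yc.
have cB : {for y, continuous (fun y : 'rV[R]_n => y - c)}.
  by apply: continuousB; [exact: cvg_id|exact: cst_continuous].
have cm : {for y, continuous (fun y : 'rV[R]_n => Num.max 1 (ep / `|y - c|) : R)}.
  apply: continuous_max; first exact: cst_continuous.
  apply: continuousM; first exact: cst_continuous.
  apply: continuousV; first by rewrite gt_eqF.
  by apply: (continuous_comp cB); exact: norm_continuous.
have cZ := continuousZ cm cB.
apply: continuousD; first exact: cst_continuous.
exact: cZ.
Qed.

(** * Openness of the image *)

Section invariance.
Context (R : realType) (n : nat).
Local Notation Q := (@rcube R n 0 1).

(** A sphere of the sup norm lies in [2 n] faces, which are boxes with one degenerate side. *)
Lemma negligible_sphere (c : 'rV[R]_n) (e : R) : 0 < e ->
  (leb (n:=n)).-negligible [set y | `|y - c| = e].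
Proof.
move=> e0.
pose I (s : bool * 'I_n) (l : 'I_n) : set R :=
  if l == s.2 then [set c ord0 l + (if s.1 then e else - e)]%R
  else `[c ord0 l - e, c ord0 l + e]%classic.
have mI s l : measurable (I s l : set (measurableTypeR R)).
  by rewrite /I; case: ifP => _; [exact: measurable_set1|exact: measurable_itv].
have I0 s : {ae leb (n:=n), forall x, ~ rbox (I s) x}.
  exists (rbox (I s)); split; first by apply: measurable_rbox => l; exact: mI.
    rewrite [LHS]leb_rbox; last exact: mI.
    by rewrite (bigD1 s.2)//= /I eqxx lebesgue_measure_set1 mul0e.
  by move=> x /= /contrapT.
have := ae_forall_count I0.
apply: negligibleS => y /= yc H.
have le l : `|y ord0 l - c ord0 l| <= e.
  by rewrite -yc; have := ler_coord_norm (y - c) l; rewrite !mxE.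
have [i yi] : exists i, `|y ord0 i - c ord0 i| = e.
  apply: contrapT => /forallNP h; have : `|y - c| < e.
    apply: norm_rV_lt => // l; rewrite lt_neqAle !mxE le andbT; apply/eqP; exact: h.
  by rewrite yc ltxx.
pose s := (0 <= y ord0 i - c ord0 i, i).
apply: (H s) => l; rewrite /I /=; case: eqVneq => [->|_].
  rewrite /s /= -yi; have [p|p] := leP 0 (y ord0 i - c ord0 i).
    by rewrite ger0_norm//= addrC subrK.
  by rewrite ltr0_norm//= opprK addrC subrK.
by rewrite /= in_itv/= -ler_distl.
Qed.

Lemma clamp_lip (c c' I I' e : R) : c <= c' + e -> c' <= c + e -> I <= I' + e -> I' <= I + e ->
  `|Num.max (- c) (Num.min c I) - Num.max (- c') (Num.min c' I')| <= e.
Proof.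
move=> h1 h2 h3 h4; rewrite ler_norml.
have [a|a] := leP c I; have [b|b] := leP c' I'; have [p|p] := leP (- c) _; have [q|q] := leP (- c') _;
  apply/andP; split; lra.
Qed.

Lemma clamp_approx (c I g d : R) : `|g| <= c -> g - d <= I -> I <= g -> 0 <= d ->
  `|Num.max (- c) (Num.min c I) - g| <= d.
Proof.
rewrite ler_norml => /andP[h1 h2] h3 h4 d0; rewrite ler_norml.
have [a|a] := leP c I; have [p|p] := leP (- c) _; apply/andP; split; lra.
Qed.

Lemma clamp_le (c I : R) : 0 <= c -> `|Num.max (- c) (Num.min c I)| <= c.
Proof.
move=> c0; rewrite ler_norml le_max lexx /= ge_max ge_min lexx andbT; lra.
Qed.

Lemma cont_on_comp m p (K : set 'rV[R]_n) (F : 'rV[R]_n -> 'rV[R]_m) (h : 'rV[R]_m -> 'rV[R]_p) :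
  cont_on K F -> (forall x, K x -> {for F x, continuous h}) -> cont_on K (h \o F).
Proof.
move=> cF ch x Kx e e0; have /cvgrPdist_lt/(_ e e0)/nbhs_ballP[d d0 H] := ch x Kx.
have [r r0 Hr] := cF x Kx d d0; exists r => // y Ky yx.
rewrite distrC; apply: H; rewrite -ball_normE /ball_ /= distrC; exact: Hr.
Qed.

Section mcshane.
Variables (K : set 'rV[R]_n) (u : 'rV[R]_n -> R) (la : R).
Hypothesis la0 : 0 <= la.
Hypothesis K0 : K !=set0.
Hypothesis u1 : forall z, K z -> `|u z| <= 1.

Let vals y := [set u z + la * `|y - z| | z in K].
(** The inf-convolution of [u] with [la * |.|], that is, the largest [la]-Lipschitz function below
    [u] on [K]. *)
Definition infconv y := inf (vals y).

Let infv y : has_inf (vals y).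
Proof.
split; first by have [z Kz] := K0; exists (u z + la * `|y - z|), z.
exists (-1) => _ [z Kz <-]; have := u1 Kz; rewrite ler_norml => /andP[h _].
by rewrite (le_trans h)// lerDl mulr_ge0.
Qed.

Lemma infconv_le y z : K z -> infconv y <= u z + la * `|y - z|.
Proof. by move=> Kz; apply: ge_inf; [have [_] := infv y|exists z]. Qed.

Lemma infconv_ge y a : (forall z, K z -> a <= u z + la * `|y - z|) -> a <= infconv y.
Proof. by move=> h; apply: lb_le_inf; [have [] := infv y|move=> _ [z Kz <-]; exact: h]. Qed.

Lemma infconv_lip y y' : infconv y <= infconv y' + la * `|y - y'|.
Proof.
rewrite -lerBlDr; apply: infconv_ge => z Kz; rewrite lerBlDr -addrA -mulrDr.
apply: le_trans (infconv_le y Kz) _; rewrite lerD2l ler_wpM2l// [leRHS]addrC.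
by have := ler_normD (y - y') (y' - z); rewrite addrA subrK.
Qed.

End mcshane.

Lemma lip_continuous m (h : 'rV[R]_n -> 'rV[R]_m) (L : R) : 0 <= L ->
  (forall y y', `|h y - h y'| <= L * `|y - y'|) -> continuous h.
Proof.
move=> L0 hL; have ch : cont_on setT h.
  move=> x _ e e0; have L10 : 0 < L + 1 by rewrite ltr_wpDl.
  exists (e / (L + 1)) => [|y _ yx]; first by rewrite divr_gt0.
  apply: le_lt_trans (hL _ _) _; apply: (@le_lt_trans _ _ ((L + 1) * `|y - x|)).
    by rewrite ler_wpM2r// lerDl.
  by rewrite mulrC -ltr_pdivlMr.
by apply/continuous_subspace_setT; exact: cont_on_within.
Qed.

(* If [c] near [F 0] is not in the image, push the image radially out of a small
   ball around [c] and follow it by a Lipschitz approximation of [G], shifted by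
   a small vector outside of the null image of the sphere: the composite is
   uniformly close to the identity and has no zero. *)
Lemma image_contains_ball (F G : 'rV[R]_n -> 'rV[R]_n) : cont_on Q F -> compact (F @` Q) -> cont_on (F @` Q) G ->
  (forall x, Q x -> G (F x) = x) ->
  exists2 e : R, 0 < e & forall c, `|c - F 0| < e -> (F @` Q) c.
Proof.
move=> cF cK cG GF; set K := F @` Q; set y0 := F 0.
have Q0 : Q 0 by apply/rcubeP; rewrite // subr0 normr0.
have Ky0 : K y0 by exists 0.
have Gy0 : G y0 = 0 by rewrite GF.
have G1 y : K y -> `|G y| <= 1.
  by move=> [x Qx <-]; rewrite GF//; move/rcubeP : Qx; rewrite subr0; apply.
have Gi1 i y : K y -> `|G y ord0 i| <= 1.
  by move=> Ky; apply: le_trans (G1 y Ky); exact: ler_coord_norm.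
have e80 : 0 < 8^-1 :> R by [].
have [rho rho0 Hrho] := cG _ Ky0 _ e80; rewrite Gy0 in Hrho.
(* Points pushed out of the ball around [c] stay within [2 ep = rho / 8] of [y0], where the
   truncation level [cc] below is at most 1/4. *)
pose ep := rho / 16; have ep0 : 0 < ep by rewrite divr_gt0.
exists ep => // c cy0; apply: contrapT => nKc.
pose K1 := K `&` [set y | ep <= `|y - c|].
have cK1 : compact K1.
  apply: compact_closedI => //.
  rewrite (_ : [set y | _] = ~` [set y | `|y - c| < ep]).
    by apply: open_closedC; exact: open_norm_lt.
  by apply/seteqP; split => y /=; rewrite leNgt => /negP.
have cGK1 : cont_on K1 G.
  move=> y [Ky _] e e0; have [d d0 H] := cG y Ky e e0.
  by exists d => // z [Kz _]; exact: H.
have [d0 d00 Hd0] : exists2 d : R, 0 < d & forall x, K1 x -> d <= `|G x|.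
  apply: cont_on_min => // _ [[x Qx <-] /= xc]; rewrite GF//.
  by apply: contraTneq xc => ->; rewrite -ltNge distrC.
(* On [K1] the approximation [P] differs from [G] by at most [de], and [|G| >= d0 > 2 de]; so [P]
   cannot take there a value [v] with [|v| <= de]. *)
pose de := Num.min d0 1 / 8.
have m0 : 0 < Num.min d0 1 by rewrite lt_min d00 ltr01.
have de0 : 0 < de by rewrite divr_gt0.
have ded0 : de + de < d0.
  have : Num.min d0 1 <= d0 by rewrite ge_min lexx.
  by rewrite /de; move: m0; move: (Num.min d0 1) => m; lra.
have de1 : de <= 8^-1.
  have : Num.min d0 1 <= 1 by rewrite ge_min lexx orbT.
  by rewrite /de; move: m0; move: (Num.min d0 1) => m; lra.
have [et et0 Het] := cont_on_unif cK cG de0.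
(* Beyond distance [et] the penalty is at least 2, the largest possible difference between values of
   a component of [G] on [K]; closer than [et], [G] varies by less than [de]. *)
pose la := 2 / et; have la0 : 0 <= la by rewrite divr_ge0// ltW.
have Kn : K !=set0 by exists y0.
pose I i := infconv K (fun z => G z ord0 i) la.
(* On [K] this level is at least [|G|], so the truncation does no harm there. Near [y0] it is small
   also off [K], where the inf-convolution is not close to [G]. *)
pose cc y := 8^-1 + `|y - y0| / rho.
have cc0 y : 0 <= cc y by rewrite addr_ge0// divr_ge0// ltW.
pose P y : 'rV[R]_n := \row_i Num.max (- cc y) (Num.min (cc y) (I i y)).
pose L := la + rho^-1.
have L0 : 0 <= L by rewrite addr_ge0// invr_ge0 ltW.
have PL y y' : `|P y - P y'| <= L * `|y - y'|.
  have cL z z' : cc z <= cc z' + L * `|z - z'|.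
    rewrite /cc -addrA lerD2l /L mulrDl addrA [X in _ <= X + _]addrC -addrA.
    have h : `|z - y0| / rho <= `|z' - y0| / rho + rho^-1 * `|z - z'|.
      rewrite [rho^-1 * _]mulrC -mulrDl ler_wpM2r ?invr_ge0 ?(ltW rho0)//.
      by have := ler_normD (z - z') (z' - y0); rewrite addrA subrK [leRHS]addrC.
    by apply: le_trans h _; rewrite lerDr mulr_ge0.
  have IL i z z' : I i z <= I i z' + L * `|z - z'|.
    apply: le_trans (infconv_lip la0 Kn (Gi1 i) z z') _.
    by rewrite lerD2l ler_wpM2r// /L lerDl invr_ge0 ltW.
  apply: norm_rV_le => [|i]; first by rewrite mulr_ge0.
  by rewrite !mxE; apply: clamp_lip; rewrite // distrC.
have PG y i : K y -> `|P y ord0 i - G y ord0 i| <= de.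
  move=> Ky; rewrite mxE; apply: clamp_approx; last exact: ltW.
  - have [yr|yr] := ltP `|y - y0| rho.
      have := Hrho _ Ky yr; rewrite subr0 => h.
      rewrite (le_trans (ler_coord_norm _ _))// (le_trans (ltW h))// lerDl divr_ge0// ltW//.
    apply: le_trans (Gi1 i y Ky) _; rewrite /cc ler_wpDl// ler_pdivlMr// mul1r//.
  - apply: (infconv_ge la0 Kn (Gi1 i)) => z Kz.
    have [yz|yz] := ltP `|y - z| et.
      have := Het _ _ Kz Ky yz => h.
      have := le_lt_trans (ler_coord_norm _ i) h; rewrite !mxE ltr_norml => /andP[h1 h2].
      have : 0 <= la * `|y - z| by rewrite mulr_ge0.
      by move: h1 h2; move: (la * _) (G y ord0 i) (G z ord0 i) => *; lra.
    have h : 2 <= la * `|y - z| by rewrite /la mulrAC ler_pdivlMr// ler_wpM2l.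
    have := Gi1 i y Ky; have := Gi1 i z Kz; rewrite !ler_norml => /andP[h1 _] /andP[_ h2].
    by move: h h1 h2; clear -de0; move: (la * _) (G y ord0 i) (G z ord0 i) => *; lra.
  - have := infconv_le la0 Kn (Gi1 i) y Ky; rewrite subrr normr0 mulr0 addr0; exact.
pose S := [set y : 'rV[R]_n | `|y - c| = ep].
have nS : (leb (n:=n)).-negligible S by exact: negligible_sphere.
have nPS : (leb (n:=n)).-negligible (P @` S) by apply: negligible_lip_image L0 _ => // x y _ _; exact: PL.
have [v v1 v2] : exists2 v : 'rV[R]_n, `|v| <= de & ~ (P @` S) v.
  apply: contrapT => h; have sub : rcube 0 de `<=` P @` S.
    move=> v /rcubeP; rewrite subr0 => /(_ (ltW de0)) vd; apply: contrapT => nv.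
    by apply: h; exists v.
  have [A [mA A0 PA]] := nPS.
  have : (leb (@rcube R n 0 de) <= leb A)%E.
    by apply: le_meas => //; [exact: measurable_rcube|exact: subset_trans PA].
  rewrite [leRHS]A0 leb_rcube ?(ltW de0)// lee_fin leNgt exprn_gt0// mulrn_wgt0//.
clear nS nPS.
have Kc y : K y -> 0 < `|y - c|.
  by move=> Ky; rewrite normr_gt0 subr_eq0; apply: contra_notN nKc => /eqP <-.
pose Phi (y : 'rV[R]_n) := c + Num.max 1 (ep / `|y - c|) *: (y - c).
have PhiE y : ep <= `|y - c| -> Phi y = y.
  move=> yc; rewrite /Phi; have -> : Num.max 1 (ep / `|y - c|) = 1.
    by apply/max_idPl; rewrite ler_pdivrMr ?mul1r//; exact: lt_le_trans ep0 yc.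
  by rewrite scale1r addrC subrK.
have PhiS y : K y -> `|y - c| < ep -> `|Phi y - c| = ep.
  move=> /Kc yc0 yc; rewrite /Phi addrC addKr.
  have -> : Num.max 1 (ep / `|y - c|) = ep / `|y - c|.
    by apply/max_idPr; rewrite ler_pdivlMr// mul1r ltW.
  have q0 : 0 <= ep / `|y - c| by rewrite divr_ge0// ltW.
  by rewrite normrZ (ger0_norm q0) divfK// gt_eqF.
have cP : continuous P.
  exact: lip_continuous L0 PL.
pose phi x := P (Phi (F x)) - v.
have cphi : cont_on Q phi.
  apply: (@cont_on_comp n n Q F (fun y => P (Phi y) - v) cF) => x Qx.
  have FK : K (F x) by exists x.
  have cPhi : {for F x, continuous Phi} by exact: radial_continuous (Kc _ FK).
  apply: continuousB; last exact: cst_continuous.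
  exact: (continuous_comp cPhi (cP _)).
have vi i : `|v ord0 i| <= de by apply: le_trans v1; exact: ler_coord_norm.
have [|x Qx] := zero_stability cphi.
  move=> x Qx; have Ky : K (F x) by exists x.
  apply: norm_rV_le => // i; rewrite !mxE.
  have [yc|yc] := leP ep `|F x - c|.
    have := PG _ i Ky; rewrite GF// !mxE PhiE// => h1; have h2 := vi i.
    by move: h1 h2; rewrite !ler_norml => /andP[? ?] /andP[? ?]; apply/andP; split; lra.
  have yy0 : `|Phi (F x) - y0| <= ep + ep.
    have := ler_normD (Phi (F x) - c) (c - y0); rewrite addrA subrK => h.
    by apply: le_trans h _; rewrite lerD// ?PhiS// ltW.
  have h1 : cc (Phi (F x)) <= 4^-1.
    have : `|Phi (F x) - y0| / rho <= 8^-1.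
      rewrite ler_pdivrMr//; apply: le_trans yy0 _; rewrite /ep; lra.
    rewrite /cc; move: (_ / rho) => t; lra.
  have h2 := le_trans (clamp_le (I i (Phi (F x))) (cc0 _)) h1.
  have h3 : `|x ord0 i| <= 8^-1.
    have Fy0 : `|F x - y0| < rho.
      have := ler_normD (F x - c) (c - y0); rewrite addrA subrK => h.
      by apply: le_lt_trans h _; move: yc cy0; rewrite /ep; lra.
    have := Hrho _ Ky Fy0; rewrite subr0 GF// => h.
    exact: le_trans (ler_coord_norm _ _) (ltW h).
  have h4 := vi i; move: h2 h3 h4; move: (Num.max _ _) (x ord0 i) (v ord0 i) => p q w.
  by rewrite !ler_norml => /andP[? ?] /andP[? ?] /andP[? ?]; apply/andP; split; lra.
move=> /eqP; rewrite subr_eq0 => /eqP Pv; have Ky : K (F x) by exists x.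
have [yc|yc] := leP ep `|F x - c|; last first.
  by apply: v2; exists (Phi (F x)) => //; exact: PhiS.
have := Hd0 (F x) (conj Ky yc); rewrite leNgt => /negP; apply; apply: le_lt_trans ded0.
apply: norm_rV_le => [|i]; first by rewrite addr_ge0// ltW.
have := PG _ i Ky; have := vi i; rewrite -Pv PhiE// !ler_norml => /andP[? ?] /andP[? ?].
by apply/andP; split; lra.
Qed.

(** Openness is local: around [x0], [f] is read in a small cube rescaled to the unit cube, with [g]
    rescaled accordingly. *)
Lemma invariance_of_domain (U : set 'rV[R]_n) (f g : 'rV[R]_n -> 'rV[R]_n) : open U ->
  {in U, cancel f g} -> {within U, continuous f} -> {within f @` U, continuous g} -> open (f @` U).
Proof.
move=> oU fgK cf cg; apply: ballP_open => _ [x0 Ux0 <-].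
have [r0 r00 rU] := open_ballP oU Ux0.
pose r := r0 / 2; have rp : 0 < r by rewrite divr_gt0.
have QU x : Q x -> U (x0 + r *: x).
  move=> /rcubeP; rewrite subr0 => /(_ ler01) x1; apply: rU.
  rewrite addrC addKr normrZ gtr0_norm// /r; apply: (@le_lt_trans _ _ (r0 / 2)); last lra.
  by rewrite ler_piMr// ltW.
pose F x := f (x0 + r *: x); pose G y := r^-1 *: (g y - x0).
have cF : cont_on Q F.
  move=> x Qx e e0; have [d d0 H] := within_cont_on cf (QU x Qx) e0.
  exists (d / r) => [|y Qy yx]; first by rewrite divr_gt0.
  apply: H; first exact: QU.
  by rewrite opprD addrACA subrr add0r -scalerBr normrZ gtr0_norm// mulrC -ltr_pdivlMr.
have FU : F @` Q `<=` f @` U by move=> _ [x Qx <-]; exists (x0 + r *: x) => //; exact: QU.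
have cK : compact (F @` Q).
  by apply: continuous_compact; [exact: cont_on_within|exact: compact_rcube].
have GF x : Q x -> G (F x) = x.
  move=> Qx; rewrite /G /F fgK; last exact/mem_set/QU.
  by rewrite addrC addKr scalerA mulVf ?scale1r// gt_eqF.
have cG : cont_on (F @` Q) G.
  move=> y Ky e e0; have re0 : 0 < r * e by rewrite mulr_gt0.
  have [d d0 H] := within_cont_on cg (FU _ Ky) re0.
  exists d => // z Kz zy; rewrite /G -scalerBr normrZ gtr0_norm ?invr_gt0//.
  by rewrite opprB addrA subrK -ltr_pdivlMl ?invr_gt0// invrK; apply: H => //; exact: FU.
have [e e0 H] := image_contains_ball cF cK cG GF.
exists e => // c; rewrite /F scaler0 addr0 in H *.
by move=> /H /FU.
Qed.

End invariance.

(** * Lusin's condition for Sobolev maps *)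

Section clamp1d.
Context (R : realType).
Local Notation lm := (@lebesgue_measure R).
Implicit Types (u : R -> R) (a b s t p q : R).

Lemma last_cross u s t p : s <= t -> (forall x, s <= x <= t -> {for x, continuous u}) ->
  u s <= p -> p <= u t -> exists2 s1, s <= s1 <= t & u s1 = p /\ forall x, s1 <= x <= t -> p <= u x.
Proof.
move=> st cu us ut.
pose E := [set x | s <= x <= t /\ u x <= p].
have hE : has_sup E by split; [exists s; rewrite /E /= lexx st|exists t => x [/andP[]]].
have s1t : s <= sup E <= t.
  by rewrite sup_upper_bound//= ?ge_sup//; [exact: (proj1 hE)|move=> x [/andP[]]|rewrite /E /= lexx st].
have gtp x : sup E < x -> x <= t -> p < u x.
  move=> sx xt; rewrite ltNge; apply/negP => uxp; have : E x.
    by split => //; rewrite xt andbT (le_trans _ (ltW sx))//; case/andP: s1t.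
  by move=> /(sup_upper_bound hE); rewrite leNgt sx.
have lep : u (sup E) <= p.
  rewrite leNgt; apply/negP => ps.
  have e0 : 0 < u (sup E) - p by rewrite subr_gt0.
  have /cvgrPdist_lt/(_ _ e0)/nbhs_ballP[d d0 H] := cu _ s1t.
  have [x Ex xd] := sup_adherent d0 hE.
  have xs := sup_upper_bound hE Ex.
  have := H x; rewrite -ball_normE /ball_ /= ger0_norm ?subr_ge0// ltrBlDl -ltrBlDr => /(_ xd).
  move=> h; have := le_lt_trans (ler_norm _) h; case: Ex => _ uxp.
  by rewrite ltrD2l ltrN2 ltNge uxp.
have [h|h] := eqVneq (u (sup E)) p.
  exists (sup E) => //; split => // x /andP[]; rewrite le_eqVlt => /orP[/eqP <- _|]; first by rewrite h.
  by move=> h1 h2; exact: ltW (gtp _ h1 h2).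
have ltp : u (sup E) < p by rewrite lt_neqAle h.
have /andP[s0 t0] := s1t.
have [||x] := @IVT R u (sup E) t p t0.
- apply: continuous_in_subspaceT => x /set_mem /=; rewrite in_itv/= => /andP[h1 h2].
  by apply: cu; rewrite (le_trans s0 h1) h2.
- by rewrite ge_min le_max lep ut orbT.
rewrite in_itv/= => /andP[]; rewrite le_eqVlt => /orP[/eqP <- _ e|h1 h2 e].
  by rewrite e ltxx in ltp.
by have := gtp _ h1 h2; rewrite e ltxx.
Qed.

Lemma first_cross u s t p : s <= t -> (forall x, s <= x <= t -> {for x, continuous u}) ->
  u s <= p -> p <= u t -> exists2 t1, s <= t1 <= t & u t1 = p /\ forall x, s <= x <= t1 -> u x <= p.
Proof.
move=> st cu us ut.
have [|x /andP[x1 x2]|||s1 s1st [u1 H]] := @last_cross (fun x => - u (- x)) (- t) (- s) (- p).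
- by rewrite lerN2.
- apply: continuousN; apply: (@continuous_comp _ _ _ (fun x => - x) u); first exact: opp_continuous.
  by apply: cu; rewrite lerNr x2 lerNl x1.
- by rewrite opprK lerN2.
- by rewrite opprK lerN2.
exists (- s1); first by rewrite lerNr lerNl andbC.
split; first exact: oppr_inj u1.
move=> x /andP[x1 x2]; have := H (- x); rewrite opprK !lerN2; apply.
by rewrite lerNr x2 x1.
Qed.

Definition clamp a b x : R := Num.max a (Num.min b x).

Lemma clamp_lt a b x y : a <= b -> clamp a b x < clamp a b y ->
  [/\ x <= clamp a b x, clamp a b y <= y, a <= clamp a b x & clamp a b y <= b].
Proof.
move=> ab xy; have yb : clamp a b y <= b by rewrite ge_max ab ge_min lexx.
have ax : a <= clamp a b x by rewrite le_max lexx.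
split => //.
  rewrite le_max le_min lexx andbT; apply/orP; right; rewrite leNgt; apply/negP => bx.
  by move: (lt_le_trans xy yb); rewrite /clamp (min_idPl (ltW bx)) (max_idPr ab) ltxx.
have := le_lt_trans ax xy; rewrite /clamp lt_max ltxx /= => h.
by rewrite (max_idPr (ltW h)) ge_min lexx orbT.
Qed.

(** Between the last crossing of the lower truncated value [p] and the next crossing of the upper
    one [q], [u] stays in [[p, q]], hence in [[a, b]]. So the variation of the truncated function is
    paid by [G] only where [a <= u <= b]. *)
Lemma clamp_upper1 u (G : R -> R) a b s t : a <= b -> s <= t ->
  (forall x, s <= x <= t -> {for x, continuous u}) -> measurable_fun setT u -> measurable_fun setT G -> (forall x, 0 <= G x) ->
  (forall x y, s <= x -> x <= y -> y <= t -> (`|u y - u x|%:E <= \int[lm]_(z in `[x, y]) (G z)%:E)%E) ->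
  clamp a b (u s) <= clamp a b (u t) ->
  ((clamp a b (u t) - clamp a b (u s))%:E <= \int[lm]_(z in `[s, t]) (G z * (a <= u z <= b)%R%:R)%:E)%E.
Proof.
move=> ab st cu mu mG G0 uG.
set p := clamp a b (u s); set q := clamp a b (u t).
have int0 : (0 <= \int[lm]_(z in `[s, t]) (G z * (a <= u z <= b)%R%:R)%:E)%E.
  by apply: integral_ge0 => z _; rewrite lee_fin mulr_ge0.
rewrite le_eqVlt => /orP[/eqP ->|pq]; first by rewrite subrr.
have [usp qut ap qb] : [/\ u s <= p, q <= u t, a <= p & q <= b].
  exact: clamp_lt.
have [s1 /andP[ss1 s1t] [us1 Hs]] := last_cross st cu usp (le_trans (ltW pq) qut).
have [||||t1 /andP[s1t1 t1t] [ut1 Ht]] := @first_cross u s1 t q.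
- exact: s1t.
- by move=> x /andP[h1 h2]; apply: cu; rewrite (le_trans ss1 h1) h2.
- by rewrite us1 ltW.
- exact: qut.
have mc : measurable_fun setT (fun z => (a <= u z <= b)%R%:R : R).
  rewrite (_ : (fun z => _) = \1_(u @^-1` `[a, b]%classic)).
    by apply: measurable_indic; rewrite -[X in measurable X]setTI; exact: mu.
  apply/funext => z; rewrite indicE; have -> // : (z \in u @^-1` `[a, b]%classic) = (a <= u z <= b).
  by apply/idP/idP => [/set_mem|h]; [|apply/mem_set]; rewrite /= in_itv.
have -> : q - p = `|u t1 - u s1| by rewrite ut1 us1 gtr0_norm// subr_gt0.
apply: le_trans (uG _ _ ss1 s1t1 t1t) _.
apply: (@le_trans _ _ (\int[lm]_(z in `[s1, t1]) (G z * (a <= u z <= b)%R%:R)%:E)%E).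
  apply: ge0_le_integral => //.
  - by move=> z _; rewrite lee_fin.
  - by apply: measurable_funTS; exact/measurable_EFinP.
  - by apply: measurable_funTS; apply/measurable_EFinP; exact: measurable_funM.
  move=> z; rewrite /= in_itv/= => /andP[z1 z2].
  have h1 := Hs z; have h2 := Ht z; rewrite z1 (le_trans z2 t1t) in h1; rewrite z1 z2 in h2.
  by rewrite (le_trans ap (h1 isT)) (le_trans (h2 isT) qb) mulr1.
apply: ge0_subset_integral => //.
- by apply: measurable_funTS; apply/measurable_EFinP; exact: measurable_funM.
- by move=> z _; rewrite lee_fin mulr_ge0.
move=> z; rewrite /= !in_itv/= => /andP[z1 z2].
by rewrite (le_trans ss1 z1) (le_trans z2 t1t).
Qed.

Lemma clampN a b x : a <= b -> clamp (- b) (- a) (- x) = - clamp a b x.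
Proof.
move=> ab; rewrite /clamp; have [?|?] := leP (- a) (- x); have [?|?] := leP b x;
  have [?|?] := leP (- b) _; have [?|?] := leP a _; lra.
Qed.

Lemma clamp_upper u (G : R -> R) a b s t : a <= b -> s <= t ->
  (forall x, s <= x <= t -> {for x, continuous u}) -> measurable_fun setT u -> measurable_fun setT G -> (forall x, 0 <= G x) ->
  (forall x y, s <= x -> x <= y -> y <= t -> (`|u y - u x|%:E <= \int[lm]_(z in `[x, y]) (G z)%:E)%E) ->
  (`|clamp a b (u t) - clamp a b (u s)|%:E <= \int[lm]_(z in `[s, t]) (G z * (a <= u z <= b)%R%:R)%:E)%E.
Proof.
move=> ab st cu mu mG G0 uG.
have [le|lt] := leP (clamp a b (u s)) (clamp a b (u t)).
  by rewrite ger0_norm ?subr_ge0//; exact: clamp_upper1.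
rewrite ltr0_norm ?subr_lt0// opprB.
have := @clamp_upper1 (fun x => - u x) G (- b) (- a) s t _ st.
rewrite !clampN// opprK !lerN2 addrC => H.
apply: le_trans (H _ _ _ mG G0 _ (ltW lt)) _ => //.
- by move=> x /cu; exact: continuousN.
- exact: measurableT_comp.
- by move=> x y h1 h2 h3; rewrite -opprD normrN; exact: uG.
under eq_integral do rewrite lerN2 lerN2 andbC.
by [].
Qed.

End clamp1d.

(** * Tonelli's theorem on rectangles *)

Section dom_tonelli.
Context d1 d2 (T1 : measurableType d1) (T2 : measurableType d2) (R : realType)
  (m1 : {sigma_finite_measure set T1 -> \bar R}) (m2 : {sigma_finite_measure set T2 -> \bar R}).
Local Open Scope ereal_scope.

Lemma dom_tonelli (A : set T1) (B : set T2) (f : T1 * T2 -> \bar R) : measurable A -> measurable B ->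
  measurable_fun setT f -> (forall z, 0 <= f z) ->
  \int[m1]_(x in A) \int[m2]_(y in B) f (x, y) = \int[m2]_(y in B) \int[m1]_(x in A) f (x, y).
Proof.
move=> mA mB mf f0.
pose g := f \_ (A `*` B).
have mg : measurable_fun setT g.
  by apply/(measurable_restrictT _ (measurableX mA mB)); exact: measurable_funTS.
have g0 z : 0 <= g z by rewrite /g patchE; case: ifP.
have gE x y : g (x, y) = if (x \in A) && (y \in B) then f (x, y) else 0.
  by rewrite /g patchE in_setX.
transitivity (\int[m1]_x \int[m2]_y g (x, y)).
  rewrite integral_mkcond; apply: eq_integral => x _; rewrite patchE; case: ifPn => xA.
    by rewrite integral_mkcond; apply: eq_integral => y _; rewrite patchE gE xA.
  by rewrite integral0_eq// => y _; rewrite gE (negbTE xA).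
rewrite (fubini_tonelli _ mg g0) [RHS]integral_mkcond; apply: eq_integral => y _; rewrite patchE; case: ifPn => yB.
  by rewrite [RHS]integral_mkcond; apply: eq_integral => x _; rewrite patchE gE yB andbT.
by rewrite integral0_eq// => x _; rewrite gE (negbTE yB) andbF.
Qed.

Lemma dom_measurable (B : set T2) (f : T1 * T2 -> \bar R) : measurable B ->
  measurable_fun setT f -> (forall z, 0 <= f z) ->
  measurable_fun setT (fun x => \int[m2]_(y in B) f (x, y)).
Proof.
move=> mB mf f0.
pose g := f \_ (setT `*` B).
have mg : measurable_fun setT g.
  by apply/(measurable_restrictT _ (measurableX measurableT mB)); exact: measurable_funTS.
have g0 z : 0 <= g z by rewrite /g patchE; case: ifP.
rewrite (_ : (fun x => _) = (fun x => \int[m2]_y g (x, y))).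
  exact: measurable_fun_fubini_tonelli_F.
apply/funext => x; rewrite integral_mkcond; apply: eq_integral => y _.
by rewrite /g !patchE in_setX in_setT.
Qed.

End dom_tonelli.

Lemma ae_prod_swap d1 d2 (T1 : measurableType d1) (T2 : measurableType d2) (R : realType)
  (m1 : {sigma_finite_measure set T1 -> \bar R}) (m2 : {sigma_finite_measure set T2 -> \bar R}) (P : T1 * T2 -> Prop) :
  {ae (m1 \x m2)%E, forall z, P z} -> {ae m2, forall y, {ae m1, forall x, P (x, y)}}.
Proof.
move=> [N [mN N0 PN]].
have mi : measurable_fun setT (fun z => (\1_N z)%:E : \bar R) by exact/measurable_EFinP.
have i0 z : (0 <= (\1_N z)%:E :> \bar R)%E by rewrite lee_fin.
have := fubini_tonelli1 (m1 := m1) (m2 := m2) _ mi i0.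
have -> : (\int[m1 \x m2]_z (\1_N z)%:E = 0)%E by rewrite integral_indic// setIT; exact: N0.
rewrite /fubini_F (fubini_tonelli _ mi i0) => /esym I0.
have : {ae m2, forall y, (\int[m1]_x (\1_N (x, y))%:E = 0)%E}.
  have /ae_eq_integral_abs : measurable_fun setT (fun y => \int[m1]_x (\1_N (x, y))%:E)%E.
    have sw : measurable_fun setT (fun z : T2 * T1 => (z.2, z.1)) by exact: measurable_fun_pair.
    by apply: (measurable_fun_fubini_tonelli_F (fun z : T2 * T1 => (\1_N (z.2, z.1))%:E)) => //; exact: measurableT_comp mi sw.
  move=> /(_ m2 measurableT)[h _].
  have := h _; rewrite (eq_integral (fun y => \int[m1]_x (\1_N (x, y))%:E)%E); last first.
    by move=> y _; rewrite gee0_abs//; apply: integral_ge0.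
  by move=> /(_ I0); apply: filterS => y /(_ I).
apply: filterS => y y0; exists (ysection N y); split; first exact: measurable_ysection.
  rewrite -(setIT (ysection N y)) -integral_indic//; last exact: measurable_ysection.
  rewrite -[RHS]y0; apply: eq_integral => x _; rewrite !indicE; congr ((nat_of_bool _)%:R%:E).
  by rewrite mem_ysection.
by move=> x /= nP; apply/ysectionP; exact: PN.
Qed.

(** * Mean oscillation on cubes *)

Section double_osc.
Context (R : realType).
Local Notation lm := (@lebesgue_measure R).

Definition coint n (c : 'rV[R]_n) (r : R) (j : 'I_n) : set (measurableTypeR R) :=
  `[c ord0 j - r, c ord0 j + r]%classic.

Lemma measurable_coint n (c : 'rV[R]_n) r j : measurable (coint c r j).
Proof. exact: measurable_itv. Qed.

Lemma lm_coint n (c : 'rV[R]_n) r j : 0 <= r -> lm (coint c r j) = (r *+ 2)%:E.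
Proof.
move=> r0; rewrite /coint lebesgue_measure_itv/= lte_fin.
case: ltP => [_|]; first by rewrite -EFinD; congr EFin; rewrite mulr2n; lra.
rewrite lerD2l => rN; have -> : r = 0 by lra.
by rewrite mul0rn.
Qed.

Lemma rcube_ins n (c : 'rV[R]_n.+1) r (j : 'I_n.+1) (x : 'rV[R]_n) (t : R) :
  rcube c r (ins j (x, t)) <-> rcube (del j c) r x /\ coint c r j t.
Proof.
split=> [h|[h1 h2] i].
  split=> [i|]; first by have := h (lift j i); rewrite ins_lift /= !mxE.
  by have := h j; rewrite insE.
have [k ->|->] := unliftP j i; last by rewrite insE.
by have := h1 k; rewrite ins_lift /= !mxE.
Qed.

Lemma upd_ins_lift n (x : 'rV[R]_n) (t : R) (j : 'I_n) s :
  upd (ins ord0 (x, t)) (lift ord0 j) s = ins ord0 (upd x j s, t).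
Proof.
apply/rowP => k; rewrite mxE; have [l ->|->] := unliftP ord0 k.
  by rewrite !ins_lift /= mxE (inj_eq lift_inj).
by rewrite (negbTE (neq_lift _ _)) !insE.
Qed.

Local Open Scope ereal_scope.

Lemma integral_rcube n (c : 'rV[R]_n.+1) r (j : 'I_n.+1) (f : 'rV[R]_n.+1 -> \bar R) :
  measurable_fun setT f -> (forall x, 0 <= f x) ->
  \int[leb (n:=n.+1)]_(x in rcube c r) f x =
  \int[leb (n:=n)]_(x in rcube (del j c) r) \int[lm]_(t in coint c r j) f (ins j (x, t)).
Proof.
move=> mf f0; have mQ := measurable_rcube c r.
rewrite integral_mkcond (integral_ins j); last 2 first.
- by apply/(measurable_restrictT _ mQ); exact: measurable_funTS.
- by move=> x; rewrite patchE; case: ifP.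
rewrite [RHS]integral_mkcond; apply: eq_integral => x _; rewrite patchE.
case: ifPn => xQ; last first.
  rewrite integral0_eq// => t _; rewrite patchE ifF//; apply/negP => /set_mem/rcube_ins[].
  by move/mem_set; rewrite (negbTE xQ).
rewrite [RHS]integral_mkcond; apply: eq_integral => t _; rewrite !patchE.
have [tI|tI] := boolP (t \in coint c r j).
  by rewrite mem_set//; apply/rcube_ins; split; apply: set_mem.
by rewrite memNset// => /rcube_ins[_ /mem_set]; rewrite (negbTE tI).
Qed.

(** To go from [x] to [y], the first coordinate of [x] is moved to that of [y], at the cost of a
    line integral [H] of [G]; the remaining oscillation [B] is between points with the same first
    coordinate [t], where the induction hypothesis applies to almost every slice. Integrating
    produces one factor [(2 r) ^ n.+1] per coordinate. *)
Lemma double_osc n (c : 'rV[R]_n) (r : R) (v G : 'rV[R]_n -> R) : (0 <= r)%R ->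
  measurable_fun setT v -> measurable_fun setT G -> (forall x, (0 <= G x)%R) ->
  (forall j, {ae leb (n:=n), forall x, rcube c r x -> forall s : R, coint c r j s ->
     `|v x - v (upd x j s)|%:E <= \int[lm]_(t in coint c r j) (G (upd x j t))%:E}) ->
  \int[leb (n:=n)]_(x in rcube c r) \int[leb (n:=n)]_(y in rcube c r) `|v x - v y|%:E <=
  (n%:R * (r *+ 2) ^+ n.+1)%:E * \int[leb (n:=n)]_(x in rcube c r) (G x)%:E.
Proof.
move=> r0; elim: n c v G => [|n IH] c v G mv mG G0 vG.
  rewrite mul0r mul0e integral0_eq// => x _; rewrite integral0_eq// => y _.
  by rewrite (_ : x = y) ?subrr ?normr0//; apply/rowP => -[].
pose c' := del ord0 c; pose I := coint c r ord0; pose Q := rcube c' r.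
have mQ : measurable Q by exact: measurable_rcube.
have mQ1 : measurable (rcube c r) by exact: measurable_rcube.
have mI : measurable I by exact: measurable_coint.
have lI : lm I = (r *+ 2)%:E by exact: lm_coint.
have icst a : \int[lm]_(_ in I) a = a * (r *+ 2)%:E.
  exact: etrans (integral_cst lm mI a) (congr1 (mule a) lI).
have lQ : leb Q = ((r *+ 2) ^+ n)%:E by exact: leb_rcube.
have icstQ a : \int[leb (n:=n)]_(_ in Q) a = a * ((r *+ 2) ^+ n)%:E.
  exact: etrans (integral_cst (leb (n:=n)) mQ a) (congr1 (mule a) lQ).
pose V x s := v (ins ord0 (x, s)); pose GG x s := G (ins ord0 (x, s)).
have mdif d (T : measurableType d) (f g : T -> 'rV[R]_n.+1) :
    measurable_fun setT f -> measurable_fun setT g -> measurable_fun setT (fun z => `|v (f z) - v (g z)|%:E).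
  move=> mf mg; apply/measurable_EFinP; apply: measurableT_comp => //.
  by apply: measurable_funB; apply: (measurableT_comp mv).
have mpair d (T : measurableType d) (f : T -> 'rV[R]_n) (g : T -> measurableTypeR R) :
    measurable_fun setT f -> measurable_fun setT g -> measurable_fun setT (fun z => ins ord0 (f z, g z)).
  by move=> mf mg; apply: (measurableT_comp (measurable_ins ord0)); exact: measurable_fun_pair.
have mG1 d (T : measurableType d) (f : T -> 'rV[R]_n.+1) : measurable_fun setT f ->
    measurable_fun setT (fun z => (G (f z))%:E).
  by move=> mf; apply/measurable_EFinP; exact: measurableT_comp mG _.
pose H x := \int[lm]_(t in I) (GG x t)%:E.
have mH : measurable_fun setT H.
  apply: (@dom_measurable _ _ _ _ _ lm I (fun z => (G (ins ord0 z))%:E)) => //.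
  - by apply: mG1; exact: measurable_ins.
  - by move=> z; rewrite lee_fin.
have H0 x : 0 <= H x by apply: integral_ge0 => t _; rewrite lee_fin; exact: G0.
have HE : \int[leb (n:=n)]_(x in Q) H x = \int[leb (n:=n.+1)]_(x in rcube c r) (G x)%:E.
  by rewrite (integral_rcube c r ord0)//; exact/measurable_EFinP.
pose K (z : 'rV[R]_n * measurableTypeR R) := \int[leb (n:=n)]_(y in Q) `|V z.1 z.2 - V y z.2|%:E.
have K0 z : 0 <= K z by apply: integral_ge0.
have mK : measurable_fun setT K.
  apply: (@dom_measurable _ _ _ _ _ (leb (n:=n)) Q (fun w => `|V w.1.1 w.1.2 - V w.2 w.1.2|%:E)) => //.
  by apply: mdif; apply: mpair => //; apply: measurableT_comp.
pose B x := \int[leb (n:=n)]_(y in Q) \int[lm]_(t in I) `|V x t - V y t|%:E.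
have BE x : B x = \int[lm]_(t in I) K (x, t).
  rewrite /B (@dom_tonelli _ _ _ _ _ (leb (n:=n)) lm Q I (fun w => `|V x w.2 - V w.1 w.2|%:E))//.
  by apply: mdif; apply: mpair.
have B0 x : 0 <= B x by rewrite BE; apply: integral_ge0.
have mB : measurable_fun setT B.
  by rewrite (funext BE); exact: (@dom_measurable _ _ _ _ _ lm I K).
have BI : \int[leb (n:=n)]_(x in Q) B x <=
    (n%:R * (r *+ 2) ^+ n.+1)%:E * \int[leb (n:=n.+1)]_(x in rcube c r) (G x)%:E.
  rewrite -HE (@dom_tonelli _ _ _ _ _ (leb (n:=n)) lm Q I (fun w => (G (ins ord0 w))%:E))//; last 2 first.
  - by apply: mG1; exact: measurable_ins.
  - by move=> z; rewrite lee_fin.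
  have c0 : (0 <= n%:R * (r *+ 2) ^+ n.+1)%R by rewrite mulr_ge0// exprn_ge0// mulrn_wge0.
  have mGt : measurable_fun setT (fun t : measurableTypeR R => \int[leb (n:=n)]_(x in Q) (G (ins ord0 (x, t)))%:E).
    apply: (@dom_measurable _ _ _ _ _ (leb (n:=n)) Q (fun w => (G (ins ord0 (w.2, w.1)))%:E)) => //.
    - by apply: mG1; exact: mpair.
    - by move=> z; rewrite lee_fin.
  have mKt : measurable_fun setT (fun t : measurableTypeR R => \int[leb (n:=n)]_(x in Q) K (x, t)).
    apply: (@dom_measurable _ _ _ _ _ (leb (n:=n)) Q (fun w => K (w.2, w.1))) => //.
    by apply: (measurableT_comp mK); exact: measurable_fun_pair.
  rewrite -ge0_integralZl//; last 2 first.
  - exact: measurable_funTS.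
  - by move=> t _; apply: integral_ge0 => x _; rewrite lee_fin.
  rewrite (eq_integral (fun x => \int[lm]_(t in I) K (x, t))); last by move=> x _; exact: BE.
  rewrite (@dom_tonelli _ _ _ _ _ (leb (n:=n)) lm Q I K)//.
  apply: ae_ge0_le_integral => //.
  - by move=> t _; apply: integral_ge0.
  - exact: measurable_funTS.
  - move=> t _; apply: mule_ge0; first by rewrite lee_fin.
    by apply: integral_ge0 => x _; rewrite lee_fin.
  - by apply: measurable_funTS; exact: measurable_funeM.
  have : {ae lm, forall t, forall j : 'I_n, {ae leb (n:=n), forall x, rcube c r (ins ord0 (x, t)) ->
      forall s : R, coint c r (lift ord0 j) s ->
      `|v (ins ord0 (x, t)) - v (upd (ins ord0 (x, t)) (lift ord0 j) s)|%:E <=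
      \int[lm]_(tau in coint c r (lift ord0 j)) (G (upd (ins ord0 (x, t)) (lift ord0 j) tau))%:E}}.
    apply: ae_forall_count => j.
    by have /(ae_ins ord0) := vG (lift ord0 j); exact: ae_prod_swap.
  apply: filterS => t Ht It; apply: (IH c' (fun x => V x t) (fun x => GG x t)) => [||x|].
  - by apply: (measurableT_comp mv); exact: mpair.
  - by apply: (measurableT_comp mG); exact: mpair.
  - exact: G0.
  move=> j; apply: filterS (Ht j) => x Hx Qx s Is.
  have cE : coint c r (lift ord0 j) = coint c' r j by rewrite /coint mxE.
  have := Hx _ s; rewrite cE upd_ins_lift; under eq_integral do rewrite upd_ins_lift.
  by apply => //; apply/rcube_ins.
have LE : \int[leb (n:=n.+1)]_(x in rcube c r) \int[leb (n:=n.+1)]_(y in rcube c r) `|v x - v y|%:E <=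
    \int[leb (n:=n.+1)]_(x in rcube c r) (((r *+ 2) ^+ n.+1)%:E * H (del ord0 x) + B (del ord0 x)).
  have p0 : (0 <= (r *+ 2) ^+ n.+1)%R by rewrite exprn_ge0// mulrn_wge0.
  apply: ae_ge0_le_integral => //.
  - by move=> x _; apply: integral_ge0.
  - apply: measurable_funTS.
    apply: (@dom_measurable _ _ _ _ _ (leb (n:=n.+1)) _ (fun w => `|v w.1 - v w.2|%:E)) => //.
    by apply: mdif.
  - by move=> x _; rewrite adde_ge0// mule_ge0// lee_fin.
  - apply: measurable_funTS; apply: emeasurable_funD.
      by apply: measurable_funeM; exact: (measurableT_comp mH (measurable_del _)).
    exact: (measurableT_comp mB (measurable_del _)).
  apply: filterS (vG ord0) => x vx Qx.
  have xE : x = ins ord0 (del ord0 x, x ord0 ord0) by rewrite delK.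
  rewrite (integral_rcube c r ord0)//; last by apply: mdif.
  rewrite -/Q -/I -/c'.
  have HB y : \int[lm]_(t in I) `|v x - V y t|%:E <=
      \int[lm]_(t in I) (H (del ord0 x) + `|V (del ord0 x) t - V y t|%:E).
    apply: ge0_le_integral => //.
    - by apply: measurable_funTS; apply: mdif => //; exact: mpair.
    - apply: measurable_funTS; apply: emeasurable_funD; first exact: measurable_cst.
      by apply: mdif; exact: mpair.
    move=> t It; have := vx Qx t It; rewrite upd_ins.
    under eq_integral do rewrite upd_ins.
    move=> h; apply: (@le_trans _ _ (`|v x - V (del ord0 x) t|%:E + `|V (del ord0 x) t - V y t|%:E)).
      by rewrite -EFinD lee_fin; exact: ler_distD.
    exact: leeD.
  have mBt y : measurable_fun setT (fun t : measurableTypeR R => `|V (del ord0 x) t - V y t|%:E).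
    by apply: mdif; exact: mpair.
  apply: (@le_trans _ _ (\int[leb (n:=n)]_(y in Q) (H (del ord0 x) * (r *+ 2)%:E +
      \int[lm]_(t in I) `|V (del ord0 x) t - V y t|%:E))).
    have mBy : measurable_fun setT (fun y => \int[lm]_(t in I) `|V (del ord0 x) t - V y t|%:E).
      apply: (@dom_measurable _ _ _ _ _ lm I (fun w => `|V (del ord0 x) w.2 - V w.1 w.2|%:E)) => //.
      by apply: mdif; exact: mpair.
    apply: ge0_le_integral => //.
    - by move=> y _; apply: integral_ge0.
    - apply: measurable_funTS; apply: (@dom_measurable _ _ _ _ _ lm I (fun w => `|v x - V w.1 w.2|%:E)) => //.
      by apply: mdif => //; exact: mpair.
    - by apply: measurable_funTS; apply: emeasurable_funD; first exact: measurable_cst.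
    move=> y Qy; apply: le_trans (HB y) _.
    rewrite ge0_integralD//; last exact: measurable_funTS.
    by rewrite -icst; apply: leeD; exact: lexx.
  rewrite ge0_integralD//.
  - have -> : ((r *+ 2) ^+ n.+1)%:E * H (del ord0 x) = H (del ord0 x) * (r *+ 2)%:E * ((r *+ 2) ^+ n)%:E.
      by rewrite -muleA -EFinM -exprS muleC.
    by rewrite -icstQ; apply: leeD; exact: lexx.
  - by move=> y _; rewrite mule_ge0// lee_fin mulrn_wge0.
  - by move=> y _; apply: integral_ge0.
  apply: measurable_funTS.
  apply: (@dom_measurable _ _ _ _ _ lm I (fun w => `|V (del ord0 x) w.2 - V w.1 w.2|%:E)) => //.
  by apply: mdif; exact: mpair.
apply: le_trans LE _.
rewrite (integral_rcube c r ord0); last 2 first.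
- apply: emeasurable_funD.
    by apply: measurable_funeM; exact: (measurableT_comp mH (measurable_del _)).
  exact: (measurableT_comp mB (measurable_del _)).
- by move=> x; rewrite adde_ge0// mule_ge0// lee_fin exprn_ge0// mulrn_wge0.
rewrite -/Q -/I -/c'.
have E x : \int[lm]_(t in I) (((r *+ 2) ^+ n.+1)%:E * H (del ord0 (ins ord0 (x, t))) + B (del ord0 (ins ord0 (x, t)))) =
    ((r *+ 2) ^+ n.+2)%:E * H x + (r *+ 2)%:E * B x.
  rewrite (eq_integral (fun=> ((r *+ 2) ^+ n.+1)%:E * H x + B x)); last first.
    by move=> t _; have [-> _] := insK ord0 (x, t : measurableTypeR R).
  rewrite icst ge0_muleDl//.
  - by rewrite muleAC -EFinM -exprSr [B x * _]muleC.
  - by rewrite mule_ge0// lee_fin exprn_ge0// mulrn_wge0.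
under eq_integral do rewrite E.
have r20 : (0 <= r *+ 2)%R by rewrite mulrn_wge0.
rewrite ge0_integralD//; last 4 first.
- by move=> x _; rewrite mule_ge0// lee_fin exprn_ge0.
- by apply: measurable_funTS; exact: measurable_funeM.
- by move=> x _; rewrite mule_ge0// lee_fin.
- by apply: measurable_funTS; exact: measurable_funeM.
have ZE (a : R) f : (0 <= a)%R -> measurable_fun setT f -> (forall x, 0 <= f x) ->
    \int[leb (n:=n)]_(x in Q) (a%:E * f x) = a%:E * \int[leb (n:=n)]_(x in Q) f x.
  by move=> a0 mf f0; rewrite ge0_integralZl//; exact: measurable_funTS.
have e0 : (0 <= (r *+ 2) ^+ n.+2)%R by rewrite exprn_ge0.
apply: (@le_trans _ _ (((r *+ 2) ^+ n.+2)%:E * (\int[leb (n:=n)]_(x in Q) H x) +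
    (r *+ 2)%:E * \int[leb (n:=n)]_(x in Q) B x)).
  by apply: leeD; [have <- := ZE _ H e0 mH H0|have <- := ZE _ B r20 mB B0]; exact: lexx.
set g := \int[leb (n:=n.+1)]_(x in rcube c r) (G x)%:E.
apply: (@le_trans _ _ (((r *+ 2) ^+ n.+2)%:E * g + (r *+ 2)%:E * ((n%:R * (r *+ 2) ^+ n.+1)%:E * g))).
  by apply: leeD; [rewrite HE; exact: lexx|apply: lee_wpmul2l; [rewrite lee_fin|exact: BI]].
have e1 : (0 <= r *+ 2 * (n%:R * (r *+ 2) ^+ n.+1))%R by rewrite !mulr_ge0// exprn_ge0.
rewrite muleA -EFinM -ge0_muleDl ?lee_fin// -EFinD mulrCA -exprS.
by rewrite -{1}[(_ ^+ n.+2)%R]mul1r -mulrDl -nat1r.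
Qed.

End double_osc.

(** * A finite Vitali covering *)

Section vitali.
Context (R : realType) (n : nat).
Implicit Types (s t : seq ('rV[R]_n * R)).

Definition far (i j : 'rV[R]_n * R) := i.2 + j.2 < `|i.1 - j.1|.

(** Greedy choice: a ball of largest radius is kept, the balls meeting it lie in the ball of triple
    radius and are discarded, and the remaining ones are treated by induction on their number. *)
Lemma finite_vitali s : (forall i, i \in s -> 0 <= i.2) ->
  exists t, [/\ {subset t <= s}, pairwise far t &
  forall i, i \in s -> exists2 j, j \in t & forall y, `|y - i.1| <= i.2 -> `|y - j.1| <= 3 * j.2].
Proof.
have [k] := ubnP (size s); elim: k s => // k IH s; rewrite ltnS => sk s0.
have [->|[i0 i0s]] : s = [::] \/ exists i0, i0 \in s.
- by case: s {sk s0} => [|i0 s]; [left|right; exists i0; rewrite inE eqxx].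
- by exists [::].
have [j js jmax] : exists2 j, j \in s & forall i, i \in s -> i.2 <= j.2.
  elim: s i0 i0s {sk s0} => // i1 s IHs i0 _.
  have [->|[i2 i2s]] : s = [::] \/ exists i2, i2 \in s.
  - by case: s {IHs} => [|i2 s]; [left|right; exists i2; rewrite inE eqxx].
  - by exists i1; rewrite ?inE// => i; rewrite inE => /eqP ->.
  have [j js jmax] := IHs _ i2s.
  have [h|h] := leP i1.2 j.2.
    by exists j => [|i]; rewrite inE ?js ?orbT// => /orP[/eqP -> //|]; exact: jmax.
  exists i1 => [|i]; first by rewrite inE eqxx.
  by rewrite inE => /orP[/eqP -> //|/jmax /le_trans]; apply; exact: ltW.
pose s' := [seq i <- s | far j i].
have s's i : i \in s' -> i \in s by rewrite mem_filter => /andP[].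
have [||t [ts ft tP]] := IH s'.
- rewrite size_filter; apply: leq_trans sk; rewrite -(count_predC (far j) s) -[X in (X < _)%N]addn0 ltn_add2l.
  rewrite -has_count; apply/hasP; exists j => //=.
  by rewrite /far subrr normr0 -leNgt addr_ge0// s0.
- by move=> i /s's; exact: s0.
exists (j :: t); split.
- by move=> i; rewrite inE => /orP[/eqP -> //|/ts/s's].
- by rewrite /= ft andbT; apply/allP => i /ts; rewrite mem_filter => /andP[].
move=> i is_; have [fi|nfi] := boolP (far j i).
  have [|l lt H] := tP i; first by rewrite mem_filter fi.
  by exists l; rewrite ?inE ?lt ?orbT.
exists j; first by rewrite inE eqxx.
move=> y yi; rewrite /far -leNgt in nfi; rewrite distrC in nfi.
have := ler_normD (y - i.1) (i.1 - j.1); rewrite addrA subrK => h.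
have := jmax i is_; lra.
Qed.

End vitali.

Lemma sum_disj d (T : measurableType d) (R : realType) (m : {measure set T -> \bar R}) (I : eqType)
    (t : seq I) (A : I -> set T) (O : set T) (F : T -> \bar R) : measurable O ->
  (forall i, measurable (A i)) -> measurable_fun O F -> (forall x, 0 <= F x)%E ->
  pairwise (fun i j => `[< A i `&` A j = set0 >]) t ->
  (\sum_(i <- t) \int[m]_(x in O `&` A i) F x <= \int[m]_(x in O) F x)%E.
Proof.
move=> mO mA mF F0; elim: t O mO mF => [|i t IH] O mO mF /=; first by rewrite big_nil integral_ge0.
move=> /andP[/allP dis pt]; rewrite big_cons.
have mOA : measurable (O `\` A i) by exact: measurableD.
have -> : (\int[m]_(x in O) F x = \int[m]_(x in O `&` A i) F x + \int[m]_(x in O `\` A i) F x)%E.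
  rewrite -[in LHS](setUIDK O (A i)) ge0_integral_setU//.
  - exact: measurableI.
  - by rewrite setUIDK.
  - by apply/disj_setPS => x [[_ h] [_ /(_ h)]].
rewrite leeD2l//; apply: le_trans (IH _ mOA _ pt); last by apply: measurable_funS mF => // x [].
rewrite big_seq [leRHS]big_seq; apply: lee_sum => k kt.
apply: ge0_subset_integral => //; first exact: measurableI.
- exact: measurableI.
- by apply: measurable_funS mF => // x [[]].
- move=> x [Ox Akx]; split => //; split => // Aix.
  have /asboolP : `[< A i `&` A k = set0 >].
    exact: dis.
  by move=> /seteqP[/(_ x (conj Aix Akx))].
Qed.

(** The last computation of [good_scale]: with [tau * L = th * rho], the term in [tau] is half of
    the left-hand side and is absorbed. *)
Lemma young_scale (R : realType) k (L tau th rho x : R) : 0 < L -> 0 < tau -> tau * L = th * rho ->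
  2 * k.+1%:R * (th * rho) * L ^+ (k.+1 + k.+1) <=
    k.+1%:R * L ^+ k.+2 * (tau * L ^+ k.+1 + (tau ^+ k)^-1 * x) -> (th * rho) ^+ k.+1 <= x.
Proof.
move=> L0 t0 tL; rewrite -tL.
have -> : 2 * k.+1%:R * (tau * L) * L ^+ (k.+1 + k.+1) =
    k.+1%:R * L ^+ k.+2 * (2 * (tau * L ^+ k.+1)).
  by rewrite exprD !exprS; ring.
rewrite ler_pM2l; last by rewrite mulr_gt0// exprn_gt0.
have -> : 2 * (tau * L ^+ k.+1) = tau * L ^+ k.+1 + tau * L ^+ k.+1 by ring.
rewrite lerD2l [leRHS]mulrC ler_pdivlMr ?exprn_gt0// => H; apply: le_trans H.
by rewrite exprMn !exprS mulrAC.
Qed.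

(** Takes the place of Hoelder's inequality: a free parameter [tau] exchanges an integral of [g] for
    one of [g ^ k.+1]. *)
Lemma young_pow (R : realType) k (g tau : R) : 0 < tau -> 0 <= g -> g <= tau + (tau ^+ k)^-1 * g ^+ k.+1.
Proof.
move=> t0 g0; have tk : 0 < tau ^+ k by rewrite exprn_gt0.
have [h|h] := leP g tau.
  by apply: le_trans h _; rewrite lerDl mulr_ge0 ?exprn_ge0// invr_ge0 ltW.
rewrite ler_wpDl ?(ltW t0)// mulrC ler_pdivlMr// exprS ler_wpM2l//.
by rewrite lerXn2r ?nnegrE// ltW.
Qed.

(** * A Poincare inequality between level sets *)

Section poincare.
Context (R : realType) (n p : nat).
Local Notation lm := (@lebesgue_measure R).
Variables (V : set 'rV[R]_n) (h : 'rV[R]_n -> 'rV[R]_p) (G : 'rV[R]_n -> R).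

(** An upper gradient along segments parallel to the axes, on almost every line. Unlike weak
    derivatives, it passes directly to slices, to distances to a point and to truncations. *)
Definition upper_gradient := forall j : 'I_n, {ae leb (n:=n), forall x, forall a b : R, a <= b ->
  (forall t, a <= t <= b -> V (upd x j t)) ->
  (`|h (upd x j b) - h (upd x j a)|%:E <= \int[lm]_(t in `[a, b]) (G (upd x j t))%:E)%E}.

Hypothesis oV : open V.
Hypothesis ch : forall x, V x -> {for x, continuous h}.
Hypothesis mG : measurable_fun setT G.
Hypothesis G0 : forall x, 0 <= G x.
Hypothesis ug : upper_gradient.

(** Extended by 0 outside of [V] to be measurable on the whole space. The sublevel sets then contain
    the complement of [V], and are estimated only inside subsets of [V]. *)
Definition hdist (w : 'rV[R]_p) : 'rV[R]_n -> R := (fun y => `|h y - w|) \_ V.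

Let hdistE w y : V y -> hdist w y = `|h y - w|.
Proof. by move=> Vy; rewrite /hdist patchE mem_set. Qed.

Lemma continuous_hdist w y : V y -> {for y, continuous (hdist w)}.
Proof.
move=> Vy; have c1 : {for y, continuous (fun y => `|h y - w|)}.
  apply: (@continuous_comp _ _ _ (fun y => h y - w) (fun z => `|z|)); last exact: norm_continuous.
  by apply: continuousB; [exact: ch|exact: cst_continuous].
move=> A; rewrite hdistE// => /c1 /nbhs_ballP[e1 e10 H1].
have [e2 e20 H2] := open_ballP oV Vy.
apply/nbhs_ballP; exists (Num.min e1 e2); first by rewrite /= lt_min e10.
move=> z; rewrite -ball_normE /ball_ /= lt_min => /andP[z1 z2].
by rewrite hdistE; [apply: H1; rewrite -ball_normE|apply: H2; rewrite distrC].
Qed.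

Lemma measurable_hdist w : measurable_fun setT (hdist w).
Proof.
apply/(measurable_restrictT _ (open_rV_measurable oV)).
apply: (@eq_measurable_fun _ _ _ _ _ (hdist w)); first by move=> y /set_mem Vy; exact: hdistE.
by apply: open_continuous_measurable_rV => // y; exact: continuous_hdist.
Qed.

Lemma continuous_upd (x : 'rV[R]_n) j (t : R) : {for t, continuous (fun t : R => upd x j t)}.
Proof.
apply/cvgrPdist_lt => e e0; near=> s; apply: norm_rV_lt => // i; rewrite !mxE.
case: eqP => _; last by rewrite subrr normr0.
by near: s; apply: (@cvgr_dist_lt _ _ _ _ _ id t) => //; exact: cvg_id.
Unshelve. all: by end_near. Qed.

Lemma measurable_upd (x : 'rV[R]_n) j : measurable_fun setT (fun t : measurableTypeR R => upd x j t).
Proof.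
apply: measurable_fun_to_rV => i; rewrite (_ : (fun t => _) = if i == j then id else cst (x ord0 i)).
  by case: ifP => _; [exact: measurable_id|exact: measurable_cst].
by apply/funext => t; rewrite mxE; case: ifP.
Qed.

Lemma upd_rcube (c x : 'rV[R]_n) r j t : rcube c r x -> coint c r j t -> rcube c r (upd x j t).
Proof.
by move=> xQ tI i; rewrite mxE; case: eqVneq => [->|_]; [exact: tI|exact: xQ].
Qed.

(** [|h - w|] inherits the upper gradient of [h] by the triangle inequality, and [clamp_upper]
    confines it to the levels between [a] and [b]. The integral over the full side of the cube is
    the form that [double_osc] requires. *)
Lemma hdist_line (w : 'rV[R]_p) (c : 'rV[R]_n) r a b j : a <= b -> rcube c r `<=` V ->
  {ae leb (n:=n), forall x, rcube c r x -> forall s : R, coint c r j s ->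
    (`|clamp a b (hdist w x) - clamp a b (hdist w (upd x j s))|%:E <=
    \int[lm]_(t in coint c r j) (G (upd x j t) * (a <= hdist w (upd x j t) <= b)%R%:R)%:E)%E}.
Proof.
move=> ab QV; apply: filterS (ug j) => x ugx xQ s sI.
pose u t := hdist w (upd x j t); pose g t := G (upd x j t).
have mu : measurable_fun setT u by exact: measurableT_comp (measurable_hdist w) (measurable_upd x j).
have mg : measurable_fun setT g by exact: measurableT_comp mG (measurable_upd x j).
have VI t : coint c r j t -> V (upd x j t) by move=> tI; apply: QV; exact: upd_rcube.
have xI : coint c r j (x ord0 j) by exact: xQ.
have conv s' t' t : coint c r j s' -> coint c r j t' -> s' <= t <= t' -> coint c r j t.
  rewrite /coint /= !in_itv/= => /andP[h1 _] /andP[_ h2] /andP[h3 h4].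
  by rewrite (le_trans h1 h3) (le_trans h4 h2).
have main s' t' : s' <= t' -> coint c r j s' -> coint c r j t' ->
    (`|clamp a b (u t') - clamp a b (u s')|%:E <=
    \int[lm]_(t in coint c r j) (g t * (a <= u t <= b)%R%:R)%:E)%E.
  move=> st sI' tI'.
  apply: (@le_trans _ _ (\int[lm]_(t in `[s', t']) (g t * (a <= u t <= b)%R%:R)%:E)%E).
    apply: clamp_upper => //.
    - move=> t tst; apply: (@continuous_comp _ _ _ (fun t => upd x j t) (hdist w)); first exact: continuous_upd.
      by apply: continuous_hdist; apply: VI; exact: conv tst.
    - by move=> t; exact: G0.
    - move=> y z sy yz zt; apply: le_trans (ugx _ _ yz _).
        rewrite lee_fin /u !hdistE; last 2 first.
        - by apply/VI/(conv _ _ _ sI' tI'); rewrite sy (le_trans yz zt).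
        - by apply/VI/(conv _ _ _ sI' tI'); rewrite (le_trans sy yz) zt.
        by apply: le_trans (ler_dist_dist _ _) _; rewrite opprB addrA subrK.
      move=> t /andP[t1 t2]; apply/VI/(conv _ _ _ sI' tI').
      by rewrite (le_trans sy t1) (le_trans t2 zt).
  have mgc : measurable_fun setT (fun t => (g t * (a <= u t <= b)%R%:R)%:E).
    apply/measurable_EFinP/measurable_funM => //.
    rewrite (_ : (fun z => _) = \1_(u @^-1` `[a, b]%classic)).
      by apply: measurable_indic; rewrite -[X in measurable X]setTI; exact: mu.
    apply/funext => z; rewrite indicE; have -> // : (z \in u @^-1` `[a, b]%classic) = (a <= u z <= b).
    by apply/idP/idP => [/set_mem|?]; [|apply/mem_set]; rewrite /= in_itv.
  apply: ge0_subset_integral => //; first exact: measurable_coint.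
  - exact: measurable_funTS.
  - by move=> t _; rewrite lee_fin mulr_ge0// G0.
  - by move=> t /=; rewrite in_itv/=; exact: conv.
have -> : hdist w x = u (x ord0 j) by rewrite /u upd_same.
have [le|/ltW le] := leP (x ord0 j) s; last exact: main.
by rewrite distrC; exact: main.
Qed.

(** The truncation at levels [a] and [b] differs by exactly [b - a] between a point of the sublevel
    set and a point of the superlevel set; restricting the double integral of [double_osc] to such
    pairs bounds it from below. *)
Lemma poincare_level (w : 'rV[R]_p) (c : 'rV[R]_n) (r a b al : R) : 0 < r -> rcube c r `<=` V -> a < b -> 0 <= al ->
  (al%:E <= leb (rcube c r `&` [set y | hdist w y <= a]%R))%E ->
  (al%:E <= leb (rcube c r `&` [set y | b <= hdist w y]%R))%E ->
  (((b - a) * al * al)%:E <= (n%:R * (r *+ 2) ^+ n.+1)%:E *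
    \int[leb (n:=n)]_(y in rcube c r) (G y * (a <= hdist w y <= b)%R%:R)%:E)%E.
Proof.
move=> r0 QV ab al0 hA hB; set Q := rcube c r.
pose v := clamp a b \o hdist w.
have mh := measurable_hdist w.
have mv : measurable_fun setT v.
  apply: (@measurableT_comp _ _ _ _ _ _ (clamp a b)) => //.
  by apply: measurable_maxr => //; apply: measurable_minr.
have mG' : measurable_fun setT (fun y => G y * (a <= hdist w y <= b)%R%:R).
  apply: measurable_funM => //.
  rewrite (_ : (fun z => _) = \1_(hdist w @^-1` `[a, b]%classic)).
    by apply: measurable_indic; rewrite -[X in measurable X]setTI; exact: mh.
  apply/funext => z; rewrite indicE; have -> // : (z \in hdist w @^-1` `[a, b]%classic) = (a <= hdist w z <= b).
  by apply/idP/idP => [/set_mem|?]; [|apply/mem_set]; rewrite /= in_itv.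
have mQ : measurable Q by exact: measurable_rcube.
apply: le_trans (@double_osc R n c r v _ (ltW r0) mv mG' (fun x => mulr_ge0 (G0 x) (ler0n _ _))
  (fun j => hdist_line w j (ltW ab) QV)).
set A := Q `&` _ in hA; set B := Q `&` _ in hB.
have mA : measurable A.
  apply: measurableI => //; rewrite -[X in measurable X]setTI.
  by rewrite (_ : [set y | _] = hdist w @^-1` `]-oo, a]%classic); [exact: mh|apply/seteqP; split => y /=; rewrite in_itv].
have mB : measurable B.
  apply: measurableI => //; rewrite -[X in measurable X]setTI.
  by rewrite (_ : [set y | _] = hdist w @^-1` `[b, +oo[%classic); [exact: mh|apply/seteqP; split => y /=; rewrite in_itv/= andbT].
have mvv : measurable_fun setT (fun z : 'rV[R]_n * 'rV[R]_n => `|v z.1 - v z.2|%:E).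
  apply/measurable_EFinP; apply: measurableT_comp => //.
  by apply: measurable_funB; apply: (measurableT_comp mv).
have mvx x : measurable_fun setT (fun y => `|v x - v y|%:E).
  apply/measurable_EFinP; apply: measurableT_comp => //.
  by apply: measurable_funB => //; exact: measurable_cst.
have mI D : measurable D -> measurable_fun setT (fun x => \int[leb (n:=n)]_(y in D) `|v x - v y|%:E)%E.
  by move=> mD; apply: (@dom_measurable _ _ _ _ _ (leb (n:=n)) D (fun z => `|v z.1 - v z.2|%:E)%E mD).
apply: (@le_trans _ _ (\int[leb (n:=n)]_(x in A) \int[leb (n:=n)]_(y in Q) `|v x - v y|%:E)%E); last first.
  apply: ge0_subset_integral => //.
  - by apply: measurable_funTS; exact: mI.
  - by move=> x _; apply: integral_ge0.
  - by move=> x [].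
have ba0 : 0 <= b - a by rewrite subr_ge0 ltW.
apply: (@le_trans _ _ (\int[leb (n:=n)]_(x in A) ((b - a) * al)%:E)%E).
  apply: (@le_trans _ _ (((b - a) * al)%:E * leb A)%E); last first.
    by have <- := integral_cst (leb (n:=n)) mA ((b - a) * al)%:E; exact: lexx.
  by rewrite EFinM; apply: lee_wpmul2l => //; rewrite lee_fin mulr_ge0.
apply: ge0_le_integral => //.
- by move=> x _; rewrite lee_fin mulr_ge0.
- by apply: measurable_funTS; exact: mI.
move=> x [Qx xa].
apply: (@le_trans _ _ (\int[leb (n:=n)]_(y in B) `|v x - v y|%:E)%E); last first.
  apply: ge0_subset_integral => //; first exact: measurable_funTS.
  by move=> y [].
apply: (@le_trans _ _ (\int[leb (n:=n)]_(x in B) (b - a)%:E)%E).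
  apply: (@le_trans _ _ ((b - a)%:E * leb B)%E); last first.
    by have <- := integral_cst (leb (n:=n)) mB (b - a)%:E; exact: lexx.
  by rewrite EFinM; apply: lee_wpmul2l.
apply: ge0_le_integral => //; first exact: measurable_funTS.
move=> y [Qy yb]; rewrite /v /= /clamp lee_fin.
rewrite (min_idPl yb) (max_idPr (ltW ab)) (min_idPr (le_trans xa (ltW ab))) (max_idPl xa).
by rewrite distrC ger0_norm.
Qed.

Lemma measurable_hdist_le w (a : R) : measurable [set y | hdist w y <= a].
Proof.
rewrite -[X in measurable X]setTI.
by rewrite (_ : [set y | _] = hdist w @^-1` `]-oo, a]%classic); [exact: measurable_hdist|apply/seteqP; split => y /=; rewrite in_itv].
Qed.

Lemma measurable_hdist_ge w (a : R) : measurable [set y | a <= hdist w y].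
Proof.
rewrite -[X in measurable X]setTI.
by rewrite (_ : [set y | _] = hdist w @^-1` `[a, +oo[%classic); [exact: measurable_hdist|apply/seteqP; split => y /=; rewrite in_itv/= andbT].
Qed.

Lemma measurable_powG k : measurable_fun setT (fun y => (G y ^+ k)%:E).
Proof. by apply/measurable_EFinP; exact: measurable_funX. Qed.

(** [poincare_level] at the levels [la * rho] and [rho], followed by [young_pow]. With the exponent
    equal to the dimension the side [L] of the cube cancels, so that the bound depends on [rho]
    alone. *)
Lemma good_scale k (w : 'rV[R]_p) (c : 'rV[R]_n) (r rho la ka : R) : n = k.+1 -> 0 < r -> rcube c r `<=` V ->
  0 < rho -> 0 < la < 1 -> 0 < ka ->
  ((ka * (r *+ 2) ^+ n)%:E <= leb (rcube c r `&` [set y | hdist w y <= la * rho]%R))%E ->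
  ((ka * (r *+ 2) ^+ n)%:E <= leb (rcube c r `&` [set y | rho <= hdist w y]%R))%E ->
  ((((1 - la) * ka ^+ 2 / (2 * n%:R) * rho) ^+ n)%:E <=
    \int[leb (n:=n)]_(y in rcube c r `&` [set y | hdist w y <= rho]%R) (G y ^+ n)%:E)%E.
Proof.
move=> nk r0 QV rho0 /andP[la0 la1] ka0 hA hB; set th := (1 - la) * _ / _.
have L0 : 0 < r *+ 2 by rewrite mulrn_wgt0.
set L := r *+ 2 in hA hB L0 *.
have n0 : 0 < n%:R :> R by rewrite nk.
have th0 : 0 < th by rewrite divr_gt0 ?mulr_gt0 ?exprn_gt0// subr_gt0.
(* With this value and the factor 2 in the denominator of [th], the first term of [young_pow]
   contributes half of the left-hand side of the Poincare inequality. *)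
pose tau := th * rho / L; have tau0 : 0 < tau by rewrite divr_gt0// mulr_gt0.
have tauL : tau * L = th * rho by rewrite divfK// gt_eqF.
set Q := rcube c r; set D := Q `&` [set y | hdist w y <= rho].
have mQ : measurable Q by exact: measurable_rcube.
have mD : measurable D by apply: measurableI => //; exact: measurable_hdist_le.
set X := (\int[leb (n:=n)]_(y in D) (G y ^+ n)%:E)%E.
have X0 : (0 <= X)%E by apply: integral_ge0 => y _; rewrite lee_fin exprn_ge0.
have al0 : 0 <= ka * L ^+ n by rewrite mulr_ge0 ?exprn_ge0// ltW.
have lr : la * rho < rho by rewrite gtr_pMl.
have := poincare_level r0 QV lr al0 hA hB.
have I1 : (\int[leb (n:=n)]_(y in Q) (G y * (la * rho <= hdist w y <= rho)%R%:R)%:E <=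
    (tau * L ^+ n)%:E + ((tau ^+ k)^-1)%:E * X)%E.
  have tk0 : 0 <= (tau ^+ k)^-1 by rewrite invr_ge0 exprn_ge0// ltW.
  have -> : (((tau ^+ k)^-1)%:E * X = \int[leb (n:=n)]_(y in Q) (((tau ^+ k)^-1)%:E * (\1_D y * G y ^+ n)%:E))%E.
    rewrite ge0_integralZl//; last 2 first.
    - apply/measurable_EFinP; apply: measurable_funTS; apply: measurable_funM; last exact: measurable_funX.
      exact: measurable_indic.
    - by move=> y _; rewrite lee_fin mulr_ge0// exprn_ge0.
    congr (_ * _)%E; rewrite /X [LHS]integral_mkcond [RHS]integral_mkcond; apply: eq_integral => y _.
    rewrite !patchE indicE; case: ifPn => yD; last by case: ifP => //; rewrite mul0r.
    by rewrite mul1r mem_set//; have [] := set_mem yD.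
  have -> : ((tau * L ^+ n)%:E = \int[leb (n:=n)]_(y in Q) tau%:E)%E.
    apply: etrans (esym (integral_cst (leb (n:=n)) mQ tau%:E)).
    by rewrite EFinM; congr (_ * _)%E; rewrite [RHS]leb_rcube// ltW.
  have mDG : measurable_fun Q (fun y => ((tau ^+ k)^-1)%:E * (\1_D y * G y ^+ n)%:E)%E.
    apply: measurable_funeM; apply/measurable_EFinP; apply: measurable_funTS.
    by apply: measurable_funM; [exact: measurable_indic|exact: measurable_funX].
  rewrite -ge0_integralD//; last 2 first.
  - by move=> y _; rewrite lee_fin ltW.
  - by move=> y _; rewrite mule_ge0// lee_fin// mulr_ge0// exprn_ge0.
  apply: ge0_le_integral => //.
  - by move=> y _; rewrite lee_fin mulr_ge0.
  - apply: measurable_funTS; apply/measurable_EFinP; apply: measurable_funM => //.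
    rewrite (_ : (fun z => _) = \1_(hdist w @^-1` `[la * rho, rho]%classic)).
      by apply: measurable_indic; rewrite -[X in measurable X]setTI; exact: measurable_hdist.
    apply/funext => z; rewrite indicE; have -> // : (z \in hdist w @^-1` `[la * rho, rho]%classic) = (la * rho <= hdist w z <= rho).
    by apply/idP/idP => [/set_mem|?]; [|apply/mem_set]; rewrite /= in_itv.
  - by apply: emeasurable_funD.
  move=> y Qy; rewrite -EFinM -EFinD lee_fin indicE.
  case: (boolP (_ <= _ <= _)) => [/andP[_ yr]|_]; last first.
    by rewrite mulr0 addr_ge0 ?(ltW tau0)// mulr_ge0// mulr_ge0// exprn_ge0.
  by rewrite mulr1 mem_set//= mul1r nk; exact: young_pow.
move=> I2; have {I1}I2 := le_trans I2 (lee_wpmul2l _ I1).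
have cn0 : (0 <= (n%:R * L ^+ n.+1)%:E :> \bar R)%E by rewrite lee_fin mulr_ge0// exprn_ge0// ltW.
have {}I2 := I2 cn0.
have [Xf|] := boolP (X \is a fin_num); last first.
  by rewrite ge0_fin_numE// -leNgt leye_eq => /eqP ->; exact: leey.
rewrite -(fineK Xf) in I2 *; move: (fine X) I2 => x.
have -> : ((n%:R * (r *+ 2) ^+ n.+1)%:E * ((tau * L ^+ n)%:E + (tau ^- k)%:E * x%:E) =
  (n%:R * (r *+ 2) ^+ n.+1 * (tau * L ^+ n + tau ^- k * x))%:E)%E by [].
rewrite !lee_fin => I2; rewrite nk.
apply: (young_scale L0 tau0 tauL); move: I2; rewrite nk; apply: le_trans.
rewrite le_eqVlt; apply/orP; left; apply/eqP.
rewrite exprD /th -nk; set N := n%:R in n0 *; set Y := L ^+ n.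
by field; rewrite gt_eqF.
Qed.

End poincare.

Lemma meas_bigU_le d (T : measurableType d) (R : realType) (m : {measure set T -> \bar R}) (I : Type)
    (t : seq I) (A : I -> set T) : (forall i, measurable (A i)) ->
  measurable (\big[setU/set0]_(i <- t) A i) /\ (m (\big[setU/set0]_(i <- t) A i) <= \sum_(i <- t) m (A i))%E.
Proof.
move=> mA; elim: t => [|i t [mt IH]]; first by rewrite !big_nil measure0; split.
rewrite !big_cons; split; first exact: measurableU.
by apply: le_trans (measureU2 _ _ _) _ => //; rewrite leeD2l.
Qed.

(** * Null sets of points with decaying oscillation *)

Section lusin.
Context (R : realType) (n : nat).
Local Notation lm := (@lebesgue_measure R).
Variables (V : set 'rV[R]_n) (h : 'rV[R]_n -> 'rV[R]_n) (G : 'rV[R]_n -> R).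
Hypothesis n0 : (0 < n)%N.
Hypothesis oV : open V.
Hypothesis ch : forall x, V x -> {for x, continuous h}.

(** The graph of [h] over [V] is null, its sections being points; Fubini in the other order makes
    almost every fibre null. Values with a fibre of positive measure are out of reach of
    [scale_exists] and are covered separately. *)
Lemma negligible_level_values : (leb (n:=n)).-negligible [set w | leb (V `&` [set y | h y = w]) <> 0%E].
Proof.
have mV := open_rV_measurable oV.
pose hc i := (fun y => h y ord0 i) \_ V.
have mhc i : measurable_fun setT (hc i).
  apply/(measurable_restrictT _ mV); apply: open_continuous_measurable_rV => // y Vy.
  by apply: (@continuous_comp _ _ _ h (fun z : 'rV[R]_n => z ord0 i)); [exact: ch|exact: coord_continuous].
pose Ga : set ('rV[R]_n * 'rV[R]_n) := [set z | V z.1 /\ h z.1 = z.2].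
have GaE : Ga = (V `*` setT) `&` \bigcap_(i in [set: 'I_n]) ((fun z : 'rV[R]_n * 'rV[R]_n => hc i z.1 - z.2 ord0 i) @^-1` [set 0]).
  apply/seteqP; split => [[y w] [/= Vy hy]|[y w] [/= [Vy _] H]].
    by split => // i _ /=; rewrite /hc patchE mem_set// hy subrr.
  split => //; apply/rowP => i; have := H i I; rewrite /= /hc patchE mem_set// => /eqP.
  by rewrite subr_eq0 => /eqP.
have mGa : measurable Ga.
  rewrite GaE; apply: measurableI; first exact: measurableX.
  apply: fin_bigcap_measurable => // i _; rewrite -[X in measurable X]setTI.
  have mf : measurable_fun setT (fun z : 'rV[R]_n * 'rV[R]_n => hc i z.1 - z.2 ord0 i).
    apply: measurable_funB; first exact: measurableT_comp (mhc i) _.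
    by apply: measurableT_comp (measurable_coordT i) _.
  by apply: mf => //; exact: measurable_set1.
have Ga0 : (leb (n:=n) \x leb (n:=n))%E Ga = 0%E.
  apply: ae_product_null => //; apply: aeW => y.
  have mxs : measurable (xsection Ga y) by exact: measurable_xsection.
  apply/eqP; rewrite eq_le measure_ge0 andbT.
  have <- : leb (rcube (h y) 0) = 0%E.
    by rewrite [LHS]leb_rcube// mul0rn expr0n; case: (n) n0.
  apply: le_meas => //; first exact: measurable_rcube.
  by move=> w /xsectionP[/= _ ->]; apply/rcubeP => //; rewrite subrr normr0.
have : {ae (leb (n:=n) \x leb (n:=n))%E, forall z, ~ Ga z}.
  by exists Ga; split => // z /= /contrapT.
move=> /ae_prod_swap; apply: negligibleS => w /= wn0 H; apply: wn0.
have mVw : measurable (V `&` [set y | h y = w]).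
  have -> : V `&` [set y | h y = w] = ysection Ga w.
    by apply/seteqP; split => [y Vy|y /ysectionP//]; apply/ysectionP.
  exact: measurable_ysection.
have [N [mN N0 HN]] := H; apply/eqP; rewrite eq_le measure_ge0 andbT -[X in (_ <= X)%E]N0.
by apply: le_meas => // y [Vy hy]; apply: HN => /=; apply.
Qed.

Hypothesis mG : measurable_fun setT G.
Hypothesis G0 : forall x, 0 <= G x.
Hypothesis ug : upper_gradient V h G.

Let rr j : R := 2^-1 ^+ j.
Let rr0 j : 0 < rr j. Proof. by rewrite exprn_gt0. Qed.

(** At arbitrarily small scales, the set where [|h - h x| >= c * la ^ j] fills less than half of the
    cube of radius [2 ^ -j], however small [c] is. Besides the integrability of [G ^ n], this is all
    that [lusin_core] retains of the two cases. *)
Definition decay la x := forall c : R, 0 < c -> forall j0 : nat, exists j, (j0 <= j)%N /\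
  (leb (rcube x (2^-1 ^+ j) `&` [set y | c * la ^+ j <= hdist V h (h x) y]%R) <
    (2^-1 * (2^-1 ^+ j *+ 2) ^+ n)%:E)%E.

Lemma small_scale (e : R) : 0 < e -> exists j, rr j < e.
Proof.
move=> e0; have [j je] : exists j : nat, j.+1%:R^-1 < e.
  by have := near_infty_natSinv_lt (PosNum e0); move/filter_ex.
exists j; apply: le_lt_trans je; rewrite /rr exprVn lef_pV2 ?posrE ?exprn_gt0//.
by rewrite -natrX ler_nat ltn_expl.
Qed.

Let mge w a := measurable_hdist_ge oV ch w a.
Let mle w a := measurable_hdist_le oV ch w a.
Let hd := hdist V h.

(** As the fibre of [h x] is null, [|h - h x| >= c * la ^ j0] on half of the cube of index [j0] once
    [c] is small, and by [decay] the analogue fails at some later index. So there is a transition: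
    at some [j], with [rho = c * la ^ j], the levels above [rho] fill half of the cube, and at
    [j.+1] the levels below [la * rho] fill half of the smaller one. This is the situation of
    [good_scale]. *)
Lemma scale_exists la O x : 0 < la < 1 -> open O -> O `<=` V -> O x -> decay la x ->
  leb (V `&` [set y | h y = h x]) = 0%E ->
  let th := (1 - la) * (2^-1 ^+ n.+1) ^+ 2 / (2 * n%:R) in
  exists rho : R, 0 < rho <= 1 /\
    (((th * rho) ^+ n)%:E <= \int[leb (n:=n)]_(y in O `&` [set y | hd (h x) y <= rho]%R) (G y ^+ n)%:E)%E.
Proof.
move=> la01 oO OV Ox dec lev0 th; have /andP[la0 la1] := la01.
have [e e0 He] := open_ballP oO Ox.
have [j0 j0e] := small_scale e0.
have QO j : (j0 <= j)%N -> rcube x (rr j) `<=` O.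
  move=> jj y /rcubeP => /(_ (ltW (rr0 j))) yx; apply: He; apply: le_lt_trans yx _.
  by apply: le_lt_trans j0e; rewrite /rr ler_wiXn2l// invf_le1// ler1n.
have mQ j : measurable (rcube x (rr j)) by exact: measurable_rcube.
have lQ j : leb (rcube x (rr j)) = ((rr j *+ 2) ^+ n)%:E by rewrite [LHS]leb_rcube// ltW.
pose B i := rcube x (rr j0) `&` [set y | i.+1%:R^-1 * la ^+ j0 <= hd (h x) y].
have mB i : measurable (B i) by apply: measurableI => //; exact: mge.
have Bcup : (leb (rcube x (rr j0)) <= leb (\bigcup_i B i))%E.
  have mc : measurable (\bigcup_i B i) by exact: bigcup_measurable.
  have mV : measurable V by exact: open_rV_measurable.
  have mz : measurable (V `&` [set y | h y = h x]).
    have -> : V `&` [set y | h y = h x] = V `&` [set y | hd (h x) y <= 0].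
      apply/seteqP; split => y [Vy]; rewrite /= /hd /hdist patchE mem_set//.
        by move=> ->; rewrite subrr normr0.
      by rewrite normr_le0 subr_eq0 => /eqP.
    by apply: measurableI => //; exact: mle.
  apply: (@le_trans _ _ (leb (\bigcup_i B i) + leb (V `&` [set y | h y = h x]))%E); last by rewrite lev0 adde0.
  apply: le_trans (measureU2 _ mc mz); apply: le_meas => //; first exact: measurableU.
  move=> y Qy; have Vy : V y by apply/OV/(QO j0).
  have [hy|hy] := pselect (h y = h x); [by right|left].
  have p0 : 0 < hd (h x) y.
    by rewrite /hd /hdist patchE mem_set// normr_gt0 subr_eq0; apply/eqP.
  have q0 : 0 < hd (h x) y / la ^+ j0 by rewrite divr_gt0// exprn_gt0.
  have [i iq] : exists i : nat, i.+1%:R^-1 < hd (h x) y / la ^+ j0.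
    by have := near_infty_natSinv_lt (PosNum q0); move/filter_ex.
  by exists i => //; split => //=; rewrite -ler_pdivlMr ?exprn_gt0// ltW.
have [i Bi] : exists i, ((2^-1 * (rr j0 *+ 2) ^+ n)%:E <= leb (B i))%E.
  apply: contrapT => /forallNP nB.
  have ndB : nondecreasing_seq B.
    move=> a b ab; apply/subsetPset => y [Qy yB]; split => //=; apply: le_trans yB.
    by rewrite ler_wpM2r ?exprn_ge0 ?(ltW la0)// lef_pV2 ?posrE// ler_nat.
  have cv := nondecreasing_cvg_mu (mu := leb (n:=n)) mB (bigcup_measurable (fun k _ => mB k)) ndB.
  have : (leb (\bigcup_i B i) <= (2^-1 * (rr j0 *+ 2) ^+ n)%:E)%E.
    rewrite -(cvg_lim _ cv)//; apply: lime_le; first by apply/cvg_ex; eexists; exact: cv.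
    by apply: nearW => k; have := nB k; move=> /negP; rewrite -ltNge => /ltW.
  move=> /(le_trans Bcup); rewrite lQ lee_fin leNgt => /negP; apply.
  by rewrite gtr_pMl ?exprn_gt0 ?mulrn_wgt0// invf_lt1// ltr1n.
pose c : R := i.+1%:R^-1; have c0 : 0 < c by rewrite invr_gt0.
pose P j := ((2^-1 * (rr j *+ 2) ^+ n)%:E <= leb (rcube x (rr j) `&` [set y | (c * la ^+ j <= hd (h x) y)%R]))%E.
have [j1 [j01 nPj1]] := dec c c0 j0.
have [j jj0 [Pj nPj]] : exists2 j, (j0 <= j)%N & P j /\ ~ P j.+1.
  apply: contrapT => H; have : P j1.
    rewrite -(subnKC j01); elim: (j1 - j0)%N => [|k IH]; first by rewrite addn0.
    rewrite addnS; apply: contrapT => nP; apply: H; exists (j0 + k)%N => //; exact: leq_addr.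
  by rewrite /P leNgt nPj1.
pose rho := c * la ^+ j; have rho0 : 0 < rho by rewrite mulr_gt0// exprn_gt0.
exists rho; split.
  rewrite rho0 /= mulr_ile1 ?(ltW c0) ?exprn_ge0 ?(ltW la0) ?exprn_ile1 ?(ltW la1) ?(ltW la0)//.
  by rewrite invf_le1// ler1n.
have QjV : rcube x (rr j) `<=` V by apply: subset_trans OV; exact: QO.
have [k nk] : exists k, n = k.+1 by case: (n) n0 => // k; exists k.
(* Half of the cube of index [j.+1] is the share [2 ^ -(n+1)] of the cube of index [j]. *)
have ka0 : 0 < 2^-1 ^+ n.+1 :> R by rewrite exprn_gt0.
apply: le_trans (good_scale oV ch mG G0 ug (w := h x) nk (rr0 j) QjV rho0 la01 ka0 _ _) _.
- have -> : 2^-1 ^+ n.+1 * (rr j *+ 2) ^+ n = 2^-1 * (rr j.+1 *+ 2) ^+ n.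
    by rewrite exprS -mulrA -exprMn /rr exprS mulrnAr.
  have /negP := nPj; rewrite -ltNge => lt.
  apply: (@le_trans _ _ (leb (rcube x (rr j.+1) `&` [set y | (hd (h x) y <= la * rho)%R]))%E); last first.
    apply: le_meas.
    - by apply: measurableI => //; exact: mle.
    - by apply: measurableI => //; exact: mle.
    move=> y [Qy yl]; split => //; move/rcubeP: Qy => /(_ (ltW (rr0 _))) Qy; apply/rcubeP; first exact: ltW.
    by apply: le_trans Qy _; rewrite /rr ler_wiXn2l// invf_le1// ler1n.
  have := lQ j.+1.
  have mg1 := measurableI _ _ (mQ j.+1) (mge (h x) (c * la ^+ j.+1)).
  have ml1 := measurableI _ _ (mQ j.+1) (mle (h x) (la * rho)).
  have : (leb (rcube x (rr j.+1)) <= leb (rcube x (rr j.+1) `&` [set y | (c * la ^+ j.+1 <= hd (h x) y)%R]) +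
     leb (rcube x (rr j.+1) `&` [set y | (hd (h x) y <= la * rho)%R]))%E.
    apply: le_trans (measureU2 _ mg1 ml1); apply: le_meas => //; first exact: measurableU.
    move=> y Qy; have [hy|hy] := leP (c * la ^+ j.+1) (hd (h x) y); [by left|right; split => //=].
    by rewrite /rho mulrCA -exprS ltW.
  move=> H1 H2; rewrite H2 in H1.
  have {H1}H1 := le_lt_trans H1 (lte_leD _ lt (lexx _)).
  set z := leb _ in H1 *; have [zf|] := boolP (z \is a fin_num); last first.
    by rewrite ge0_fin_numE ?measure_ge0// -leNgt leye_eq => /eqP ->; exact: leey.
  have {}H1 := H1 zf.
  rewrite -(fineK zf) in H1 *; rewrite -EFinD lte_fin in H1; rewrite lee_fin.
  by move: H1; set a := (_ ^+ n); lra.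
- apply: le_trans Pj; rewrite lee_fin ler_wpM2r ?exprn_ge0 ?mulrn_wge0 ?(ltW (rr0 _))//.
  by rewrite exprS ler_piMr// exprn_ile1// invf_le1// ler1n.
apply: ge0_subset_integral.
- by apply: measurableI => //; exact: mle.
- by apply: measurableI; [exact: open_rV_measurable|exact: mle].
- by apply: measurable_funTS; exact: measurable_powG.
- by move=> y _; rewrite lee_fin exprn_ge0.
- by move=> y [Qy yr]; split => //; exact: (QO j).
Qed.

(* A Vitali covering in the image, not in the domain: by [scale_exists] each ball
   of radius [rho] around a point of [h @` N] carries at least [(th * rho) ^+ n] of
   the integral of [G ^+ n], and preimages of disjoint balls are disjoint. *)
Lemma lusin_core la (N : set 'rV[R]_n) : 0 < la < 1 ->
  (\int[leb (n:=n)]_(x in V) (G x ^+ n)%:E < +oo)%E ->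
  compact N -> N `<=` V -> leb N = 0%E -> (forall x, N x -> decay la x) ->
  (leb (n:=n)).-negligible (h @` N).
Proof.
move=> la01 Gfin cN NV N0 dec; have /andP[la0 la1] := la01.
have mV := open_rV_measurable oV.
have mN := compact_rV_measurable cN.
pose th := (1 - la) * (2^-1 ^+ n.+1) ^+ 2 / (2 * n%:R).
have th0 : 0 < th.
  by rewrite divr_gt0 ?mulr_gt0 ?exprn_gt0 ?subr_gt0 ?ltr0n.
apply: negligible_small => e e0.
(* A cube of radius [3 rho] has volume [(6 / th) ^ n] times [(th * rho) ^ n], and the latter is
   bounded by an integral of [G ^ n]; this factor is compensated here. Half of [e] is kept for the
   values with non-null fibres. *)
pose e1 := e / 2 * (th / 6) ^+ n.
have e10 : 0 < e1 by apply: mulr_gt0; [exact: divr_gt0|apply: exprn_gt0; exact: divr_gt0].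
pose Gn x := G x ^+ n * \1_V x.
have mGn : measurable_fun setT Gn by apply: measurable_funM; [exact: measurable_funX|exact: measurable_indic].
have Gn0 x : 0 <= Gn x by rewrite mulr_ge0// exprn_ge0.
have GnE O : measurable O -> O `<=` V -> (\int[leb (n:=n)]_(x in O) (Gn x)%:E = \int[leb (n:=n)]_(x in O) (G x ^+ n)%:E)%E.
  move=> mO OV; apply: eq_integral => x /set_mem Ox; rewrite /Gn indicE mem_set ?mulr1//; exact: OV.
have iGn : (leb (n:=n)).-integrable setT (EFin \o Gn).
  apply/integrableP; split; first exact/measurable_EFinP.
  apply: le_lt_trans Gfin; rewrite [leRHS]integral_mkcond; apply: ge0_le_integral => //.
  - by apply: measurableT_comp => //; exact/measurable_EFinP.
  - by apply/(measurable_restrictT _ mV); apply: measurable_funTS; exact: measurable_powG.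
  move=> x _; rewrite /= patchE ger0_norm// /Gn indicE; case: ifP; rewrite ?mulr1 ?mulr0//.
have [d [d0 Hd]] := integral_normr_continuous iGn e10.
have d20 : 0 < d / 2 by rewrite divr_gt0.
have [ON [oON NON lON]] := leb_open_approx mN d20.
rewrite N0 add0e in lON.
pose O := ON `&` V.
have oO : open O by exact: openI.
have mO := open_rV_measurable oO.
have OV : O `<=` V by move=> x [].
have intO : (\int[leb (n:=n)]_(x in O) (G x ^+ n)%:E <= e1%:E)%E.
  have lO : (leb O < d%:E)%E.
    apply: (@le_lt_trans _ _ (d / 2)%:E); last by rewrite lte_fin; lra.
    apply: le_trans lON; apply: le_meas => //; first exact: open_rV_measurable.
    by move=> x [].
  have := Hd O mO lO; rewrite -GnE// => /ltW; rewrite -lee_fin; apply: le_trans.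
  have iO : (leb (n:=n)).-integrable O (EFin \o Gn) by exact: integrableS iGn.
  rewrite /Rintegral fineK; last first.
    by apply: integrable_fin_num => //; exact: (integrable_norm iO).
  rewrite le_eqVlt; apply/orP; left; apply/eqP; apply: eq_integral => x _.
  by rewrite ger0_norm.
have [W1 [mW1 W10 sW1]] := negligible_level_values.
have e20 : 0 < e / 2 by rewrite divr_gt0.
have [W' [oW' W1W' lW']] := leb_open_approx mW1 e20.
have mW' := open_rV_measurable oW'.
have {lW'}lW' : (leb W' <= (e / 2)%:E)%E.
  by apply: le_trans lW' _; rewrite [X in (X + _)%E]W10 add0e.
(* The exceptional values are removed through an open set of measure at most [e / 2], so that the
   remaining values form a compact set and finitely many balls suffice. *)
pose K := h @` N `\` W'.
have chN : compact (h @` N).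
  apply: continuous_compact => //; apply: continuous_in_subspaceT => x /set_mem Nx.
  by apply: ch; exact: NV.
have cK : compact K by apply: compact_closedI => //; exact: open_closedC.
have /choice[rho rhoP] : forall w, exists r : R, K w -> 0 < r <= 1 /\
    (((th * r) ^+ n)%:E <= \int[leb (n:=n)]_(y in O `&` [set y | hd w y <= r]%R) (G y ^+ n)%:E)%E.
  move=> w; have [[[x Nx <-] nW]|nK] := pselect (K w); last by exists 0.
  have Ox : O x by split; [exact: NON|exact: NV].
  have [|r rP] := @scale_exists la O x la01 oO OV Ox (dec x Nx); last by exists r.
  by apply: contrapT => H; apply: nW; apply: W1W'; apply: sW1.
have [D DK KD] : finite_subset_cover K (fun w => ball w (rho w)) K.
  have := cK; rewrite compact_cover; apply.
    by move=> w /rhoP[/andP[r0 _] _]; exact: ball_open.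
  by move=> w Kw; exists w => //; have [/andP[r0 _] _] := rhoP w Kw; exact: ballxx.
pose s := [seq (w, rho w) | w <- finmap.enum_fset D].
have sP i : i \in s -> K i.1 /\ i.2 = rho i.1.
  by move=> /mapP[w wD ->]; split => //; exact: set_mem (DK w wD).
have [|t [ts tfar tP]] := @finite_vitali R n s.
  by move=> i /sP[Ki ->]; have [/andP[/ltW ? _] _] := rhoP _ Ki.
pose A (i : 'rV[R]_n * R) := rcube i.1 (3 * i.2).
have mA i : measurable (A i) by exact: measurable_rcube.
have [mU leU] := meas_bigU_le (leb (n:=n)) t mA.
exists (W' `|` \big[setU/set0]_(i <- t) A i); split.
- exact: measurableU.
- move=> w Nw; have [Ww|nWw] := pselect (W' w); [by left|right].
  have [w' /= w'D ww'] := KD w (conj Nw nWw).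
  have w's : (w', rho w') \in s by apply/mapP; exists w'.
  have [j jt Hj] := tP _ w's.
  rewrite -bigcup_seq; exists j => //=.
  have [Kj j2] := sP j (ts j jt); have [/andP[r0 _] _] := rhoP _ Kj.
  apply/rcubeP; first by rewrite mulr_ge0// j2 ltW.
  by apply: Hj => /=; move: ww'; rewrite -ball_normE /ball_ /= distrC => /ltW.
apply: le_trans (measureU2 _ mW' mU) _.
have -> : (e%:E = (e / 2)%:E + (e / 2)%:E)%E by rewrite -EFinD -splitr.
apply: leeD => //; apply: le_trans leU _.
apply: (@le_trans _ _ (\sum_(i <- t) ((6 / th) ^+ n)%:E * \int[leb (n:=n)]_(y in O `&` [set y | hd i.1 y <= i.2]%R) (G y ^+ n)%:E)%E).
  rewrite big_seq [leRHS]big_seq; apply: lee_sum => i it.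
  have [Ki i2] := sP i (ts i it); have [/andP[r0 _] Hr] := rhoP _ Ki.
  rewrite [leLHS]leb_rcube; last by rewrite mulr_ge0// i2 ltW.
  rewrite i2; apply: (@le_trans _ _ (((6 / th) ^+ n)%:E * ((th * rho i.1) ^+ n)%:E)%E).
    rewrite -EFinM lee_fin -exprMn mulrA divfK ?gt_eqF//.
    rewrite le_eqVlt; apply/orP; left; apply/eqP; congr (_ ^+ n); rewrite mulr2n; lra.
  by apply: lee_wpmul2l => //; rewrite lee_fin exprn_ge0// divr_ge0// ltW.
rewrite -ge0_sume_distrr; last by move=> i _; apply: integral_ge0 => y _; rewrite lee_fin exprn_ge0.
have sd : (\sum_(i <- t) \int[leb (n:=n)]_(y in O `&` [set y | hd i.1 y <= i.2]%R) (G y ^+ n)%:E <= e1%:E)%E.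
  have E i : O `&` [set y | (hd i.1 y <= i.2)%R] = O `&` (V `&` [set y | (hd i.1 y <= i.2)%R]).
    by apply/seteqP; split => y [Oy]; [move=> ?; split => //; split => //; exact: OV|move=> []].
  rewrite (eq_bigr _ (fun i _ => congr1 (fun D => \int[leb (n:=n)]_(y in D) (G y ^+ n)%:E)%E (E i))).
  apply: le_trans intO; apply: (@sum_disj _ _ _ (leb (n:=n)) _ t (fun i => V `&` [set y | hd i.1 y <= i.2])%R) => //.
  - by move=> i; apply: measurableI => //; exact: mle.
  - by apply: measurable_funTS; exact: measurable_powG.
  - by move=> y; rewrite lee_fin exprn_ge0.
  apply: sub_pairwise tfar => i j ij; apply/asboolP/seteqP; split => // y [[Vy]].
  rewrite /= /hd /hdist !patchE mem_set// => h1 [_ h2].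
  have := ler_distD (h y) i.1 j.1; rewrite [`|i.1 - h y|]distrC => h3.
  by move: ij; rewrite /far ltNge (le_trans h3)// lerD.
apply: le_trans (lee_wpmul2l _ sd) _; first by rewrite lee_fin exprn_ge0// divr_ge0// ltW.
rewrite -EFinM lee_fin /e1 mulrCA -exprMn.
have -> : 6 / th * (th / 6) = 1 by rewrite mulrA divfK ?gt_eqF// divff.
by rewrite expr1n mulr1.
Qed.

End lusin.

Lemma geom_small (R : realType) (be la K c : R) j0 : 0 < be -> be < la -> 0 < c ->
  exists j, (j0 <= j)%N /\ K * be ^+ j < c * la ^+ j.
Proof.
move=> b0 bl c0; have la0 := lt_trans b0 bl.
have q1 : `|be / la| < 1 by rewrite ger0_norm ?divr_ge0 ?ltW// ltr_pdivrMr// mul1r.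
have K0 : 0 < c / (`|K| + 1) by rewrite divr_gt0// ltr_wpDl.
have : \forall j \near \oo, (j0 <= j)%N /\ (be / la) ^+ j < c / (`|K| + 1).
  by apply: filterI; [exact: nbhs_infty_ge|exact: (cvgr_lt 0 (cvg_expr q1))].
move=> /filter_ex[j [jj H]]; exists j; split => //.
have l0 : 0 < la ^+ j by rewrite exprn_gt0.
move: H; rewrite expr_div_n ltr_pdivrMr// mulrAC ltr_pdivlMr ?ltr_wpDl//; apply: le_lt_trans.
rewrite mulrC ler_wpM2l ?exprn_ge0 ?(ltW b0)//.
by rewrite (le_trans (ler_norm _))// lerDl.
Qed.

Lemma young_powR (R : realType) (q g tau : R) : 1 <= q -> 0 < tau -> 0 <= g ->
  g <= tau + tau `^ (1 - q) * g `^ q.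
Proof.
move=> q1 t0 g0; have [h1|h1] := leP g tau.
  by apply: le_trans h1 _; rewrite lerDl mulr_ge0 ?powR_ge0.
have gp := lt_trans t0 h1.
have gE : g `^ q = g * g `^ (q - 1).
  transitivity (g `^ 1 * g `^ (q - 1)); last by rewrite powRr1.
  rewrite -powRD; last by rewrite (gt_eqF gp) implybT.
  by congr (_ `^ _); ring.
have tE : tau `^ (1 - q) = (tau `^ (q - 1))^-1 by rewrite -powRN opprB.
rewrite gE tE mulrCA ler_wpDl ?(ltW t0)// ler_peMr//.
rewrite ler_pdivlMl ?powR_gt0// mulr1.
by apply: ge0_ler_powR; rewrite ?subr_ge0// ?nnegrE ltW.
Qed.

(** * Decay of the oscillation *)

Section decay.
Context (R : realType) (n : nat).
Variables (V : set 'rV[R]_n) (h : 'rV[R]_n -> 'rV[R]_n) (G : 'rV[R]_n -> R).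
Hypothesis n0 : (0 < n)%N.
Hypothesis oV : open V.
Hypothesis ch : forall x, V x -> {for x, continuous h}.

Let L0 j : 0 < (2^-1 ^+ j *+ 2 : R). Proof. by rewrite mulrn_wgt0// exprn_gt0. Qed.
Let Ln0 j : 0 < 2^-1 * (2^-1 ^+ j *+ 2) ^+ n :> R. Proof. by rewrite mulr_gt0// exprn_gt0. Qed.

Lemma powR_half (a : R) : 0 < a -> 0 < (2^-1 : R) `^ a < 1.
Proof.
move=> a0; rewrite powR_gt0 ?invr_gt0//=.
have h1 : (2^-1 : R) `^ a < 1 `^ a by rewrite gt0_ltr_powR ?nnegrE ?invr_ge0// invf_lt1// ltr1n.
by rewrite powR1 in h1.
Qed.

Lemma powR_scale (a : R) j : (2^-1 ^+ j : R) `^ a = ((2^-1 : R) `^ a) ^+ j.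
Proof.
rewrite -powR_mulrn ?invr_ge0// -powRrM mulrC powRrM powR_mulrn// powR_ge0.
Qed.

Lemma decay_hoelder (al C : R) x : 0 < al -> V x ->
  (forall y, V y -> `|h y - h x| <= C * `|y - x| `^ al) ->
  decay V h ((1 + (2^-1 : R) `^ al) / 2) x.
Proof.
move=> al0 Vx hC c c0 j0; have /andP[b0 b1] := powR_half al0.
set be := _ `^ _ in b0 b1 *.
have bl : be < (1 + be) / 2 by lra.
have [j [jj H]] := geom_small `|C| j0 b0 bl c0; exists j; split => //.
rewrite (_ : _ `&` _ = set0) ?measure0 ?lte_fin//.
apply/seteqP; split => // y [Qy /=]; rewrite leNgt => /negP; apply.
apply: le_lt_trans H; rewrite /hdist patchE; case: ifPn => [/set_mem Vy|_]; last first.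
  by rewrite mulr_ge0// exprn_ge0// ltW.
apply: le_trans (hC _ Vy) _; apply: (@le_trans _ _ (`|C| * `|y - x| `^ al)).
  by rewrite ler_wpM2r ?powR_ge0// ler_norm.
rewrite ler_wpM2l// -powR_scale ge0_ler_powR// ?nnegrE// ?(ltW al0)//; last first.
  by move/rcubeP: Qy; apply; rewrite exprn_ge0.
Qed.

Hypothesis mG : measurable_fun setT G.
Hypothesis G0 : forall x, 0 <= G x.
Hypothesis ug : upper_gradient V h G.
Variable q : R.
Hypothesis nq : n%:R < q.
Hypothesis Gq : (\int[leb (n:=n)]_(x in V) (G x `^ q)%:E < +oo)%E.

Let nR0 : 0 < n%:R :> R. Proof. by rewrite ltr0n. Qed.
Let q0 : 0 < q. Proof. exact: lt_trans nR0 nq. Qed.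
(** The exponent of Morrey's embedding of [W^{1,q}] into Hoelder continuous functions. *)
Let al := 1 - n%:R / q.
Let al0 : 0 < al. Proof. by rewrite subr_gt0 ltr_pdivrMr// mul1r. Qed.
Let be : R := (2^-1 : R) `^ al.
Let X := fine (\int[leb (n:=n)]_(x in V) (G x `^ q)%:E).
Let X0 : 0 <= X. Proof. by apply: fine_ge0; apply: integral_ge0 => x _; rewrite lee_fin powR_ge0. Qed.
Let be01 : 0 < be < 1. Proof. exact: powR_half. Qed.

(** [2 ^ (n + n + 2)] is the inverse square of the share [2 ^ -(n+1)], the other 2 bounds [2 ^ al],
    and [1 + X] collects the two terms of [young_powR]. *)
Let M := n%:R * 2 * 2 ^+ (n + n + 2) * (1 + X).

(** [poincare_level] and [young_powR] with [tau = L ^ (- n / q)], the value for which [tau * L ^ n]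
    and [tau ^ (1 - q)] coincide. What remains is a multiple of [L ^ al], of order [be ^ j]. *)
Lemma decay_step (w : 'rV[R]_n) x j (a b : R) : rcube x (2^-1 ^+ j) `<=` V -> a < b ->
  ((2^-1 * (2^-1 ^+ j *+ 2) ^+ n)%:E <= leb (rcube x (2^-1 ^+ j) `&` [set y | b <= hdist V h w y]%R))%E ->
  ((2^-1 * (2^-1 ^+ j.+1 *+ 2) ^+ n)%:E <= leb (rcube x (2^-1 ^+ j.+1) `&` [set y | hdist V h w y <= a]%R))%E ->
  b - a <= M * be ^+ j.
Proof.
move=> QV ab hb ha.
set r : R := 2^-1 ^+ j in QV hb *; have r0 : 0 < r by rewrite exprn_gt0.
pose L := r *+ 2; have Lp : 0 < L by exact: L0.
pose ka : R := 2^-1 ^+ n.+1; have ka0 : 0 < ka by rewrite exprn_gt0.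
have kaE : ka * L ^+ n = 2^-1 * (2^-1 ^+ j.+1 *+ 2) ^+ n.
  by rewrite /ka exprS -mulrA -exprMn /L /r [2^-1 ^+ j.+1]exprS mulrnAr.
have kL0 : 0 <= ka * L ^+ n by rewrite mulr_ge0// ?exprn_ge0// ltW.
have mQ i : measurable (rcube x (2^-1 ^+ i)) by exact: measurable_rcube.
have hb' : ((ka * L ^+ n)%:E <= leb (rcube x r `&` [set y | b <= hdist V h w y]%R))%E.
  apply: le_trans hb; rewrite lee_fin ler_wpM2r ?exprn_ge0 ?(ltW Lp)//.
  by rewrite /ka exprS ler_piMr// exprn_ile1// invf_le1// ler1n.
have ha' : ((ka * L ^+ n)%:E <= leb (rcube x r `&` [set y | hdist V h w y <= a]%R))%E.
  rewrite kaE; apply: le_trans ha _; apply: le_meas.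
  - by apply: measurableI => //; exact: measurable_hdist_le.
  - by apply: measurableI; [exact: measurable_rcube|exact: measurable_hdist_le].
  move=> y [Qy ya]; split => //; move/rcubeP: Qy; rewrite exprn_ge0// => /(_ isT) Qy; apply/rcubeP; first exact: ltW.
  by apply: le_trans Qy _; rewrite /r ler_wiXn2l// invf_le1// ler1n.
have := poincare_level oV ch mG G0 ug r0 QV ab kL0 ha' hb'.
pose tau := L `^ (- (n%:R / q)); have tau0 : 0 < tau by rewrite powR_gt0.
have mQr : measurable (rcube x r) by exact: measurable_rcube.
have q1 : 1 <= q by apply: le_trans (ltW nq); rewrite ler1n.
have I1 : (\int[leb (n:=n)]_(y in rcube x r) (G y * (a <= hdist V h w y <= b)%R%:R)%:E <=
    (tau * L ^+ n + tau `^ (1 - q) * X)%:E)%E.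
  have mGq : measurable_fun setT (fun y => (G y `^ q)%:E).
    by apply/measurable_EFinP; apply: (measurableT_comp (measurable_powR q) mG).
  apply: (@le_trans _ _ (\int[leb (n:=n)]_(y in rcube x r) (tau%:E + (tau `^ (1 - q))%:E * (G y `^ q)%:E))%E).
    apply: ge0_le_integral => //.
    - by move=> y _; rewrite lee_fin mulr_ge0.
    - apply: measurable_funTS; apply/measurable_EFinP; apply: measurable_funM => //.
      rewrite (_ : (fun z => _) = \1_(hdist V h w @^-1` `[a, b]%classic)).
        by apply: measurable_indic; rewrite -[X in measurable X]setTI; exact: measurable_hdist.
      apply/funext => z; rewrite indicE; have -> // : (z \in hdist V h w @^-1` `[a, b]%classic) = (a <= hdist V h w z <= b).
      by apply/idP/idP => [/set_mem|?]; [|apply/mem_set]; rewrite /= in_itv.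
    - apply: measurable_funTS; apply: emeasurable_funD; first exact: measurable_cst.
      exact: measurable_funeM.
    move=> y Qy; rewrite -EFinM -EFinD lee_fin; apply: le_trans (young_powR q1 tau0 (G0 y)).
    by rewrite ler_piMr//; case: (_ <= _ <= _).
  rewrite ge0_integralD//; last 3 first.
  - by move=> y _; rewrite lee_fin ltW.
  - by move=> y _; rewrite -EFinM lee_fin mulr_ge0 ?powR_ge0.
  - by apply: measurable_funTS; exact: measurable_funeM.
  rewrite ge0_integralZl//; last 3 first.
  - exact: measurable_funTS.
  - by move=> y _; rewrite lee_fin powR_ge0.
  - by rewrite lee_fin powR_ge0.
  rewrite EFinD; apply: leeD.
    apply: (@le_trans _ _ (tau%:E * leb (rcube x r))%E).
      by have <- := integral_cst (leb (n:=n)) mQr tau%:E; exact: lexx.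
    by rewrite EFinM; apply: lee_wpmul2l; [rewrite lee_fin ltW|rewrite [leLHS]leb_rcube// ltW].
  rewrite EFinM; apply: lee_wpmul2l; first by rewrite lee_fin powR_ge0.
  rewrite /X fineK; last first.
    by rewrite ge0_fin_numE//; apply: integral_ge0 => y _; rewrite lee_fin powR_ge0.
  apply: ge0_subset_integral => //; first exact: open_rV_measurable.
    exact: measurable_funTS.
  by move=> y _; rewrite lee_fin powR_ge0.
move=> I2; have {I1}I2 := le_trans I2 (lee_wpmul2l _ I1).
have cn0 : (0 <= (n%:R * L ^+ n.+1)%:E :> \bar R)%E by rewrite lee_fin mulr_ge0// exprn_ge0// ltW.
have := I2 cn0; rewrite -EFinM lee_fin.
have powL : L ^+ n = L `^ n%:R by rewrite powR_mulrn// ltW.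
have Lne : L != 0 by rewrite gt_eqF.
have E1 : tau * L ^+ n = L `^ (n%:R - n%:R / q).
  by rewrite powL /tau -powRD ?Lne ?implybT// addrC.
have E2 : tau `^ (1 - q) = L `^ (n%:R - n%:R / q).
  rewrite /tau -powRrM; congr (_ `^ _); have qn0 : q != 0 by rewrite gt_eqF.
  by field.
have E3 : L * (L `^ (n%:R - n%:R / q)) = L ^+ n * L `^ al.
  rewrite powL -{1}(powRr1 (ltW Lp)) -!powRD ?Lne ?implybT//; congr (_ `^ _).
  by rewrite /al; ring.
rewrite E1 E2 -/L => I3.
have LE : L `^ al <= 2 * be ^+ j.
  have -> : L = 2 * r by rewrite /L mulr_natl.
  rewrite powRM ?ler0n ?(ltW r0)// /r powR_scale -/be ler_wpM2r ?exprn_ge0 ?powR_ge0//.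
  rewrite -[leRHS]powRr1 ?ler0n// ler_powR ?ler1n// /al lerBlDr lerDl divr_ge0// ltW//.
have I4 : (b - a) * ka ^+ 2 <= n%:R * (1 + X) * L `^ al.
  have LL : 0 < L ^+ n * L ^+ n by rewrite mulr_gt0// exprn_gt0.
  rewrite -(ler_pM2r LL).
  have -> : (b - a) * ka ^+ 2 * (L ^+ n * L ^+ n) = (b - a) * (ka * L ^+ n) * (ka * L ^+ n) by ring.
  apply: le_trans I3 _; rewrite le_eqVlt; apply/orP; left; apply/eqP.
  transitivity (n%:R * (1 + X) * L ^+ n * (L * L `^ (n%:R - n%:R / q))); first by rewrite exprS; ring.
  by rewrite E3; ring.
have kaV : ka ^+ 2 * 2 ^+ (n + n + 2) = 1.
  have -> : (n + n + 2 = n.+1 * 2)%N by rewrite muln2 -addnn addn2 addSn addnS.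
  by rewrite /ka -exprM exprVn mulVf// expf_neq0// pnatr_eq0.
have : (b - a) * ka ^+ 2 <= n%:R * (1 + X) * (2 * be ^+ j).
  apply: le_trans I4 _; rewrite ler_wpM2l// mulr_ge0// addr_ge0//.
have p2 : 0 < 2 ^+ (n + n + 2) :> R by rewrite exprn_gt0.
move=> I5; have {}I5 := ler_wpM2r (ltW p2) I5.
have e : (b - a) * ka ^+ 2 * 2 ^+ (n + n + 2) = b - a by rewrite -mulrA kaV mulr1.
rewrite e in I5; apply: le_trans I5 _.
by rewrite le_eqVlt; apply/orP; left; apply/eqP; rewrite /M; ring.
Qed.

(** If a level [T = c * la ^ j] were reached on half of the cube of index [j], then by [decay_step]
    slightly lower levels would be reached on half of all smaller concentric cubes. The losses are
    geometric and stay below [T / 2], which contradicts the continuity of [h] at [x]. *)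
Lemma decay_sobolev x : V x -> decay V h ((1 + be) / 2) x.
Proof.
move=> Vx c c0 j0; have /andP[b0 b1] := be01.
have bl : be < (1 + be) / 2 by lra.
have [e e0 He] := open_ballP oV Vx.
have [J Je] := small_scale e0.
have QV j : (J <= j)%N -> rcube x (2^-1 ^+ j) `<=` V.
  move=> jj y /rcubeP; rewrite exprn_ge0// => /(_ isT) yx; apply: He; apply: le_lt_trans yx _.
  by apply: le_lt_trans Je; rewrite ler_wiXn2l// invf_le1// ler1n.
have M0 : 0 <= M by rewrite !mulr_ge0// addr_ge0.
pose K := (M + 1) / (1 - be); have K0 : 0 < K by rewrite divr_gt0 ?subr_gt0// ltr_wpDl.
have [j [jj H]] := geom_small (4 * K) (maxn j0 J) b0 bl c0.
exists j; split; first exact: leq_trans (leq_maxl _ _) jj.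
have {}jj := leq_trans (leq_maxr _ _) jj.
set T := c * _ in H *; rewrite ltNge; apply/negP => PT.
(* Consecutive levels differ by [2 (M + 1) be ^ (j + i)], more than [decay_step] allows for a
   failure at step [i], and their total drop is below [2 K be ^ j < T / 2] by the choice of [j]. *)
pose b i := T - (1 - be ^+ i) * (2 * K * be ^+ j).
have PP i : ((2^-1 * (2^-1 ^+ (j + i) *+ 2) ^+ n)%:E <=
    leb (rcube x (2^-1 ^+ (j + i)) `&` [set y | b i <= hdist V h (h x) y]%R))%E.
  elim: i => [|i IH]; first by rewrite addn0 /b expr0 subrr mul0r subr0.
  rewrite addnS leNgt; apply/negP => lt.
  have bi : b i - b i.+1 = 2 * (M + 1) * be ^+ (j + i).
    have be1 : 1 - be != 0 by rewrite gt_eqF// subr_gt0.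
    by rewrite /b exprD exprS /K; field.
  have lt' : b i.+1 < b i by rewrite -subr_gt0 bi !mulr_gt0 ?exprn_gt0// ltr_wpDl.
  have := @decay_step (h x) x (j + i) (b i.+1) (b i) (QV _ (leq_trans jj (leq_addr _ _))) lt' IH.
  rewrite bi => D; suff : 2 * (M + 1) * be ^+ (j + i) <= M * be ^+ (j + i).
    by rewrite ler_pM2r ?exprn_gt0//; move: M0; lra.
  apply: D.
  set Q := rcube x (2^-1 ^+ (j + i).+1) in lt *.
  have mQ : measurable Q by exact: measurable_rcube.
  have mg1 := measurableI _ _ mQ (measurable_hdist_ge oV ch (h x) (b i.+1)).
  have ml1 := measurableI _ _ mQ (measurable_hdist_le oV ch (h x) (b i.+1)).
  have : (leb Q <= leb (Q `&` [set y | (b i.+1 <= hdist V h (h x) y)%R]) +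
     leb (Q `&` [set y | (hdist V h (h x) y <= b i.+1)%R]))%E.
    apply: le_trans (measureU2 _ mg1 ml1); apply: le_meas => //; first exact: measurableU.
    by move=> y Qy; have [hy|hy] := leP (b i.+1) (hdist V h (h x) y); [left|right; split => //=; exact: ltW].
  rewrite [X in (X <= _)%E -> _]leb_rcube ?exprn_ge0// => H1.
  have {H1}H1 := le_lt_trans H1 (lte_leD _ lt (lexx _)).
  set z := leb _ in H1 *; have [zf|] := boolP (z \is a fin_num); last first.
    by rewrite ge0_fin_numE ?measure_ge0// -leNgt leye_eq => /eqP ->; exact: leey.
  have {}H1 := H1 zf.
  rewrite -(fineK zf) in H1 *; rewrite -EFinD lte_fin in H1; rewrite lee_fin.
  by move: H1; set a := (_ ^+ n); lra.
have T0 : 0 < T / 2 by rewrite divr_gt0// mulr_gt0// exprn_gt0//; lra.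
have bT i : T / 2 < b i.
  have k1 : (1 - be ^+ i) * (2 * K * be ^+ j) <= 2 * K * be ^+ j.
    have p0 : 0 <= 2 * K * be ^+ j by rewrite mulr_ge0 ?exprn_ge0 ?(ltW b0)// mulr_ge0// ltW.
    have p1 : 1 - be ^+ i <= 1 by rewrite lerBlDr lerDl exprn_ge0// ltW.
    exact: ler_piMl.
  have k2 : 4 * K * be ^+ j = 2 * (2 * K * be ^+ j) by ring.
  by rewrite /b; move: k1 H; rewrite k2; move: (2 * K * be ^+ j) (1 - be ^+ i) => k l; nra.
have /cvgrPdist_lt/(_ _ T0)/nbhs_ballP[d d0 Hd] := continuous_hdist (w := h x) oV ch Vx.
have [i id] := small_scale d0.
have := PP i; rewrite (_ : _ `&` _ = set0) ?measure0 ?lee_fin ?leNgt ?Ln0//.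
apply/seteqP; split => // y [Qy /=]; rewrite leNgt => /negP; apply.
apply: lt_trans (bT i).
have yd : `|y - x| < d.
  move/rcubeP: Qy; rewrite exprn_ge0// => /(_ isT) yx; apply: le_lt_trans yx _.
  by apply: le_lt_trans id; rewrite ler_wiXn2l ?leq_addl// invf_le1// ler1n.
have := Hd y; rewrite -ball_normE /ball_ /= distrC => /(_ yd).
have -> : hdist V h (h x) x = 0 by rewrite /hdist patchE mem_set// subrr normr0.
by rewrite sub0r normrN => h1; exact: le_lt_trans (ler_norm _) h1.
Qed.

End decay.

Theorem lusin_sobolev (R : realType) (n : nat) (V : set 'rV[R]_n) (h : 'rV[R]_n -> 'rV[R]_n)
    (G : 'rV[R]_n -> R) (q : R) (N : set 'rV[R]_n) : (0 < n)%N -> open V ->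
  (forall x, V x -> {for x, continuous h}) -> measurable_fun setT G -> (forall x, 0 <= G x) ->
  upper_gradient V h G -> (\int[leb (n:=n)]_(x in V) (G x `^ q)%:E < +oo)%E ->
  (n%:R < q \/ q = n%:R /\ exists al C : R, 0 < al /\
    forall x y, V x -> V y -> `|h x - h y| <= C * `|x - y| `^ al) ->
  compact N -> N `<=` V -> leb N = 0%E -> (leb (n:=n)).-negligible (h @` N).
Proof.
move=> n0 oV ch mG G0 ug Gq [nq|[qn [al [C [al0 hC]]]]] cN NV N0.
- have al0 : 0 < 1 - n%:R / q.
    have q0 : 0 < q by apply: lt_trans nq; rewrite ltr0n.
    by rewrite subr_gt0 ltr_pdivrMr// mul1r.
  have /andP[b0 b1] := powR_half al0.
  have [B [_ HB]] := compact_bounded cN.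
  have NB x : N x -> `|x| < B + 2.
    move=> Nx; apply: (@le_lt_trans _ _ (B + 1)); last by rewrite ltrD2l ltr1n.
    by apply: HB => //; rewrite ltrDl.
  (* On a bounded set [G ^ n <= 1 + G ^ q] is integrable, as [lusin_core] requires. *)
  pose V' := V `&` [set x | `|x - 0| < B + 2].
  have oV' : open V' by apply: openI => //; exact: open_norm_lt.
  have mV' := open_rV_measurable oV'.
  have V'V : V' `<=` V by move=> x [].
  have ug' : upper_gradient V' h G.
    by move=> j; apply: filterS (ug j) => x H a b ab abV; apply: H => // t /abV /V'V.
  have mGq : measurable_fun setT (fun y => (G y `^ q)%:E).
    by apply/measurable_EFinP; apply: (measurableT_comp (measurable_powR q) mG).
  have Gq' : (\int[leb (n:=n)]_(x in V') (G x `^ q)%:E < +oo)%E.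
    apply: le_lt_trans Gq; apply: ge0_subset_integral => //.
    - exact: open_rV_measurable.
    - exact: measurable_funTS.
    - by move=> x _; rewrite lee_fin powR_ge0.
  have ch' x : V' x -> {for x, continuous h} by move=> /V'V; exact: ch.
  apply: (lusin_core n0 oV' ch' mG G0 ug' (la := (1 + 2^-1 `^ (1 - n%:R / q)) / 2)) => //.
  + by move: b0 b1; set be := _ `^ _ => ? ?; apply/andP; split; lra.
  + have lV' : (leb V' < +oo)%E.
      apply: le_lt_trans (ltry ((`|B + 2| *+ 2) ^+ n)).
      rewrite -(leb_rcube 0 (normr_ge0 (B + 2))); apply: le_meas => //; first exact: measurable_rcube.
      move=> x [_ /= /ltW xB]; apply/rcubeP => //; apply: le_trans xB _; exact: ler_norm.
    apply: (@le_lt_trans _ _ (\int[leb (n:=n)]_(x in V') (1%:E + (G x `^ q)%:E))%E).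
      apply: ge0_le_integral => //.
      - by move=> x _; rewrite lee_fin exprn_ge0.
      - by apply: measurable_funTS; exact: measurable_powG.
      - by apply: measurable_funTS; apply: emeasurable_funD; first exact: measurable_cst.
      move=> x _; rewrite -EFinD lee_fin; have [h1|h1] := leP (G x) 1.
        by apply: (@le_trans _ _ 1); [rewrite exprn_ile1|rewrite lerDl powR_ge0].
      by rewrite -powR_mulrn//; apply: le_trans (ler_powR (ltW h1) (ltW nq)) _; rewrite ler_wpDl.
    rewrite ge0_integralD//; last 2 first.
    - by move=> x _; rewrite lee_fin powR_ge0.
    - exact: measurable_funTS.
    by apply: lte_add_pinfty => //; have -> := integral_cst (leb (n:=n)) mV' 1%:E; rewrite mul1e.
  + by move=> x Nx; split; [exact: NV|rewrite /= subr0; exact: NB].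
  + by move=> x Nx; apply: (decay_sobolev n0 oV' ch' mG G0 ug' nq Gq'); split; [exact: NV|rewrite /= subr0; exact: NB].
- have /andP[b0 b1] := powR_half al0.
  apply: (lusin_core n0 oV ch mG G0 ug (la := (1 + 2^-1 `^ al) / 2)) => //.
  + by move: b0 b1; set be := _ `^ _ => ? ?; apply/andP; split; lra.
  + move: Gq; rewrite qn; apply: le_lt_trans; rewrite le_eqVlt; apply/orP; left; apply/eqP.
    by apply: eq_integral => x _; rewrite powR_mulrn.
  + by move=> x Nx; apply: (decay_hoelder (C := C) al0 (NV x Nx)) => y Vy; apply: hC => //; exact: NV.
Qed.

(** * Approximate linearity on compact pieces *)

Lemma measurable_bigcap_count d (T : measurableType d) (I : countType) (P : set I) (F : I -> set T) :
  (forall i, P i -> measurable (F i)) -> measurable (\bigcap_(i in P) F i).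
Proof.
move=> mF; rewrite -[X in measurable X]setCK setC_bigcap bigcup_mkcond; apply: measurableC.
apply: countable_bigcupT_measurable => [|i]; first exact: countableP.
by case: ifPn => [/set_mem Pi|_]; [apply: measurableC; exact: mF|exact: measurable0].
Qed.

(** * Difference quotients along the axes *)

Section line_diff.
Context (R : realType).
Local Notation lm := (@lebesgue_measure R).

Lemma line_diff (u v : R -> R) (a b : R) : lm.-integrable `[a, b] (EFin \o v) ->
  (forall s t, a <= s -> s <= t -> t <= b -> \int[lm]_(x in `[s, t]) v x = u t - u s) ->
  {ae lm, forall s, a < s < b -> forall e : R, 0 < e -> exists2 d : R, 0 < d &
    forall t, `|t| < d -> `|u (s + t) - u s - t * v s| <= e * `|t|}.
Proof.
move=> iv uv; have mI : measurable (`[a, b]%classic : set R) by exact: measurable_itv.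
pose vb := v \_ `[a, b].
have ivb : lm.-integrable setT (EFin \o vb).
  by have [H _] := @integrable_mkcond _ _ _ lm _ (EFin \o v) mI; have := H iv; rewrite restrict_EFin.
have lvb : locally_integrable setT vb by exact: integrable_locally.
have := lebesgue_differentiation lvb; apply: filterS; first exact: (ae_filter_ringOfSetsType lm).
move=> s ls /andP[as_ sb] e e0.
have ivab : lm.-integrable [set` Interval (BLeft a) (BRight b)] (EFin \o vb) by exact: integrableS ivb.
have /= [der dE] := FTC1_lebesgue_pt sb ivab as_ ls.
set F := fun _ => _ in der dE.
have FE x : a <= x -> x <= b -> F x = u x - u a.
  move=> ax xb; rewrite -(uv a x) ?lexx//; apply: eq_Rintegral => y /set_mem; rewrite /= in_itv/= => /andP[y1 y2].
  by rewrite /vb patchE mem_set//= in_itv/= y1 (le_trans y2 xb).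
have vs : vb s = v s by rewrite /vb patchE mem_set//= in_itv/= !ltW.
have H : h^-1 *: (F (h *: 1 + s) - F s) @[h --> (0:R)^'] --> v s.
  by move: der; rewrite -vs -dE derive1E.
have /cvgrPdist_le/(_ _ e0) Hn := H; have /nbhs_ballP[d d0 Hd] := Hn.
pose d' := Num.min d (Num.min (s - a) (b - s)).
have d'0 : 0 < d' by rewrite !lt_min d0 !subr_gt0 as_.
exists d' => // t; rewrite !lt_min => /andP[t1 /andP[t2 t3]].
have [->|t0] := eqVneq t 0; first by rewrite addr0 subrr mul0r subr0 normr0 mulr0.
have := Hd t; rewrite -ball_normE /ball_ /= sub0r normrN => /(_ t1 t0).
have tn0 : 0 < `|t| by rewrite normr_gt0.
rewrite -(ler_pM2r tn0) -normrM; apply: le_trans.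
have [h1 h2] : a <= s + t /\ s + t <= b.
  move: t2 t3; rewrite !ltr_norml => /andP[? ?] /andP[? ?]; split; lra.
rewrite -[t *: 1]/(t * 1) mulr1 [t + s]addrC !FE ?(ltW as_) ?(ltW sb)//.
rewrite le_eqVlt; apply/orP; left; apply/eqP.
rewrite -[X in `|X| = _]opprK normrN; congr (`|_|).
by rewrite -[_ *: _]/(_ * _); field.
Qed.

End line_diff.

Section base.
Context (R : realType) (n p : nat).
Local Notation lm := (@lebesgue_measure R).
Variables (U : set 'rV[R]_n) (f : 'rV[R]_n -> 'rV[R]_p) (DT : 'rV[R]_n -> 'M[R]_(n, p)).
Hypothesis oU : open U.
Hypothesis cf : forall x, U x -> {for x, continuous f}.
Hypothesis mD : forall i j, measurable_fun U (fun x => DT x j i).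

(** [DT] is the transposed derivative, with the partial derivatives as rows, so that linear
    increments of row vectors read [h *m DT x]. *)
Definition acl := forall i j, {ae leb (n:=n), forall x, forall a b : R, a <= b ->
  (forall t, a <= t <= b -> U (upd x j t)) ->
  lm.-integrable `[a, b] (fun t => (DT (upd x j t) j i)%:E) /\
  \int[lm]_(t in `[a, b]) DT (upd x j t) j i = f (upd x j b) ord0 i - f (upd x j a) ord0 i}.

Hypothesis Hacl : acl.

Definition fpatch i := (fun x => f x ord0 i) \_ U.
Definition dpatch i j := (fun x => DT x j i) \_ U.

Let mU : measurable U := open_rV_measurable oU.

Lemma measurable_fpatch i : measurable_fun setT (fpatch i).
Proof.
apply/(measurable_restrictT _ mU); apply: open_continuous_measurable_rV => // y Vy.
by apply: (@continuous_comp _ _ _ f (fun z : 'rV[R]_p => z ord0 i)); [exact: cf|exact: coord_continuous].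
Qed.

Lemma measurable_dpatch i j : measurable_fun setT (dpatch i j).
Proof. by apply/(measurable_restrictT _ mU). Qed.

Definition quot_le (e : R) (j : 'I_n) (x : 'rV[R]_n) (t : R) := forall i,
  `|fpatch i (upd x j (x ord0 j + t)) - fpatch i x - t * dpatch i j x| <= e * `|t|.

(** Only rational increments are tested, which keeps the set measurable; [quot_set_real] recovers
    the real ones. *)
Definition quot_set (e : R) (j : 'I_n) (N : nat) : set 'rV[R]_n :=
  [set x | forall t : rat, `|ratr t : R| < N.+1%:R^-1 -> quot_le e j x (ratr t)].

Lemma measurable_updt (j : 'I_n) (t : R) : measurable_fun setT (fun x : 'rV[R]_n => upd x j (x ord0 j + t)).
Proof.
apply: measurable_fun_to_rV => i.
rewrite (_ : (fun x => _) = if i == j then (fun x : 'rV[R]_n => x ord0 j + t) else (fun x : 'rV[R]_n => x ord0 i)).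
  case: ifP => _; last exact: measurable_coordT.
  by apply: measurable_funD => //; exact: measurable_coordT.
by apply/funext => x; rewrite mxE; case: ifP.
Qed.

Lemma measurable_quot_set e j N : measurable (quot_set e j N).
Proof.
have -> : quot_set e j N = \bigcap_(t in [set t : rat | `|ratr t : R| < N.+1%:R^-1])
    \bigcap_(i in [set: 'I_p]) [set x | `|fpatch i (upd x j (x ord0 j + ratr t)) - fpatch i x - ratr t * dpatch i j x| <= e * `|ratr t : R|].
  by apply/seteqP; split => x H; [move=> t tN i _; exact: H|move=> t tN i; exact: (H t tN i I)].
apply: measurable_bigcap_count => t _; apply: fin_bigcap_measurable => // i _.
rewrite -[X in measurable X]setTI.
have mf : measurable_fun setT (fun x => `|fpatch i (upd x j (x ord0 j + ratr t)) - fpatch i x - ratr t * dpatch i j x|).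
  apply: measurableT_comp => //; apply: measurable_funB; last first.
    by apply: measurable_funM => //; exact: measurable_dpatch.
  apply: measurable_funB; last exact: measurable_fpatch.
  by apply: measurableT_comp (measurable_fpatch i) _; exact: measurable_updt.
rewrite (_ : [set x | _] = (fun x => `|fpatch i (upd x j (x ord0 j + ratr t)) - fpatch i x - ratr t * dpatch i j x|) @^-1` `]-oo, e * `|ratr t : R|]%classic).
  exact: mf.
by apply/seteqP; split => x /=; rewrite in_itv.
Qed.

End base.

Section base_ae.
Context (R : realType) (n p : nat).
Local Notation lm := (@lebesgue_measure R).
Variables (U : set 'rV[R]_n.+1) (f : 'rV[R]_n.+1 -> 'rV[R]_p) (DT : 'rV[R]_n.+1 -> 'M[R]_(n.+1, p)).
Hypothesis oU : open U.
Hypothesis cf : forall x, U x -> {for x, continuous f}.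
Hypothesis mD : forall i j, measurable_fun U (fun x => DT x j i).
Hypothesis Hacl : acl U f DT.

(** On almost every line [f] is a primitive of its partial derivative, and Lebesgue differentiation
    applies. The condition is a countable union of measurable ones, so Fubini can be used in
    reverse. The doubled cube keeps the lines through [rcube c r] inside [U] on both sides of the
    point. *)
Lemma quot_set_ae (e r : R) (c : 'rV[R]_n.+1) (j : 'I_n.+1) : 0 < e -> 0 < r -> rcube c (r + r) `<=` U ->
  {ae leb (n:=n.+1), forall x, rcube c r x -> exists N, quot_set U f DT e j N x}.
Proof.
move=> e0 r0 cU; apply/(ae_ins j).
have mQ : measurable (rcube c r) by exact: measurable_rcube.
apply: ae_prodP.
  rewrite (_ : [set z | _] = ins j @^-1` (~` rcube c r `|` \bigcup_N quot_set U f DT e j N)).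
    rewrite -[X in measurable X]setTI; apply: measurable_ins => //.
    apply: measurableU; first exact: measurableC.
    by apply: bigcup_measurable => N _; exact: measurable_quot_set.
  apply/seteqP; split => z /=.
    move=> H; have [Qz|nQ] := pselect (rcube c r (ins j z)); [right|by left].
    by have [N HN] := H Qz; exists N.
  by move=> [nQ /nQ //|[N _ HN] _]; exists N.
have acl1 : {ae leb (n:=n), forall x, {ae lm, forall s, forall i : 'I_p, forall a b : R, a <= b ->
    (forall t, a <= t <= b -> U (ins j (x, t))) ->
    lm.-integrable `[a, b] (fun t => (DT (ins j (x, t)) j i)%:E) /\
    \int[lm]_(t in `[a, b]) DT (ins j (x, t)) j i = f (ins j (x, b)) ord0 i - f (ins j (x, a)) ord0 i}}.
  have : {ae (leb (n:=n) \x lm)%E, forall z, forall i : 'I_p, forall a b : R, a <= b ->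
      (forall t, a <= t <= b -> U (ins j (z.1, t))) ->
      lm.-integrable `[a, b] (fun t => (DT (ins j (z.1, t)) j i)%:E) /\
      \int[lm]_(t in `[a, b]) DT (ins j (z.1, t)) j i = f (ins j (z.1, b)) ord0 i - f (ins j (z.1, a)) ord0 i}.
    apply: ae_forall_count => i; have /(ae_ins j) := Hacl i j; apply: filterS => z H a b ab abU.
    have E t : upd (ins j z) j t = ins j (z.1, t) by exact: upd_insE.
    have [] := H a b ab (fun t tab => eq_ind_r U (abU t tab) (E t)).
    have -> : (fun t : measurableTypeR R => (DT (upd (ins j z) j t) j i)%:E) = (fun t => (DT (ins j (z.1, t)) j i)%:E).
      by apply/funext => t; rewrite E.
    by rewrite !E => h1 h2; split => //; rewrite -h2; apply: eq_Rintegral => t _; rewrite E.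
  by move=> /ae_prod.
apply: filterS acl1 => x aclx.
pose a := c ord0 j - (r + r); pose b := c ord0 j + (r + r).
have ab : a <= b by rewrite /a /b; move: r0; lra.
have [xQ|nxQ] := pselect (rcube (del j c) r x); last first.
  by apply: aeW => s /rcube_ins[].
have abU t : a <= t <= b -> U (ins j (x, t)).
  move=> tab; apply: cU; apply/rcube_ins; split; last by rewrite /coint /= in_itv.
  by move/rcubeP : xQ => /(_ (ltW r0)) xQ; apply/rcubeP; [by rewrite addr_ge0// ltW|by apply: le_trans xQ _; rewrite lerDl ltW].
have lineD : {ae lm, forall s, forall i : 'I_p, a < s < b -> exists2 d : R, 0 < d &
    forall t, `|t| < d -> `|f (ins j (x, s + t)) ord0 i - f (ins j (x, s)) ord0 i - t * DT (ins j (x, s)) j i| <= e * `|t|}.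
  apply: ae_forall_count => i.
  have [iv|niv] := pselect (lm.-integrable `[a, b] (fun t => (DT (ins j (x, t)) j i)%:E) /\
     forall s t, a <= s -> s <= t -> t <= b -> \int[lm]_(y in `[s, t]) DT (ins j (x, y)) j i =
       f (ins j (x, t)) ord0 i - f (ins j (x, s)) ord0 i).
    have := @line_diff R (fun t => f (ins j (x, t)) ord0 i) (fun t => DT (ins j (x, t)) j i) a b iv.1 iv.2.
    apply: filterS; first exact: (ae_filter_ringOfSetsType lm).
    by move=> s H /H/(_ _ e0).
  apply: filterS aclx => s H; exfalso; apply: niv; split; first by have [] := H i a b ab abU.
  move=> s' t h1 h2 h3; have [|_ ->//] := H i s' t h2 _.
  by move=> y /andP[y1 y2]; apply: abU; rewrite (le_trans h1 y1) (le_trans y2 h3).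
move: lineD; apply: filterS; first exact: (ae_filter_ringOfSetsType lm).
move=> s Hs /rcube_ins[_]; rewrite /coint /= in_itv/= => /andP[s1 s2].
have sab : a < s < b by rewrite /a /b; apply/andP; split; move: r0 s1 s2; lra.
have /choice[d dP] : forall i : 'I_p, exists d : R, 0 < d /\ forall t, `|t| < d ->
    `|f (ins j (x, s + t)) ord0 i - f (ins j (x, s)) ord0 i - t * DT (ins j (x, s)) j i| <= e * `|t|.
  by move=> i; have [d d0 H] := Hs i sab; exists d.
pose dm := \big[Num.min/r]_i d i.
have dm0 : 0 < dm by apply: lt_bigmin => // i _; exact: (dP i).1.
have [N HN] : exists N : nat, N.+1%:R^-1 < dm.
  by have := near_infty_natSinv_lt (PosNum dm0); move/filter_ex.
exists N => t tN i.
have E t' : upd (ins j (x, s)) j t' = ins j (x, t') by exact: (upd_insE (x, s : measurableTypeR R)).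
have {}tN := lt_trans tN HN.
have tr : `|ratr t : R| < r.
  by apply: lt_le_trans tN _; exact: bigmin_le_id.
have td : `|ratr t : R| < d i by apply: lt_le_trans tN _; exact: bigmin_le_cond.
rewrite insE /= E /fpatch /dpatch !patchE !mem_set; last 2 first.
- by apply: abU; move: sab => /andP[/ltW -> /ltW ->].
- apply: abU; move: tr; rewrite ltr_norml /a /b => /andP[? ?]; apply/andP; split; lra.
exact: (dP i).2.
Qed.

End base_ae.

(** * Countable measurable covers up to null sets *)

Section ccover.
Context (R : realType) (n : nat).
Implicit Types (P : set 'rV[R]_n -> Prop) (S : set 'rV[R]_n).

Definition ccover P S := exists A : nat -> set 'rV[R]_n,
  [/\ forall i, measurable (A i), forall i, A i `<=` S, forall i, P (A i) &
  {ae leb (n:=n), forall x, S x -> exists i, A i x}].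

Lemma ccover_count (I : countType) P S (A : I -> set 'rV[R]_n) : P set0 ->
  (forall i, measurable (A i)) -> (forall i, A i `<=` S) -> (forall i, P (A i)) ->
  {ae leb (n:=n), forall x, S x -> exists i, A i x} -> ccover P S.
Proof.
move=> P0 mA AS PA H; exists (fun k => if unpickle k is Some i then A i else set0); split.
- by move=> k; case: unpickle.
- by move=> k; case: unpickle.
- by move=> k; case: unpickle.
- by apply: filterS H => x + Sx => /(_ Sx)[i Aix]; exists (pickle i); rewrite pickleK.
Qed.

Lemma ccover_trans P P' S : P' set0 -> ccover P S ->
  (forall A, measurable A -> A `<=` S -> P A -> ccover P' A) -> ccover P' S.
Proof.
move=> P0 [A [mA AS PA HA]] H.
have /choice[B HB] : forall i, exists B : nat -> set 'rV[R]_n,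
    [/\ forall k, measurable (B k), forall k, B k `<=` A i, forall k, P' (B k) &
    {ae leb (n:=n), forall x, A i x -> exists k, B k x}].
  by move=> i; apply: H.
apply: (@ccover_count (nat * nat)%type P' S (fun i => B i.1 i.2)) => //.
- by move=> i; have [] := HB i.1.
- by move=> i; have [_ h _ _] := HB i.1; apply: subset_trans (h i.2) _.
- by move=> i; have [] := HB i.1.
have : {ae leb (n:=n), forall x, forall i, A i x -> exists k, B i k x}.
  by apply: ae_forall_count => i; have [] := HB i.
by apply: filterS2 HA => x h1 h2 /h1[i /h2[k Bx]]; exists (i, k).
Qed.

Lemma rat_center (x : 'rV[R]_n) (r : R) : 0 < r ->
  exists q : 'rV[rat]_n, `|x - map_mx ratr q| <= r.
Proof.
move=> r0; have /choice[q qP] : forall i : 'I_n, exists q : rat, ratr q \in `](x ord0 i - r), (x ord0 i)[.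
  by move=> i; apply: rat_in_itvoo; rewrite ltrBlDr ltrDl.
exists (\row_i q i); apply: norm_rV_le => [|i]; first exact: ltW.
rewrite !mxE; have := qP i; rewrite in_itv/= => /andP[h1 h2].
by rewrite ger0_norm ?subr_ge0 ?(ltW h2)// lerBlDl -lerBlDr ltW.
Qed.

Lemma ccover_small S (eta : R) : measurable S -> 0 < eta ->
  ccover (fun A => forall x y, A x -> A y -> `|y - x| < eta) S.
Proof.
move=> mS eta0; have e40 : 0 < eta / 4 by rewrite divr_gt0.
apply: (@ccover_count 'rV[rat]_n _ S (fun q => S `&` rcube (map_mx ratr q) (eta / 4))) => //.
- by move=> q; apply: measurableI => //; exact: measurable_rcube.
- move=> q x y [_ Qx] [_ Qy].
  have /rcubeP h1 := Qx; have {}h1 := h1 (ltW e40); have /rcubeP h2 := Qy; have {}h2 := h2 (ltW e40).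
  have := ler_distD (map_mx ratr q) y x; rewrite [`|map_mx ratr q - x|]distrC => h3.
  by apply: le_lt_trans h3 _; move: h1 h2 eta0; lra.
apply: aeW => x Sx; have [q xq] := rat_center x e40.
by exists q; split => //; apply/rcubeP => //; exact: ltW.
Qed.

End ccover.

(** Density is controlled at the radii [1/(i+1)] only; every small distance [r] is comparable to one
    of them up to a factor 2. *)
Lemma harm_scale (R : realType) (r : R) (i0 : nat) : 0 < r -> r <= i0.+1%:R^-1 ->
  exists i, (i0 <= i)%N /\ r <= i.+1%:R^-1 <= 2 * r.
Proof.
move=> r0 ri; have rV0 : 0 <= r^-1 by rewrite invr_ge0 ltW.
have /andP[h1 h2] := truncn_itv rV0.
have h3 : (i0.+1 <= Num.truncn r^-1)%N.
  rewrite truncn_ge_nat// -(invrK i0.+1%:R) lef_pV2 ?posrE//.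
case: (Num.truncn _) h1 h2 h3 => // i h1 h2 h3; exists i; split => //.
rewrite -[X in X <= _](invrK r) lef_pV2 ?posrE ?invr_gt0//  h1 /=.
rewrite -(invrK (2 * r)) lef_pV2 ?posrE ?invr_gt0 ?mulr_gt0// invfM.
have : i.+2%:R <= 2 * i.+1%:R :> R by rewrite -natrM ler_nat mul2n -addnn addnS ltnS ltnS leq_addr.
by move: h2; move: (i.+2%:R) (i.+1%:R) (r^-1) => a b c; lra.
Qed.

(** * Density points along the axes *)

Section density.
Context (R : realType) (n : nat).
Local Notation lm := (@lebesgue_measure R).
Implicit Types (A : set 'rV[R]_n).

Definition bad A (k : 'I_n) (rho : R) (x : 'rV[R]_n) : set (measurableTypeR R) :=
  [set s | `|s - x ord0 k| < rho /\ ~ A (upd x k s)].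

(** At most a sixteenth of the interval of radius [1/(i+1)] around [x] on its [k]-th line misses
    [A]. Two such defects together cannot cover an interval of length [1/(i+1)], which is what
    [lin_step] exploits. *)
Definition dense_at A k (i : nat) : set 'rV[R]_n :=
  [set x | (lm (bad A k i.+1%:R^-1 x) <= (i.+1%:R^-1 / 8)%:E)%E].

Lemma measurable_bad_pair A k rho : measurable A ->
  measurable [set z : 'rV[R]_n * measurableTypeR R | `|z.2 - z.1 ord0 k| < rho /\ ~ A (upd z.1 k z.2)].
Proof.
move=> mA; rewrite (_ : mkset _ = [set z : 'rV[R]_n * measurableTypeR R | `|z.2 - z.1 ord0 k| < rho] `&`
    (fun z : 'rV[R]_n * measurableTypeR R => upd z.1 k z.2) @^-1` (~` A)).
  apply: measurableI.
    rewrite (_ : mkset _ = (fun z : 'rV[R]_n * measurableTypeR R => `|z.2 - z.1 ord0 k|) @^-1` `]-oo, rho[%classic); last first.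
      by apply/seteqP; split => z /=; rewrite in_itv.
    rewrite -[X in measurable X]setTI.
    have mf : measurable_fun setT (fun z : 'rV[R]_n * measurableTypeR R => `|z.2 - z.1 ord0 k|).
      apply: measurableT_comp => //; apply: measurable_funB; first exact: measurable_snd.
      exact: measurableT_comp (measurable_coordT k) measurable_fst.
    exact: mf.
  rewrite -[X in measurable X]setTI.
  have mf : measurable_fun setT (fun z : 'rV[R]_n * measurableTypeR R => upd z.1 k z.2).
    apply: measurable_fun_to_rV => i.
    rewrite (_ : (fun z => _) = if i == k then (fun z : 'rV[R]_n * measurableTypeR R => z.2) else (fun z => z.1 ord0 i)).
      case: ifP => _; first exact: measurable_snd.
      exact: measurableT_comp (measurable_coordT i) measurable_fst.
    by apply/funext => z; rewrite mxE; case: ifP.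
  by apply: mf => //; exact: measurableC.
by apply/seteqP; split => z [].
Qed.

Lemma bad_xsection A k rho x : bad A k rho x = xsection
  [set z : 'rV[R]_n * measurableTypeR R | `|z.2 - z.1 ord0 k| < rho /\ ~ A (upd z.1 k z.2)] x.
Proof. by apply/seteqP; split => s; [move=> H; apply/xsectionP|move=> /xsectionP]. Qed.

Lemma measurable_bad A k rho x : measurable A -> measurable (bad A k rho x).
Proof. by move=> mA; rewrite bad_xsection; apply: measurable_xsection; exact: measurable_bad_pair. Qed.

Lemma measurable_dense_at A k i : measurable A -> measurable (dense_at A k i).
Proof.
move=> mA; rewrite /dense_at; rewrite -[X in measurable X]setTI.
have mf : measurable_fun setT (fun x => lm (bad A k i.+1%:R^-1 x)).
  rewrite (_ : (fun x => _) = (fun x => (lm \o xsection [set z : 'rV[R]_n * measurableTypeR R |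
      `|z.2 - z.1 ord0 k| < i.+1%:R^-1 /\ ~ A (upd z.1 k z.2)]) x)).
    by apply: measurable_fun_xsection; exact: measurable_bad_pair.
  by apply/funext => x; rewrite bad_xsection.
exact: (emeasurable_fun_infty_c measurableT mf).
Qed.

End density.

Lemma density_ae (R : realType) (n : nat) (A : set 'rV[R]_n) (k : 'I_n) : measurable A ->
  {ae leb (n:=n), forall x, A x -> exists i0, forall i, (i0 <= i)%N -> dense_at A k i x}.
Proof.
case: n A k => [A []//|n A k mA]; set lm := @lebesgue_measure R.
apply/(ae_ins k); apply: ae_prodP.
  rewrite (_ : [set z | _] = ins k @^-1` (~` A `|` \bigcup_i0 \bigcap_(i in [set i | (i0 <= i)%N]) dense_at A k i)).
    rewrite -[X in measurable X]setTI; apply: measurable_ins => //.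
    apply: measurableU; first exact: measurableC.
    apply: bigcup_measurable => i0 _; apply: bigcap_measurableType => i _; exact: measurable_dense_at.
  apply/seteqP; split => z /=.
    move=> H; have [Az|nA] := pselect (A (ins k z)); [right|by left].
    by have [i0 Hi] := H Az; exists i0.
  by move=> [nA /nA //|[i0 _ Hi] _]; exists i0.
apply: aeW => x.
pose Ax : set (measurableTypeR R) := [set s | A (ins k (x, s))].
have mAx : measurable Ax.
  have mx : measurable_fun setT (fun s : measurableTypeR R => ins k (x, s)).
    by apply: (measurableT_comp (measurable_ins k)); exact: measurable_fun_pair.
  by rewrite -[X in measurable X]setTI; exact: mx.
have := @lebesgue_density R Ax mAx; apply: filterS; first exact: (ae_filter_ringOfSetsType lm).
move=> s Hs As.
have bE rho : bad A k rho (ins k (x, s)) = ball (s : R) rho `\` Ax.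
  have E t : upd (ins k (x, s)) k t = ins k (x, t) by exact: (upd_insE (x, s : measurableTypeR R)).
  apply/seteqP; split => t; rewrite /bad /Ax /= insE E -ball_normE /ball_ /= distrC; by move=> [].
(* The share 15/16 of an interval of length [2 r] leaves out at most [r / 8]. *)
have h15 : (15 / 16 < 1 :> R) by lra.
have fb (r : R) : 0 < r -> lm (ball s r) = (2 * r)%:E 
  by move=> r0; rewrite mulr_natl; exact: (lebesgue_measure_ball (s : R) (ltW r0)).
have fI (r : R) : 0 < r -> lm (Ax `&` ball s r) \is a fin_num.
  move=> r0; rewrite ge0_fin_numE//; apply: (@le_lt_trans _ _ (lm (ball s r))); last by rewrite fb// ltry.
  have mb : measurable (ball s r : set (measurableTypeR R)) by exact: measurable_ball.
  by apply: (@le_meas _ _ _ (@lebesgue_measure R)) => //; exact: measurableI.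
have [d d0 Hd] : exists2 d : R, 0 < d & forall r, 0 < r -> r < d -> (15 / 16) * (2 * r) < fine (lm (Ax `&` ball s r)).
  have Hf : fine (lm (Ax `&` ball s r) / lm (ball s r))%E @[r --> 0^'+] --> (1 : R).
    by move: Hs; rewrite indicE mem_set// => /fine_cvg.
  have := cvgr_gt 1 Hf (15 / 16) h15.
  move=> [d /= d0 Hd]; exists d => // r r0 rd; have := Hd r; rewrite /ball /= sub0r normrN gtr0_norm// => /(_ rd r0).
  rewrite fb// -(fineK (fI r r0)) inver mulf_eq0 !gt_eqF// -EFinM /=.
  by rewrite (@ltr_pdivlMr _ (2 * r) (15 / 16)) ?mulr_gt0.
have [i0 Hi0] : exists i0 : nat, i0.+1%:R^-1 < d.
  by have := near_infty_natSinv_lt (PosNum d0); move/filter_ex.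
exists i0 => i i0i; rewrite /dense_at /= bE.
have r0 : 0 < i.+1%:R^-1 :> R by rewrite invr_gt0.
have rd : i.+1%:R^-1 < d by apply: le_lt_trans Hi0; rewrite lef_pV2 ?posrE// ler_nat.
move: (i.+1%:R^-1) r0 rd => r r0 rd.
have := measureD (mu := lm) (measurable_ball s r) mAx.
have b0 : (lm (ball s r) < +oo)%E by have := fb r r0 => ->; rewrite ltry.
move=> /(_ b0) => mD; suff h : (lm (ball s r) - lm (ball s r `&` Ax) <= (r / 8)%:E)%E.
  exact: (eq_ind_r (fun z => (z <= (r / 8)%:E)%E) h mD).
have -> : lm (ball s r) = (2 * r)%:E by exact: fb.
have -> : ball s r `&` Ax = Ax `&` ball s r by rewrite setIC.
rewrite -(fineK (fI r r0)) -EFinB lee_fin; have := Hd r r0 rd; move: (fine _) => y; lra.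
Qed.

Lemma quot_set_cover_ae (R : realType) (n p : nat) (U : set 'rV[R]_n) (f : 'rV[R]_n -> 'rV[R]_p)
    (DT : 'rV[R]_n -> 'M[R]_(n, p)) (e r : R) (c : 'rV[R]_n) (j : 'I_n) : open U ->
  (forall x, U x -> {for x, continuous f}) -> (forall i j, measurable_fun U (fun x => DT x j i)) ->
  acl U f DT -> 0 < e -> 0 < r -> rcube c (r + r) `<=` U ->
  {ae leb (n:=n), forall x, rcube c r x -> exists N, quot_set U f DT e j N x}.
Proof.
case: n U f DT c j => [U f DT c []//|n U f DT c j] oU cf mD Hacl e0 r0 cU.
exact: quot_set_ae.
Qed.

Lemma common_itv (R : realType) (s a b rho : R) : Num.max a b - rho < s -> s < Num.max a b ->
  `|a - b| <= rho -> 0 < rho -> `|s - a| < rho /\ `|s - b| < rho.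
Proof.
rewrite !ltr_norml ler_norml => h1 h2 /andP[h3 h4] h5.
have : Num.max a b = a /\ b <= a \/ Num.max a b = b /\ a <= b by case: (leP a b) => ab; [right|left]; split => //; exact: ltW.
by move=> [[E ab]|[E ab]]; rewrite E in h1 h2; split; apply/andP; split; lra.
Qed.

(** * From lines to approximate linearity *)

Section linearization.
Context (R : realType) (n p : nat).
Local Notation lm := (@lebesgue_measure R).
Variables (U : set 'rV[R]_n) (f : 'rV[R]_n -> 'rV[R]_p) (DT : 'rV[R]_n -> 'M[R]_(n, p)).
Hypothesis oU : open U.
Hypothesis cf : forall x, U x -> {for x, continuous f}.
Hypothesis mD : forall i j, measurable_fun U (fun x => DT x j i).
Hypothesis Hacl : acl U f DT.

(** A strict failure at [t] would persist nearby by continuity of [f], hence occur at a rational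
    increment. The doubled cube keeps the moved points in [U]. *)
Lemma quot_set_real (e r : R) (c : 'rV[R]_n) j N x (t : R) : 0 <= e -> rcube c (r + r) `<=` U ->
  rcube c r x -> 0 < r -> N.+1%:R^-1 < r -> quot_set U f DT e j N x -> `|t| < N.+1%:R^-1 ->
  `|f (upd x j (x ord0 j + t)) - f x - t *: row j (DT x)| <= e * `|t|.
Proof.
move=> e0 cU Qx r0 Nr H tN.
have xU (s : R) : `|s| < N.+1%:R^-1 -> U (upd x j (x ord0 j + s)).
  move=> sN; apply: cU; apply/rcubeP; first by rewrite addr_ge0// ltW.
  apply: norm_rV_le => [|i]; first by rewrite addr_ge0// ltW.
  have xi : `|x ord0 i - c ord0 i| <= r.
    have := ler_coord_norm (x - c) i; rewrite !mxE => /le_trans; apply.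
    by have /rcubeP h := Qx; apply: h; exact: ltW.
  rewrite !mxE; case: eqP => [->|_]; last by apply: le_trans xi _; rewrite lerDl ltW.
  have xj := xi; rewrite addrAC; apply: le_trans (ler_normD _ _) _; apply: lerD => //.
  have xij : `|x ord0 j - c ord0 j| <= r.
    have := ler_coord_norm (x - c) j; rewrite !mxE => /le_trans; apply.
    by have /rcubeP h := Qx; apply: h; exact: ltW.
  exact: xij.
  by apply: ltW; exact: lt_trans sN Nr.
apply: norm_rV_le => [|i]; first by rewrite mulr_ge0.
rewrite !mxE leNgt; apply/negP => Hlt.
pose phi (s : R) := `|f (upd x j (x ord0 j + s)) ord0 i - f x ord0 i - s * DT x j i| - e * `|s|.
have cphi : {for t, continuous phi}.
  have c1 : {for t, continuous (fun s : R => f (upd x j (x ord0 j + s)) ord0 i)}.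
    apply: (@continuous_comp _ _ _ (fun s : R => f (upd x j (x ord0 j + s))) (fun z : 'rV[R]_p => z ord0 i)); last exact: coord_continuous.
    apply: (@continuous_comp _ _ _ (fun s : R => upd x j (x ord0 j + s)) f); last by apply: cf; exact: xU.
    apply: (@continuous_comp _ _ _ (fun s : R => x ord0 j + s) (fun s => upd x j s)); last exact: continuous_upd.
    by apply: continuousD; [exact: cst_continuous|exact: cvg_id].
  have c2 : {for t, continuous (fun s : R => s * DT x j i)}.
    by apply: continuousM; [exact: cvg_id|exact: cst_continuous].
  have c3 : {for t, continuous (fun s : R => f (upd x j (x ord0 j + s)) ord0 i - f x ord0 i - s * DT x j i)}.
    by apply: continuousB => //; apply: continuousB => //; exact: cst_continuous.
  apply: continuousB.
    by apply: (@continuous_comp _ _ _ (fun s : R => f (upd x j (x ord0 j + s)) ord0 i - f x ord0 i - s * DT x j i) Num.norm) => //; exact: norm_continuous.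
  by apply: continuousM; [exact: cst_continuous|exact: norm_continuous].
have phi0 : 0 < phi t by rewrite subr_gt0.
have Hn : \forall s \near t, 0 < phi s by exact: (cvgr_gt (phi t) cphi 0 phi0).
have /nbhs_ballP[d /= d0 Hd] := Hn.
pose d' := Num.min d (N.+1%:R^-1 - `|t|).
have d'0 : 0 < d' by rewrite lt_min d0 subr_gt0.
have tt' : t < t + d' by rewrite ltrDl.
have [q] := rat_in_itvoo tt'.
rewrite in_itv/= => /andP[q1 q2].
have qt : `|ratr q - t| < d' by rewrite gtr0_norm ?subr_gt0// ltrBlDl.
have [qtd qtN] : `|ratr q - t| < d /\ `|ratr q - t| < N.+1%:R^-1 - `|t| by move: qt; rewrite lt_min => /andP[].
have qN : `|ratr q| < N.+1%:R^-1 :> R.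
  by rewrite -[ratr q](subrK t); apply: le_lt_trans (ler_normD _ _) _; rewrite -ltrBrDr.
have /(_ _)/lt_geF := Hd (ratr q); rewrite -ball_normE /ball_ /= distrC => /(_ qtd).
rewrite /phi subr_le0 => /negP; apply.
have := H q qN i; rewrite /fpatch /dpatch !patchE !mem_set //; last exact: xU.
by have := xU 0; rewrite normr0 invr_gt0 ltr0Sn addr0 upd_same; apply.
Qed.

(** Uniform partial differentiability: one radius and one matrix for the whole of [A]. The moved
    point [upd x j _] need not belong to [A]. *)
Definition hbound (d e : R) (cm : 'M[R]_(n, p)) (A : set 'rV[R]_n) :=
  forall x, A x -> forall j (s : R), `|s| < d ->
  `|f (upd x j (x ord0 j + s)) - f x - s *: row j cm| <= e * `|s|.

(** [k] is the number of coordinates in which the two points may differ; [lin_cover] raises it from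
    0 to [n], each coordinate costing [4 e]. *)
Definition lin_le (k : nat) (C : R) (cm : 'M[R]_(n, p)) (A : set 'rV[R]_n) :=
  forall x y, A x -> A y -> (forall l : 'I_n, (k <= l)%N -> y ord0 l = x ord0 l) ->
  `|f y - f x - (y - x) *m cm| <= C * `|y - x|.

(* By density, [x] and [y] in [A] admit a common value [s] such that [upd x k s]
   and [upd y k s] are still in [A]; these two points have the same [k]-th
   coordinate, so that [lin_le k] compares them, while [hbound] controls the two
   moves along the [k]-th axis. *)
Lemma lin_step (k : 'I_n) (C d e : R) cm A : measurable A -> 0 < d -> 0 <= C -> 0 <= e ->
  hbound d e cm A -> lin_le k C cm A -> ccover (lin_le k.+1 (C + 4 * e) cm) A.
Proof.
move=> mA d0 C0 e0 hA lA.
apply: (@ccover_trans _ _ (fun A' => A' `<=` A /\ exists i0, forall x, A' x -> forall i, (i0 <= i)%N -> dense_at A k i x)).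
- by move=> x y [].
- apply: (@ccover_count _ _ nat _ _ (fun i0 => A `&` \bigcap_(i in [set i | (i0 <= i)%N]) dense_at A k i)).
  + by split => //; exists 0%N => x [].
  + move=> i0; apply: measurableI => //; apply: bigcap_measurableType => i _; exact: measurable_dense_at.
  + by move=> i0 x [].
  + by move=> i0; split; [move=> x []|exists i0 => x [_ H] i ii; exact: H].
  have := density_ae k mA; apply: filterS => x H Ax; have [i0 Hi] := H Ax.
  by exists i0; split.
move=> A1 mA1 _ [A1A [i0 Hi0]].
(* The first bound gives a density radius [rho] between [r] and [2 r] with index beyond [i0]; the
   second makes [2 r < d], so that moves shorter than [rho] are covered by [hbound]. *)
have eta0 : 0 < Num.min i0.+1%:R^-1 (d / 2) by rewrite lt_min invr_gt0 ltr0Sn divr_gt0.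
have [B [mB BA Bs Bc]] := ccover_small mA1 eta0.
exists B; split => // b x y Bx By xyk.
have := Bs b x y Bx By; rewrite lt_min => /andP[yx1 yx2].
set r := `|y - x| in yx1 yx2 *.
have [/eqP yx|yx] := eqVneq y x.
  by rewrite /r (eqP yx) !subrr mul0mx subrr !normr0 mulr0.
have r0 : 0 < r by rewrite normr_gt0 subr_eq0.
have [i [ii /andP[ri1 ri2]]] := harm_scale r0 (ltW yx1).
set rho := i.+1%:R^-1 in ri1 ri2.
have Ax := A1A _ (BA b x Bx); have Ay := A1A _ (BA b y By).
have dx : dense_at A k i x by apply: Hi0 => //; exact: BA Bx.
have dy : dense_at A k i y by apply: Hi0 => //; exact: BA By.
have [s [sx sy Asx Asy]] : exists s : R, [/\ `|s - x ord0 k| < rho, `|s - y ord0 k| < rho, A (upd x k s) & A (upd y k s)].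
  apply: contrapT => nex.
  have rho0 : 0 < rho by exact: lt_le_trans r0 ri1.
  (* The interval of length [rho] to the left of the larger coordinate lies within [rho] of both;
     the two bad sets have total measure at most [rho / 4] and leave a point of it. *)
  pose c := Num.max (x ord0 k) (y ord0 k).
  have cb : `|x ord0 k - y ord0 k| <= rho.
    by have := ler_coord_norm (y - x) k; rewrite !mxE distrC => h; apply: le_trans h ri1.
  have sub : (`]c - rho, c[%classic : set (measurableTypeR R)) `<=` bad A k rho x `|` bad A k rho y.
    move=> s /=; rewrite in_itv/= => /andP[s1 s2].
    have [sx sy] := common_itv s1 s2 cb rho0.
    have [Asx|] := pselect (A (upd x k s)); last by left.
    have [Asy|] := pselect (A (upd y k s)); last by right.
    by exfalso; apply: nex; exists s.
  have mb z : measurable (bad A k rho z) by exact: measurable_bad.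
  have h := @le_meas _ _ _ lm _ _ (measurable_itv _) (measurableU _ _ (mb x) (mb y)) sub.
  have h' := le_trans h (measureU2 lm (mb x) (mb y)).
  have := le_trans h' (leeD dx dy).
  have E : lm (`]c - rho, c[%classic : set (measurableTypeR R)) = rho%:E.
    have := lebesgue_measure_itv `]c - rho, c[; rewrite /= lte_fin ltrBlDr ltrDl rho0 => h2.
    by apply: etrans h2 _; rewrite -EFinB opprB addrC subrK.
  move=> h3; have := eq_ind _ (fun z => (z <= _)%E) h3 _ E; rewrite -EFinD lee_fin -/rho.
  by move: (rho) rho0 => rr; lra.
pose x' := upd x k s; pose y' := upd y k s.
have yx'E : `|y' - x'| <= r.
  apply: norm_rV_le => [|l]; first exact: ltW.
  rewrite !mxE; case: eqP => _; first by rewrite subrr normr0 ltW.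
  by have := ler_coord_norm (y - x) l; rewrite !mxE.
have h1 : `|f y' - f x' - (y' - x') *m cm| <= C * r.
  apply: le_trans (lA x' y' Asx Asy _) _; last by rewrite ler_wpM2l.
  move=> l kl; rewrite !mxE; case: eqP => // /eqP lk; apply: xyk.
  by rewrite ltn_neqAle kl eq_sym andbT -(inj_eq val_inj) in lk *.
have hx z : A z -> `|s - z ord0 k| < rho -> `|f (upd z k s) - f z - (upd z k s - z) *m cm| <= 2 * e * r.
  move=> Az sz; have := hA z Az k (s - z ord0 k); rewrite [z ord0 k + _]addrC subrK.
  have -> : (upd z k s - z) *m cm = (s - z ord0 k) *: row k cm.
    rewrite rowE scalemxAl; congr (_ *m _); apply/rowP => l; rewrite !mxE eqxx/=.
    by case: eqP => [->|_]; rewrite ?mulr1 ?mulr0 ?subrr.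
  move=> H; apply: le_trans (H _) _; first by apply: lt_trans sz _; move: ri2 yx2; lra.
  by rewrite [2 * e]mulrC -mulrA ler_wpM2l// ltW// (lt_le_trans sz ri2).
have -> : f y - f x - (y - x) *m cm = (f y' - f x' - (y' - x') *m cm) + (f x' - f x - (x' - x) *m cm)
    - (f y' - f y - (y' - y) *m cm).
  rewrite !mulmxBl; move: (f y) (f x) (f y') (f x') (y *m cm) (x *m cm) (y' *m cm) (x' *m cm).
  move=> a1 a2 a3 a4 a5 a6 a7 a8; apply/rowP => l; rewrite !mxE; ring.
apply: le_trans (ler_normB _ _) _; apply: le_trans (lerD (ler_normD _ _) (lexx _)) _.
have := hx x Ax sx; have := hx y Ay sy; rewrite -/x' -/y'.
rewrite mulrDl; move: h1; lra.
Qed.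

Lemma lin_cover (d e : R) cm A : measurable A -> 0 < d -> 0 <= e -> hbound d e cm A ->
  ccover (lin_le n (n%:R * (4 * e)) cm) A.
Proof.
move=> mA d0 e0; suff : forall k, (k <= n)%N -> forall A, measurable A -> hbound d e cm A -> ccover (lin_le k (k%:R * (4 * e)) cm) A.
  by move=> H; exact: H.
elim=> [_ B mB hB|k IH kn B mB hB].
  exists (fun _ => B); split; [by []|by move=> _ x| |by apply: aeW => x Bx; exists 0%N].
  move=> _ x y Bx By xy; have -> : y = x by apply/rowP => l; exact: xy.
  by rewrite !subrr mul0mx subrr !normr0 mulr0.
apply: (ccover_trans _ (IH (ltnW kn) B mB hB)) => [x y []//|A1 mA1 A1B lA1].
have := @lin_step (Ordinal kn) (k%:R * (4 * e)) d e cm A1 mA1 d0 _ e0 _ lA1.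
have -> : k.+1%:R * (4 * e) = k%:R * (4 * e) + 4 * e by rewrite -[k.+1%:R]natr1 mulrDl mul1r.
apply.
  by rewrite !mulr_ge0.
by move=> x A1x; apply: hB; exact: A1B.
Qed.

(** The pieces are indexed by a rational cube, a radius [1/(N+1)] and a rational matrix within [e]
    of the derivative, which are countably many. Replacing [DT x] by the constant matrix costs the
    second [e]. *)
Lemma hbound_cover (e : R) : 0 < e -> ccover (fun A => exists (d : R) cm, [/\ 0 < d, hbound d (2 * e) cm A &
   forall x, A x -> forall i j, `|DT x j i - cm j i| <= e]) U.
Proof.
move=> e0.
pose J := ('rV[rat]_n * nat * nat * 'M[rat]_(n, p))%type.
pose c (i : J) : 'rV[R]_n := map_mx ratr i.1.1.1.
pose r (i : J) : R := i.1.1.2.+1%:R^-1.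
pose cm (i : J) : 'M[R]_(n, p) := map_mx ratr i.2.
pose ok (i : J) := `[< rcube (c i) (r i + r i) `<=` U /\ i.1.2.+1%:R^-1 < r i >].
pose A (i : J) := if ok i then rcube (c i) (r i) `&` (\bigcap_(k in [set: 'I_p]) \bigcap_(j in [set: 'I_n])
   [set x | `|dpatch U DT k j x - cm i j k| <= e]) `&` \bigcap_(j in [set: 'I_n]) quot_set U f DT e j i.1.2 else set0.
have r0 i : 0 < r i by rewrite invr_gt0.
apply: (@ccover_count _ _ J _ _ A).
- by exists 1, 0; split.
- move=> i; rewrite /A; case: ifP => // _; apply: measurableI; last first.
    by apply: fin_bigcap_measurable => // j _; exact: measurable_quot_set.
  apply: measurableI; first exact: measurable_rcube.
  apply: fin_bigcap_measurable => // k _; apply: fin_bigcap_measurable => // j _.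
  have mf : measurable_fun setT (fun x => `|dpatch U DT k j x - cm i j k|).
    apply: measurableT_comp => //; apply: measurable_funB => //; exact: measurable_dpatch.
  rewrite -[X in measurable X]setTI (_ : mkset _ = (fun x => `|dpatch U DT k j x - cm i j k|) @^-1` `]-oo, e]%classic).
    exact: mf.
  by apply/seteqP; split => x /=; rewrite in_itv.
- move=> i; rewrite /A; case: ifPn => [/asboolP[h _]|_]; last by move=> x [].
  move=> x [[Qx _] _]; apply: h.
  apply/rcubeP; first by rewrite addr_ge0// ltW.
  by have /rcubeP := Qx => /(_ (ltW (r0 i))) h; apply: le_trans h _; rewrite lerDl ltW.
- move=> i; rewrite /A; case: ifPn => [/asboolP[h1 h2]|_]; last by exists 1, 0; split.
  have sub : rcube (c i) (r i) `<=` U.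
    move=> x Qx; apply: h1; apply/rcubeP; first by rewrite addr_ge0// ltW.
    by have /rcubeP := Qx => /(_ (ltW (r0 i))) h; apply: le_trans h _; rewrite lerDl ltW.
  have cl x : (\bigcap_(k in [set: 'I_p]) \bigcap_(j in [set: 'I_n])
      [set x | `|dpatch U DT k j x - cm i j k| <= e]) x -> U x -> forall k j, `|DT x j k - cm i j k| <= e.
    by move=> H Ux k j; have := H k I j I; rewrite /dpatch /= patchE mem_set.
  exists i.1.2.+1%:R^-1, (cm i); split; first by rewrite invr_gt0.
    move=> x [[Qx Dx] qx] j s sN.
    have Ux := sub _ Qx.
    have h3 := quot_set_real (ltW e0) h1 Qx (r0 i) h2 (qx j I) sN.
    have h4 : `|s *: row j (DT x - cm i)| <= e * `|s|.
      rewrite normrZ mulrC ler_wpM2r//; apply: norm_rV_le => [|k]; first exact: ltW.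
      by have := cl x Dx Ux k j; rewrite !mxE.
    rewrite (_ : f _ - f x - s *: row j (cm i) = (f (upd x j (x ord0 j + s)) - f x - s *: row j (DT x)) + s *: row j (DT x - cm i)).
      by apply: le_trans (ler_normD _ _) _; apply: le_trans (lerD h3 h4) _; rewrite -mulrDl mulr_natl mulr2n.
    by apply/rowP => k; rewrite !mxE; ring.
  by move=> x [[Qx Dx] qx] k j; apply: cl => //; exact: sub.
have : {ae leb (n:=n), forall x, forall i : 'rV[rat]_n * nat * 'I_n,
    rcube (map_mx ratr i.1.1) (i.1.2.+1%:R^-1 + i.1.2.+1%:R^-1) `<=` U ->
    rcube (map_mx ratr i.1.1) i.1.2.+1%:R^-1 x -> exists N, quot_set U f DT e i.2 N x}.
  apply: ae_forall_count => i.
  have [cU|ncU] := pselect (rcube (map_mx ratr i.1.1) (i.1.2.+1%:R^-1 + i.1.2.+1%:R^-1) `<=` U); last by apply: aeW.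
  have := @quot_set_cover_ae R n p U f DT e i.1.2.+1%:R^-1 (map_mx ratr i.1.1) i.2 oU cf mD Hacl e0.
  by rewrite invr_gt0 ltr0Sn => /(_ isT cU); apply: filterS => x Hx _.
apply: filterS => x Hx Ux.
have [d d0 dU] := open_ballP oU Ux.
have [m md] : exists m : nat, m.+1%:R^-1 < d / 4 by apply: natSinv_lt; rewrite divr_gt0.
have m0 : 0 < m.+1%:R^-1 :> R by rewrite invr_gt0.
have [cq xq] := rat_center x m0.
have cU : rcube (map_mx ratr cq) (m.+1%:R^-1 + m.+1%:R^-1) `<=` U.
  move=> y /rcubeP h; apply: dU; have {}h := h (addr_ge0 (ltW m0) (ltW m0)).
  have := ler_distD (map_mx ratr cq) y x; rewrite [`|map_mx ratr cq - x|]distrC => h3.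
  by apply: le_lt_trans h3 _; move: h xq md; move: (m.+1%:R^-1) => mm; lra.
have Qx : rcube (map_mx ratr cq) m.+1%:R^-1 x by apply/rcubeP => //; exact: ltW.
have /choice[N HN] : forall j : 'I_n, exists N, quot_set U f DT e j N x by move=> j; exact: (Hx (cq, m, j)).
pose M := (m.+1 + \max_j N j)%N.
have /choice[C HC] : forall jk : 'I_n * 'I_p, exists q : rat, `|DT x jk.1 jk.2 - ratr q| <= e.
  move=> jk; have [|q] := @rat_in_itvoo R (DT x jk.1 jk.2) (DT x jk.1 jk.2 + e); first by rewrite ltrDl.
  rewrite in_itv/= => /andP[q1 q2]; exists q; rewrite distrC ger0_norm ?subr_ge0 ?(ltW q1)// lerBlDl ltW//.
exists (cq, m, M, \matrix_(j, k) C (j, k)); rewrite /A ifT; last first.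
  apply/asboolP; split => //; rewrite /r /= ltf_pV2 ?posrE// ltr_nat /M.
  by rewrite ltnS leq_addr.
split; first split => //.
  by move=> k _ j _; rewrite /= /dpatch patchE mem_set// /cm /= !mxE; exact: (HC (j, k)).
move=> j _ t tM; apply: HN; apply: lt_le_trans tM _.
rewrite lef_pV2 ?posrE// ler_nat ltnS /M; apply: leq_trans (leq_addl _ _); exact: leq_bigmax.
Qed.

Theorem linearization_cover (e : R) : 0 < e ->
  ccover (fun A => forall x0 x y, A x0 -> A x -> A y -> `|f y - f x - (y - x) *m DT x0| <= e * `|y - x|) U.
Proof.
(* [lin_cover] with the error [2 e'] gives [8 n e'], and passing from [cm] to [DT x0] adds [n e'];
   the 1 avoids a division by 0. *)
move=> e0; pose e' := e / (9 * n%:R + 1).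
have n9 : 0 < 9 * n%:R + 1 :> R by rewrite ltr_wpDl// mulr_ge0.
have e'0 : 0 < e' by rewrite divr_gt0.
apply: (ccover_trans _ (hbound_cover e'0)) => [x0 x y []//|A mA AU [d [cm [d0 hA cA]]]].
have e2 : 0 <= 2 * e' by rewrite mulr_ge0// ltW.
have [B [mB BA lB cB]] := lin_cover mA d0 e2 hA.
exists B; split => // b x0 x y Bx0 Bx By.
have h1 : `|f y - f x - (y - x) *m cm| <= n%:R * (4 * (2 * e')) * `|y - x|.
  by apply: lB Bx By _ => l; rewrite leqNgt ltn_ord.
have h2 : `|(y - x) *m (DT x0 - cm)| <= n%:R * e' * `|y - x|.
  apply: norm_rV_le => [|i]; first by rewrite !mulr_ge0// ltW.
  rewrite mxE; apply: le_trans (ler_norm_sum _ _ _) _.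
  apply: (@le_trans _ _ (\sum_(j < n) `|y - x| * e')).
    apply: ler_sum => j _; rewrite normrM ler_pM//; first exact: ler_coord_norm.
    by rewrite !mxE; apply: cA; exact: BA Bx0.
  by rewrite sumr_const card_ord -[X in X <= _]mulr_natl [`|_| * e']mulrC mulrA.
have -> : f y - f x - (y - x) *m DT x0 = (f y - f x - (y - x) *m cm) - (y - x) *m (DT x0 - cm).
  by rewrite mulmxBr; apply/rowP => l; rewrite !mxE; ring.
apply: le_trans (ler_normB _ _) _; apply: le_trans (lerD h1 h2) _.
rewrite -mulrDl ler_wpM2r// /e'.
rewrite [X in X <= _](_ : _ = e * (9 * n%:R / (9 * n%:R + 1))).
  by rewrite ler_piMr ?(ltW e0)// ler_pdivrMr// mul1r lerDl.
by field; rewrite gt_eqF.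
Qed.

End linearization.

(** * Charts and fibres *)

(** The pieces are made disjoint, then exhausted by compact sets with [compact_exhaustion]; both
    operations pass to subsets, hence the heredity of [P]. *)
Lemma ccover_compact (R : realType) n (P : set 'rV[R]_n -> Prop) (S : set 'rV[R]_n) :
  (forall A B, A `<=` B -> P B -> P A) -> ccover P S ->
  exists K : nat -> set 'rV[R]_n, [/\ forall i, compact (K i), trivIset setT K, forall i, K i `<=` S,
    forall i, P (K i) & {ae leb (n:=n), forall x, S x -> exists i, K i x}].
Proof.
move=> hP [A [mA AS PA cA]].
have sD i : seqDU A i `<=` A i by exact: subDsetl.
have mDU i : measurable (seqDU A i).
  by apply: measurableD => //; apply: bigsetU_measurable => k _.
have /choice[K HK] := fun i => compact_exhaustion (mDU i).
pose L (k : nat) := if pickle_inv k is Some (i, j) then K i j else set0.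
exists L; split.
- move=> k; rewrite /L; case: (pickle_inv k) => [[i j]|]; last exact: compact0.
  by have [] := HK i.
- move=> k k' _ _ [x []]; rewrite /L.
  have H i j : K i j `<=` A i by have [_ h _ _] := HK i; exact: subset_trans (h j) (sD i).
  case E : (pickle_inv k) => [[i j]|//]; case E' : (pickle_inv k') => [[i' j']|//] x1 x2.
  have [_ s1 t1 _] := HK i; have [_ s2 t2 _] := HK i'.
  have ii : i = i' by apply: (@trivIset_seqDU _ A) => //; exists x; split; [exact: s1 x1|exact: s2 x2].
  subst i'; have jj : j = j' by apply: t1 => //; exists x.
  subst j'; have := @pickle_invK (nat * nat)%type k; have := @pickle_invK (nat * nat)%type k'.
  by rewrite E E' => /= <- <-.
- move=> k; rewrite /L; case: (pickle_inv k) => [[i j]|//] x Kx.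
  by have [_ s1 _ _] := HK i; apply: (AS i); apply: sD; exact: s1 Kx.
- move=> k; rewrite /L; case: (pickle_inv k) => [[i j]|].
    apply: hP (PA i); have [_ s1 _ _] := HK i; exact: subset_trans (s1 j) (sD i).
  exact: hP (PA 0%N).
have : {ae leb (n:=n), forall x, forall i, seqDU A i x -> exists j, K i j x}.
  apply: ae_forall_count => i; have [cK _ _ H0] := HK i.
  have mB : measurable (seqDU A i `\` \bigcup_j K i j).
    by apply: measurableD => //; apply: bigcup_measurable => j _; exact: compact_rV_measurable.
  have : (leb (n:=n)).-negligible (seqDU A i `\` \bigcup_j K i j) by exists (seqDU A i `\` \bigcup_j K i j); split.
  apply: negligibleS => x /= nH; have /not_implyP[Dx nK] := nH; split => //.
  by move=> [j _ Kj]; apply: nK; exists j.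
apply: filterS2 cA => x h1 h2 Sx; have [i Ax] := h1 Sx.
have : (\bigcup_k A k) x by exists i.
rewrite seqDU_bigcup_eq => -[i' _ Di']; have [j Kj] := h2 _ Di'.
by exists (pickle (i', j)); rewrite /L pickleK_inv.
Qed.

Lemma leb_compact_lt (R : realType) n (K : set 'rV[R]_n) : compact K -> (leb K < +oo)%E.
Proof.
move=> cK; have [M [_ HM]] := compact_bounded cK.
pose r := Num.max 0 (M + 1).
have r0 : 0 <= r by rewrite le_max lexx.
apply: (@le_lt_trans _ _ (leb (rcube 0 r))); last by rewrite leb_rcube// ltry.
apply: le_meas; [exact: compact_rV_measurable|exact: measurable_rcube|].
move=> x Kx; apply/rcubeP => //; rewrite subr0.
have Mr : M < M + 1 by rewrite ltrDl.
by have := HM _ Mr x Kx; move=> /le_trans; apply; rewrite le_max lexx orbT.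
Qed.

(** The measures of the disjoint pieces add up to [leb Z], so [lip_image_le] bounds the image by
    [(2 c / (j+1)) ^ n] times [leb Z + 1], and [j] is arbitrary. The summand 1 pays for the errors
    of [lip_image_le] on the pieces. *)
Lemma fine_lip_null (R : realType) n (Z : set 'rV[R]_n) (psi : 'rV[R]_n -> 'rV[R]_n) (c : R) : (0 < n)%N ->
  measurable Z -> (leb Z < +oo)%E -> 0 <= c ->
  (forall j : nat, exists P : nat -> set 'rV[R]_n, [/\ forall l, measurable (P l), trivIset setT P,
     Z = \bigcup_l P l & forall l x y, P l x -> P l y -> `|psi x - psi y| <= c / j.+1%:R * `|x - y|]) ->
  (leb (n:=n)).-negligible (psi @` Z).
Proof.
move=> n0 mZ Zoo c0 H; apply: negligible_small => e e0.
pose z := fine (leb Z).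
have z0 : 0 <= z by rewrite fine_ge0.
have zE : leb Z = z%:E by rewrite fineK// ge0_fin_numE.
have d0 : 0 < Num.min 1 (e / (z + 1)) / (c *+ 2 + 1).
  by rewrite divr_gt0 ?lt_min ?ltr01 ?divr_gt0 ?ltr_wpDl ?mulrn_wge0.
have [j jd] := natSinv_lt d0.
have [P [mP tP ZP lP]] := H j.
pose L := c / j.+1%:R.
have L0 : 0 <= L by rewrite divr_ge0.
have L2 : L *+ 2 <= Num.min 1 (e / (z + 1)).
  have cj : c / j.+1%:R <= c * (Num.min 1 (e / (z + 1)) / (c *+ 2 + 1)) by rewrite ler_wpM2l// ltW.
  have m0 : 0 < Num.min 1 (e / (z + 1)) by rewrite lt_min ltr01 divr_gt0// ltr_wpDl.
  apply: (@le_trans _ _ (c * (Num.min 1 (e / (z + 1)) / (c *+ 2 + 1)) *+ 2)); first by rewrite lerMn2r cj orbT.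
  have c1 : 0 < c *+ 2 + 1 by rewrite ltr_wpDl// mulrn_wge0.
  rewrite mulrCA -mulrnAr; move: (Num.min _ _) m0 => M m0.
  by rewrite ler_piMr ?(ltW m0)// -mulrnAl ler_pdivrMr// mul1r lerDl.
have [L21 L2e] : L *+ 2 <= 1 /\ L *+ 2 <= e / (z + 1) by move: L2; rewrite le_min => /andP[].
have el (l : nat) : 0 < 1 / (2 ^ l.+1)%:R :> R by rewrite divr_gt0// ltr0n expn_gt0.
have /choice[B HB] := fun l => lip_image_le (@subset_refl _ (P l)) (mP l) L0 (el l) (lP l).
exists (\bigcup_l B l); split.
- by apply: bigcup_measurable => l _; have [] := HB l.
- rewrite ZP image_bigcup; apply: subset_bigcup => l _; by have [] := HB l.
have mB l : measurable (B l) by have [] := HB l.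
apply: le_trans (meas_bigcup_le _ mB) _.
apply: (@le_trans _ _ (\sum_(l <oo) ((L *+ 2) ^+ n)%:E * (leb (P l) + (1 / (2 ^ l.+1)%:R)%:E))%E).
  by apply: lee_nneseries => l _ //; have [] := HB l.
rewrite nneseriesZl; last by move=> l _; rewrite adde_ge0// lee_fin ltW.
apply: (@le_trans _ _ (((L *+ 2) ^+ n)%:E * (leb Z + 1%:E))%E).
  apply: lee_wpmul2l; first by rewrite lee_fin exprn_ge0// mulrn_wge0.
  apply: le_trans (epsilon_trick _ _ _) _ => //.
  have -> : leb Z = (\sum_(i <oo) leb (P i))%E; last exact: lexx.
    by rewrite ZP measure_bigcup//; apply: eq_eseriesl => i; rewrite in_setT.
rewrite zE -EFinD -EFinM lee_fin.
apply: (@le_trans _ _ (L *+ 2 * (z + 1))).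
  rewrite ler_wpM2r ?addr_ge0// -[X in _ <= X]expr1 ler_wiXn2l ?mulrn_wge0//.
by rewrite -ler_pdivlMr// ltr_wpDl.
Qed.

Section proj.
Context (R : realType) (k m : nat) (s : {perm 'I_(k + m)}).
Definition pl (w : 'rV[R]_(k + m)) : 'rV[R]_k := \row_i w ord0 ((s^-1)%g (lshift m i)).
Definition pr (w : 'rV[R]_(k + m)) : 'rV[R]_m := \row_i w ord0 ((s^-1)%g (rshift k i)).

Lemma pl_joinp z : pl (joinp s z) = z.1.
Proof. by apply/rowP => i; rewrite mxE joinpl. Qed.
Lemma pr_joinp z : pr (joinp s z) = z.2.
Proof. by apply/rowP => i; rewrite mxE joinpr. Qed.
Lemma joinp_proj w : joinp s (pl w, pr w) = w.
Proof.
apply/rowP => i; pose P i := joinp s (pl w, pr w) ord0 i = w ord0 i.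
by apply: (joinp_ind (s := s) (P := P)) => {}i; rewrite /P ?joinpl ?joinpr mxE.
Qed.
Lemma norm_pl w : `|pl w| <= `|w|.
Proof. by apply: norm_rV_le => // i; rewrite mxE ler_coord_norm. Qed.
Lemma norm_pr w : `|pr w| <= `|w|.
Proof. by apply: norm_rV_le => // i; rewrite mxE ler_coord_norm. Qed.
Lemma plB w w' : pl (w - w') = pl w - pl w'.
Proof. by apply/rowP => i; rewrite !mxE. Qed.
Lemma prB w w' : pr (w - w') = pr w - pr w'.
Proof. by apply/rowP => i; rewrite !mxE. Qed.
Lemma norm_joinp (z : 'rV[R]_k * 'rV[R]_m) : `|joinp s z| <= Num.max `|z.1| `|z.2|.
Proof.
apply: norm_rV_le => [|i]; first by rewrite le_max normr_ge0.
pose P i := `|joinp s z ord0 i| <= Num.max `|z.1| `|z.2|.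
by apply: (joinp_ind (s := s) (P := P)) => {}i; rewrite /P ?joinpl ?joinpr le_max ler_coord_norm ?orbT.
Qed.
Lemma joinpB (z z' : 'rV[R]_k * 'rV[R]_m) : joinp s z - joinp s z' = joinp s (z.1 - z'.1, z.2 - z'.2).
Proof.
by rewrite -[RHS]joinp_proj; rewrite -[LHS]joinp_proj plB prB !pl_joinp !pr_joinp.
Qed.
Lemma pl_continuous : continuous pl.
Proof.
apply: (@lip_continuous _ _ _ _ 1) => // y y'; rewrite mul1r -plB; exact: norm_pl.
Qed.
Lemma pr_continuous : continuous pr.
Proof.
apply: (@lip_continuous _ _ _ _ 1) => // y y'; rewrite mul1r -prB; exact: norm_pr.
Qed.
End proj.

(** * Null sets seen through one chart *)

Section core.
Context (R : realType) (k m : nat).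
Local Notation n := (k + m)%N.
Variables (U : set 'rV[R]_n) (f g : 'rV[R]_n -> 'rV[R]_n) (DT : 'rV[R]_n -> 'M[R]_n).
Variables (s t : {perm 'I_n}).
Hypothesis m0 : (0 < m)%N.
Hypothesis fU : forall x, U x -> {for x, continuous f}.
Hypothesis gf : forall x, U x -> g (f x) = x.
Hypothesis lusin : {ae leb (n:=k), forall y, forall N : set 'rV[R]_m, compact N ->
  (forall z, N z -> (f @` U) (joinp s (y, z))) -> leb N = 0%E ->
  (leb (n:=m)).-negligible ((fun z => pr t (g (joinp s (y, z)))) @` N)}.
Hypothesis dl : forall e : R, 0 < e ->
  ccover (fun A => forall x0 x y, A x0 -> A x -> A y -> `|f y - f x - (y - x) *m DT x0| <= e * `|y - x|) U.

(** [s] sorts the components of [f] and [t] the variables. The two halves are joined with [t], so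
    that the chart of the identity is the identity when [s = t], and slices of the image over [y]
    are the [x2]-projections of the fibres [f1 = y]. *)
Definition chart (x : 'rV[R]_n) := joinp t (pl s (f x), pr t x).

Lemma chart_core (K : set 'rV[R]_n) (L c : R) : compact K -> K `<=` U -> 0 <= L -> 0 <= c ->
  (forall x y, K x -> K y -> `|y - x| <= L * `|chart y - chart x|) ->
  (forall j : nat, exists C : nat -> set 'rV[R]_n, [/\ forall l, compact (C l), trivIset setT C,
     forall x, K x -> exists l, C l x & forall l x y, K x -> K y -> C l x -> C l y ->
       pl s (f x) = pl s (f y) -> `|pr s (f y) - pr s (f x)| <= c / j.+1%:R * `|pr t y - pr t x|]) ->
  leb K = 0%E.
Proof.
move=> cK KU L0 c0 KL HC.
have cfK (B : set 'rV[R]_n) : B `<=` U -> {within B, continuous f}.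
  by move=> BU; apply: continuous_in_subspaceT => x /set_mem Bx; apply: fU; exact: BU.
have cF (B : set 'rV[R]_n) : B `<=` U -> {within B, continuous chart}.
  move=> BU; apply: cont_on_within => x Bx e e0.
  have [d d0 Hd] := within_cont_on (cfK B BU) Bx e0.
  exists (Num.min d e); first by rewrite lt_min d0.
  move=> y By; rewrite lt_min => /andP[yd ye]; rewrite /chart joinpB; apply: le_lt_trans (norm_joinp _ _) _.
  rewrite /= -plB -prB gt_max (le_lt_trans (norm_pl _ _) (Hd y By yd))/=.
  exact: le_lt_trans (norm_pr _ _) ye.
have cFK (B : set 'rV[R]_n) : compact B -> B `<=` U -> compact (chart @` B).
  by move=> cB BU; apply: continuous_compact => //; exact: cF.
have inj x y : K x -> K y -> chart x = chart y -> x = y.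
  move=> Kx Ky xy; have := KL x y Kx Ky; rewrite xy subrr normr0 mulr0 normr_le0 subr_eq0 => /eqP.
  by [].
have [G HG] : exists G : 'rV[R]_n -> 'rV[R]_n, forall x, K x -> G (chart x) = x.
  have H w : exists x, forall x', K x' -> chart x' = w -> x' = x.
    have [[x [Kx xw]]|nx] := pselect (exists x, K x /\ chart x = w).
      by exists x => x' Kx' xw'; apply: inj => //; rewrite xw.
    by exists 0 => x' Kx' xw'; exfalso; apply: nx; exists x'.
  have [G HG] := choice H; exists G => x Kx; symmetry; exact: HG.
have mslice (B : set 'rV[R]_n) (y : 'rV[R]_k) : measurable B -> measurable [set z : 'rV[R]_m | B (joinp t (y, z))].
  move=> mB; have mj : measurable_fun setT (fun z : 'rV[R]_m => joinp t (y, z)).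
    by apply: (measurableT_comp (measurable_joinp t)); exact: measurable_fun_pair.
  by rewrite -[X in measurable X]setTI; exact: mj.
have ZE (B : set 'rV[R]_n) (y : 'rV[R]_k) (z : 'rV[R]_m) : (chart @` B) (joinp t (y, z)) <-> exists x, [/\ B x, pl s (f x) = y & pr t x = z].
  split=> [[x Bx xE]|[x [Bx <- <-]]]; last by exists x.
  exists x; split => //.
    by have := congr1 (pl t) xE; rewrite /chart !pl_joinp.
  by have := congr1 (pr t) xE; rewrite /chart !pr_joinp.
have mFK : measurable (chart @` K) by apply: compact_rV_measurable; exact: cFK.
have FK0 : leb (chart @` K) = 0%E.
  apply: (leb_joinp0 (s := t)) => //; move: lusin; apply: filterS => y Hy.
  (* [Z] is the [x2]-projection of the fibre [f1 = y] in [K]; on it [psi] sends [x2] to the value of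
     [f2], and [N] is the set of these values. [psi] shows that [N] is null, and the hypothesis
     [lusin] goes back from [N] to [Z]. *)
  pose Z := [set z | (chart @` K) (joinp t (y, z))].
  have mZ : measurable Z by exact: mslice.
  pose psi (z : 'rV[R]_m) : 'rV[R]_m := pr s (f (G (joinp t (y, z)))).
  have psiE x : K x -> pl s (f x) = y -> psi (pr t x) = pr s (f x).
    by move=> Kx xy; rewrite /psi -xy -/(chart x) HG.
  pose N := pr s @` (f @` K `&` pl s @^-1` [set y]).
  have NE : N = psi @` Z.
    apply/seteqP; split => z.
      move=> [_ [[x Kx <-] /= xy] <-]; exists (pr t x); first by apply/ZE; exists x.
      exact: psiE.
    move=> [z' /ZE [x [Kx xy <-]] <-]; rewrite psiE//; exists (f x) => //; split => //; by exists x.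
  have cN : compact N.
    apply: continuous_compact; first by apply: continuous_subspaceT; exact: pr_continuous.
    apply: compact_closedI; first by apply: continuous_compact => //; exact: cfK.
    apply: closed_comp; first by move=> w _; exact: pl_continuous.
    by apply: compact_rV_closed; exact: compact_set1.
  have Noo : (leb Z < +oo)%E.
    apply: (@le_lt_trans _ _ (leb (pr t @` K))); last first.
      by apply: leb_compact_lt; apply: continuous_compact => //; apply: continuous_subspaceT; exact: pr_continuous.
    apply: le_meas => //.
      apply: compact_rV_measurable; apply: continuous_compact => //; apply: continuous_subspaceT; exact: pr_continuous.
    by move=> z /ZE[x [Kx _ <-]]; exists x.
  have N0 : (leb (n:=m)).-negligible N.
    rewrite NE; apply: (@fine_lip_null R m Z psi c) => // j.
    have [C [cC tC KC lC]] := HC j.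
    exists (fun l => [set z | (chart @` (K `&` C l)) (joinp t (y, z))]); split.
    - move=> l; apply: mslice; apply: compact_rV_measurable; apply: cFK; last by move=> x [/KU].
      by apply: compact_closedI => //; exact: compact_rV_closed.
    - move=> l l' _ _ [z [/ZE[x [[Kx Cx] xy xz]] /ZE[x' [[Kx' Cx'] xy' xz']]]].
      have xx : x = x' by apply: inj => //; rewrite /chart xy xy' xz xz'.
      by apply: tC => //; exists x; split => //; rewrite xx.
    - apply/seteqP; split => z.
        move=> /ZE[x [Kx xy xz]]; have [l Cx] := KC x Kx; exists l => //; apply/ZE; by exists x.
      by move=> [l _ /ZE[x [[Kx _] xy xz]]]; apply/ZE; exists x.
    move=> l z z' /ZE[x [[Kx Cx] xy <-]] /ZE[x' [[Kx' Cx'] xy' <-]].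
    by rewrite !psiE//; apply: (lC l x' x) => //; exact: etrans xy' (esym xy).
  have leN0 : leb N = 0%E by apply: measure_negligible => //; exact: compact_rV_measurable.
  have NV z : N z -> (f @` U) (joinp s (y, z)).
    move=> [_ [[x Kx <-] /= xy] <-]; rewrite -xy joinp_proj; exists x => //; exact: KU.
  have := Hy N cN NV leN0; apply: negligibleS.
  move=> z /ZE[x [Kx xy <-]]; exists (pr s (f x)).
    by exists (f x) => //; split => //; exists x.
  by rewrite -xy joinp_proj gf//; exact: KU.
have : (leb (n:=n)).-negligible (G @` (chart @` K)).
  apply: (@negligible_lip_image _ _ _ _ L) => //; first by exists (chart @` K); split.
  by move=> _ _ [x Kx <-] [y Ky <-]; rewrite !HG//; exact: KL.
move=> H; apply: measure_negligible; first exact: compact_rV_measurable.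
by apply: negligibleS H => x Kx; exists (chart x); [exists x|exact: HG].
Qed.

(** The first bound says that the differential of [f2] is dominated by that of [f1], the second that
    the differential of the chart is bounded below. A fixed precision of the linearization makes the
    chart injective with Lipschitz inverse on each piece; arbitrarily fine precision then makes [f2]
    nearly constant on the fibres of [f1]. *)
Lemma rank_core (S : set 'rV[R]_n) (M : R) : 0 < M -> S `<=` U ->
  (forall x h, S x -> `|pr s (h *m DT x)| <= M * `|pl s (h *m DT x)|) ->
  (forall x h, S x -> `|h| <= M * (`|pl s (h *m DT x)| + `|pr t h|)) ->
  (leb (n:=n)).-negligible S.
Proof.
move=> M0 SU H1 H2.
pose P e := fun A : set 'rV[R]_n => forall x0 x y, A x0 -> A x -> A y -> `|f y - f x - (y - x) *m DT x0| <= e * `|y - x|.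
have hP e A B : A `<=` B -> P e B -> P e A.
  by move=> AB PB x0 x y *; apply: PB; exact: AB.
(* At this precision the linearization error, multiplied by [M], is half of [|y - x|] and is
   absorbed on the left. *)
have e00 : 0 < (2 * M)^-1 by rewrite invr_gt0 mulr_gt0.
have [A [cA _ AU PA HA]] := ccover_compact (@hP _) (dl e00).
have /choice[C HC] := fun j : nat => ccover_compact (@hP _) (dl (e := j.+1%:R^-1) ltac:(by rewrite invr_gt0)).
have HCc j l : compact (C j l) by have [] := HC j.
pose T i := A i `&` \bigcap_(j in setT) \bigcup_(l in [set l | C j l `&` S !=set0]) C j l.
have mT i : measurable (T i).
  apply: measurableI; first exact: compact_rV_measurable.
  apply: bigcap_measurableType => j _; apply: bigcup_measurable => l _; exact: compact_rV_measurable.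
(* [T i] is a measurable substitute for [A i `&` S], where [S] itself need not be
   measurable: the estimates only use one point of [S] in each piece. *)
have T0 i : A i `&` S !=set0 -> leb (T i) = 0%E.
  move=> [x0 [Ax0 Sx0]].
  have [K [cK KT _ TK]] := compact_exhaustion (mT i).
  have K0 b : leb (K b) = 0%E.
    have KA : K b `<=` A i by move=> x /KT[].
    have KU : K b `<=` U by apply: subset_trans KA (AU i).
    have lin x y (x1 : 'rV[R]_n) (e : R) B : P e B -> B x1 -> B x -> B y -> S x1 ->
       `|pl s ((y - x) *m DT x1)| <= `|pl s (f y) - pl s (f x)| + e * `|y - x|.
      move=> PB B1 Bx By S1; have := PB x1 x y B1 Bx By => h.
      have -> : (y - x) *m DT x1 = (f y - f x) - (f y - f x - (y - x) *m DT x1) by rewrite subKr.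
      by rewrite plB plB; apply: le_trans (ler_normB _ _) _; rewrite lerD2l; apply: le_trans (norm_pl _ _) h.
    have lip x y : K b x -> K b y -> `|y - x| <= 2 * M * (`|pl s (f y) - pl s (f x)| + `|pr t y - pr t x|).
      move=> Kx Ky; have h1 := lin x y x0 _ _ (PA i) Ax0 (KA _ Kx) (KA _ Ky) Sx0.
      have h2 := H2 x0 (y - x) Sx0; rewrite prB in h2.
      have h3 : `|y - x| <= M * (`|pl s (f y) - pl s (f x)| + (2 * M)^-1 * `|y - x| + `|pr t y - pr t x|).
        by apply: le_trans h2 _; rewrite ler_pM2l// lerD2r.
      move: h3; rewrite !mulrDr mulrA invfM mulrCA divff ?gt_eqF// mulr1 => h3.
      have := normr_ge0 (y - x); move: h3 M0; rewrite -!mulrA; lra.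
    have lip' x y : K b x -> K b y -> `|y - x| <= 4 * M * `|chart y - chart x|.
      move=> Kx Ky; apply: le_trans (lip x y Kx Ky) _.
      have -> : 4 * M = 2 * M * 2 by ring.
      rewrite -[leRHS]mulrA ler_pM2l ?mulr_gt0// mulr_natl mulr2n; apply: lerD.
        by have := norm_pl t (chart y - chart x); rewrite plB !pl_joinp.
      by have := norm_pr t (chart y - chart x); rewrite prB !pr_joinp.
    (* On a fibre, [f2] moves by at most [(M + 1) / (j + 1)] times [|y - x|], and [|y - x|] is at
       most [2 M] times the distance of the [x2]-projections. *)
    apply: (@chart_core (K b) (4 * M) ((M + 1) * (2 * M)) (cK b) KU) => //.
    - by rewrite mulr_ge0// ltW.
    - by rewrite !mulr_ge0 ?addr_ge0// ltW.
    move=> j; have [_ tC CU PC HCj] := HC j.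
    exists (fun l => if `[< C j l `&` S !=set0 >] then C j l else set0); split.
    - by move=> l; case: ifP => _; [exact: HCc|exact: compact0].
    - exact: trivIset_if.
    - move=> x /KT[_ /(_ j I)[l /= lS Cx]]; exists l; rewrite ifT//; exact/asboolP.
    move=> l x y Kx Ky; case: ifPn => [/asboolP[x1 [C1 S1]] Cx Cy xy|_ []].
    have h1 := lin x y x1 _ _ (PC l) C1 Cx Cy S1; rewrite xy subrr normr0 add0r in h1.
    have h2 := lip x y Kx Ky; rewrite xy subrr normr0 add0r in h2.
    have h3 := PC l x1 x y C1 Cx Cy.
    have -> : pr s (f y) - pr s (f x) = pr s (f y - f x - (y - x) *m DT x1) + pr s ((y - x) *m DT x1).
      by rewrite -prB [pr s (_ - _ *m _)]prB subrK.
    have e0 : 0 < j.+1%:R^-1 :> R by rewrite invr_gt0.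
    have h4 := H1 x1 (y - x) S1.
    apply: le_trans (ler_normD _ _) _.
    apply: (@le_trans _ _ ((M + 1) * j.+1%:R^-1 * `|y - x|)).
      rewrite mulrDl mulrDl mul1r addrC; apply: lerD; last exact: le_trans (norm_pr _ _) h3.
      by apply: le_trans h4 _; rewrite -mulrA ler_pM2l.
    have -> : (M + 1) * (2 * M) / j.+1%:R * `|pr t y - pr t x| = (M + 1) / j.+1%:R * (2 * M * `|pr t y - pr t x|) by ring.
    by rewrite ler_pM2l// mulr_gt0// addr_gt0.
  have : (leb (n:=n)).-negligible (\bigcup_b K b `|` (T i `\` \bigcup_b K b)).
    apply: negligibleU; last first.
      exists (T i `\` \bigcup_b K b); split => //; apply: measurableD => //; apply: bigcup_measurable => b _; exact: compact_rV_measurable.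
    apply: negligible_bigcup => b; exists (K b); split; [exact: compact_rV_measurable|exact: K0|by []].
  move=> H; apply: measure_negligible => //; apply: negligibleS H => x Tx.
  by have [Kx|nK] := pselect ((\bigcup_b K b) x); [left|right].
have : {ae leb (n:=n), forall x, (U x -> exists i, A i x) /\ forall j, U x -> exists l, C j l x}.
  have : {ae leb (n:=n), forall x, forall j, U x -> exists l, C j l x}.
    by apply: ae_forall_count => j; have [] := HC j.
  by apply: filterS2 HA.
move=> H.
have : (leb (n:=n)).-negligible ((\bigcup_i if `[< A i `&` S !=set0 >] then T i else set0)).
  apply: negligible_bigcup => i; case: ifPn => [/asboolP h|_]; last exact: negligible_set0.
  by exists (T i); split => //; exact: T0.
move=> H'; have := negligibleU H' H; apply: negligibleS => x Sx.
have [nx|hx] := pselect ((U x -> exists i, A i x) /\ forall j, U x -> exists l, C j l x); last by right.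
left; have [i Ax] := nx.1 (SU _ Sx); exists i => //.
rewrite ifT; last by apply/asboolP; exists x.
split => // j _; have [l Cx] := nx.2 j (SU _ Sx); exists l => //; by exists x.
Qed.

End core.

(** The values of [f] are listed first and the remaining indices after them. *)
Lemma perm_extend (k m : nat) (f : 'I_k -> 'I_(k + m)) : injective f ->
  exists s : {perm 'I_(k + m)}, forall i, (s^-1)%g (lshift m i) = f i.
Proof.
move=> injf; pose a := codom f ++ enum [predC codom f].
have ca : size (codom f) = k by rewrite size_codom card_ord.
have sa : size a = (k + m)%N.
  have := cardC (mem (codom f)); rewrite card_codom// !card_ord => E.
  by rewrite size_cat ca -cardE; apply: etrans E; congr (_ + _)%N; apply: eq_card => x; rewrite !inE.
have ua : uniq a.
  rewrite cat_uniq enum_uniq andbT; apply/andP; split; first by rewrite /codom map_inj_uniq ?enum_uniq.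
  by apply/hasPn => x; rewrite mem_enum inE.
pose h (i : 'I_(k + m)) : 'I_(k + m) := nth i a i.
have injh : injective h.
  move=> i j; rewrite /h (set_nth_default j) ?sa// => /eqP; rewrite nth_uniq ?sa// => /eqP E; exact: val_inj.
exists (perm injh)^-1%g => i; rewrite invgK permE /h nth_cat ca /= ltn_ord.
by rewrite (nth_map i) ?size_enum_ord// nth_ord_enum.
Qed.

Lemma mulmx_norm_le (R : realType) a b (B : 'M[R]_(a, b)) :
  exists2 C : R, 0 <= C & forall v : 'rV[R]_a, `|v *m B| <= C * `|v|.
Proof.
exists (\sum_i \sum_j `|B i j|); first by apply: sumr_ge0 => i _; exact: sumr_ge0.
move=> v; apply: norm_rV_le => [|j].
  by rewrite mulr_ge0//; apply: sumr_ge0 => i _; exact: sumr_ge0.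
rewrite mxE; apply: le_trans (ler_norm_sum _ _ _) _; rewrite mulr_suml; apply: ler_sum => i _.
rewrite normrM mulrC; apply: ler_pM => //; last exact: ler_coord_norm.
by rewrite (bigD1 j)//= lerDl sumr_ge0.
Qed.

(** [k] independent columns, selected by [s], form [D] with [A = D *m X], which bounds the other
    components. Then [k] independent rows of [D], selected by [t], form an invertible block [B1], so
    that [pl t h] is solved from [h *m D] and [pr t h]. *)
Lemma rank_split (R : realType) (k m : nat) (A : 'M[R]_(k + m)) : \rank A = k ->
  exists (s t : {perm 'I_(k + m)}) (M : R), 0 < M /\ forall h : 'rV[R]_(k + m),
    `|pr s (h *m A)| <= M * `|pl s (h *m A)| /\ `|h| <= M * (`|pl s (h *m A)| + `|pr t h|).
Proof.
move=> rA; have rAT : k = \rank A^T by rewrite mxrank_tr.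
have [s sE] : exists s : {perm 'I_(k + m)}, forall i, (s^-1)%g (lshift m i) = maxrankfun A^T (cast_ord rAT i).
  by apply: perm_extend => i j /maxrankfun_inj/cast_ord_inj.
pose D : 'M[R]_(k + m, k) := colsub (fun i => (s^-1)%g (lshift m i)) A.
have plE (h : 'rV[R]_(k + m)) : pl s (h *m A) = h *m D.
  by apply/rowP => i; rewrite !mxE; apply: eq_bigr => j _; rewrite mxE.
have DE : D^T = castmx (esym rAT, erefl) (rowsub (maxrankfun A^T) A^T).
  apply/matrixP => i j; rewrite castmxE !mxE /= esymK cast_ord_id sE //.
have [X AX] : exists X : 'M[R]_(k, k + m), A = D *m X.
  have : (A^T <= D^T)%MS.
    by rewrite DE eqmx_cast eq_maxrowsub.
  by move=> /submxP[X XE]; exists X^T; rewrite -[A]trmxK XE trmx_mul trmxK.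
have rD : k = \rank D by rewrite -mxrank_tr DE eqmx_cast eq_maxrowsub.
have [t tE] : exists t : {perm 'I_(k + m)}, forall i, (t^-1)%g (lshift m i) = maxrankfun D (cast_ord rD i).
  by apply: perm_extend => i j /maxrankfun_inj/cast_ord_inj.
pose B1 : 'M[R]_k := rowsub (fun i => (t^-1)%g (lshift m i)) D.
pose B2 : 'M[R]_(m, k) := rowsub (fun i => (t^-1)%g (rshift k i)) D.
have hD (h : 'rV[R]_(k + m)) : h *m D = pl t h *m B1 + pr t h *m B2.
  apply/rowP => j; rewrite !mxE (reindex_inj (@perm_inj _ (t^-1)%g)) big_split_ord /=.
  by congr (_ + _); apply: eq_bigr => i _; rewrite !mxE.
have uB1 : B1 \in unitmx.
  rewrite -row_free_unit /row_free.
  have -> : B1 = castmx (esym rD, erefl) (rowsub (maxrankfun D) D).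
    by apply/matrixP => i j; rewrite castmxE !mxE /= esymK cast_ord_id tE.
  by rewrite eqmx_cast eq_maxrowsub -rD.
have [C1 C10 H1] := mulmx_norm_le X.
have [C2 C20 H2] := mulmx_norm_le B2.
have [C3 C30 H3] := mulmx_norm_le (invmx B1).
exists s, t, (C1 + C3 + C3 * C2 + 1).
have M0 : 0 < C1 + C3 + C3 * C2 + 1 by rewrite ltr_wpDl// !addr_ge0// mulr_ge0.
split => // h; rewrite plE; split.
  have -> : h *m A = h *m D *m X by rewrite {1}AX mulmxA.
  apply: le_trans (norm_pr _ _) _; apply: le_trans (H1 _) _; rewrite ler_wpM2r//.
  by rewrite -!addrA lerDl !addr_ge0// mulr_ge0.
have hl : pl t h = (h *m D - pr t h *m B2) *m invmx B1 by rewrite hD addrK mulmxK.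
apply: (@le_trans _ _ (Num.max `|pl t h| `|pr t h|)); first by rewrite -{1}(joinp_proj t h); exact: norm_joinp.
rewrite ge_max; apply/andP; split; last first.
  by rewrite mulrDr; have := normr_ge0 (h *m D); have := normr_ge0 (pr t h); move: C10 C20 C30 M0 (mulr_ge0 C30 C20) => *; nra.
rewrite hl; apply: le_trans (H3 _) _.
have h4 : `|h *m D - pr t h *m B2| <= `|h *m D| + C2 * `|pr t h|.
  by apply: le_trans (ler_normB _ _) _; rewrite lerD2l; exact: H2.
apply: (le_trans (ler_wpM2l C30 h4)).
have := normr_ge0 (h *m D); have := normr_ge0 (pr t h).
move: (`|h *m D|) (`|pr t h|) => a b b0 a0; move: C10 C20 C30 M0 (mulr_ge0 C30 C20) => *; nra.
Qed.

(** * Slices of Sobolev maps *)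

Section sobolev_acl.
Context (R : realType).
Local Notation lm := (@lebesgue_measure R).

Lemma in_Lq_measurable n q (U : set 'rV[R]_n) u : measurable U -> in_Lq q U u -> measurable_fun U u.
Proof.
move=> mU; rewrite /in_Lq inE => /andP[/= mu _]; apply/(measurable_restrictT _ mU).
exact: (set_mem mu).
Qed.

(** On a set of finite measure, [|u| <= 1 + |u| ^ q] is integrable. *)
Lemma in_Lq_integrable_box n q (U : set 'rV[R]_n) u (a b : 'I_n -> R) : measurable U -> 1 <= q -> in_Lq q U u ->
  rbox (fun i => `[a i, b i]%classic) `<=` U ->
  (leb (n:=n)).-integrable (rbox (fun i => `[a i, b i]%classic)) (EFin \o u).
Proof.
move=> mU q1 uq BU; have iq := Lfun_integrable q1 uq.
set B := rbox _ in BU *.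
have mB : measurable B by apply: measurable_rbox => i; exact: measurable_itv.
have Boo : (leb B < +oo)%E.
  pose c := Num.max 0 (\big[Num.max/0]_i Num.max `|a i| `|b i|).
  apply: (@le_lt_trans _ _ (leb (rcube (0 : 'rV[R]_n) c))); last by rewrite leb_rcube ?ltry// le_max lexx.
  apply: le_meas => //; first exact: measurable_rcube.
  move=> x Bx; apply/rcubeP; first by rewrite le_max lexx.
  rewrite subr0; apply: norm_rV_le => [|i]; first by rewrite le_max lexx.
  have := Bx i; rewrite /= in_itv/= => /andP[h1 h2].
  rewrite le_max; apply/orP; right; apply: le_trans (le_bigmax _ _ i).
  rewrite le_max; have [x0|x0] := lerP 0 (x ord0 i).
    by apply/orP; right; rewrite (ger0_norm x0) (le_trans h2)// ler_norm.
  by apply/orP; left; rewrite (ltr0_norm x0) -[`|a i|]normrN; apply: le_trans (ler_norm _); rewrite lerN2.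
have iB : (leb (n:=n)).-integrable B (fun x => (1 + `|(u \_ U) x| `^ q)%:E).
  apply: (@integrableD _ _ _ _ _ mB (fun _ => 1%:E) (fun x => (`|(u \_ U) x| `^ q)%:E)).
    apply/integrableP; split; first exact: measurable_cst.
    by under eq_integral do rewrite gee0_abs// ?lee_fin//; rewrite integral_cst// mul1e.
  by apply: integrableS iq.
apply: le_integrable iB => //.
  apply/measurable_EFinP; apply: measurable_funS (in_Lq_measurable mU uq) => //.
move=> x Bx; rewrite !abse_EFin lee_fin; apply: le_trans (ler_norm _).
have -> : (u \_ U) x = u x by rewrite patchE mem_set//; exact: BU.
have [u1|u1] := leP `|u x| 1; first by apply: le_trans u1 _; rewrite lerDl powR_ge0.
have : `|u x| `^ 1 <= `|u x| `^ q by apply: ler_powR => //; exact: ltW.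
by rewrite powRr1// => h; apply: le_trans h _; rewrite lerDr.
Qed.

Lemma sobolev_acl n p q (U : set 'rV[R]_n) (f : 'rV[R]_n -> 'rV[R]_p) Df : open U ->
  (forall x, U x -> {for x, continuous f}) -> 1 <= q -> sobolev_with_derivative q U f Df ->
  acl U f (fun x => (Df x)^T).
Proof.
case: n U f Df => [|n] U f Df oU cf q1 sf i j; first by case: j.
have [_ /(_ j)[vq wp]] := sf i; have mU := open_rV_measurable oU.
have cfi x : U x -> {for x, continuous (fun y => f y ord0 i)}.
  move=> Ux; apply: (@continuous_comp _ _ _ f (fun z : 'rV[R]_p => z ord0 i)); last exact: coord_continuous.
  exact: cf.
have := @weak_partial_acl R n j U (fun x => f x ord0 i) (fun x => Df x i j) oU cfi _ wp.
move=> H; have {}H := H (fun a b => in_Lq_integrable_box mU q1 vq).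
apply: filterS H => x H a b ab abU; have [h1 h2] := H a b ab abU.
have E : (fun t : measurableTypeR R => (Df (upd x j t))^T j i) = (fun t => Df (upd x j t) i j).
  by apply/funext => t; rewrite mxE.
by rewrite -h2; split; [apply: eq_integrable h1 => // t _; rewrite mxE|apply: eq_Rintegral => t _; rewrite mxE].
Qed.

End sobolev_acl.

(** The sum is at most the number of terms times the largest one. *)
Lemma powR_sum_le (R : realType) (I : finType) (c : I -> R) (q : R) : 0 < q -> (forall i, 0 <= c i) ->
  (\sum_i c i) `^ q <= #|I|%:R `^ q * \sum_i c i `^ q.
Proof.
move=> q0 c0.
case: (pickP [pred i : I | true]) => [i0 _|e]; last first.
  by rewrite !big_pred0// powR0 ?gt_eqF// mulr0.
case: (arg_maxP c (i0 := i0) (P := predT)) => // i _ Hi.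
apply: (@le_trans _ _ ((#|I|%:R * c i) `^ q)).
  apply: ge0_ler_powR; rewrite ?nnegrE ?sumr_ge0 ?mulr_ge0 ?(ltW q0)//.
  by apply: le_trans (ler_sum _ (fun j _ => Hi j isT)) _; rewrite sumr_const mulr_natl.
rewrite powRM// ler_wpM2l ?powR_ge0// (bigD1 i)//= lerDl; apply: sumr_ge0 => j _; exact: powR_ge0.
Qed.

Section gradient.
Context (R : realType) (n p : nat) (V : set 'rV[R]_n) (g : 'rV[R]_n -> 'rV[R]_p) (Dg : 'rV[R]_n -> 'M[R]_(p, n)) (q : R).
Local Notation lm := (@lebesgue_measure R).
Hypothesis oV : open V.
Hypothesis cg : forall x, V x -> {for x, continuous g}.
Hypothesis q1 : 1 <= q.
Hypothesis sg : sobolev_with_derivative q V g Dg.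

Definition grad_sum (x : 'rV[R]_n) : R := \sum_(ij : 'I_p * 'I_n) `|((fun y => Dg y ij.1 ij.2) \_ V) x|.

Let mV : measurable V := open_rV_measurable oV.

Lemma grad_sum_ge0 x : 0 <= grad_sum x. Proof. exact: sumr_ge0. Qed.

Lemma measurable_grad_sum : measurable_fun setT grad_sum.
Proof.
apply: measurable_sum => ij; apply: measurableT_comp => //.
apply/(measurable_restrictT _ mV); apply: in_Lq_measurable (proj1 (proj2 (sg ij.1) ij.2)) => //.
Qed.

Lemma grad_sum_integrable : (leb (n:=n)).-integrable setT (fun x => (grad_sum x `^ q)%:E).
Proof.
have q0 : 0 < q by apply: lt_le_trans q1.
have h : (leb (n:=n)).-integrable setT (fun x => (#|{: 'I_p * 'I_n}|%:R `^ q)%:E *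
   \sum_(ij : 'I_p * 'I_n) (`|((fun y => Dg y ij.1 ij.2) \_ V) x| `^ q)%:E)%E.
  apply: integrableZl => //; apply: integrable_sum => // ij _.
  exact: Lfun_integrable q1 (proj1 (proj2 (sg ij.1) ij.2)).
apply: le_integrable h => //.
  apply/measurable_EFinP; exact: measurableT_comp (measurable_powR q) measurable_grad_sum.
move=> x _; rewrite sumEFin -EFinM !abse_EFin lee_fin ger0_norm ?powR_ge0//.
by apply: le_trans (ler_norm _); exact: powR_sum_le.
Qed.

Lemma grad_sum_upper : upper_gradient V g grad_sum.
Proof.
move=> j.
have H : {ae leb (n:=n), forall x, forall i : 'I_p, forall a b : R, a <= b -> (forall t, a <= t <= b -> V (upd x j t)) ->
  lm.-integrable `[a, b] (fun t => ((Dg (upd x j t))^T j i)%:E) /\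
  \int[lm]_(t in `[a, b]) (Dg (upd x j t))^T j i = g (upd x j b) ord0 i - g (upd x j a) ord0 i}.
  apply: ae_forall_count => i; exact: (sobolev_acl oV cg q1 sg i j).
apply: filterS H => x H a b ab abV.
have mI : measurable (`[a, b]%classic : set (measurableTypeR R)) by exact: measurable_itv.
have G0 : (0 <= \int[lm]_(t in `[a, b]) (grad_sum (upd x j t))%:E)%E.
  by apply: integral_ge0 => t _; rewrite lee_fin grad_sum_ge0.
case E : (\int[lm]_(t in `[a, b]) (grad_sum (upd x j t))%:E)%E G0 => [c| |] // G0; last by rewrite leey.
rewrite lee_fin; apply: norm_rV_le => [//|i]; rewrite !mxE.
have [h1 h2] := H i a b ab abV; rewrite -h2 -lee_fin -E.
apply: (@le_trans _ _ (\int[lm]_(t in `[a, b]) `|(Dg (upd x j t))^T j i|%:E)%E).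
  rewrite /Rintegral -abse_EFin fineK; last exact: integrable_fin_num h1.
  by apply: le_abse_integral => //; have /integrableP[] := h1.
have mG : measurable_fun `[a, b] (fun t : measurableTypeR R => (grad_sum (upd x j t))%:E).
  apply/measurable_EFinP; apply: measurable_funTS; apply: measurableT_comp measurable_grad_sum _.
  exact: measurable_upd.
apply: ge0_le_integral => //.
- by apply/measurable_EFinP; apply: measurableT_comp => //; have /integrableP[/measurable_EFinP] := h1.
move=> t /=; rewrite in_itv/= => tab; rewrite lee_fin mxE /grad_sum (bigD1 (i, j))//=.
by rewrite patchE mem_set ?lerDl ?sumr_ge0//; exact: abV.
Qed.

End gradient.

Section slices.
Context (R : realType) (k m : nat) (s t : {perm 'I_(k + m)}).
Local Notation n := (k + m)%N.
Local Notation lm := (@lebesgue_measure R).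
Variables (V : set 'rV[R]_n) (g : 'rV[R]_n -> 'rV[R]_n) (G : 'rV[R]_n -> R) (q : R).
Hypothesis m0 : (0 < m)%N.
Hypothesis oV : open V.
Hypothesis cg : forall x, V x -> {for x, continuous g}.
Hypothesis mG : measurable_fun setT G.
Hypothesis G0 : forall x, 0 <= G x.
Hypothesis ug : upper_gradient V g G.
Hypothesis Gq : (leb (n:=n)).-integrable setT (fun x => (G x `^ q)%:E).
Hypothesis Hq : m%:R < q \/ q = m%:R /\ hoelder_continuous V g.

Lemma joinp_dist (y : 'rV[R]_k) (z z' : 'rV[R]_m) : `|joinp s (y, z) - joinp s (y, z')| <= `|z - z'|.
Proof.
rewrite joinpB; apply: le_trans (norm_joinp _ _) _.
by rewrite /= subrr normr0 ge_max lexx normr_ge0.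
Qed.

Lemma joinp_upd (y : 'rV[R]_k) (z : 'rV[R]_m) j (tau : R) :
  upd (joinp s (y, z)) ((s^-1)%g (rshift k j)) tau = joinp s (y, upd z j tau).
Proof.
apply/rowP => i; pose P i := upd (joinp s (y, z)) ((s^-1)%g (rshift k j)) tau ord0 i = joinp s (y, upd z j tau) ord0 i.
apply: (joinp_ind (s := s) (P := P)) => {}i; rewrite /P.
  rewrite updE_neq ?joinpl//; apply/eqP => /perm_inj/eqP; by rewrite eq_lrshift.
have [->|ij] := eqVneq i j; first by rewrite updE joinpr /= updE.
rewrite updE_neq ?joinpr /= ?updE_neq//; apply/eqP => /perm_inj/eqP; rewrite eq_rshift; exact/negP.
Qed.

Lemma measurable_joinp_slice (y : 'rV[R]_k) : measurable_fun setT (fun z : 'rV[R]_m => joinp s (y, z)).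
Proof. by apply: (measurableT_comp (measurable_joinp s)); exact: measurable_fun_pair. Qed.

(** By Fubini, on almost every slice the restriction of [G] has an integrable [q]-th power and is an
    upper gradient of the slice of [g], so [lusin_sobolev] applies. The set of good [y] is found
    before [N] is chosen, because the null sets to which it is applied depend on [y]. *)
Lemma lusin_slices : {ae leb (n:=k), forall y, forall N : set 'rV[R]_m, compact N ->
  (forall z, N z -> V (joinp s (y, z))) -> leb N = 0%E ->
  (leb (n:=m)).-negligible ((fun z => pr t (g (joinp s (y, z)))) @` N)}.
Proof.
have aeI : {ae leb (n:=k), forall y, (\int[leb (n:=m)]_z (G (joinp s (y, z)) `^ q)%:E < +oo)%E}.
  pose Phi w := (G w `^ q)%:E.
  have mPhi : measurable_fun setT Phi.
    by apply/measurable_EFinP; exact: measurableT_comp (measurable_powR q) mG.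
  have Phi0 w : (0 <= Phi w)%E by rewrite lee_fin powR_ge0.
  have mI : measurable_fun setT (fun y => \int[leb (n:=m)]_z Phi (joinp s (y, z)))%E.
    apply: (@measurable_fun_fubini_tonelli_F _ _ _ _ R (leb (n:=m)) (fun yz => Phi (joinp s yz))).
      exact: measurableT_comp mPhi (measurable_joinp s).
    by move=> z; exact: Phi0.
  have I0 y : (0 <= \int[leb (n:=m)]_z Phi (joinp s (y, z)))%E by exact: integral_ge0.
  have : (leb (n:=k)).-integrable setT (fun y => \int[leb (n:=m)]_z Phi (joinp s (y, z)))%E.
    apply/integrableP; split => //.
    under eq_integral do rewrite gee0_abs//.
    rewrite -(integral_joinp s)//; exact: integral_fune_lt_pinfty.
  move=> /integrable_ae H; have {}H := H measurableT.
  by apply: filterS H => y /(_ I); rewrite ge0_fin_numE.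
have aeU : {ae leb (n:=k), forall y, forall j : 'I_m, {ae leb (n:=m), forall z, forall a b : R, a <= b ->
    (forall tau, a <= tau <= b -> V (joinp s (y, upd z j tau))) ->
    (`|g (joinp s (y, upd z j b)) - g (joinp s (y, upd z j a))|%:E <=
      \int[lm]_(tau in `[a, b]) (G (joinp s (y, upd z j tau)))%:E)%E}}.
  apply: ae_forall_count => j; have := ae_joinp s (ug ((s^-1)%g (rshift k j))).
  apply: filterS => y; apply: filterS => z H a b ab abV.
  have := H a b ab; rewrite !joinp_upd.
  under eq_integral do rewrite joinp_upd.
  by apply => tau tab; rewrite joinp_upd; exact: abV.
apply: filterS2 aeI aeU => y Iy Uy N cN NV N0.
have jc z : {for z, continuous (fun z : 'rV[R]_m => joinp s (y, z))}.
  by apply: (@lip_continuous _ _ _ _ 1) => // z1 z2; rewrite mul1r; exact: joinp_dist.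
pose Vy := [set z : 'rV[R]_m | V (joinp s (y, z))].
have oVy : open Vy by apply: open_comp => // z _; exact: jc.
apply: (@lusin_sobolev R m Vy (fun z => pr t (g (joinp s (y, z)))) (fun z => G (joinp s (y, z))) q N) => //.
- move=> z Vz; apply: (@continuous_comp _ _ _ (fun z => g (joinp s (y, z))) (pr t)); last exact: pr_continuous.
  by apply: (@continuous_comp _ _ _ (fun z : 'rV[R]_m => joinp s (y, z)) g) => //; exact: cg.
- exact: measurableT_comp mG (measurable_joinp_slice y).
- move=> j; move: (Uy j); apply: filterS => z H a b ab abV; apply: le_trans (H a b ab abV).
  by rewrite lee_fin -prB; exact: norm_pr.
- apply: le_lt_trans Iy; apply: ge0_subset_integral => //; first exact: open_rV_measurable.
    apply/measurable_EFinP; apply: measurableT_comp (measurable_powR q) _.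
    exact: measurableT_comp mG (measurable_joinp_slice y).
  by move=> z _; rewrite lee_fin powR_ge0.
case: Hq => [?|[qm [al /andP[al0 _] [_ [C HC]]]]]; [by left|right; split => //; exists al, `|C|; split => // z z' Vz Vz'].
rewrite -prB; apply: le_trans (norm_pr _ _) _; apply: le_trans (HC _ _ Vz Vz') _.
apply: (le_trans (ler_wpM2r (powR_ge0 _ _) (ler_norm C))).
rewrite ler_wpM2l//; apply: ge0_ler_powR; rewrite ?nnegrE ?(ltW al0)//; exact: joinp_dist.
Qed.

End slices.

(** * Rank strata and conclusion *)

Section rank_null.
Context (R : realType).

(** The permutations and an integer bound for the constant of [rank_split] range over a countable
    set, so that each choice can be treated by [rank_core] with uniform constants. Openness of the
    image is what allows the continuity and weak derivatives of [g] to be used on its slices. *)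
Lemma rank_null (k m : nat) (q : R) (U : set 'rV[R]_(k + m)) (f g : 'rV[R]_(k + m) -> 'rV[R]_(k + m)) Df :
  (0 < m)%N -> open U -> homeomorphism_onto_image U f g -> sobolev_with_derivative 1 U f Df -> 1 <= q ->
  sobolev q (f @` U) g -> m%:R < q \/ q = m%:R /\ hoelder_continuous (f @` U) g ->
  (leb (n:=k + m)).-negligible [set x | U x /\ \rank (Df x) = k].
Proof.
move=> m0 oU [fK cf cg] sf q1 [Dg sg] Hq.
have oV : open (f @` U) by exact: invariance_of_domain fK cf cg.
have {}cf x : U x -> {for x, continuous f}.
  by move: cf; rewrite continuous_open_subspace// => H Ux; apply: H; exact/mem_set.
have {}cg x : (f @` U) x -> {for x, continuous g}.
  by move: cg; rewrite continuous_open_subspace// => H Ux; apply: H; exact/mem_set.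
pose DT x := (Df x)^T.
have mDT i j : measurable_fun U (fun x => DT x j i).
  rewrite (_ : (fun x => _) = (fun x => Df x i j)); last by apply/funext => x; rewrite mxE.
  by have [_ /(_ j)[h _]] := sf i; apply: in_Lq_measurable h; exact: open_rV_measurable.
have dl := @linearization_cover R _ _ U f DT oU cf mDT (sobolev_acl oU cf (lexx 1) sf).
have gf x : U x -> g (f x) = x by move=> Ux; apply: fK; exact/mem_set.
pose I := ({perm 'I_(k + m)} * {perm 'I_(k + m)} * nat)%type.
pose S (i : I) := [set x | U x /\ forall h : 'rV[R]_(k + m),
  `|pr i.1.1 (h *m DT x)| <= i.2.+1%:R * `|pl i.1.1 (h *m DT x)| /\
  `|h| <= i.2.+1%:R * (`|pl i.1.1 (h *m DT x)| + `|pr i.1.2 h|)].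
have S0 i : (leb (n:=k + m)).-negligible (S i).
  have lus := @lusin_slices R k m i.1.1 i.1.2 (f @` U) g (grad_sum (f @` U) Dg) q m0 oV cg
    (measurable_grad_sum oV sg) (@grad_sum_ge0 _ _ _ _ _) (grad_sum_upper oV cg q1 sg) (grad_sum_integrable oV q1 sg) Hq.
  apply: (@rank_core R k m U f g DT i.1.1 i.1.2 m0 cf gf lus dl (S i) i.2.+1%:R) => //.
  - by move=> x [].
  - by move=> x h [_ H]; exact: (H h).1.
  - by move=> x h [_ H]; exact: (H h).2.
have : {ae leb (n:=k + m), forall x, forall i, ~ S i x}.
  by apply: ae_forall_count => i; apply: negligibleS (S0 i) => x /= /contrapT.
apply: negligibleS => x [Ux rx] /= H.
have [s [t [M [M0 HM]]]] := @rank_split R k m (DT x) (etrans (mxrank_tr _) rx).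
apply: (H (s, t, Num.truncn M)); split => //= h.
have Mt : M <= (Num.truncn M).+1%:R by rewrite ltW// truncnS_gt.
have [h1 h2] := HM h; split.
  by apply: le_trans h1 _; rewrite ler_wpM2r.
by apply: le_trans h2 _; rewrite ler_wpM2r// addr_ge0.
Qed.

End rank_null.

Theorem theorem2 (R : realType) (n m : nat) (q : R)
    (Omega E : set 'rV[R]_n) (f g : 'rV[R]_n -> 'rV[R]_n)
    (Df : 'rV[R]_n -> 'M[R]_n)
    (Omega_neq0 : Omega !=set0)
    (Omega_bounded : bounded_set Omega)
    (Omega_open : open Omega)
    (f_bisob : bi_sobolev Omega f g)
    (Df_weak : sobolev_with_derivative 1 Omega f Df)
    (q_ge1 : 1 <= q)
    (g_sob : sobolev q (f @` Omega) g)
    (E_sub : E `<=` Omega)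
    (E_meas : lebesgue_measurable E)
    (Jf0 : {ae lebesgue_rV R n, forall x, E x -> \det (Df x) = 0})
    (case_a_or_b : (q = m%:R /\ hoelder_continuous (f @` Omega) g) \/ m%:R < q) :
  {ae lebesgue_rV R n,
    forall x, E x -> (\rank (Df x))%:Z <= n%:Z - m%:Z - 1}.
Proof.
have [fg _ _] := f_bisob.
have null (k : nat) : (k < n)%N -> (n <= k + m)%N -> {ae lebesgue_rV R n, forall x, ~ (Omega x /\ \rank (Df x) = k)}.
  move=> kn nkm; have nE : n = (k + (n - k))%N by rewrite subnKC// ltnW.
  have m'0 : (0 < n - k)%N by rewrite subn_gt0.
  have m'm : (n - k <= m)%N by rewrite leq_subLR.
  (* In case (a) with [n - k < m] the exponent [q = m] is already supercritical for [n - k]; Hoelder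
     continuity is called upon only when [n - k = m]. *)
  have Hq : (n - k)%:R < q \/ q = (n - k)%:R /\ hoelder_continuous (f @` Omega) g.
    move: m'm; rewrite leq_eqVlt => /orP[/eqP->|lt]; first by case: case_a_or_b; [right|left].
    left; case: case_a_or_b => [[-> _]|]; first by rewrite ltr_nat.
    by apply: lt_trans; rewrite ltr_nat.
  move: (n - k)%N nE m'0 Hq => m' nE m'0 Hq; clear -nE m'0 Hq fg Df_weak q_ge1 g_sob Omega_open.
  subst n; have := rank_null m'0 Omega_open fg Df_weak q_ge1 g_sob Hq.
  by apply: negligibleS => x /= /contrapT.
have : {ae lebesgue_rV R n, forall x, forall k : nat, (k < n)%N -> (n <= k + m)%N -> ~ (Omega x /\ \rank (Df x) = k)}.
  apply: ae_forall_count => k; have [kn|nk] := ltnP k n; last by apply: aeW.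
  have [nkm|nkm] := leqP n (k + m); last by apply: aeW.
  by move: (null k kn nkm); apply: filterS.
move=> H; apply: filterS2 Jf0 H => x det0 H Ex.
have rn : (\rank (Df x) < n)%N.
  rewrite ltn_neqAle rank_leq_row andbT; apply/negP => rE.
  have : Df x \in unitmx by rewrite -row_free_unit.
  by rewrite unitmxE det0// unitr0.
have : (\rank (Df x) + m < n)%N.
  by rewrite ltnNge; apply/negP => h; apply: (H _ rn h); split => //; exact: E_sub.
move: (\rank _) => r; lia.
Qed.
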